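(* For every $\ell\ge 1$, all the zeros of $g_{k,1}(\tau)=q+O(q^{\ell+1})$ in the fundamental domain $\mathcal{F}$ lie on the arc $\mathcal{A}=\{e^{i\theta}:\frac{\pi}{2}\le\theta\le\frac{2\pi}{3}\}$.
   Context: Let $k\ge 0$ be an even integer and write $k=12\ell+k'$ with $k'\in\{0,4,6,8,10,14\}$. Let $M_k$ denote the space of holomorphic modular forms of weight $k$ for $\mathrm{PSL}_2(\mathbb{Z})$, with $q=e^{2\pi i\tau}$, $\tau$ in the upper half plane $\mathbb{H}$. The Miller basis $\{g_{k,m}\}_{m=0}^{\ell}$ of $M_k$ is defined by requiring, for each $0\le m\le\ell$, that $g_{k,m}\in M_k$ satisfies $g_{k,m}(\tau)=q^m+O(q^{\ell+1})$; in particular $g_{k,1}$ is the cusp form in $M_k$ with $g_{k,1}(\tau)=q+O(q^{\ell+1})$. The fundamental domain is $\mathcal{F}=\{z\in\mathbb{H}:|z|\ge 1,\,-\frac12\le\Re(z)\le 0\}\cup\{z\in\mathbb{H}:|z|>1,\,0<\Re(z)<\frac12\}$. *)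

(* Defs.v *)
From Stdlib Require Import Reals Arith.
From Coquelicot Require Import Coquelicot.
Open Scope R_scope.

(* q = e^{2 pi i tau} *)
Definition qpar (tau : C) : C :=
  (exp (-(2 * PI * Im tau)) * cos (2 * PI * Re tau),
   exp (-(2 * PI * Im tau)) * sin (2 * PI * Re tau)).

Definition in_H (tau : C) : Prop := 0 < Im tau.

Definition has_qexp (f : C -> C) (a : nat -> C) : Prop :=
  forall tau : C, in_H tau ->
    is_series (fun n : nat => Cmult (a n) (Cpow (qpar tau) n)) (f tau).

(* Holomorphic modular forms of weight k for PSL_2(Z):
   holomorphic on H, 1-periodic and holomorphic at the cusp are jointly
   expressed by the existence of a q-expansion convergent on H;
   plus the weight-k transformation law under tau -> -1/tau. *)
Definition modular_form (k : nat) (f : C -> C) : Prop :=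
  (exists a : nat -> C, has_qexp f a) /\
  forall tau : C, in_H tau -> f (Copp (Cinv tau)) = Cmult (Cpow tau k) (f tau).

(* k = 12 ell + k' with k' in {0,4,6,8,10,14} *)
Definition ell (k : nat) : nat :=
  if Nat.eqb (k mod 12) 2 then k / 12 - 1 else k / 12.

Definition is_g_k1 (k : nat) (g : C -> C) : Prop :=
  modular_form k g /\
  exists a : nat -> C, has_qexp g a /\
    a 0%nat = RtoC 0 /\ a 1%nat = RtoC 1 /\
    (forall n : nat, (2 <= n <= ell k)%nat -> a n = RtoC 0).

Definition in_F (z : C) : Prop :=
  in_H z /\
  ((Cmod z >= 1 /\ -(1/2) <= Re z <= 0) \/
   (Cmod z > 1 /\ 0 < Re z < 1/2)).

Definition on_arc (z : C) : Prop :=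
  exists theta : R, PI / 2 <= theta <= 2 * PI / 3 /\ z = (cos theta, sin theta).

(* Main.v *)
(** Write k = 12 l + 4 a + 6 b with a <= 2, b <= 1. Then g = E4^a E6^b Delta^l p(j) with p monic of degree
    l - 1 and real coefficients, and j maps the open arc injectively into (0, 1728). So it suffices to find l - 1
    distinct roots of p in (0, 1728), and to know that on the fundamental domain E4, E6 and j - x (0 < x < 1728)
    vanish only on the arc.
    For l >= 13, expand instead g = sum_m d_m Delta^(m+1) E_(k-12(m+1)) over Eisenstein series. On the arc the
    first term dominates, and z^((k-12)/2) E_(k-12)(z) at z = e^(i t) is close to 2 cos((k-12) t / 2), which
    changes sign l - 1 times. For l <= 12 the polynomial p is computed exactly.
    Off the arc: with z running up a vertical line of real part in (-1/2, 0), the argument of j is increasing,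
    because Im(E6 conj(E4)) > 0; it starts at 0 on the arc and stays below 2 pi, so j is never positive again. *)
Require Import Defs.
From Stdlib Require Import Reals Arith Lra Lia Psatz ZArith List FunctionalExtensionality.
From Coquelicot Require Import Coquelicot.
Open Scope R_scope.

(** Neither contour integration nor the valence formula is used. A form is handled as its
    coefficient sequence [a], with [F a] the sum of the q-series. Two forms of the same weight agree
    once enough coefficients agree: division by a power of [Delta] leaves negative weight or weight
    2, and there a growth argument near the real line kills every coefficient. The laws of [Delta],
    [E4] and [E6] under inversion all flow from that of E2, which is proved by rearranging a
    conditionally convergent double series. Counting zeros becomes counting roots of p: l - 1
    distinct roots leave room for no other. The split at l = 13 comes from the error budget on the
    arc. The terms after the first contribute at most 3.5 * 0.153 + 2 * 782 / 2^(l - 1), and the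
    first term exceeds 2 cos by a quantity between 0 and 1 up to a tiny error, so the contribution
    must stay below 1 where the cosine is 1 or -1; l - 1 = 12 is the first value for which it
    does. *)

(** * Elementary facts on complex numbers *)

Lemma C_ext (x y : C) : Re x = Re y -> Im x = Im y -> x = y.
Proof. destruct x, y; simpl; intros -> ->; reflexivity. Qed.

Lemma im_le_Cmod (c : C) : Rabs (Im c) <= Cmod c.
Proof. eapply Rle_trans; [apply Rmax_r | apply (Rmax_Cmod c)]. Qed.

Lemma Cmod_le_re_im (c : C) : Cmod c <= Rabs (Re c) + Rabs (Im c).
Proof.
  destruct c as [x y]; unfold Cmod; simpl.
  apply Rsqr_incr_0_var; [| pose proof (Rabs_pos x); pose proof (Rabs_pos y); lra].
  rewrite Rsqr_sqrt by nra. unfold Rsqr.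
  pose proof (Rabs_pos x); pose proof (Rabs_pos y).
  assert (Rabs x * Rabs x = x * x) by (rewrite <- Rabs_mult; apply Rabs_pos_eq; nra).
  assert (Rabs y * Rabs y = y * y) by (rewrite <- Rabs_mult; apply Rabs_pos_eq; nra).
  nra.
Qed.

Lemma Cmod_sub (x y : C) : Cmod (x - y) <= Cmod x + Cmod y.
Proof. unfold Cminus. rewrite <- (Cmod_opp y). apply Cmod_triangle. Qed.

Lemma Cmod_sym (x y : C) : Cmod (x - y) = Cmod (y - x).
Proof. rewrite <- Cmod_opp. f_equal. ring. Qed.

Lemma Cmod_sub_ge (x y : C) : Cmod x - Cmod y <= Cmod (x - y).
Proof.
  pose proof (Cmod_triangle (x - y) y) as H. replace (x - y + y)%C with x in H by ring. lra.
Qed.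

Lemma Cmod_Rp (r : R) : 0 <= r -> Cmod r = r.
Proof. intros H. rewrite Cmod_R. now apply Rabs_pos_eq. Qed.

Lemma im_plus (a b : C) : Im (a + b) = Im a + Im b.
Proof. reflexivity. Qed.
Lemma im_opp (a : C) : Im (- a) = - Im a.
Proof. reflexivity. Qed.
Lemma re_minus (a b : C) : Re (a - b) = Re a - Re b.
Proof. reflexivity. Qed.
Lemma im_minus (a b : C) : Im (a - b) = Im a - Im b.
Proof. reflexivity. Qed.
Lemma im_RtoC (r : R) : Im r = 0.
Proof. reflexivity. Qed.
Lemma im_scal_l (r : R) (c : C) : Im (r * c) = r * Im c.
Proof. rewrite im_mult, re_RtoC, im_RtoC. ring. Qed.

Lemma C_real (x : C) : Im x = 0 -> x = RtoC (Re x).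
Proof. intros H. apply C_ext; [reflexivity | exact H]. Qed.

(** * Finite sums and real series *)

Fixpoint csum (u : nat -> C) (n : nat) : C :=
  match n with O => RtoC 0 | S m => (csum u m + u m)%C end.
Fixpoint rsum (u : nat -> R) (n : nat) : R :=
  match n with O => 0 | S m => rsum u m + u m end.

Lemma csum_ext (u v : nat -> C) n :
  (forall k, (k < n)%nat -> u k = v k) -> csum u n = csum v n.
Proof.
  induction n as [|n IH]; intros H; simpl; [reflexivity|].
  rewrite IH by (intros; apply H; lia). rewrite H by lia. reflexivity.
Qed.

Lemma csum_plus (u v : nat -> C) n : csum (fun k => u k + v k)%C n = (csum u n + csum v n)%C.
Proof. induction n as [|n IH]; simpl; [|rewrite IH]; ring. Qed.

Lemma csum_scal (c : C) (u : nat -> C) n : csum (fun k => c * u k)%C n = (c * csum u n)%C.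
Proof. induction n as [|n IH]; simpl; [|rewrite IH]; ring. Qed.

Lemma csum_S (u : nat -> C) n : csum u (S n) = (u O + csum (fun k => u (S k)) n)%C.
Proof.
  induction n as [|n IH]; [simpl; ring|].
  change (csum u (S (S n))) with (csum u (S n) + u (S n))%C.
  change (csum (fun k => u (S k)) (S n)) with (csum (fun k => u (S k)) n + u (S n))%C.
  rewrite IH. ring.
Qed.

Lemma csum_zero (u : nat -> C) n : (forall k, (k < n)%nat -> u k = RtoC 0) -> csum u n = RtoC 0.
Proof.
  induction n as [|n IH]; intros H; simpl; [reflexivity|].
  rewrite IH, H by (intros; try apply H; lia). ring.
Qed.

Lemma csum_split (u : nat -> C) m n :
  csum u (m + n) = (csum u m + csum (fun k => u (m + k)%nat) n)%C.
Proof.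
  induction n as [|n IH]; [rewrite Nat.add_0_r; simpl; ring|].
  rewrite Nat.add_succ_r. simpl. rewrite IH. ring.
Qed.

Lemma csum_mod (u : nat -> C) n : Cmod (csum u n) <= rsum (fun k => Cmod (u k)) n.
Proof.
  induction n as [|n IH]; simpl; [rewrite Cmod_0; lra|].
  eapply Rle_trans; [apply Cmod_triangle|]. lra.
Qed.

Lemma csum_re (u : nat -> C) n : Re (csum u n) = rsum (fun k => Re (u k)) n.
Proof. induction n as [|n IH]; [reflexivity|]. cbn [csum rsum]. rewrite re_plus, IH. reflexivity. Qed.
Lemma csum_im (u : nat -> C) n : Im (csum u n) = rsum (fun k => Im (u k)) n.
Proof. induction n as [|n IH]; [reflexivity|]. cbn [csum rsum]. rewrite im_plus, IH. reflexivity. Qed.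

Lemma rsum_le (u v : nat -> R) n :
  (forall k, (k < n)%nat -> u k <= v k) -> rsum u n <= rsum v n.
Proof.
  induction n as [|n IH]; intros H; simpl; [lra|].
  assert (u n <= v n) by (apply H; lia). assert (rsum u n <= rsum v n) by (apply IH; intros; apply H; lia). lra.
Qed.
Lemma rsum_ext (u v : nat -> R) n : (forall k, (k < n)%nat -> u k = v k) -> rsum u n = rsum v n.
Proof.
  induction n as [|n IH]; intros H; simpl; [reflexivity|].
  rewrite IH by (intros; apply H; lia). rewrite H by lia. reflexivity.
Qed.
Lemma rsum_scal c (u : nat -> R) n : rsum (fun k => c * u k) n = c * rsum u n.
Proof. induction n as [|n IH]; simpl; [|rewrite IH]; ring. Qed.
Lemma rsum_plus (u v : nat -> R) n : rsum (fun k => u k + v k) n = rsum u n + rsum v n.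
Proof. induction n as [|n IH]; simpl; [|rewrite IH]; ring. Qed.
Lemma rsum_nonneg (u : nat -> R) n : (forall k, (k < n)%nat -> 0 <= u k) -> 0 <= rsum u n.
Proof.
  intros H. induction n as [|n IH]; simpl; [lra|].
  assert (0 <= u n) by (apply H; lia).
  assert (0 <= rsum u n) by (apply IH; intros; apply H; lia). lra.
Qed.

Lemma rsum_sum_n (a : nat -> R) n : sum_n a n = rsum a (S n).
Proof.
  induction n as [|n IH]; [rewrite sum_O; simpl; ring|].
  rewrite sum_Sn, IH. reflexivity.
Qed.
Lemma csum_sum_n (a : nat -> C) n : sum_n a n = csum a (S n).
Proof.
  induction n as [|n IH]; [rewrite sum_O; simpl; ring|].
  rewrite sum_Sn, IH. reflexivity.
Qed.

Lemma Series_lim (a : nat -> R) : ex_series a -> is_lim_seq (rsum a) (Series a).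
Proof.
  intros H. apply is_lim_seq_incr_1. eapply is_lim_seq_ext; [|exact (Series_correct a H)].
  intros n. apply rsum_sum_n.
Qed.

Lemma Series_eq_lim (a : nat -> R) (l : R) : is_lim_seq (rsum a) l -> is_series a l.
Proof.
  intros H. apply is_lim_seq_incr_1 in H. unfold is_series.
  eapply is_lim_seq_ext in H; [exact H|]. intros n. symmetry. apply rsum_sum_n.
Qed.

Lemma ex_series_major (a b : nat -> R) :
  (forall n, 0 <= a n <= b n) -> ex_series b -> ex_series a.
Proof.
  intros H Hb. apply (ex_series_le (K := R_AbsRing) (V := R_CompleteNormedModule) a b); [|exact Hb].
  intros n. unfold norm; simpl. unfold abs; simpl. rewrite Rabs_pos_eq; apply H.
Qed.

Lemma ex_series_scalR c (a : nat -> R) : ex_series a -> ex_series (fun n => c * a n).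
Proof. exact (ex_series_scal (K := R_AbsRing) (V := R_NormedModule) c a). Qed.

Lemma ex_series_bound (a : nat -> R) M :
  (forall n, 0 <= a n) -> (forall n, rsum a n <= M) -> ex_series a.
Proof.
  intros Ha HM.
  destruct (ex_finite_lim_seq_incr (rsum a) M) as [l Hl]; [intros n; simpl; specialize (Ha n); lra | exact HM|].
  exists l. now apply Series_eq_lim.
Qed.

Lemma rsum_le_Series (a : nat -> R) n : (forall k, 0 <= a k) -> ex_series a -> rsum a n <= Series a.
Proof.
  intros Ha He. refine (is_lim_seq_incr_compare (rsum a) (Series a) (Series_lim a He) _ n).
  intros k; simpl; specialize (Ha k); lra.
Qed.

Lemma Series_nonneg (a : nat -> R) : (forall k, 0 <= a k) -> ex_series a -> 0 <= Series a.
Proof. intros Ha He. apply (rsum_le_Series a 0 Ha He). Qed.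

Lemma Series_tail (a : nat -> R) N : ex_series a ->
  Series (fun k => a (N + k)%nat) = Series a - rsum a N.
Proof.
  intros He. induction N as [|N IH]; [rewrite (Series_ext _ a) by reflexivity; simpl; lra|].
  rewrite (Series_incr_1 (fun k => a (N + k)%nat)) in IH by now apply ex_series_incr_n.
  rewrite Nat.add_0_r in IH. simpl rsum.
  replace (Series (fun k => a (S N + k)%nat)) with (Series (fun k => a (N + S k)%nat)).
  - lra.
  - apply Series_ext; intros k; f_equal; lia.
Qed.

(** * Absolutely convergent complex series *)

(** Componentwise, hence total; the value is meaningful only under [asum], which most rules below
    therefore carry as a hypothesis. *)
Definition CSer (u : nat -> C) : C :=
  (Series (fun n => Re (u n)), Series (fun n => Im (u n))).
Definition asum (u : nat -> C) : Prop := ex_series (fun n => Cmod (u n)).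

Lemma asum_major (u : nat -> C) (b : nat -> R) :
  (forall n, Cmod (u n) <= b n) -> ex_series b -> asum u.
Proof. intros H. apply ex_series_major. intros n; split; [apply Cmod_ge_0 | apply H]. Qed.

Lemma asum_re u : asum u -> ex_series (fun n => Re (u n)).
Proof.
  intros H. apply ex_series_Rabs. apply (ex_series_major _ (fun n => Cmod (u n))); [|exact H].
  intros n; split; [apply Rabs_pos | apply re_le_Cmod].
Qed.
Lemma asum_im u : asum u -> ex_series (fun n => Im (u n)).
Proof.
  intros H. apply ex_series_Rabs. apply (ex_series_major _ (fun n => Cmod (u n))); [|exact H].
  intros n; split; [apply Rabs_pos | apply im_le_Cmod].
Qed.

Lemma CSer_ext (u v : nat -> C) : (forall n, u n = v n) -> CSer u = CSer v.
Proof. intros H. unfold CSer. f_equal; apply Series_ext; intros n; now rewrite H. Qed.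
Lemma asum_ext (u v : nat -> C) : (forall n, u n = v n) -> asum u -> asum v.
Proof. intros H. apply ex_series_ext. intros n; now rewrite H. Qed.

Lemma CSer_plus u v : asum u -> asum v -> CSer (fun n => u n + v n)%C = (CSer u + CSer v)%C.
Proof.
  intros Hu Hv. unfold CSer. apply C_ext; simpl.
  - rewrite <- Series_plus by now apply asum_re. reflexivity.
  - rewrite <- Series_plus by now apply asum_im. reflexivity.
Qed.
Lemma asum_plus u v : asum u -> asum v -> asum (fun n => u n + v n)%C.
Proof.
  intros Hu Hv. eapply asum_major; [|exact (ex_series_plus _ _ Hu Hv)].
  intros n. apply Cmod_triangle.
Qed.

Lemma asum_scal c u : asum u -> asum (fun n => c * u n)%C.
Proof.
  intros Hu. eapply ex_series_ext; [|exact (ex_series_scal (Cmod c) _ Hu)].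
  intros n. simpl. now rewrite Cmod_mult.
Qed.
Lemma CSer_scal c u : asum u -> CSer (fun n => c * u n)%C = (c * CSer u)%C.
Proof.
  intros Hu. pose proof (asum_re u Hu) as Hr. pose proof (asum_im u Hu) as Hi.
  unfold CSer. apply C_ext.
  - rewrite re_mult; simpl. rewrite <- !Series_scal_l.
    rewrite <- Series_minus; [apply Series_ext; intros; apply re_mult | |];
      now apply ex_series_scalR.
  - rewrite im_mult; simpl. rewrite <- !Series_scal_l.
    rewrite <- Series_plus; [apply Series_ext; intros; apply im_mult | |];
      now apply ex_series_scalR.
Qed.
Lemma asum_minus u v : asum u -> asum v -> asum (fun n => u n - v n)%C.
Proof.
  intros Hu Hv. eapply asum_major; [|exact (ex_series_plus _ _ Hu Hv)].
  intros n. apply Cmod_sub.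
Qed.
Lemma CSer_minus u v : asum u -> asum v -> CSer (fun n => u n - v n)%C = (CSer u - CSer v)%C.
Proof.
  intros Hu Hv. rewrite (CSer_ext _ (fun n => u n + (RtoC (-1)) * v n)%C) by (intros; ring_simplify; ring).
  rewrite CSer_plus, CSer_scal; [ring | assumption | assumption | now apply asum_scal].
Qed.

(* [clim u l] is convergence, phrased so that real squeeze lemmas apply. *)
Definition clim (u : nat -> C) (l : C) : Prop := is_lim_seq (fun n => Cmod (u n - l)) 0.

Lemma clim_squeeze (u : nat -> C) l (b : nat -> R) :
  (forall n, Cmod (u n - l) <= b n) -> is_lim_seq b 0 -> clim u l.
Proof.
  intros H Hb. apply (is_lim_seq_le_le (fun _ => 0) _ b); [|apply is_lim_seq_const|exact Hb].
  intros n; split; [apply Cmod_ge_0 | apply H].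
Qed.

Lemma Ceq_minus (x y : C) : (x - y)%C = RtoC 0 -> x = y.
Proof. intros H. replace x with (x - y + y)%C by ring. rewrite H. ring. Qed.

Lemma clim_unique u l m : clim u l -> clim u m -> l = m.
Proof.
  intros Hl Hm. apply Ceq_minus. apply Cmod_eq_0. apply Rle_antisym; [|apply Cmod_ge_0].
  pose proof (is_lim_seq_plus' _ _ _ _ Hl Hm) as H. rewrite Rplus_0_l in H.
  refine (is_lim_seq_le (fun _ => Cmod (l - m)) _ (Cmod (l - m)) 0 _ (is_lim_seq_const _) H).
  intros n. rewrite (Cmod_sym (u n) l).
  replace (l - m)%C with ((l - u n) + (u n - m))%C by ring. apply Cmod_triangle.
Qed.

Lemma clim_ext u v l : (forall n, u n = v n) -> clim u l -> clim v l.
Proof. intros H. apply is_lim_seq_ext. intros n; now rewrite H. Qed.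

Lemma clim_parts u l : is_lim_seq (fun n => Re (u n)) (Re l) -> is_lim_seq (fun n => Im (u n)) (Im l) -> clim u l.
Proof.
  intros Hr Hi.
  apply (clim_squeeze _ _ (fun n => Rabs (Re (u n) - Re l) + Rabs (Im (u n) - Im l))).
  - intros n. rewrite <- re_minus, <- im_minus. apply Cmod_le_re_im.
  - replace (Finite 0) with (Finite (0 + 0)) by (f_equal; ring). apply is_lim_seq_plus'.
    + apply -> is_lim_seq_abs_0. rewrite <- (Rminus_diag (Re l)).
      apply is_lim_seq_minus'; [exact Hr | apply is_lim_seq_const].
    + apply -> is_lim_seq_abs_0. rewrite <- (Rminus_diag (Im l)).
      apply is_lim_seq_minus'; [exact Hi | apply is_lim_seq_const].
Qed.

Lemma CSer_lim u : asum u -> clim (csum u) (CSer u).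
Proof.
  intros H. apply clim_parts.
  - eapply is_lim_seq_ext; [|apply (Series_lim _ (asum_re u H))]. intros n; symmetry; apply csum_re.
  - eapply is_lim_seq_ext; [|apply (Series_lim _ (asum_im u H))]. intros n; symmetry; apply csum_im.
Qed.

Lemma clim_bound u l M : clim u l -> (forall n, Cmod (u n) <= M) -> Cmod l <= M.
Proof.
  intros H HM.
  assert (H0 : is_lim_seq (fun n => Cmod (u n - l) + M) (0 + M)).
  { apply is_lim_seq_plus'; [exact H | apply is_lim_seq_const]. }
  rewrite Rplus_0_l in H0.
  refine (is_lim_seq_le (fun _ => Cmod l) _ (Cmod l) M _ (is_lim_seq_const _) H0).
  intros n. pose proof (Cmod_triangle (l - u n) (u n)) as Ht.
  replace (l - u n + u n)%C with l in Ht by ring. rewrite Cmod_sym in Ht. specialize (HM n). lra.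
Qed.

Lemma CSer_bound u (b : nat -> R) : (forall n, Cmod (u n) <= b n) -> ex_series b ->
  Cmod (CSer u) <= Series b.
Proof.
  intros H Hb. pose proof (asum_major u b H Hb) as Hu.
  apply (clim_bound (csum u) _ _ (CSer_lim u Hu)). intros n.
  eapply Rle_trans; [apply csum_mod|].
  eapply Rle_trans; [apply rsum_le; intros k _; apply H|].
  apply rsum_le_Series; [|exact Hb]. intros k. eapply Rle_trans; [apply Cmod_ge_0 | apply H].
Qed.

Lemma asum_S u : asum u <-> asum (fun n => u (S n)).
Proof. apply (ex_series_incr_1 (fun n => Cmod (u n))). Qed.

Lemma CSer_S u : asum u -> CSer u = (u O + CSer (fun n => u (S n)))%C.
Proof.
  intros H. apply C_ext.
  - exact (Series_incr_1 (fun n => Re (u n)) (asum_re u H)).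
  - exact (Series_incr_1 (fun n => Im (u n)) (asum_im u H)).
Qed.

Lemma CSer_zero u : (forall n, u n = RtoC 0) -> CSer u = RtoC 0.
Proof.
  intros H. assert (E : Series (fun _ : nat => 0) = 0).
  { rewrite (Series_ext _ (fun _ => 0 * 0)) by (intros; ring). rewrite Series_scal_l. ring. }
  apply C_ext; simpl; rewrite <- E; apply Series_ext; intros n; now rewrite H.
Qed.

Lemma asum_finite u N : (forall n, (N <= n)%nat -> u n = RtoC 0) -> asum u.
Proof.
  revert u. induction N as [|N IH]; intros u H.
  - apply (ex_series_bound _ 0); [intros; apply Cmod_ge_0|].
    intros n. induction n as [|n IHn]; simpl; [lra|]. rewrite H, Cmod_0 by lia. lra.
  - apply asum_S. apply IH. intros n Hn. apply H. lia.
Qed.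

Lemma CSer_finite u N : (forall n, (N <= n)%nat -> u n = RtoC 0) -> CSer u = csum u N.
Proof.
  intros H. apply (clim_unique (csum u)); [apply CSer_lim, (asum_finite u N H)|].
  apply is_lim_seq_incr_n with N. apply (is_lim_seq_ext (fun _ => 0)); [|apply is_lim_seq_const].
  intros n. rewrite Nat.add_comm, csum_split, (csum_zero (fun k => u (N + k)%nat)) by (intros; apply H; lia).
  replace (csum u N + 0 - csum u N)%C with (RtoC 0) by ring. now rewrite Cmod_0.
Qed.

Lemma asum_shift u N : asum u -> asum (fun k => u (N + k)%nat).
Proof. exact (proj1 (ex_series_incr_n (fun n => Cmod (u n)) N)). Qed.

Lemma CSer_tail u N : asum u -> CSer u = (csum u N + CSer (fun k => u (N + k)%nat))%C.
Proof.
  intros H. induction N as [|N IH]; [simpl; rewrite Cplus_0_l; reflexivity|].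
  rewrite IH, CSer_S by now apply asum_shift.
  rewrite Nat.add_0_r. simpl csum. rewrite Cplus_assoc. f_equal.
  apply CSer_ext; intros k; f_equal; lia.
Qed.

Lemma CSer_csum (u : nat -> nat -> C) M : (forall m, asum (u m)) ->
  asum (fun n => csum (fun m => u m n) M) /\
  CSer (fun n => csum (fun m => u m n) M) = csum (fun m => CSer (u m)) M.
Proof.
  intros H. induction M as [|M [IH1 IH2]].
  - split; [apply (asum_finite _ 0); reflexivity | apply CSer_zero; reflexivity].
  - split; [now apply (asum_plus (fun n => csum (fun m => u m n) M))|].
    simpl. rewrite <- IH2. apply (CSer_plus (fun n => csum (fun m => u m n) M)); auto.
Qed.

Section Fubini.
Context (u : nat -> nat -> C) (a b : nat -> R).
Context (Hu : forall m n, Cmod (u m n) <= a m * b n) (Ha : ex_series a) (Hb : ex_series b).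

Lemma fubini_row m : asum (u m).
Proof. apply (asum_major _ (fun n => a m * b n)); [auto|]. now apply ex_series_scalR. Qed.
Lemma fubini_col n : asum (fun m => u m n).
Proof.
  apply (asum_major _ (fun m => b n * a m)); [intros m; rewrite Rmult_comm; auto|].
  now apply ex_series_scalR.
Qed.
Lemma fubini_rows : asum (fun m => CSer (u m)).
Proof.
  apply (asum_major _ (fun m => Series b * a m)); [|now apply ex_series_scalR].
  intros m. rewrite Rmult_comm, <- Series_scal_l.
  apply CSer_bound; [auto|]. now apply ex_series_scalR.
Qed.

(** Summing the first M rows column by column leaves in column n a remainder of at most t M * b n,
    where t M is the tail of [a]; the total error Series b * t M tends to 0. *)
Lemma fubini : CSer (fun m => CSer (u m)) = CSer (fun n => CSer (fun m => u m n)).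
Proof.
  apply (clim_unique (csum (fun m => CSer (u m)))); [apply CSer_lim, fubini_rows|].
  set (t := fun M => Series (fun k => a (M + k)%nat)).
  assert (Ht : forall M, ex_series (fun k => a (M + k)%nat)) by (intros; now apply ex_series_incr_n).
  apply (clim_squeeze _ _ (fun M => Series b * t M)).
  - intros M. destruct (CSer_csum u M fubini_row) as [H1 H2]. rewrite <- H2.
    assert (Htl : forall n, Cmod (csum (fun m => u m n) M - CSer (fun m => u m n)) <= t M * b n).
    { intros n. rewrite (CSer_tail (fun m => u m n) M) by apply fubini_col.
      match goal with |- Cmod ?x <= _ => replace x with (- CSer (fun k => u (M + k)%nat n))%C by ring end.
      rewrite Cmod_opp. unfold t. rewrite Rmult_comm, <- Series_scal_l.
      apply CSer_bound; [intros; rewrite Rmult_comm; auto|]. now apply ex_series_scalR. }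
    assert (Hs : asum (fun n => CSer (fun m => u m n))).
    { apply (asum_ext (fun n => csum (fun m => u m n) M - (csum (fun m => u m n) M - CSer (fun m => u m n)))%C);
        [intros; ring|].
      apply asum_minus; [exact H1|].
      apply (asum_major _ (fun n => t M * b n)); [exact Htl|]. now apply ex_series_scalR. }
    rewrite <- CSer_minus by assumption.
    rewrite (Rmult_comm (Series b)), <- Series_scal_l.
    apply CSer_bound; [exact Htl|]. now apply ex_series_scalR.
  - replace (Finite 0) with (Rbar_mult (Series b) (Finite (Series a - Series a)));
      [|simpl; f_equal; ring].
    apply is_lim_seq_scal_l. eapply is_lim_seq_ext; [intros M; symmetry; apply (Series_tail a M Ha)|].
    apply is_lim_seq_minus'; [apply is_lim_seq_const | now apply Series_lim].
Qed.
Lemma fubini_cols : asum (fun n => CSer (fun m => u m n)).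
Proof.
  apply (asum_major _ (fun m => Series a * b m)); [|now apply ex_series_scalR].
  intros m. rewrite Rmult_comm, <- Series_scal_l.
  apply CSer_bound; [|now apply ex_series_scalR]. intros n. rewrite Rmult_comm. auto.
Qed.
End Fubini.

Lemma CSer_conj u : CSer (fun n => Cconj (u n)) = Cconj (CSer u).
Proof.
  apply C_ext; [reflexivity|]. simpl. rewrite <- Series_opp. reflexivity.
Qed.

(** Translates the filter convergence in which [has_qexp] is stated. [sum_n] includes the index n
    while [csum] stops before it, hence the shifts by one. *)
Lemma is_series_clim (u : nat -> C) l : is_series u l <-> clim (csum u) l.
Proof.
  split.
  - intros H. unfold clim. apply is_lim_seq_incr_1. apply is_lim_seq_spec. intros eps.
    destruct (H (fun y => Cmod (y - l) < eps)) as [N HN].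
    { apply (locally_le_locally_norm l). exists eps. intros y Hy. exact Hy. }
    exists N. intros n Hn. rewrite <- csum_sum_n, Rminus_0_r, Rabs_pos_eq by apply Cmod_ge_0.
    now apply HN.
  - intros H P HP.
    apply (locally_norm_le_locally l) in HP. destruct HP as [eps He].
    unfold clim in H. apply is_lim_seq_incr_1 in H. apply is_lim_seq_spec in H. destruct (H eps) as [N HN].
    exists N. intros n Hn. apply He. specialize (HN n Hn).
    rewrite <- csum_sum_n, Rminus_0_r, Rabs_pos_eq in HN by apply Cmod_ge_0. exact HN.
Qed.

(** * Power series in the unit disc *)

(** Radius of convergence at least 1, phrased as boundedness of the terms at each radius r < 1. This
    form passes to Cauchy products and to derivatives without touching limits. *)
Definition PSc (a : nat -> C) : Prop :=
  forall r, 0 < r < 1 -> exists A, forall n, Cmod (a n) * r ^ n <= A.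
Definition Ev (a : nat -> C) (q : C) : C := CSer (fun n => a n * q ^ n)%C.

Lemma pow_le1 t n : 0 <= t <= 1 -> t ^ n <= 1.
Proof. intros H. rewrite <- (pow1 n). now apply pow_incr. Qed.

Lemma pow_dec t m n : 0 <= t <= 1 -> (m <= n)%nat -> t ^ n <= t ^ m.
Proof.
  intros H Hmn. replace n with (m + (n - m))%nat by lia. rewrite pow_add.
  pose proof (pow_le1 t (n - m) H). pose proof (pow_le t m (proj1 H)).
  pose proof (pow_le t (n - m) (proj1 H)). nra.
Qed.

Lemma rsum_geom t n : 0 <= t < 1 -> rsum (fun k => t ^ k) n <= / (1 - t).
Proof.
  intros H. rewrite <- Series_geom by (rewrite Rabs_pos_eq; lra).
  apply rsum_le_Series; [intros; apply pow_le; lra | apply ex_series_geom; rewrite Rabs_pos_eq; lra].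
Qed.

Lemma rsum_const (x : R) n : rsum (fun _ => x) n = INR n * x.
Proof. induction n as [|n IH]; [simpl; ring|]. cbn [rsum]. rewrite S_INR, IH. ring. Qed.

Lemma n_pow_bound t n : 0 <= t < 1 -> INR n * t ^ n <= / (1 - t).
Proof.
  intros H. eapply Rle_trans; [|apply (rsum_geom t n H)].
  replace (INR n * t ^ n) with (rsum (fun _ => t ^ n) n).
  - apply rsum_le. intros k Hk. apply pow_dec; [lra | lia].
  - apply rsum_const.
Qed.

(** Boundedness at the larger radius s = (1 + r) / 2 gives decay with ratio r / s at radius r. The
    ratio returned is the midpoint of r / s and 1, so that it is positive even when r = 0. *)
Lemma PSc_geom a r : PSc a -> 0 <= r < 1 ->
  exists A t, 0 <= A /\ 0 < t < 1 /\ forall n, Cmod (a n) * r ^ n <= A * t ^ n.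
Proof.
  intros H Hr. set (s := (1 + r) / 2).
  destruct (H s) as [A HA]; [unfold s; lra|].
  assert (H0 : 0 <= A).
  { eapply Rle_trans; [|apply (HA O)]. simpl. pose proof (Cmod_ge_0 (a O)). lra. }
  exists A, ((1 + r / s) / 2).
  assert (Hs : 0 < s) by (unfold s; lra).
  assert (Hrs : 0 <= r / s < 1).
  { split; [apply Rmult_le_pos; [lra | left; now apply Rinv_0_lt_compat]|].
    apply (Rmult_lt_reg_r s); [lra|]. unfold Rdiv. rewrite Rmult_assoc, Rinv_l by lra. unfold s; lra. }
  split; [exact H0|]. split; [lra|]. intros n.
  replace (Cmod (a n) * r ^ n) with ((Cmod (a n) * s ^ n) * (r / s) ^ n).
  - apply Rmult_le_compat; [apply Rmult_le_pos; [apply Cmod_ge_0 | apply pow_le; lra] | apply pow_le; lra | apply HA |].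
    apply pow_incr. lra.
  - unfold Rdiv. rewrite Rpow_mult_distr, pow_inv. field. apply pow_nonzero. lra.
Qed.

Lemma ex_series_geomR A t : 0 <= t < 1 -> ex_series (fun n => A * t ^ n).
Proof. intros H. apply ex_series_scalR, ex_series_geom. rewrite Rabs_pos_eq; lra. Qed.

Lemma PSc_abs a r : PSc a -> 0 <= r < 1 -> ex_series (fun n => Cmod (a n) * r ^ n).
Proof.
  intros H Hr. destruct (PSc_geom a r H Hr) as (A & t & HA & Ht & Hb).
  apply (ex_series_major _ (fun n => A * t ^ n)); [|apply ex_series_geomR; lra].
  intros n; split; [apply Rmult_le_pos; [apply Cmod_ge_0 | apply pow_le; lra] | apply Hb].
Qed.

Lemma PSc_asum a q : PSc a -> Cmod q < 1 -> asum (fun n => a n * q ^ n)%C.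
Proof.
  intros H Hq. apply (ex_series_ext (fun n => Cmod (a n) * Cmod q ^ n)).
  - intros n. now rewrite Cmod_mult, Cmod_pow.
  - apply PSc_abs; [exact H | split; [apply Cmod_ge_0 | exact Hq]].
Qed.

(** A term is a difference of consecutive partial sums, and a convergent sequence is bounded; one
    point of convergence on each circle is therefore enough. *)
Lemma PSc_series (a : nat -> C) :
  (forall r, 0 < r < 1 -> exists q, Cmod q = r /\ exists l : C, is_series (fun n => a n * q ^ n)%C l) -> PSc a.
Proof.
  intros H r Hr. destruct (H r Hr) as (q & Hq & l & Hl).
  assert (Hc : is_lim_seq (fun n => Cmod (csum (fun n => a n * q ^ n)%C n - l)) 0) by now apply is_series_clim.
  destruct (filterlim_bounded (fun n => Cmod (csum (fun n => a n * q ^ n)%C n - l))) as [M HM];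
    [now exists 0|].
  exists (2 * M). intros n. rewrite <- Hq, <- Cmod_pow, <- Cmod_mult.
  replace (a n * q ^ n)%C with ((csum (fun n => a n * q ^ n)%C (S n) - l) - (csum (fun n => a n * q ^ n)%C n - l))%C
    by (simpl; ring).
  eapply Rle_trans; [apply Cmod_sub|].
  assert (HM' : forall n, Cmod (csum (fun n => a n * q ^ n)%C n - l) <= M).
  { intros k. specialize (HM k). unfold norm in HM; simpl in HM. unfold abs in HM; simpl in HM.
    rewrite Rabs_pos_eq in HM by apply Cmod_ge_0. exact HM. }
  pose proof (HM' n). pose proof (HM' (S n)). lra.
Qed.

Definition psh (a : nat -> C) : nat -> C := fun n => a (S n).
(** The Euler operator q d/dq. *)
Definition D (a : nat -> C) : nat -> C := fun n => (INR n * a n)%C.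
Definition conv (a b : nat -> C) : nat -> C := fun n => csum (fun k => a k * b (n - k)%nat)%C (S n).
Definition padd (a b : nat -> C) : nat -> C := fun n => (a n + b n)%C.
Definition pscal (c : C) (a : nat -> C) : nat -> C := fun n => (c * a n)%C.
Definition pone : nat -> C := fun n => match n with O => RtoC 1 | _ => RtoC 0 end.

Lemma PSc_le a b : PSc b -> (forall n, Cmod (a n) <= Cmod (b n)) -> PSc a.
Proof.
  intros H Hab r Hr. destruct (H r Hr) as [A HA]. exists A. intros n.
  eapply Rle_trans; [|apply HA]. apply Rmult_le_compat_r; [apply pow_le; lra | apply Hab].
Qed.
Lemma PSc_add a b : PSc a -> PSc b -> PSc (padd a b).
Proof.
  intros Ha Hb r Hr. destruct (Ha r Hr) as [A HA]. destruct (Hb r Hr) as [B HB].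
  exists (A + B). intros n. specialize (HA n). specialize (HB n).
  assert (0 <= r ^ n) by (apply pow_le; lra). pose proof (Cmod_triangle (a n) (b n)). unfold padd. nra.
Qed.
Lemma PSc_scal c a : PSc a -> PSc (pscal c a).
Proof.
  intros Ha r Hr. destruct (Ha r Hr) as [A HA]. exists (Cmod c * A). intros n.
  unfold pscal. rewrite Cmod_mult, Rmult_assoc. apply Rmult_le_compat_l; [apply Cmod_ge_0 | apply HA].
Qed.
Lemma PSc_one : PSc pone.
Proof.
  intros r Hr. exists 1. intros [|n]; simpl; rewrite ?Cmod_1, ?Cmod_0; lra.
Qed.
Lemma PSc_D a : PSc a -> PSc (D a).
Proof.
  intros Ha r Hr. destruct (PSc_geom a r Ha) as (A & t & HA & Ht & H); [lra|].
  exists (A * / (1 - t)). intros n. unfold D. rewrite Cmod_mult, Cmod_Rp by apply pos_INR.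
  rewrite Rmult_assoc. pose proof (n_pow_bound t n). specialize (H n). pose proof (pos_INR n).
  apply Rle_trans with (INR n * (A * t ^ n)); [now apply Rmult_le_compat_l|].
  replace (INR n * (A * t ^ n)) with (A * (INR n * t ^ n)) by ring. apply Rmult_le_compat_l; lra.
Qed.
Lemma PSc_psh a : PSc a -> PSc (psh a).
Proof.
  intros Ha r Hr. destruct (Ha r Hr) as [A HA]. exists (A / r). intros n.
  apply (Rmult_le_reg_r r); [lra|]. unfold Rdiv. rewrite (Rmult_assoc A), Rinv_l, Rmult_1_r by lra.
  specialize (HA (S n)). simpl in HA. unfold psh. nra.
Qed.

Lemma conv_mod a b n r : 0 <= r ->
  Cmod (conv a b n) * r ^ n <= rsum (fun k => (Cmod (a k) * r ^ k) * (Cmod (b (n - k)%nat) * r ^ (n - k))) (S n).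
Proof.
  intros Hr. rewrite Rmult_comm. eapply Rle_trans;
    [apply Rmult_le_compat_l; [now apply pow_le | apply csum_mod]|].
  rewrite <- rsum_scal. apply rsum_le. intros k Hk. rewrite Cmod_mult.
  replace (r ^ n) with (r ^ k * r ^ (n - k)) by (rewrite <- pow_add; f_equal; lia).
  right. ring.
Qed.

Lemma PSc_conv a b : PSc a -> PSc b -> PSc (conv a b).
Proof.
  intros Ha Hb r Hr.
  destruct (PSc_geom a r Ha) as (A & t & HA & Ht & H); [lra|].
  destruct (PSc_geom b r Hb) as (B & s & HB & Hs & H'); [lra|].
  set (m := Rmax t s). assert (Hm : 0 <= m < 1) by (unfold m, Rmax; destruct Rle_dec; lra).
  assert (t <= m) by apply Rmax_l. assert (s <= m) by apply Rmax_r.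
  exists (A * B * (1 + / (1 - m))). intros n.
  eapply Rle_trans; [apply conv_mod; lra|].
  apply Rle_trans with (rsum (fun _ => A * B * m ^ n) (S n)).
  - apply rsum_le. intros k Hk.
    replace (m ^ n) with (m ^ k * m ^ (n - k)) by (rewrite <- pow_add; f_equal; lia).
    replace (A * B * (m ^ k * m ^ (n - k))) with ((A * m ^ k) * (B * m ^ (n - k))) by ring.
    apply Rmult_le_compat; try (apply Rmult_le_pos; [apply Cmod_ge_0 | apply pow_le; lra]).
    + eapply Rle_trans; [apply H|]. apply Rmult_le_compat_l; [lra|]. apply pow_incr; lra.
    + eapply Rle_trans; [apply H'|]. apply Rmult_le_compat_l; [lra|]. apply pow_incr; lra.
  - rewrite rsum_const, S_INR. pose proof (n_pow_bound m n Hm). pose proof (pow_le1 m n).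
    replace ((INR n + 1) * (A * B * m ^ n)) with (A * B * (m ^ n + INR n * m ^ n)) by ring.
    apply Rmult_le_compat_l; [now apply Rmult_le_pos|]. lra.
Qed.

Lemma Ev_add a b q : PSc a -> PSc b -> Cmod q < 1 -> Ev (padd a b) q = (Ev a q + Ev b q)%C.
Proof.
  intros Ha Hb Hq. unfold Ev. rewrite <- CSer_plus by now apply PSc_asum.
  apply CSer_ext. intros n. unfold padd. ring.
Qed.
Lemma Ev_scal c a q : PSc a -> Cmod q < 1 -> Ev (pscal c a) q = (c * Ev a q)%C.
Proof.
  intros Ha Hq. unfold Ev. rewrite <- CSer_scal by now apply PSc_asum.
  apply CSer_ext. intros n. unfold pscal. ring.
Qed.
Lemma Ev_psh a q : PSc a -> Cmod q < 1 -> Ev a q = (a O + q * Ev (psh a) q)%C.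
Proof.
  intros Ha Hq. unfold Ev. rewrite CSer_S by now apply PSc_asum.
  rewrite <- CSer_scal by (apply PSc_asum; [now apply PSc_psh | exact Hq]).
  simpl Cpow. rewrite Cmult_1_r. f_equal. apply CSer_ext. intros n. unfold psh. simpl. ring.
Qed.
Lemma Ev_one q : Ev pone q = RtoC 1.
Proof.
  unfold Ev. rewrite (CSer_finite _ 1); [simpl; ring|]. intros [|n] Hn; [lia | simpl; ring].
Qed.
Lemma Ev_ext a b q : (forall n, a n = b n) -> Ev a q = Ev b q.
Proof. intros H. apply CSer_ext. intros n. now rewrite H. Qed.

(** [fubini] is applied to the triangular array with entry a_k b_(n-k) q^n at (k, n) for k <= n.
    With w = sqrt m, the estimate m^n = w^(2n) <= w^(k + n) on the triangle supplies the product
    bound that [fubini] asks for. *)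
Lemma Ev_conv a b q : PSc a -> PSc b -> Cmod q < 1 -> Ev (conv a b) q = (Ev a q * Ev b q)%C.
Proof.
  intros Ha Hb Hq.
  assert (Hq0 : 0 <= Cmod q < 1) by (split; [apply Cmod_ge_0 | exact Hq]).
  destruct (PSc_geom a _ Ha Hq0) as (A & t & HA & Ht & H).
  destruct (PSc_geom b _ Hb Hq0) as (B & s & HB & Hs & H').
  set (m := Rmax t s). assert (Hm : 0 < m < 1) by (unfold m, Rmax; destruct Rle_dec; lra).
  assert (Htm : t <= m) by apply Rmax_l. assert (Hsm : s <= m) by apply Rmax_r.
  set (u := fun k n => if (k <=? n)%nat then ((a k * q ^ k) * (b (n - k)%nat * q ^ (n - k)))%C else RtoC 0).
  set (w := sqrt m).
  assert (Hw : 0 < w < 1).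
  { unfold w. split; [now apply sqrt_lt_R0|]. rewrite <- sqrt_1. apply sqrt_lt_1; lra. }
  assert (Hww : w * w = m) by (apply sqrt_sqrt; lra).
  assert (Hu : forall k n, Cmod (u k n) <= (A * w ^ k) * (B * w ^ n)).
  { intros k n. unfold u. destruct (Nat.leb_spec k n) as [Hkn|Hkn].
    - rewrite !Cmod_mult, !Cmod_pow.
      apply Rle_trans with ((A * m ^ k) * (B * m ^ (n - k))).
      + apply Rmult_le_compat; try (apply Rmult_le_pos; [apply Cmod_ge_0 | apply pow_le; lra]).
        * eapply Rle_trans; [apply H|]. apply Rmult_le_compat_l; [lra|]. apply pow_incr; lra.
        * eapply Rle_trans; [apply H'|]. apply Rmult_le_compat_l; [lra|]. apply pow_incr; lra.
      + replace (A * m ^ k * (B * m ^ (n - k))) with (A * B * w ^ (n + n)).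
        * replace (A * w ^ k * (B * w ^ n)) with (A * B * w ^ (k + n)) by (rewrite pow_add; ring).
          apply Rmult_le_compat_l; [now apply Rmult_le_pos|]. apply pow_dec; [lra | lia].
        * replace (A * m ^ k * (B * m ^ (n - k))) with (A * B * (m ^ k * m ^ (n - k))) by ring.
          rewrite <- pow_add. replace (k + (n - k))%nat with n by lia.
          rewrite <- Hww, Rpow_mult_distr, pow_add. ring.
    - rewrite Cmod_0. apply Rmult_le_pos; apply Rmult_le_pos; try lra; apply pow_le; lra. }
  assert (Ea : ex_series (fun n => A * w ^ n)) by (apply ex_series_geomR; lra).
  assert (Eb : ex_series (fun n => B * w ^ n)) by (apply ex_series_geomR; lra).
  pose proof (fubini u _ _ Hu Ea Eb) as HF.
  transitivity (CSer (fun n => CSer (fun m => u m n))).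
  - apply CSer_ext. intros n. rewrite (CSer_finite _ (S n)).
    + unfold conv. rewrite (Cmult_comm _ (q ^ n)), <- csum_scal. apply csum_ext. intros k Hk.
      unfold u. destruct (Nat.leb_spec k n) as [Hkn|Hkn]; [|lia].
      replace (q ^ n)%C with (q ^ k * q ^ (n - k))%C by (rewrite <- Cpow_add_r; f_equal; lia). ring.
    + intros k Hk. unfold u. destruct (Nat.leb_spec k n); [lia | reflexivity].
  - rewrite <- HF. rewrite (Cmult_comm (Ev a q)). unfold Ev at 2. rewrite <- CSer_scal by now apply PSc_asum.
    apply CSer_ext. intros k. rewrite (Cmult_comm (Ev b q)).
    rewrite (CSer_tail _ k) by (apply (fubini_row u _ _ Hu Eb)).
    rewrite csum_zero.
    + rewrite Cplus_0_l. unfold Ev. rewrite <- CSer_scal by now apply PSc_asum.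
      apply CSer_ext. intros n. unfold u. destruct (Nat.leb_spec k (k + n)) as [Hkn|Hkn]; [|lia].
      replace (k + n - k)%nat with n by lia. reflexivity.
    + intros j Hj. unfold u. destruct (Nat.leb_spec k j); [lia | reflexivity].
Qed.

Lemma Ev_bound a q r : PSc a -> Cmod q <= r < 1 -> Cmod (Ev a q) <= Series (fun n => Cmod (a n) * r ^ n).
Proof.
  intros Ha Hq. apply CSer_bound.
  - intros n. rewrite Cmod_mult, Cmod_pow. apply Rmult_le_compat_l; [apply Cmod_ge_0|].
    apply pow_incr. split; [apply Cmod_ge_0 | tauto].
  - apply PSc_abs; [exact Ha|]. pose proof (Cmod_ge_0 q). lra.
Qed.

Lemma Ev_conj (a : nat -> C) q : (forall n, Im (a n) = 0) -> Ev a (Cconj q) = Cconj (Ev a q).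
Proof.
  intros H. unfold Ev. rewrite <- CSer_conj. apply CSer_ext. intros n.
  rewrite Cmult_conj, Cpow_conj. f_equal. apply C_ext; [now rewrite re_conj|].
  rewrite im_conj, H. ring.
Qed.

Definition rser (a : nat -> C) : Prop := forall n, Im (a n) = 0.
Definition pser (a : nat -> C) : Prop := forall n, Im (a n) = 0 /\ 0 <= Re (a n).

Lemma csum_pos u n : (forall k, (k < n)%nat -> Im (u k) = 0 /\ 0 <= Re (u k)) -> Im (csum u n) = 0 /\ 0 <= Re (csum u n).
Proof.
  intros H. induction n as [|n IH]; [split; simpl; lra|]. cbn [csum].
  rewrite re_plus, im_plus. destruct (H n); [lia|]. destruct IH; [intros; apply H; lia|]. split; lra.
Qed.
Lemma pser_conv a b : pser a -> pser b -> pser (conv a b).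
Proof.
  intros Ha Hb n. apply csum_pos. intros k _. rewrite re_mult, im_mult.
  destruct (Ha k), (Hb (n - k)%nat) as [? ?]. rewrite H, H1. split; [ring | nra].
Qed.
Lemma rser_conv a b : rser a -> rser b -> rser (conv a b).
Proof.
  intros Ha Hb n. unfold conv. induction (S n) as [|m IH]; [reflexivity|].
  cbn [csum]. rewrite im_plus, im_mult, IH, (Ha m), (Hb (n - m)%nat). ring.
Qed.

Lemma Ev_pos a (r : R) : pser a -> PSc a -> 0 <= r < 1 ->
  Ev a r = RtoC (Series (fun n => Re (a n) * r ^ n)) /\ ex_series (fun n => Re (a n) * r ^ n).
Proof.
  intros Hp Ha Hr.
  assert (H : forall n, (a n * r ^ n)%C = RtoC (Re (a n) * r ^ n)).
  { intros n. rewrite (C_real (a n)) at 1 by apply Hp. rewrite <- RtoC_pow, <- RtoC_mult. reflexivity. }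
  split.
  - unfold Ev, CSer. apply C_ext.
    + apply Series_ext. intros n. rewrite H. reflexivity.
    + cbn [Im snd RtoC]. rewrite (Series_ext _ (fun n => 0 * 0)); [rewrite Series_scal_l; ring|].
      intros n. rewrite H. simpl. ring.
  - eapply ex_series_ext; [|apply (asum_re _ (PSc_asum a r Ha ltac:(rewrite Cmod_Rp; lra)))].
    intros n. cbn beta. rewrite H. reflexivity.
Qed.

(** * Complex derivatives *)

(* Differentiability with a quadratic remainder; all functions below are analytic, and this form composes without limits. *)
Definition cder (f : C -> C) (z l : C) : Prop :=
  exists K d, 0 <= K /\ 0 < d /\ forall h, Cmod h < d -> Cmod (f (z + h)%C - f z - l * h) <= K * (Cmod h) ^ 2.

Lemma cder_intro f z l K d : 0 < d ->
  (forall h, Cmod h < d -> Cmod (f (z + h)%C - f z - l * h) <= K * (Cmod h) ^ 2) -> cder f z l.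
Proof.
  intros Hd H. exists (Rabs K), d. split; [apply Rabs_pos|]. split; [exact Hd|].
  intros h Hh. eapply Rle_trans; [now apply H|].
  apply Rmult_le_compat_r; [apply pow2_ge_0 | apply Rle_abs].
Qed.

Lemma cder_const c z : cder (fun _ => c) z 0.
Proof.
  apply (cder_intro _ _ _ 0 1); [lra|]. intros h _.
  replace (c - c - 0 * h)%C with (RtoC 0) by ring. rewrite Cmod_0. lra.
Qed.
Lemma cder_id z : cder (fun z => z) z 1.
Proof.
  apply (cder_intro _ _ _ 0 1); [lra|]. intros h _.
  replace (z + h - z - 1 * h)%C with (RtoC 0) by ring. rewrite Cmod_0. lra.
Qed.

Lemma cder_eqv f z l m : cder f z l -> l = m -> cder f z m.
Proof. now intros H <-. Qed.

Lemma cder_local f g z l d : 0 < d -> (forall h, Cmod h < d -> f (z + h)%C = g (z + h)%C) ->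
  cder f z l -> cder g z l.
Proof.
  intros Hd H (K & e & HK & He & Hf). apply (cder_intro _ _ _ K (Rmin d e)); [now apply Rmin_glb_lt|].
  intros h Hh. assert (Cmod h < d) by (eapply Rlt_le_trans; [exact Hh | apply Rmin_l]).
  assert (Cmod h < e) by (eapply Rlt_le_trans; [exact Hh | apply Rmin_r]).
  replace (g z) with (f z); [rewrite <- H by assumption; now apply Hf|].
  specialize (H 0). rewrite Cplus_0_r in H. apply H. rewrite Cmod_0. exact Hd.
Qed.

Lemma cder_ext f g z l : (forall x, f x = g x) -> cder f z l -> cder g z l.
Proof. intros H. apply (cder_local _ _ _ _ 1); [lra | intros; apply H]. Qed.

Lemma cder_plus f g z l m : cder f z l -> cder g z m -> cder (fun z => f z + g z)%C z (l + m).
Proof.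
  intros (K & d & HK & Hd & Hf) (L & e & HL & He & Hg).
  apply (cder_intro _ _ _ (K + L) (Rmin d e)); [now apply Rmin_glb_lt|]. intros h Hh.
  assert (H1 : Cmod h < d) by (eapply Rlt_le_trans; [exact Hh | apply Rmin_l]).
  assert (H2 : Cmod h < e) by (eapply Rlt_le_trans; [exact Hh | apply Rmin_r]).
  replace (f (z + h)%C + g (z + h)%C - (f z + g z) - (l + m) * h)%C
    with ((f (z + h)%C - f z - l * h) + (g (z + h)%C - g z - m * h))%C by ring.
  eapply Rle_trans; [apply Cmod_triangle|]. specialize (Hf h H1). specialize (Hg h H2). lra.
Qed.

Lemma cder_lip f z l : cder f z l ->
  exists M d, 0 <= M /\ 0 < d /\ forall h, Cmod h < d -> Cmod (f (z + h)%C - f z) <= M * Cmod h.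
Proof.
  intros (K & d & HK & Hd & Hf). exists (K + Cmod l), (Rmin d 1).
  pose proof (Cmod_ge_0 l). split; [lra|]. split; [apply Rmin_glb_lt; lra|]. intros h Hh.
  assert (H1 : Cmod h < d) by (eapply Rlt_le_trans; [exact Hh | apply Rmin_l]).
  assert (H2 : Cmod h < 1) by (eapply Rlt_le_trans; [exact Hh | apply Rmin_r]).
  specialize (Hf h H1). pose proof (Cmod_triangle (f (z + h)%C - f z - l * h) (l * h)) as Ht.
  replace (f (z + h)%C - f z - l * h + l * h)%C with (f (z + h)%C - f z)%C in Ht by ring.
  rewrite Cmod_mult in Ht. pose proof (Cmod_ge_0 h).
  assert (K * Cmod h ^ 2 <= K * Cmod h) by (apply Rmult_le_compat_l; [lra | nra]). lra.
Qed.

Lemma cder_mult f g z l m : cder f z l -> cder g z m ->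
  cder (fun z => f z * g z)%C z (l * g z + f z * m).
Proof.
  intros Hf0 Hg0. destruct (cder_lip f z l Hf0) as (M1 & d1 & HM1 & Hd1 & Hl1).
  destruct (cder_lip g z m Hg0) as (M2 & d2 & HM2 & Hd2 & Hl2).
  destruct Hf0 as (K & d & HK & Hd & Hf), Hg0 as (L & e & HL & He & Hg).
  apply (cder_intro _ _ _ (K * Cmod (g z) + Cmod (f z) * L + M1 * M2) (Rmin (Rmin d e) (Rmin d1 d2)));
    [repeat apply Rmin_glb_lt; assumption|]. intros h Hh.
  apply Rmin_Rgt_l in Hh. destruct Hh as [Ha Hb].
  apply Rmin_Rgt_l in Ha. apply Rmin_Rgt_l in Hb. destruct Ha as [Ha1 Ha2], Hb as [Hb1 Hb2].
  replace (f (z + h)%C * g (z + h)%C - f z * g z - (l * g z + f z * m) * h)%C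
    with ((f (z + h)%C - f z - l * h) * g z + f z * (g (z + h)%C - g z - m * h)
          + (f (z + h)%C - f z) * (g (z + h)%C - g z))%C by ring.
  eapply Rle_trans; [apply Cmod_triangle|].
  eapply Rle_trans; [apply Rplus_le_compat_r, Cmod_triangle|]. rewrite !Cmod_mult.
  specialize (Hf h Ha1). specialize (Hg h Ha2). specialize (Hl1 h Hb1). specialize (Hl2 h Hb2).
  assert (H1 := Rmult_le_compat_r _ _ _ (Cmod_ge_0 (g z)) Hf).
  assert (H2 := Rmult_le_compat_l _ _ _ (Cmod_ge_0 (f z)) Hg).
  assert (H3 := Rmult_le_compat _ _ _ _ (Cmod_ge_0 _) (Cmod_ge_0 _) Hl1 Hl2). nra.
Qed.

Lemma cder_scal c f z l : cder f z l -> cder (fun z => c * f z)%C z (c * l).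
Proof.
  intros H. eapply cder_eqv; [exact (cder_mult _ _ _ _ _ (cder_const c z) H) | cbv beta; ring].
Qed.
Lemma cder_minus f g z l m : cder f z l -> cder g z m -> cder (fun z => f z - g z)%C z (l - m).
Proof.
  intros Hf Hg. apply (cder_ext (fun z => f z + (RtoC (-1)) * g z)%C); [intros; ring|].
  eapply cder_eqv; [apply (cder_plus _ _ _ _ _ Hf (cder_scal (RtoC (-1)) _ _ _ Hg)) | cbv beta; ring].
Qed.

Lemma cder_comp f g z l m : cder f (g z) l -> cder g z m -> cder (fun z => f (g z)) z (l * m).
Proof.
  intros (K & d & HK & Hd & Hf) Hg0. destruct (cder_lip g z m Hg0) as (M & e & HM & He & Hl).
  destruct Hg0 as (L & e' & HL & He' & Hg).
  apply (cder_intro _ _ _ (K * M ^ 2 + Cmod l * L) (Rmin (Rmin e e') (d / (M + 1)))).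
  { repeat apply Rmin_glb_lt; try assumption. apply Rdiv_lt_0_compat; lra. }
  intros h Hh. apply Rmin_Rgt_l in Hh. destruct Hh as [Ha Hb].
  apply Rmin_Rgt_l in Ha. destruct Ha as [Ha1 Ha2].
  specialize (Hl h Ha1). specialize (Hg h Ha2). pose proof (Cmod_ge_0 h) as Hh0.
  assert (Hk : Cmod (g (z + h)%C - g z) < d).
  { assert (Cmod h * (M + 1) < d); [|nra].
    apply (Rmult_lt_compat_r (M + 1)) in Hb; [|lra].
    unfold Rdiv in Hb. rewrite Rmult_assoc, Rinv_l in Hb by lra. lra. }
  specialize (Hf _ Hk). replace (g z + (g (z + h)%C - g z))%C with (g (z + h)%C) in Hf by ring.
  replace (f (g (z + h)%C) - f (g z) - l * m * h)%C
    with ((f (g (z + h)%C) - f (g z) - l * (g (z + h)%C - g z)) + l * (g (z + h)%C - g z - m * h))%C by ring.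
  eapply Rle_trans; [apply Cmod_triangle|]. rewrite Cmod_mult.
  assert (H2 := Rmult_le_compat_l _ _ _ (Cmod_ge_0 l) Hg).
  pose proof (Cmod_ge_0 (g (z + h)%C - g z)).
  assert (Cmod (g (z + h)%C - g z) ^ 2 <= (M * Cmod h) ^ 2) by (apply pow_incr; lra).
  assert (K * Cmod (g (z + h)%C - g z) ^ 2 <= K * (M * Cmod h) ^ 2) by now apply Rmult_le_compat_l.
  nra.
Qed.

Lemma cder_inv z : z <> RtoC 0 -> cder (fun z => / z)%C z (- / (z * z)).
Proof.
  intros Hz. pose proof (proj1 (Cmod_gt_0 z) Hz) as Hz0.
  apply (cder_intro _ _ _ (2 / Cmod z ^ 3) (Cmod z / 2)); [lra|]. intros h Hh.
  assert (Hzh : Cmod z / 2 <= Cmod (z + h)).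
  { pose proof (Cmod_sub_ge z (- h)) as Hs. replace (z - - h)%C with (z + h)%C in Hs by ring.
    rewrite Cmod_opp in Hs. lra. }
  assert (Hne : (z + h)%C <> RtoC 0) by (apply Cmod_gt_0; lra).
  replace (/ (z + h) - / z - - / (z * z) * h)%C with (h * h * / (z * z * (z + h)))%C by (field; auto).
  rewrite !Cmod_mult, Cmod_inv by (repeat apply Cmult_neq_0; auto). rewrite !Cmod_mult.
  replace (2 / Cmod z ^ 3 * Cmod h ^ 2) with (Cmod h * Cmod h * / (Cmod z * Cmod z * (Cmod z / 2))) by (field; lra).
  apply Rmult_le_compat_l; [pose proof (Cmod_ge_0 h); nra|].
  apply Rinv_le_contravar; [apply Rmult_lt_0_compat; nra|]. apply Rmult_le_compat_l; [nra | lra].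
Qed.

Lemma cder_pow f z l n : cder f z l -> cder (fun z => f z ^ S n)%C z (INR (S n) * f z ^ n * l).
Proof.
  intros H. induction n as [|n IH].
  - apply (cder_ext f); [intros; simpl; ring|]. apply (cder_eqv _ _ _ _ H). simpl; ring.
  - apply (cder_ext (fun z => f z * f z ^ S n)%C); [reflexivity|].
    eapply cder_eqv; [apply (cder_mult _ _ _ _ _ H IH)|].
    rewrite (S_INR (S n)), RtoC_plus. simpl Cpow. ring.
Qed.

Lemma cder_unique f z l m : cder f z l -> cder f z m -> l = m.
Proof.
  intros (K & d & HK & Hd & Hf) (L & e & HL & He & Hg).
  apply Ceq_minus, Cmod_eq_0, Rle_antisym; [|apply Cmod_ge_0].
  apply Rnot_lt_le. intros Hlt.
  set (x := Rmin (Rmin (d / 2) (e / 2)) (Cmod (l - m) / (2 * (K + L + 1)))).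
  assert (Hx : 0 < x).
  { unfold x. repeat apply Rmin_glb_lt; try lra. apply Rdiv_lt_0_compat; lra. }
  assert (Hx1 : x < d) by (eapply Rle_lt_trans; [apply Rle_trans with (1 := Rmin_l _ _); apply Rmin_l | lra]).
  assert (Hx2 : x < e) by (eapply Rle_lt_trans; [apply Rle_trans with (1 := Rmin_l _ _); apply Rmin_r | lra]).
  assert (Hx3 : x * (2 * (K + L + 1)) <= Cmod (l - m)).
  { apply Rle_trans with (Cmod (l - m) / (2 * (K + L + 1)) * (2 * (K + L + 1)));
      [apply Rmult_le_compat_r; [lra | apply Rmin_r] | right; field; lra]. }
  assert (Hm : Cmod x = x) by (apply Cmod_Rp; lra).
  specialize (Hf x). specialize (Hg x). rewrite Hm in Hf, Hg.
  specialize (Hf Hx1). specialize (Hg Hx2).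
  pose proof (Cmod_sub (f (z + x)%C - f z - m * x) (f (z + x)%C - f z - l * x)) as Ht.
  match type of Ht with Cmod ?y <= _ => replace y with ((l - m) * x)%C in Ht by ring end.
  rewrite Cmod_mult, Hm in Ht. nra.
Qed.

Lemma in_H_local z : in_H z -> exists d, 0 < d /\ forall h, Cmod h < d -> in_H (z + h).
Proof.
  unfold in_H. intros H. exists (Im z). split; [exact H|]. intros h Hh.
  rewrite im_plus. pose proof (im_le_Cmod h) as H1.
  assert (Rabs (Im h) < Im z) by lra. apply Rabs_def2 in H0. lra.
Qed.

(** Differentiates an identity known only on the half-plane, by locality of [cder]; this is how
    functional equations are passed to derivatives. *)
Lemma cder_H_eq f g z l m : (forall x, in_H x -> f x = g x) -> in_H z -> cder f z l -> cder g z m -> l = m.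
Proof.
  intros H Hz Hf Hg. destruct (in_H_local z Hz) as (d & Hd & Hl).
  apply (cder_unique g z); [|exact Hg]. apply (cder_local f g z l d Hd); [|exact Hf].
  intros h Hh. now apply H, Hl.
Qed.

Lemma cder_re_derive f (t : R) l : cder f t l -> is_derive (fun x : R => Re (f x)) t (Re l).
Proof.
  intros (K & d & HK & Hd & Hf). apply is_derive_Reals. intros eps He.
  assert (Hx : 0 < Rmin d (eps / (K + 1))) by (apply Rmin_glb_lt; [lra | apply Rdiv_lt_0_compat; lra]).
  exists (mkposreal _ Hx). simpl. intros h Hh0 Hh. apply Rmin_Rgt_l in Hh. destruct Hh as [H1 H2].
  specialize (Hf h). rewrite Cmod_R in Hf. specialize (Hf H1). rewrite <- RtoC_plus in Hf.
  replace ((Re (f (t + h)%R) - Re (f t)) / h - Re l) with (Re (f (RtoC (t + h)) - f t - l * h)%C / h).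
  - unfold Rdiv. rewrite Rabs_mult, Rabs_inv.
    pose proof (Rabs_pos_lt h Hh0) as Hp.
    apply (Rmult_lt_reg_r (Rabs h)); [exact Hp|]. rewrite Rmult_assoc, Rinv_l, Rmult_1_r by lra.
    eapply Rle_lt_trans; [apply re_le_Cmod|]. eapply Rle_lt_trans; [exact Hf|].
    assert (Rabs h * (K + 1) < eps).
    { replace eps with (eps / (K + 1) * (K + 1)) by (field; lra). apply Rmult_lt_compat_r; lra. }
    nra.
  - rewrite !re_minus, re_scal_r. field. exact Hh0.
Qed.

Lemma cder_im_derive f (t : R) l : cder f t l -> is_derive (fun x : R => Im (f x)) t (Im l).
Proof.
  intros H. apply (cder_scal (- Ci)) in H. apply cder_re_derive in H.
  replace (Im l) with (Re (- Ci * l)) by (destruct l; simpl; ring).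
  eapply is_derive_ext; [|exact H]. intros x. cbv beta. destruct (f x); simpl; ring.
Qed.

(** The half-plane is convex, and along the segment from z to w the real and imaginary parts have
    zero derivative. *)
Lemma cder_const_H f : (forall z, in_H z -> cder f z 0) ->
  forall z w, in_H z -> in_H w -> f z = f w.
Proof.
  intros H z w Hz Hw.
  assert (HD : forall t : R, 0 <= t <= 1 -> cder (fun x => f (z + x * (w - z))%C) t 0).
  { intros t Ht. eapply cder_eqv.
    - apply (cder_comp f (fun x => z + x * (w - z))%C t 0 (w - z)).
      + apply H. unfold in_H in *. rewrite im_plus, im_scal_l, im_minus. nra.
      + eapply cder_eqv; [apply cder_plus; [apply cder_const | apply cder_mult; [apply cder_id | apply cder_const]]|].
        cbv beta; ring.
    - ring. }
  replace (f z) with (f (z + 0 * (w - z))%C) by (f_equal; ring).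
  replace (f w) with (f (z + 1 * (w - z))%C) by (f_equal; ring).
  apply C_ext.
  - apply (eq_is_derive (fun t : R => Re (f (z + t * (w - z))%C)) 0 1); [|lra].
    intros t Ht. exact (cder_re_derive _ t _ (HD t Ht)).
  - apply (eq_is_derive (fun t : R => Im (f (z + t * (w - z))%C)) 0 1); [|lra].
    intros t Ht. exact (cder_im_derive _ t _ (HD t Ht)).
Qed.

(** * The exponential and the local parameter *)

Definition cexp (w : C) : C := (exp (Re w) * cos (Im w), exp (Re w) * sin (Im w)).
Definition tpi : C := (2 * PI * Ci)%C.

Lemma cexp_add w v : cexp (w + v) = (cexp w * cexp v)%C.
Proof.
  unfold cexp. rewrite re_plus, im_plus, exp_plus, cos_plus, sin_plus.
  apply C_ext; simpl; ring.
Qed.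
Lemma cexp_0 : cexp 0 = RtoC 1.
Proof. unfold cexp. simpl. rewrite exp_0, cos_0, sin_0. apply C_ext; simpl; ring. Qed.
Lemma Cmod_cexp w : Cmod (cexp w) = exp (Re w).
Proof.
  unfold cexp, Cmod; simpl.
  replace (_ + _) with (exp (Re w) ^ 2).
  - apply sqrt_pow2, Rlt_le, exp_pos.
  - pose proof (sin2_cos2 (Im w)) as H. unfold Rsqr in H.
    transitivity (exp (Re w) ^ 2 * (sin (Im w) * sin (Im w) + cos (Im w) * cos (Im w))); [rewrite H|]; ring.
Qed.
Lemma qpar_cexp z : qpar z = cexp (tpi * z).
Proof.
  unfold qpar, cexp, tpi. destruct z as [x y]. simpl.
  f_equal; f_equal; f_equal; ring.
Qed.
Lemma qpar_add z w : qpar (z + w) = (qpar z * qpar w)%C.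
Proof. rewrite !qpar_cexp, <- cexp_add. f_equal. ring. Qed.
Lemma qpar_1 : qpar 1 = RtoC 1.
Proof.
  unfold qpar; simpl. rewrite !Rmult_0_r, Ropp_0, exp_0, !Rmult_1_r, cos_2PI, sin_2PI.
  apply C_ext; simpl; ring.
Qed.
Lemma qpar_T z : qpar (z + 1) = qpar z.
Proof. rewrite qpar_add, qpar_1. ring. Qed.
Lemma Cmod_qpar z : Cmod (qpar z) = exp (- (2 * PI * Im z)).
Proof.
  rewrite qpar_cexp, Cmod_cexp. f_equal. unfold tpi. destruct z; simpl; ring.
Qed.
Lemma qpar_neq0 z : qpar z <> RtoC 0.
Proof. apply Cmod_gt_0. rewrite Cmod_qpar. apply exp_pos. Qed.
Lemma qpar_lt1 z : in_H z -> Cmod (qpar z) < 1.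
Proof.
  intros H. rewrite Cmod_qpar, <- exp_0. apply exp_increasing.
  unfold in_H in H. pose proof PI_RGT_0. nra.
Qed.
Lemma qpar_pow z n : (qpar z ^ n)%C = qpar (INR n * z).
Proof.
  induction n as [|n IH].
  - simpl. rewrite qpar_cexp. replace (tpi * (0 * z))%C with (RtoC 0) by ring. now rewrite cexp_0.
  - rewrite Cpow_S, IH, <- qpar_add. f_equal. rewrite S_INR, RtoC_plus. ring.
Qed.

(** One step of a Taylor remainder estimate: order n for the derivative becomes order n + 1 for the
    function. The expansions of exp, sin and cos below iterate it from a crude bound. *)
Lemma mvt_pow (f f' : R -> R) K n : 0 <= K -> (forall t, Rabs t <= 1 -> is_derive f t (f' t)) -> f 0 = 0 ->
  (forall t, Rabs t <= 1 -> Rabs (f' t) <= K * Rabs t ^ n) ->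
  forall t, Rabs t <= 1 -> Rabs (f t) <= K * Rabs t ^ (S n).
Proof.
  intros HK0 Hd H0 HK t Ht.
  assert (Hb : forall x, Rmin 0 t <= x <= Rmax 0 t -> Rabs x <= Rabs t).
  { intros x. unfold Rmin, Rmax. destruct (Rle_dec 0 t); intros Hx.
    - rewrite !Rabs_pos_eq; lra.
    - rewrite !Rabs_left1; lra. }
  destruct (MVT_gen f 0 t f') as (c & Hc & E).
  - intros x Hx. apply Hd. pose proof (Hb x). lra.
  - intros x Hx. apply derivable_continuous_pt. exists (f' x). apply is_derive_Reals, Hd.
    pose proof (Hb x Hx). lra.
  - rewrite H0, !Rminus_0_r in E. rewrite E, Rabs_mult. simpl.
    pose proof (Hb c Hc) as Hct. specialize (HK c ltac:(lra)).
    assert (HK' : K * Rabs c ^ n <= K * Rabs t ^ n).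
    { apply Rmult_le_compat_l; [exact HK0|]. apply pow_incr. split; [apply Rabs_pos | exact Hct]. }
    pose proof (Rabs_pos t). pose proof (Rabs_pos (f' c)). nra.
Qed.

Lemma exp_taylor t : Rabs t <= 1 -> Rabs (exp t - 1 - t - t ^ 2 / 2) <= 3 * Rabs t ^ 3.
Proof.
  revert t. apply (mvt_pow _ (fun t => exp t - 1 - t)); [lra | | |].
  - intros t _. auto_derive; [trivial | field].
  - rewrite exp_0. field.
  - apply (mvt_pow _ (fun t => exp t - 1)); [lra | | |].
    + intros t _. auto_derive; [trivial | ring].
    + rewrite exp_0. ring.
    + apply (mvt_pow _ exp); [lra | | |].
      * intros t _. auto_derive; [trivial | ring].
      * rewrite exp_0. ring.
      * intros t Ht. rewrite Rabs_pos_eq by apply Rlt_le, exp_pos. simpl.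
        apply Rabs_le_between in Ht. rewrite Rmult_1_r.
        eapply Rle_trans; [|exact exp_le_3]. destruct (Req_dec t 1) as [->|]; [lra|].
        apply Rlt_le, exp_increasing. lra.
Qed.

Lemma trig_taylor t : Rabs t <= 1 -> Rabs (cos t - 1 + t ^ 2 / 2) <= Rabs t ^ 3 /\ Rabs (sin t - t) <= Rabs t ^ 3.
Proof.
  revert t.
  assert (Hs : forall t, Rabs t <= 1 -> Rabs (sin t) <= 1 * Rabs t ^ 1).
  { apply (mvt_pow _ cos); [lra | | apply sin_0 |].
    - intros t _. auto_derive; [trivial | ring].
    - intros t _. simpl. rewrite Rmult_1_r. apply Rabs_le. apply COS_bound. }
  assert (Hc : forall t, Rabs t <= 1 -> Rabs (cos t - 1) <= 1 * Rabs t ^ 2).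
  { apply (mvt_pow _ (fun t => - sin t)); [lra | | rewrite cos_0; ring |].
    - intros t _. auto_derive; [trivial | ring].
    - intros t Ht. rewrite Rabs_Ropp. now apply Hs. }
  assert (Hs3 : forall t, Rabs t <= 1 -> Rabs (sin t - t) <= 1 * Rabs t ^ 3).
  { apply (mvt_pow _ (fun t => cos t - 1)); [lra | | rewrite sin_0; ring | exact Hc].
    intros t _. auto_derive; [trivial | ring]. }
  intros t Ht. split; [|specialize (Hs3 t Ht); lra].
  apply Rle_trans with (1 * Rabs t ^ 4).
  - revert t Ht. apply (mvt_pow _ (fun t => - (sin t - t))); [lra | | rewrite cos_0; field |].
    + intros t _. auto_derive; [trivial | field].
    + intros t Ht. rewrite Rabs_Ropp. now apply Hs3.
  - rewrite Rmult_1_l. apply pow_dec; [split; [apply Rabs_pos | exact Ht] | lia].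
Qed.

Lemma cexp_taylor w : Cmod w <= 1 -> Cmod (cexp w - 1 - w - w * w / 2) <= 13 * Cmod w ^ 3.
Proof.
  intros Hw. destruct w as [u v]. set (m := Cmod (u, v)) in *.
  assert (Hu : Rabs u <= m) by exact (re_le_Cmod (u, v)).
  assert (Hv : Rabs v <= m) by exact (im_le_Cmod (u, v)).
  assert (Hm3 : forall x, Rabs x <= m -> Rabs x ^ 3 <= m ^ 3) by (intros; apply pow_incr; split; [apply Rabs_pos | assumption]).
  pose proof (exp_taylor u ltac:(lra)) as Ha. destruct (trig_taylor v ltac:(lra)) as [Hb Hc].
  pose proof (Hm3 u Hu). pose proof (Hm3 v Hv).
  set (a := exp u - 1 - u - u ^ 2 / 2) in *. set (b := cos v - 1 + v ^ 2 / 2) in *. set (c := sin v - v) in *.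
  assert (Huu : Rabs (u * v * v) <= m ^ 3).
  { rewrite !Rabs_mult. simpl. rewrite Rmult_1_r, <- Rmult_assoc.
    apply Rmult_le_compat; try apply Rabs_pos; [apply Rmult_le_pos; apply Rabs_pos | | exact Hv].
    apply Rmult_le_compat; try apply Rabs_pos; assumption. }
  assert (Hvv : Rabs (u * u * v) <= m ^ 3).
  { rewrite !Rabs_mult. simpl. rewrite Rmult_1_r, <- Rmult_assoc.
    apply Rmult_le_compat; try apply Rabs_pos; [apply Rmult_le_pos; apply Rabs_pos | | exact Hv].
    apply Rmult_le_compat; try apply Rabs_pos; assumption. }
  apply Rabs_le_between in Hu, Hv, Huu, Hvv.
  assert (HB : Rabs ((1 + u + u ^ 2 / 2) * b) <= 5 / 2 * m ^ 3).
  { rewrite Rabs_mult. apply Rmult_le_compat; try apply Rabs_pos; [apply Rabs_le; split; nra | lra]. }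
  assert (HC : Rabs ((1 + u + u ^ 2 / 2) * c) <= 5 / 2 * m ^ 3).
  { rewrite Rabs_mult. apply Rmult_le_compat; try apply Rabs_pos; [apply Rabs_le; split; nra | lra]. }
  assert (HA : Rabs (a * cos v) <= 3 * m ^ 3).
  { rewrite Rabs_mult, <- (Rmult_1_r (3 * m ^ 3)). apply Rmult_le_compat; try apply Rabs_pos; [lra|].
    apply Rabs_le, COS_bound. }
  assert (HA' : Rabs (a * sin v) <= 3 * m ^ 3).
  { rewrite Rabs_mult, <- (Rmult_1_r (3 * m ^ 3)). apply Rmult_le_compat; try apply Rabs_pos; [lra|].
    apply Rabs_le, SIN_bound. }
  eapply Rle_trans; [apply Cmod_le_re_im|].
  replace (Re (cexp (u, v) - 1 - (u, v) - (u, v) * (u, v) / 2))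
    with (- (u * v * v) / 2 - (u * u * v) * v / 4 + (1 + u + u ^ 2 / 2) * b + a * cos v)
    by (unfold a, b, cexp; simpl; field).
  replace (Im (cexp (u, v) - 1 - (u, v) - (u, v) * (u, v) / 2))
    with ((u * u * v) / 2 + (1 + u + u ^ 2 / 2) * c + a * sin v)
    by (unfold a, c, cexp; simpl; field).
  assert (Hw4 : Rabs ((u * u * v) * v) <= m ^ 3).
  { rewrite Rabs_mult, <- (Rmult_1_r (m ^ 3)). apply Rmult_le_compat; try apply Rabs_pos; apply Rabs_le; lra. }
  apply Rabs_le_between in HA, HA', HB, HC, Hw4.
  assert (Rabs (- (u * v * v) / 2 - (u * u * v) * v / 4 + (1 + u + u ^ 2 / 2) * b + a * cos v) <= 13 / 2 * m ^ 3)
    by (apply Rabs_le; lra).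
  assert (Rabs ((u * u * v) / 2 + (1 + u + u ^ 2 / 2) * c + a * sin v) <= 6 * m ^ 3) by (apply Rabs_le; lra).
  assert (0 <= m ^ 3) by (apply pow_le, Cmod_ge_0). lra.
Qed.

Lemma cder_cexp w : cder cexp w (cexp w).
Proof.
  apply (cder_intro _ _ _ (Cmod (cexp w) * 14) 1); [lra|]. intros h Hh.
  rewrite cexp_add. replace (cexp w * cexp h - cexp w - cexp w * h)%C with (cexp w * (cexp h - 1 - h))%C by ring.
  rewrite Cmod_mult, Rmult_assoc. apply Rmult_le_compat_l; [apply Cmod_ge_0|].
  pose proof (cexp_taylor h ltac:(lra)) as H.
  pose proof (Cmod_triangle (cexp h - 1 - h - h * h / 2) (h * h / 2)) as Ht.
  replace (cexp h - 1 - h - h * h / 2 + h * h / 2)%C with (cexp h - 1 - h)%C in Ht by ring.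
  rewrite Cmod_div, Cmod_mult, (Cmod_Rp 2) in Ht by (try apply RtoC_neq; lra || (intros E; apply RtoC_inj in E; lra)).
  pose proof (Cmod_ge_0 h). simpl in *. nra.
Qed.

Lemma cder_qpar z : cder qpar z (tpi * qpar z).
Proof.
  apply (cder_ext (fun z => cexp (tpi * z))); [intros; symmetry; apply qpar_cexp|].
  eapply cder_eqv.
  - apply (cder_comp cexp (fun z => tpi * z)%C); [apply cder_cexp | apply cder_scal, cder_id].
  - cbv beta. rewrite qpar_cexp. ring.
Qed.

(** * Differentiation of power series *)

(** The second-order remainder of p^n at q, multiplied by q and by r so that no exponent n - 1 or n
    - 2 appears and the induction can start at 0. *)
Lemma pow_taylor (p q : C) r n : 0 < r -> Cmod p <= r -> Cmod q <= r ->
  r * Cmod (q * (p ^ n - q ^ n) - INR n * q ^ n * (p - q)) <= INR n ^ 2 * r ^ n * Cmod (p - q) ^ 2.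
Proof.
  intros Hr Hp Hq. induction n as [|n IH].
  - replace (q * (p ^ 0 - q ^ 0) - INR 0 * q ^ 0 * (p - q))%C with (RtoC 0) by (simpl; ring).
    rewrite Cmod_0. simpl. lra.
  - set (e := (q * (p ^ n - q ^ n) - INR n * q ^ n * (p - q))%C) in *.
    replace (q * (p ^ S n - q ^ S n) - INR (S n) * q ^ S n * (p - q))%C
      with (p * e + INR n * q ^ n * ((p - q) * (p - q)))%C
      by (unfold e; rewrite S_INR, RtoC_plus; simpl; ring).
    pose proof (Cmod_triangle (p * e) (INR n * q ^ n * ((p - q) * (p - q)))) as Ht.
    rewrite !Cmod_mult, Cmod_pow, (Cmod_Rp (INR n)) in Ht by apply pos_INR.
    set (x := Cmod (p - q)) in *. pose proof (pos_INR n) as Hn.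
    assert (Hqn : Cmod q ^ n <= r ^ n) by (apply pow_incr; split; [apply Cmod_ge_0 | exact Hq]).
    assert (H1 : Cmod p * Cmod e <= r * Cmod e) by (apply Rmult_le_compat_r; [apply Cmod_ge_0 | exact Hp]).
    assert (Hx : 0 <= x * x) by nra.
    assert (H2 : INR n * Cmod q ^ n * (x * x) <= INR n * r ^ n * (x * x))
      by (apply Rmult_le_compat_r; [exact Hx | now apply Rmult_le_compat_l]).
    apply Rle_trans with (r * (r * Cmod e + INR n * r ^ n * (x * x))); [apply Rmult_le_compat_l; lra|].
    rewrite S_INR. simpl.
    assert (Hr2 : 0 <= r ^ n * r * (x * x)) by (apply Rmult_le_pos; [apply Rmult_le_pos; [apply pow_le; lra | lra] | exact Hx]).
    assert (H3 : r * (r * Cmod e) <= r * (INR n ^ 2 * r ^ n * x ^ 2)) by (apply Rmult_le_compat_l; lra).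
    simpl in H3. nra.
Qed.

(** The remainders of [pow_taylor] are summable because [D] applied twice preserves [PSc]. The
    derivative is expressed through [D], hence the division by q. *)
Lemma cder_Ev a q : PSc a -> Cmod q < 1 -> q <> RtoC 0 -> cder (Ev a) q (Ev (D a) q / q).
Proof.
  intros Ha Hq Hq0. set (r := (1 + Cmod q) / 2).
  pose proof (proj1 (Cmod_gt_0 q) Hq0) as Hqp.
  assert (Hr : 0 < r < 1) by (unfold r; lra).
  pose proof (PSc_D _ (PSc_D _ Ha)) as HDD.
  set (S0 := Series (fun n => Cmod (D (D a) n) * r ^ n)).
  assert (HS0 : ex_series (fun n => Cmod (D (D a) n) * r ^ n)) by (apply PSc_abs; [exact HDD | lra]).
  apply (cder_intro _ _ _ (S0 / (r * Cmod q)) (r - Cmod q)); [unfold r; lra|]. intros h Hh.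
  assert (Hp : Cmod (q + h) <= r) by (eapply Rle_trans; [apply Cmod_triangle | lra]).
  assert (Hp1 : Cmod (q + h) < 1) by lra. assert (Hqr : Cmod q <= r) by (unfold r; lra).
  assert (E : (q * (Ev a (q + h) - Ev a q) - Ev (D a) q * h)%C
     = CSer (fun n => a n * (q * ((q + h) ^ n - q ^ n) - INR n * q ^ n * ((q + h) - q)))%C).
  { rewrite (CSer_ext _ (fun n => (q * (a n * (q + h) ^ n) - q * (a n * q ^ n)) - h * (D a n * q ^ n)))%C
      by (intros; unfold D; ring).
    unfold Ev.
    rewrite CSer_minus, CSer_minus, !CSer_scal; try ring;
      repeat (apply asum_minus || apply asum_scal || apply PSc_asum || apply PSc_D); assumption. }
  assert (HB : Cmod (q * (Ev a (q + h) - Ev a q) - Ev (D a) q * h) <= Cmod h ^ 2 / r * S0).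
  { rewrite E. unfold S0. rewrite <- Series_scal_l. apply CSer_bound; [|now apply ex_series_scalR].
    intros n. rewrite Cmod_mult.
    pose proof (pow_taylor (q + h) q r n (proj1 Hr) Hp Hqr) as HT.
    replace (q + h - q)%C with h in * by ring.
    apply (Rmult_le_reg_l r); [lra|].
    replace (r * (Cmod h ^ 2 / r * (Cmod (D (D a) n) * r ^ n))) with (Cmod (a n) * (INR n ^ 2 * r ^ n * Cmod h ^ 2)).
    - replace (r * (Cmod (a n) * Cmod (q * ((q + h) ^ n - q ^ n) - INR n * q ^ n * h)))
        with (Cmod (a n) * (r * Cmod (q * ((q + h) ^ n - q ^ n) - INR n * q ^ n * h))) by ring.
      apply Rmult_le_compat_l; [apply Cmod_ge_0 | exact HT].
    - unfold D. rewrite !Cmod_mult, Cmod_Rp by apply pos_INR. field. lra. }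
  apply (Rmult_le_reg_l (Cmod q)); [exact Hqp|]. rewrite <- Cmod_mult.
  replace (q * (Ev a (q + h) - Ev a q - Ev (D a) q / q * h))%C
    with (q * (Ev a (q + h) - Ev a q) - Ev (D a) q * h)%C by (field; exact Hq0).
  eapply Rle_trans; [exact HB|]. right. field. lra.
Qed.

Definition F (a : nat -> C) (z : C) : C := Ev a (qpar z).

Lemma cder_F a z : PSc a -> in_H z -> cder (F a) z (tpi * F (D a) z).
Proof.
  intros Ha Hz. unfold F. eapply cder_eqv.
  - apply (cder_comp (Ev a) qpar); [apply cder_Ev; [exact Ha | now apply qpar_lt1 | apply qpar_neq0] | apply cder_qpar].
  - field. apply qpar_neq0.
Qed.

Lemma F_T a z : F a (z + 1) = F a z.
Proof. unfold F. now rewrite qpar_T. Qed.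

(** * Lipschitz summation *)

Definition isq (n : nat) : R := / INR (S n) ^ 2.

Lemma INR_S_pos n : 0 < INR (S n).
Proof. apply lt_0_INR. lia. Qed.
Lemma INR_S_ge1 n : 1 <= INR (S n).
Proof. rewrite S_INR. pose proof (pos_INR n). lra. Qed.

Lemma isq_pos n : 0 < isq n.
Proof. apply Rinv_0_lt_compat, pow_lt, INR_S_pos. Qed.

Lemma rsum_isq_le n : rsum isq (S n) <= 2 - / INR (S n).
Proof.
  induction n as [|n IH]; [unfold isq; simpl; lra|].
  change (rsum isq (S (S n))) with (rsum isq (S n) + isq (S n)). unfold isq at 2.
  pose proof (INR_S_ge1 n) as H. rewrite (S_INR (S n)). set (x := INR (S n)) in *.
  apply Rle_trans with (2 - / x + / (x + 1) ^ 2); [unfold x in *; lra|].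
  assert (/ (x + 1) ^ 2 <= / x - / (x + 1)); [|lra].
  replace (/ x - / (x + 1)) with (/ (x * (x + 1))) by (field; lra).
  apply Rinv_le_contravar; nra.
Qed.

Lemma ex_isq : ex_series isq.
Proof.
  apply (ex_series_bound _ 2); [intros; apply Rlt_le, isq_pos|]. intros [|n]; [simpl; lra|].
  pose proof (rsum_isq_le n). pose proof (Rinv_0_lt_compat _ (INR_S_pos n)). lra.
Qed.

(** Combines |z + m| >= Im z with |z + m| >= |m| - |z|, weighted by 1 + |z| and Im z. *)
Lemma lat_bound z : in_H z -> exists c, 0 < c /\ forall m : R, c * (1 + Rabs m) <= Cmod (z + m).
Proof.
  unfold in_H. intros Hz. pose proof (Cmod_ge_0 z).
  exists (Im z / (1 + Cmod z + Im z)). split; [apply Rdiv_lt_0_compat; lra|]. intros m.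
  apply (Rmult_le_reg_r (1 + Cmod z + Im z)); [lra|].
  replace (Im z / (1 + Cmod z + Im z) * (1 + Rabs m) * (1 + Cmod z + Im z)) with (Im z * (1 + Rabs m)) by (field; lra).
  pose proof (im_le_Cmod (z + m)) as H1. rewrite im_plus, im_RtoC, Rplus_0_r, Rabs_pos_eq in H1 by lra.
  pose proof (Cmod_sub_ge m (- z)) as H2. replace (m - - z)%C with (z + m)%C in H2 by ring.
  rewrite Cmod_opp, Cmod_R in H2.
  assert (Im z * (1 + Cmod z) <= Cmod (z + m) * (1 + Cmod z)) by (apply Rmult_le_compat_r; lra).
  assert (Im z * (Rabs m - Cmod z) <= Im z * Cmod (z + m)) by (apply Rmult_le_compat_l; lra). lra.
Qed.

Lemma in_H_add z (m : R) : in_H z -> in_H (z + m).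
Proof. unfold in_H. rewrite im_plus, im_RtoC. lra. Qed.
Lemma in_H_neq0 z : in_H z -> z <> RtoC 0.
Proof. unfold in_H. intros H E. rewrite E in H. simpl in H. lra. Qed.

(* The summands with index n+1 and -(n+1), paired so that the case s = 1 (the cotangent) converges. *)
Definition Lt (s : nat) (z : C) (n : nat) : C := (/ (z + INR (S n)) ^ s + / (z - INR (S n)) ^ s)%C.
Definition L (s : nat) (z : C) : C := (/ z ^ s + CSer (Lt s z))%C.

Lemma inv_pow_bound (w : C) c x s : 0 < c -> 1 <= x -> c * x <= Cmod w ->
  Cmod (/ w ^ (2 + s)) <= / c ^ (2 + s) * / x ^ 2.
Proof.
  intros Hc Hx Hw. assert (Hw0 : 0 < Cmod w) by nra.
  rewrite Cmod_inv by (apply Cpow_nz, Cmod_gt_0; exact Hw0).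
  rewrite Cmod_pow, <- Rinv_mult. apply Rinv_le_contravar.
  - apply Rmult_lt_0_compat; apply pow_lt; lra.
  - apply Rle_trans with ((c * x) ^ (2 + s)); [|apply pow_incr; nra].
    rewrite Rpow_mult_distr. apply Rmult_le_compat_l; [apply pow_le; lra|].
    rewrite pow_add. rewrite <- (Rmult_1_r (x ^ 2)) at 1. apply Rmult_le_compat_l; [nra|].
    now apply pow_R1_Rle.
Qed.

Lemma lat_pm z : in_H z -> exists c, 0 < c /\
  forall n, c * INR (S n) <= Cmod (z + INR (S n)) /\ c * INR (S n) <= Cmod (z - INR (S n)).
Proof.
  intros Hz. destruct (lat_bound z Hz) as (c & Hc & H). exists c. split; [exact Hc|]. intros n.
  pose proof (INR_S_pos n) as Hn. split.
  - eapply Rle_trans; [|apply H]. rewrite Rabs_pos_eq; nra.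
  - replace (z - INR (S n))%C with (z + (- INR (S n))%R)%C by (rewrite RtoC_opp; ring).
    eapply Rle_trans; [|apply H]. rewrite Rabs_Ropp, Rabs_pos_eq; nra.
Qed.

Lemma Lt_bound z s : in_H z -> (1 <= s)%nat -> exists K, forall n, Cmod (Lt s z n) <= K * isq n.
Proof.
  intros Hz Hs. destruct (lat_pm z Hz) as (c & Hc & H).
  destruct s as [|[|s]]; [lia | |].
  - exists (2 * Cmod z / (c * c)). intros n. destruct (H n) as [H1 H2]. pose proof (INR_S_ge1 n) as Hn.
    assert (N1 : (z + INR (S n))%C <> RtoC 0) by (apply Cmod_gt_0; nra).
    assert (N2 : (z - INR (S n))%C <> RtoC 0) by (apply Cmod_gt_0; nra).
    unfold Lt. replace (/ (z + INR (S n)) ^ 1 + / (z - INR (S n)) ^ 1)%C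
      with (2 * z * / ((z + INR (S n)) * (z - INR (S n))))%C by (simpl; field; split; assumption).
    rewrite !Cmod_mult, Cmod_inv, Cmod_mult, (Cmod_Rp 2) by (try apply Cmult_neq_0; try assumption; lra).
    unfold isq. replace (2 * Cmod z / (c * c) * / INR (S n) ^ 2) with (2 * Cmod z * / (c * c * INR (S n) ^ 2))
      by (field; split; apply Rgt_not_eq; [apply INR_S_pos | exact Hc]).
    apply Rmult_le_compat_l; [pose proof (Cmod_ge_0 z); lra|].
    apply Rinv_le_contravar; [apply Rmult_lt_0_compat; nra|].
    replace (c * c * INR (S n) ^ 2) with ((c * INR (S n)) * (c * INR (S n))) by ring.
    apply Rmult_le_compat; nra.
  - exists (2 * / c ^ (2 + s)). intros n. destruct (H n) as [H1 H2]. pose proof (INR_S_ge1 n) as Hn.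
    unfold Lt. eapply Rle_trans; [apply Cmod_triangle|].
    pose proof (inv_pow_bound _ c _ s Hc Hn H1). pose proof (inv_pow_bound _ c _ s Hc Hn H2).
    change (S (S s)) with (2 + s)%nat. unfold isq. lra.
Qed.

Lemma asum_Lt z s : in_H z -> (1 <= s)%nat -> asum (Lt s z).
Proof.
  intros Hz Hs. destruct (Lt_bound z s Hz Hs) as [K HK].
  apply (asum_major _ _ HK). apply ex_series_scalR, ex_isq.
Qed.

Lemma inv_pow_taylor s : exists K, 0 <= K /\ forall t : C, Cmod t <= 1 / 2 ->
  Cmod (/ (1 + t) ^ s - 1 + INR s * t) <= K * Cmod t ^ 2.
Proof.
  induction s as [|s (K & HK & IH)].
  - exists 0. split; [lra|]. intros t Ht.
    replace (/ (1 + t) ^ 0 - 1 + INR 0 * t)%C with (RtoC 0) by (simpl; field). rewrite Cmod_0. lra.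
  - exists (2 * (INR (S s) + K)). pose proof (INR_S_pos s). split; [lra|]. intros t Ht.
    assert (H1 : 1 / 2 <= Cmod (1 + t)).
    { pose proof (Cmod_sub_ge 1 (- t)) as Hs. replace (1 - - t)%C with (1 + t)%C in Hs by ring.
      rewrite Cmod_opp, Cmod_1 in Hs. lra. }
    assert (N : (1 + t)%C <> RtoC 0) by (apply Cmod_gt_0; lra).
    replace (/ (1 + t) ^ S s - 1 + INR (S s) * t)%C
      with ((INR (S s) * (t * t) + (/ (1 + t) ^ s - 1 + INR s * t)) * / (1 + t))%C
      by (rewrite S_INR, RtoC_plus; simpl Cpow; field; split; [apply Cpow_nz|]; exact N).
    rewrite Cmod_mult, Cmod_inv by exact N.
    pose proof (Cmod_triangle (INR (S s) * (t * t)) (/ (1 + t) ^ s - 1 + INR s * t)) as Ht2.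
    rewrite !Cmod_mult, (Cmod_Rp (INR (S s))) in Ht2 by lra. specialize (IH t Ht).
    assert (/ Cmod (1 + t) <= 2) by (replace 2 with (/ (1 / 2)) by field; apply Rinv_le_contravar; lra).
    replace (2 * (INR (S s) + K) * Cmod t ^ 2) with ((INR (S s) * (Cmod t * Cmod t) + K * Cmod t ^ 2) * 2) by ring.
    apply Rmult_le_compat; [apply Cmod_ge_0 | left; apply Rinv_0_lt_compat; lra | lra | assumption].
Qed.

(** The expansion at 1 rescaled by w. The constant K is uniform in w, so the remainders can be
    summed over all translates. *)
Lemma inv_pow_taylor_at s : exists K, 0 <= K /\ forall w h : C, w <> RtoC 0 -> Cmod h <= Cmod w / 2 ->
  Cmod (/ (w + h) ^ s - / w ^ s - - INR s * / w ^ (S s) * h) <= K * Cmod h ^ 2 * Cmod (/ w ^ (2 + s)).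
Proof.
  destruct (inv_pow_taylor s) as (K & HK & H). exists K. split; [exact HK|]. intros w h Hw Hh.
  pose proof (proj1 (Cmod_gt_0 w) Hw) as Hp.
  assert (Ht : Cmod (h / w) <= 1 / 2).
  { rewrite Cmod_div by exact Hw. apply (Rmult_le_reg_r (Cmod w)); [exact Hp|].
    unfold Rdiv. rewrite Rmult_assoc, Rinv_l by lra. lra. }
  specialize (H _ Ht).
  assert (N : (w + h)%C <> RtoC 0).
  { apply Cmod_gt_0. pose proof (Cmod_sub_ge w (- h)) as Hs. replace (w - - h)%C with (w + h)%C in Hs by ring.
    rewrite Cmod_opp in Hs. lra. }
  replace (/ (w + h) ^ s - / w ^ s - - INR s * / w ^ (S s) * h)%C
    with (/ w ^ s * (/ (1 + h / w) ^ s - 1 + INR s * (h / w)))%C.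
  - rewrite Cmod_mult. apply Rle_trans with (Cmod (/ w ^ s) * (K * Cmod (h / w) ^ 2)).
    + apply Rmult_le_compat_l; [apply Cmod_ge_0 | exact H].
    + right. rewrite Cmod_div by exact Hw. rewrite !Cmod_inv, !Cmod_pow by now apply Cpow_nz.
      rewrite pow_add. field. split; [apply pow_nonzero|]; lra.
  - replace (1 + h / w)%C with ((w + h) * / w)%C by (field; exact Hw).
    rewrite Cpow_mult_l, Cpow_inv by exact Hw. simpl Cpow. field.
    repeat split; try exact Hw; apply Cpow_nz; assumption.
Qed.

Lemma cder_CSer (u : nat -> C -> C) (u' : nat -> C) (b : nat -> R) z d : 0 < d -> ex_series b ->
  (forall h, Cmod h < d -> asum (fun n => u n (z + h)%C)) -> asum u' ->
  (forall n h, Cmod h < d -> Cmod (u n (z + h)%C - u n z - u' n * h) <= b n * Cmod h ^ 2) ->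
  cder (fun x => CSer (fun n => u n x)) z (CSer u').
Proof.
  intros Hd Hb Hs Hs' H. apply (cder_intro _ _ _ (Series b) d Hd). intros h Hh.
  assert (H0 : asum (fun n => u n z)).
  { apply (asum_ext (fun n => u n (z + 0)%C)); [intros; f_equal; ring|]. apply Hs. rewrite Cmod_0. exact Hd. }
  rewrite (Cmult_comm (CSer u')), <- CSer_scal, <- CSer_minus, <- CSer_minus;
    [| try apply asum_minus; auto .. | exact Hs'].
  - rewrite Rmult_comm, <- Series_scal_l. apply CSer_bound; [|now apply ex_series_scalR].
    intros n. rewrite (Rmult_comm _ (b n)), (Cmult_comm h). now apply H.
  - now apply asum_scal.
Qed.

Lemma cder_L s z : (1 <= s)%nat -> in_H z -> cder (L s) z (- INR s * L (S s) z).
Proof.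
  intros Hs Hz. destruct (inv_pow_taylor_at s) as (K & HK & HT).
  destruct (lat_pm z Hz) as (c & Hc & Hl).
  assert (Hy : 0 < Im z) by exact Hz.
  assert (Hw : forall m : R, Im z <= Cmod (z + m)).
  { intros m. pose proof (im_le_Cmod (z + m)) as H. rewrite im_plus, im_RtoC, Rplus_0_r, Rabs_pos_eq in H by lra. exact H. }
  eapply cder_eqv.
  - apply (cder_plus (fun z => / z ^ s)%C (fun z => CSer (fun n => Lt s z n)) z (- INR s * / z ^ S s)
      (CSer (fun n => - INR s * Lt (S s) z n)%C)).
    + apply (cder_intro _ _ _ (K * Cmod (/ z ^ (2 + s))) (Im z / 2)); [lra|]. intros h Hh.
      specialize (Hw 0). rewrite Cplus_0_r in Hw.
      eapply Rle_trans; [apply HT; [now apply in_H_neq0 | lra]|]. right; ring.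
    + apply (cder_CSer (fun n x => Lt s x n) _ (fun n => (2 * K * / c ^ (2 + s)) * isq n) z (Im z / 2)); [lra | | | |].
      * apply ex_series_scalR, ex_isq.
      * intros h Hh. apply asum_Lt; [|exact Hs]. unfold in_H in *. rewrite im_plus.
        pose proof (im_le_Cmod h) as Hi. assert (Hi' : Rabs (Im h) < Im z / 2) by lra.
        apply Rabs_def2 in Hi'. lra.
      * apply asum_scal, asum_Lt; [exact Hz | lia].
      * intros n h Hh. destruct (Hl n) as [H1 H2]. pose proof (INR_S_ge1 n) as Hn.
        pose proof (Hw (INR (S n))) as W1. pose proof (Hw (- INR (S n))) as W2.
        rewrite RtoC_opp in W2. fold (Cminus z (INR (S n))) in W2.
        assert (N1 : (z + INR (S n))%C <> RtoC 0) by (apply Cmod_gt_0; nra).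
        assert (N2 : (z - INR (S n))%C <> RtoC 0) by (apply Cmod_gt_0; nra).
        pose proof (HT _ h N1 ltac:(lra)) as T1. pose proof (HT _ h N2 ltac:(lra)) as T2.
        pose proof (inv_pow_bound _ c _ s Hc Hn H1) as B1. pose proof (inv_pow_bound _ c _ s Hc Hn H2) as B2.
        unfold Lt.
        replace (z + h + INR (S n))%C with (z + INR (S n) + h)%C by ring.
        replace (z + h - INR (S n))%C with (z - INR (S n) + h)%C by ring.
        match goal with |- Cmod ?x <= _ => replace x with
          ((/ (z + INR (S n) + h) ^ s - / (z + INR (S n)) ^ s - - INR s * / (z + INR (S n)) ^ S s * h)
          + (/ (z - INR (S n) + h) ^ s - / (z - INR (S n)) ^ s - - INR s * / (z - INR (S n)) ^ S s * h))%C by ring end.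
        eapply Rle_trans; [apply Cmod_triangle|].
        assert (0 <= K * Cmod h ^ 2) by (apply Rmult_le_pos; [exact HK | apply pow2_ge_0]).
        pose proof (Rmult_le_compat_l _ _ _ H B1) as C1. pose proof (Rmult_le_compat_l _ _ _ H B2) as C2.
        unfold isq. lra.
  - unfold L. rewrite CSer_scal by (apply asum_Lt; [exact Hz | lia]). ring.
Qed.

(** * The partial fraction expansion of the cotangent *)

Lemma clim_inv_lin (z : C) (e : R) : in_H z -> (e = 1 \/ e = -1) ->
  is_lim_seq (fun n => Cmod (/ (z + (e * INR n)%R) ^ 2)) 0.
Proof.
  intros Hz He. destruct (lat_bound z Hz) as (c & Hc & H).
  apply (is_lim_seq_le_le (fun _ => 0) _ (fun n => / c ^ 2 * isq n)).
  - intros n. split; [apply Cmod_ge_0|].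
    apply (inv_pow_bound _ c (INR (S n)) 0 Hc (INR_S_ge1 n)). eapply Rle_trans; [|apply H].
    rewrite Rabs_mult, (Rabs_pos_eq (INR n)), S_INR by apply pos_INR.
    replace (Rabs e) with 1 by (destruct He as [-> | ->]; [rewrite Rabs_R1 | rewrite Rabs_left]; lra). right; ring.
  - apply is_lim_seq_const.
  - replace (Finite 0) with (Rbar_mult (/ c ^ 2) 0) by (simpl; f_equal; ring).
    apply is_lim_seq_scal_l. apply ex_series_lim_0, ex_isq.
Qed.

Lemma clim_plus u v l m : clim u l -> clim v m -> clim (fun n => u n + v n)%C (l + m).
Proof.
  intros Hu Hv. apply (clim_squeeze _ _ (fun n => Cmod (u n - l) + Cmod (v n - m))).
  - intros n. replace (u n + v n - (l + m))%C with ((u n - l) + (v n - m))%C by ring. apply Cmod_triangle.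
  - rewrite <- (Rplus_0_l 0). now apply is_lim_seq_plus'.
Qed.
Lemma clim_scal c u l : clim u l -> clim (fun n => c * u n)%C (c * l).
Proof.
  intros Hu. apply (clim_squeeze _ _ (fun n => Cmod c * Cmod (u n - l))).
  - intros n. rewrite <- Cmod_mult. right. f_equal. ring.
  - replace (Finite 0) with (Rbar_mult (Cmod c) 0) by (simpl; f_equal; ring). now apply is_lim_seq_scal_l.
Qed.
Lemma clim_0 u : is_lim_seq (fun n => Cmod (u n)) 0 -> clim u 0.
Proof. apply is_lim_seq_ext. intros n. f_equal. ring. Qed.
Lemma clim_sub u l (f : nat -> nat) : clim u l -> filterlim f eventually eventually -> clim (fun n => u (f n)) l.
Proof. intros Hu Hf. exact (is_lim_seq_subseq _ _ f Hf Hu). Qed.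

Definition Lp (z : C) (N : nat) : C := (/ z ^ 2 + csum (Lt 2 z) N)%C.

Lemma Lp_lim z : in_H z -> clim (Lp z) (L 2 z).
Proof.
  intros Hz. apply (clim_plus (fun _ => / z ^ 2)%C).
  - apply (clim_squeeze _ _ (fun _ => 0)); [|apply is_lim_seq_const].
    intros n. replace (/ z ^ 2 - / z ^ 2)%C with (RtoC 0) by ring. rewrite Cmod_0. lra.
  - apply CSer_lim, asum_Lt; [exact Hz | lia].
Qed.

Lemma L2_T z : in_H z -> L 2 (z + 1) = L 2 z.
Proof.
  intros Hz. apply (clim_unique (Lp (z + 1))); [apply Lp_lim, (in_H_add z 1 Hz)|].
  (* Translation by 1 moves the window of 2N + 1 poles: one end term enters, the other leaves, and
     both tend to 0. *)
  apply (clim_ext (fun N => Lp z N + (/ (z + 1 + (1 * INR N)%R) ^ 2 + (RtoC (-1)) * / (z + (-1 * INR N)%R) ^ 2))%C).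
  - intros N. induction N as [|N IH].
    + unfold Lp. simpl csum. rewrite !Rmult_0_r. replace (z + 1 + 0)%C with (z + 1)%C by ring.
      replace (z + 0)%C with z by ring. ring.
    + unfold Lp in *. cbn [csum]. unfold Lt at 2 4.
      replace (z + 1 - INR (S N))%C with (z + (-1 * INR N)%R)%C by (rewrite S_INR, RtoC_mult, RtoC_plus; ring).
      replace (z + INR (S N))%C with (z + 1 + (1 * INR N)%R)%C by (rewrite S_INR, RtoC_mult, RtoC_plus; ring).
      replace (z + (-1 * INR (S N))%R)%C with (z - INR (S N))%C by (rewrite RtoC_mult; ring).
      replace (z + 1 + (1 * INR (S N))%R)%C with (z + 1 + INR (S N))%C by (rewrite RtoC_mult; ring).
      rewrite (Cplus_assoc (/ (z + 1) ^ 2)), <- IH. ring.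
  - replace (L 2 z) with (L 2 z + (0 + (RtoC (-1)) * 0))%C by ring.
    apply clim_plus; [now apply Lp_lim|]. apply clim_plus; [|apply clim_scal]; apply clim_0.
    + apply clim_inv_lin; [apply (in_H_add z 1 Hz) | now left].
    + apply clim_inv_lin; [exact Hz | now right].
Qed.

Lemma in_H_half z : in_H z -> in_H (z / 2).
Proof. unfold in_H, Cdiv. intros H. rewrite <- RtoC_inv by lra. rewrite Cmult_comm, im_scal_l. lra. Qed.

Lemma L2_dup z : in_H z -> (L 2 (z / 2) + L 2 ((z + 1) / 2))%C = (4 * L 2 z)%C.
Proof.
  intros Hz. apply (clim_unique (fun N => Lp (z / 2) N + Lp ((z + 1) / 2) N)%C).
  - apply clim_plus; apply Lp_lim; apply in_H_half; [exact Hz | apply (in_H_add z 1 Hz)].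
  (* The points z / 2 + n and (z + 1) / 2 + n with |n| <= N are the halves of z - 2N, ..., z + 2N +
     1; [Lp z (2 * N)] lacks the last of these. *)
  - apply (clim_ext (fun N => 4 * Lp z (2 * N) + 4 * / (z + 1 + (1 * INR (2 * N))%R) ^ 2)%C).
    + assert (Hne : forall x : R, (z + x)%C <> RtoC 0) by (intros; apply in_H_neq0; now apply in_H_add).
      intros N. induction N as [|N IH].
      * unfold Lp. simpl csum. replace (1 * INR (2 * 0)) with 0 by (simpl; ring).
        pose proof (Hne 0) as N0. pose proof (Hne 1) as N1. rewrite Cplus_0_r in N0 |- *. simpl Cpow. field.
        split; assumption.
      * replace (2 * S N)%nat with (S (S (2 * N))) by lia. unfold Lp in *. cbn [csum].
        transitivity (4 * (/ z ^ 2 + csum (Lt 2 z) (2 * N)) + 4 * / (z + 1 + (1 * INR (2 * N))%R) ^ 2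
          + (Lt 2 (z / 2) N + Lt 2 ((z + 1) / 2) N))%C; [|rewrite IH; ring].
        unfold Lt at 2 3 5 6. rewrite !S_INR, mult_INR. set (x := INR N). replace (INR 2) with 2 by (simpl; ring).
        pose proof (Hne (2 * x + 1)) as A1. pose proof (Hne (2 * x + 2)) as A2. pose proof (Hne (2 * x + 3)) as A3.
        pose proof (Hne (- (2 * x + 1))) as A4. pose proof (Hne (- (2 * x + 2))) as A5.
        rewrite ?RtoC_mult, ?RtoC_opp, ?RtoC_plus, ?RtoC_mult in *.
        set (X := RtoC x) in *. clearbody X.
        replace (z + 1 + 1 * (2 * X))%C with (z + (2 * X + 1))%C by ring.
        replace (z + 1 + 1 * (2 * X + 1 + 1))%C with (z + (2 * X + 3))%C by ring.
        replace (z + (2 * X + 1 + 1))%C with (z + (2 * X + 2))%C by ring.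
        replace (z - (2 * X + 1))%C with (z + - (2 * X + 1))%C by ring.
        replace (z - (2 * X + 1 + 1))%C with (z + - (2 * X + 2))%C by ring.
        replace (z / 2 + (X + 1))%C with ((z + (2 * X + 2)) / 2)%C by field.
        replace (z / 2 - (X + 1))%C with ((z + - (2 * X + 2)) / 2)%C by field.
        replace ((z + 1) / 2 + (X + 1))%C with ((z + (2 * X + 3)) / 2)%C by field.
        replace ((z + 1) / 2 - (X + 1))%C with ((z + - (2 * X + 1)) / 2)%C by field.
        set (y1 := (z + (2 * X + 1))%C) in *. set (y2 := (z + (2 * X + 2))%C) in *.
        set (y3 := (z + (2 * X + 3))%C) in *. set (y4 := (z + - (2 * X + 1))%C) in *.
        set (y5 := (z + - (2 * X + 2))%C) in *. clearbody y1 y2 y3 y4 y5.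
        generalize (csum (Lt 2 z) (2 * N)) (/ z ^ 2)%C. intros.
        simpl Cpow. field. repeat split; assumption.
    + replace (4 * L 2 z)%C with (4 * L 2 z + 4 * 0)%C by ring.
      assert (Hd : filterlim (fun N => (2 * N)%nat) eventually eventually).
      { intros P [M HM]. exists M. intros n Hn. apply HM. lia. }
      apply clim_plus; apply clim_scal.
      * apply (clim_sub (Lp z)); [now apply Lp_lim | exact Hd].
      * apply (clim_sub (fun n => / (z + 1 + (1 * INR n)%R) ^ 2)%C); [|exact Hd].
        apply clim_0, clim_inv_lin; [apply (in_H_add z 1 Hz) | now left].
Qed.

Lemma exp_mono x y : x <= y -> exp x <= exp y.
Proof. intros [H | ->]; [now apply Rlt_le, exp_increasing | lra]. Qed.
Lemma Cmult_cancel_l (c x y : C) : c <> RtoC 0 -> (c * x)%C = (c * y)%C -> x = y.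
Proof.
  intros Hc E. replace x with (/ c * (c * x))%C by (field; exact Hc). rewrite E. field. exact Hc.
Qed.

(** pi^2 / sin^2(pi z), written in q. *)
Definition R2 (z : C) : C := (tpi * tpi * qpar z / ((1 - qpar z) * (1 - qpar z)))%C.

Lemma qpar_neq1 z : in_H z -> (1 - qpar z)%C <> RtoC 0.
Proof.
  intros Hz E. pose proof (qpar_lt1 z Hz) as H. apply Ceq_minus in E. rewrite <- E, Cmod_1 in H. lra.
Qed.

Lemma qpar_half z : qpar ((z + 1) / 2) = (- qpar (z / 2))%C.
Proof.
  replace ((z + 1) / 2)%C with (z / 2 + (1 / 2)%R)%C by (rewrite RtoC_div by lra; field).
  rewrite qpar_add. replace (qpar (1 / 2)%R) with (RtoC (-1)); [ring|].
  unfold qpar; simpl. rewrite !Rmult_0_r, Ropp_0, exp_0, !Rmult_1_l.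
  replace (2 * PI * (1 / 2)) with PI by field. rewrite cos_PI, sin_PI. reflexivity.
Qed.

Lemma qpar_double z : qpar z = (qpar (z / 2) * qpar (z / 2))%C.
Proof. rewrite <- qpar_add. f_equal. field. Qed.

Lemma R2_dup z : in_H z -> (R2 (z / 2) + R2 ((z + 1) / 2))%C = (4 * R2 z)%C.
Proof.
  intros Hz. unfold R2. rewrite qpar_half, (qpar_double z).
  pose proof (qpar_neq1 _ (in_H_half z Hz)) as N1.
  pose proof (qpar_neq1 _ (in_H_half _ (in_H_add z 1 Hz))) as N2. rewrite qpar_half in N2.
  set (p := qpar (z / 2)) in *. field. repeat split; try assumption.
  intros E. apply (Cmult_neq_0 _ _ N1 N2). rewrite <- E. ring.
Qed.

(** Jordan's inequality with half its constant, read off the alternating Taylor bound for the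
    sine. *)
Lemma sin_lower x : 0 <= x <= 1 / 2 -> x <= sin (PI * x).
Proof.
  intros Hx. pose proof PI_4 as H4. pose proof PI2_3_2 as H32.
  assert (Hp : 0 <= PI * x <= PI) by nra.
  pose proof (proj1 (SIN (PI * x) (proj1 Hp) (proj2 Hp))) as H.
  apply Rle_trans with (2 := H). unfold sin_lb, sin_approx, sin_term. simpl.
  set (u := PI * x) in *. assert (Hu : u <= 2) by (unfold u; nra).
  assert (x <= u / 3) by (unfold u; nra).
  replace (_ + _) with (u * (1 - u ^ 2 / 6 + u ^ 4 * (1 / 120 - u ^ 2 / 5040))) by (field).
  assert (1 / 3 <= 1 - u ^ 2 / 6 + u ^ 4 * (1 / 120 - u ^ 2 / 5040)); [|nra].
  assert (u ^ 2 <= 4) by nra. assert (0 <= u ^ 4 * (1 / 120 - u ^ 2 / 5040)); [|lra].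
  apply Rmult_le_pos; [apply pow_le; lra | lra].
Qed.

Lemma sqr_sin_lower x : Rabs x <= 1 / 2 -> x ^ 2 <= sin (PI * x) ^ 2.
Proof.
  intros H. apply Rabs_le_between in H. destruct (Rle_or_lt 0 x).
  - pose proof (sin_lower x ltac:(lra)). nra.
  - pose proof (sin_lower (- x) ltac:(lra)) as Hs. rewrite Ropp_mult_distr_r_reverse, sin_neg in Hs. nra.
Qed.

(** For z = x + i y one has |1 - q|^2 = (1 - |q|)^2 + 4 |q| sin^2(pi x), and the two terms dominate
    4 |q| y^2 and 4 |q| x^2. *)
Lemma one_minus_qpar_lower z : in_H z -> Rabs (Re z) <= 1 / 2 ->
  4 * Cmod (qpar z) * Cmod z ^ 2 <= Cmod (1 - qpar z) ^ 2.
Proof.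
  intros Hz Hx. rewrite !Cmod2_alt, Cmod_qpar. destruct z as [x y]. unfold in_H in Hz. simpl Im in *. simpl Re in *.
  pose proof (sqr_sin_lower x Hx) as Hs. pose proof PI2_3_2 as H32.
  set (r := exp (- (PI * y))). assert (Hr : exp (- (2 * PI * y)) = r ^ 2).
  { unfold r. simpl. rewrite Rmult_1_r, <- exp_plus. f_equal. ring. }
  assert (Hr0 : 0 < r) by apply exp_pos.
  assert (Hpy : 0 <= PI * y) by nra.
  assert (HE : 1 + PI * y <= / r) by (unfold r; rewrite exp_Ropp, Rinv_inv; apply exp_ineq1_le).
  assert (HE2 : r <= 1) by (apply (Rmult_le_reg_r (/ r)); [now apply Rinv_0_lt_compat|]; rewrite Rinv_r by lra; lra).
  assert (Hy : 2 * y * r <= 1 - r ^ 2).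
  { assert (r * (1 + PI * y) <= 1) by (apply (Rmult_le_compat_l r) in HE; [rewrite Rinv_r in HE by lra; exact HE | lra]).
    nra. }
  assert (Hy2 : (2 * y * r) ^ 2 <= (1 - r ^ 2) ^ 2) by (apply pow_incr; nra).
  unfold qpar; simpl Re; simpl Im. rewrite Hr.
  replace (2 * PI * x) with (2 * (PI * x)) by ring. rewrite cos_2a, sin_2a.
  pose proof (sin2_cos2 (PI * x)) as Hsc. unfold Rsqr in Hsc.
  set (s := sin (PI * x)) in *. set (c := cos (PI * x)) in *.
  assert (Hc : c * c = 1 - s * s) by lra.
  assert (E : (1 + - (r ^ 2 * (c * c - s * s))) ^ 2 + (0 + - (r ^ 2 * (2 * s * c))) ^ 2
     = (1 - r ^ 2) ^ 2 + 4 * r ^ 2 * s ^ 2).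
  { replace ((0 + - (r ^ 2 * (2 * s * c))) ^ 2) with (4 * r ^ 4 * s ^ 2 * (c * c)) by ring. rewrite Hc. ring. }
  rewrite E. assert (4 * r ^ 2 * x ^ 2 <= 4 * r ^ 2 * s ^ 2) by (apply Rmult_le_compat_l; nra). nra.
Qed.

Lemma R2_bound z : in_H z -> Rabs (Re z) <= 1 / 2 -> Cmod (R2 z) <= PI ^ 2 / Cmod z ^ 2.
Proof.
  intros Hz Hx. pose proof (one_minus_qpar_lower z Hz Hx) as H.
  pose proof (qpar_neq1 z Hz) as N. pose proof (proj1 (Cmod_gt_0 _) N) as Hp.
  pose proof (proj1 (Cmod_gt_0 _) (in_H_neq0 z Hz)) as Hz0. pose proof PI_RGT_0 as HPI.
  unfold R2. rewrite Cmod_div, !Cmod_mult by now apply Cmult_neq_0.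
  replace (Cmod tpi) with (2 * PI)
    by (unfold tpi; rewrite !Cmod_mult, Cmod_Ci, !Cmod_Rp by lra; ring).
  apply (Rmult_le_reg_r (Cmod (1 - qpar z) ^ 2 * Cmod z ^ 2)); [apply Rmult_lt_0_compat; nra|].
  replace (2 * PI * (2 * PI) * Cmod (qpar z) / (Cmod (1 - qpar z) * Cmod (1 - qpar z)) * (Cmod (1 - qpar z) ^ 2 * Cmod z ^ 2))
    with (PI ^ 2 * (4 * Cmod (qpar z) * Cmod z ^ 2)) by (field; lra).
  replace (PI ^ 2 / Cmod z ^ 2 * (Cmod (1 - qpar z) ^ 2 * Cmod z ^ 2)) with (PI ^ 2 * Cmod (1 - qpar z) ^ 2) by (field; lra).
  apply Rmult_le_compat_l; [nra | exact H].
Qed.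

Lemma Cmod_tpi : Cmod tpi = 2 * PI.
Proof. pose proof PI_RGT_0. unfold tpi; rewrite !Cmod_mult, Cmod_Ci, !Cmod_Rp by lra; ring. Qed.
Lemma tpi_neq0 : tpi <> RtoC 0.
Proof. apply Cmod_gt_0. rewrite Cmod_tpi. pose proof PI_RGT_0. lra. Qed.

(** The double poles cancel: with w = 2 pi i z, the numerator (1 - e^w)^2 - w^2 e^w vanishes to
    fourth order at w = 0. *)
Lemma R2_near z : in_H z -> Rabs (Re z) <= 1 / 2 -> Cmod (tpi * z) <= 1 ->
  Cmod (/ z ^ 2 - R2 z) <= 600 * (2 * PI) ^ 4.
Proof.
  intros Hz Hx Hw. pose proof (one_minus_qpar_lower z Hz Hx) as H.
  pose proof (qpar_neq1 z Hz) as N. pose proof (proj1 (Cmod_gt_0 _) N) as Hp.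
  pose proof (in_H_neq0 z Hz) as Nz. pose proof (proj1 (Cmod_gt_0 _) Nz) as Hz0. pose proof PI_RGT_0 as HPI.
  set (w := (tpi * z)%C) in *. pose proof (cexp_taylor w Hw) as HT.
  assert (Eq : qpar z = cexp w) by apply qpar_cexp.
  set (rho := (cexp w - 1 - w - w * w / 2)%C) in *.
  assert (Hwm : Cmod w = 2 * PI * Cmod z) by (unfold w; now rewrite Cmod_mult, Cmod_tpi).
  assert (Hw0 : 0 < Cmod w) by (rewrite Hwm; nra).
  assert (Nw : w <> RtoC 0) by (now apply Cmod_gt_0).
  set (num := ((1 - qpar z) * (1 - qpar z) - qpar z * (w * w))%C).
  assert (En : num = (rho * rho + 2 * (w * rho) - w * w * (w * w) / 4)%C).
  { unfold num. rewrite Eq. replace (cexp w) with (1 + w + w * w / 2 + rho)%C by (unfold rho; ring). field. }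
  assert (Hnum : Cmod num <= 200 * Cmod w ^ 4).
  { rewrite En. eapply Rle_trans; [apply Cmod_sub|].
    eapply Rle_trans; [apply Rplus_le_compat_r, Cmod_triangle|].
    rewrite Cmod_div, !Cmod_mult, !Cmod_Rp by (try lra; intros E; apply RtoC_inj in E; lra).
    set (x := Cmod w) in *. set (y := Cmod rho) in *. assert (0 <= y) by apply Cmod_ge_0.
    assert (0 <= x ^ 3 <= 1) by (split; [apply pow_le; lra | apply pow_le1; lra]).
    assert (y * y <= (13 * x ^ 3) * (13 * x ^ 3)) by (apply Rmult_le_compat; lra).
    assert (x * y <= x * (13 * x ^ 3)) by (apply Rmult_le_compat_l; lra).
    assert (x ^ 6 <= x ^ 4) by (apply pow_dec; [lra | lia]).
    replace ((13 * x ^ 3) * (13 * x ^ 3)) with (169 * x ^ 6) in * by ring.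
    replace (x * (13 * x ^ 3)) with (13 * x ^ 4) in * by ring.
    replace (x * x * (x * x)) with (x ^ 4) by ring. assert (0 <= x ^ 4) by (apply pow_le; lra). lra. }
  assert (Hq : 1 / 3 <= Cmod (qpar z)).
  { rewrite Cmod_qpar. assert (Im z <= Cmod z) by (pose proof (im_le_Cmod z); pose proof (Rle_abs (Im z)); lra).
    assert (Hexp : exp (-1) <= exp (- (2 * PI * Im z))).
    { assert (2 * PI * Im z <= 2 * PI * Cmod z) by (apply Rmult_le_compat_l; lra).
      apply exp_mono. lra. }
    assert (E1 : exp (-1) = / exp 1) by (rewrite <- exp_Ropp; f_equal; ring).
    pose proof exp_le_3. pose proof (exp_pos 1).
    assert (/ 3 <= / exp 1) by (apply Rinv_le_contravar; lra). lra. }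
  replace (/ z ^ 2 - R2 z)%C with (tpi * tpi * num / (w * w * ((1 - qpar z) * (1 - qpar z))))%C.
  - rewrite Cmod_div, !Cmod_mult by (apply Cmult_neq_0; apply Cmult_neq_0; assumption). rewrite Cmod_tpi.
    assert (Hd : Cmod z ^ 2 <= Cmod (1 - qpar z) * Cmod (1 - qpar z)) .
    { assert (4 * (1 / 3) * Cmod z ^ 2 <= 4 * Cmod (qpar z) * Cmod z ^ 2) by (apply Rmult_le_compat_r; nra).
      replace (Cmod (1 - qpar z) * Cmod (1 - qpar z)) with (Cmod (1 - qpar z) ^ 2) by ring. nra. }
    set (Q := Cmod (1 - qpar z) * Cmod (1 - qpar z)) in *. assert (0 < Q) by (unfold Q; nra).
    apply (Rmult_le_reg_r (Cmod w * Cmod w * Q)); [apply Rmult_lt_0_compat; nra|].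
    replace (2 * PI * (2 * PI) * Cmod num / (Cmod w * Cmod w * Q) * (Cmod w * Cmod w * Q)) with ((2 * PI) ^ 2 * Cmod num)
      by (field; lra).
    apply Rle_trans with ((2 * PI) ^ 2 * (200 * Cmod w ^ 4)); [apply Rmult_le_compat_l; [nra | exact Hnum]|].
    rewrite Hwm. replace (600 * (2 * PI) ^ 4 * (2 * PI * Cmod z * (2 * PI * Cmod z) * Q))
      with ((2 * PI) ^ 6 * Cmod z ^ 2 * (600 * Q)) by ring.
    replace ((2 * PI) ^ 2 * (200 * (2 * PI * Cmod z) ^ 4)) with ((2 * PI) ^ 6 * Cmod z ^ 2 * (200 * Cmod z ^ 2)) by ring.
    apply Rmult_le_compat_l; [apply Rmult_le_pos; apply pow_le; lra | lra].
  - unfold num, R2, w. simpl Cpow. field. repeat split; try assumption; apply tpi_neq0.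
Qed.

Lemma L2_rest_bound z : in_H z -> Rabs (Re z) <= 1 / 2 -> Cmod (CSer (Lt 2 z)) <= 8 * Series isq.
Proof.
  intros Hz Hx. rewrite <- Series_scal_l. apply CSer_bound; [|apply ex_series_scalR, ex_isq].
  intros n. pose proof (INR_S_ge1 n) as Hn. apply Rabs_le_between in Hx. unfold Lt.
  eapply Rle_trans; [apply Cmod_triangle|].
  assert (H1 : 1 / 2 * INR (S n) <= Cmod (z + INR (S n))).
  { eapply Rle_trans; [|apply re_le_Cmod]. rewrite re_plus, re_RtoC, Rabs_pos_eq; lra. }
  assert (H2 : 1 / 2 * INR (S n) <= Cmod (z - INR (S n))).
  { eapply Rle_trans; [|apply re_le_Cmod]. rewrite re_minus, re_RtoC, Rabs_left1; lra. }
  pose proof (inv_pow_bound _ (1 / 2) _ 0 ltac:(lra) Hn H1) as B1.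
  pose proof (inv_pow_bound _ (1 / 2) _ 0 ltac:(lra) Hn H2) as B2.
  replace (/ (1 / 2) ^ (2 + 0)) with 4 in B1, B2 by (simpl; field). change (2 + 0)%nat with 2%nat in B1, B2. unfold isq. lra.
Qed.

(** In the strip |Re z| <= 1/2 only the pole at 0 matters. Close to it [R2_near] applies; farther
    away 1 / z^2 and [R2] are bounded separately. Periodicity carries any point into the strip. *)
Lemma L2_R2_bounded : exists M, 0 <= M /\ forall z, in_H z -> Cmod (L 2 z - R2 z) <= M.
Proof.
  pose proof PI_RGT_0 as HPI.
  set (M := 8 * Series isq + 600 * (2 * PI) ^ 4 + (1 + PI ^ 2) * (2 * PI) ^ 2).
  assert (HS : 0 <= Series isq) by (apply Series_nonneg; [intros; apply Rlt_le, isq_pos | apply ex_isq]).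
  assert (H4 : 0 <= 600 * (2 * PI) ^ 4) by (apply Rmult_le_pos; [lra | apply pow_le; lra]).
  assert (H5 : 0 <= (1 + PI ^ 2) * (2 * PI) ^ 2) by (apply Rmult_le_pos; nra).
  assert (H0 : forall z, in_H z -> Rabs (Re z) <= 1 / 2 -> Cmod (L 2 z - R2 z) <= M).
  { intros z Hz Hx. unfold L. replace (/ z ^ 2 + CSer (Lt 2 z) - R2 z)%C with (CSer (Lt 2 z) + (/ z ^ 2 - R2 z))%C by ring.
    eapply Rle_trans; [apply Cmod_triangle|]. pose proof (L2_rest_bound z Hz Hx).
    destruct (Rle_or_lt (Cmod (tpi * z)) 1) as [Hw|Hw]; [pose proof (R2_near z Hz Hx Hw); unfold M; lra|].
    pose proof (Cmod_sub (/ z ^ 2) (R2 z)) as Hs. pose proof (R2_bound z Hz Hx) as HR.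
    pose proof (in_H_neq0 z Hz) as Nz. pose proof (proj1 (Cmod_gt_0 _) Nz) as Hz0.
    rewrite Cmod_inv, Cmod_pow in Hs by now apply Cpow_nz.
    rewrite Cmod_mult, Cmod_tpi in Hw.
    assert (Hinv : / Cmod z ^ 2 <= (2 * PI) ^ 2).
    { replace ((2 * PI) ^ 2) with (/ (/ (2 * PI)) ^ 2) by (field; lra). apply Rinv_le_contravar; [apply pow_lt, Rinv_0_lt_compat; lra|].
      apply pow_incr. split; [left; apply Rinv_0_lt_compat; lra|].
      apply (Rmult_le_reg_l (2 * PI)); [lra|]. rewrite Rinv_r by lra. lra. }
    unfold Rdiv in HR. assert (PI ^ 2 * / Cmod z ^ 2 <= PI ^ 2 * (2 * PI) ^ 2) by (apply Rmult_le_compat_l; nra).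
    unfold M. lra. }
  exists M. split; [unfold M; lra|].
  assert (HT : forall z, in_H z -> (L 2 (z + 1) - R2 (z + 1))%C = (L 2 z - R2 z)%C).
  { intros z Hz. rewrite L2_T by exact Hz. unfold R2. now rewrite qpar_T. }
  assert (Hn : forall n z, in_H z -> Rabs (Re z) <= 1 / 2 + INR n -> Cmod (L 2 z - R2 z) <= M).
  { induction n as [|n IH]; intros z Hz Hx; [apply H0; [exact Hz | simpl in Hx; lra]|].
    rewrite S_INR in Hx. apply Rabs_le_between in Hx. pose proof (pos_INR n).
    destruct (Rle_or_lt (Rabs (Re z)) (1 / 2)) as [Hs|Hs]; [now apply H0|].
    destruct (Rle_or_lt 0 (Re z)) as [Hr|Hr]; [rewrite Rabs_pos_eq in Hs by exact Hr | rewrite Rabs_left in Hs by exact Hr].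
    - assert (Hz' : in_H (z + (-1)%R)) by now apply in_H_add.
      replace z with (z + (-1)%R + 1)%C by (destruct z; apply injective_projections; simpl; ring). rewrite HT by exact Hz'. apply IH; [exact Hz'|].
      rewrite re_plus, re_RtoC. apply Rabs_le. lra.
    - rewrite <- HT by exact Hz. apply IH; [exact (in_H_add z 1 Hz)|]. rewrite re_plus, re_RtoC. apply Rabs_le. lra. }
  intros z Hz. destruct (INR_unbounded (Rabs (Re z))) as [n Hnz]. apply (Hn n z Hz). lra.
Qed.

(** The Herglotz trick: the difference d satisfies d(z/2) + d((z + 1)/2) = 4 d(z), so a bound M for
    d improves to M/2, then M/4, and so on. *)
Lemma L2_eq z : in_H z -> L 2 z = R2 z.
Proof.
  intros Hz. destruct L2_R2_bounded as (M & HM & HB).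
  assert (H : forall n x, in_H x -> Cmod (L 2 x - R2 x) <= M * (1 / 2) ^ n).
  { induction n as [|n IH]; intros x Hx; [rewrite Rmult_1_r; now apply HB|].
    pose proof (L2_dup x Hx) as E1. pose proof (R2_dup x Hx) as E2.
    pose proof (IH _ (in_H_half x Hx)) as I1. pose proof (IH _ (in_H_half _ (in_H_add x 1 Hx))) as I2.
    pose proof (Cmod_triangle (L 2 (x / 2) - R2 (x / 2)) (L 2 ((x + 1) / 2) - R2 ((x + 1) / 2))) as Ht.
    match type of Ht with Cmod ?y <= _ => replace y with (4 * (L 2 x - R2 x))%C in Ht end.
    - rewrite Cmod_mult, Cmod_Rp in Ht by lra. simpl. lra.
    - replace (4 * (L 2 x - R2 x))%C with (4 * L 2 x - 4 * R2 x)%C by ring. rewrite <- E1, <- E2. ring. }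
  apply Ceq_minus, Cmod_eq_0, Rle_antisym; [|apply Cmod_ge_0].
  refine (is_lim_seq_le (fun _ => Cmod (L 2 z - R2 z)) (fun n => M * (1 / 2) ^ n) (Cmod (L 2 z - R2 z)) 0 _ (is_lim_seq_const _) _).
  - intros n. now apply H.
  - replace (Finite 0) with (Rbar_mult M 0) by (simpl; f_equal; ring).
    apply is_lim_seq_scal_l, is_lim_seq_geom. rewrite Rabs_pos_eq; lra.
Qed.

(** pi cot(pi z), written in q. *)
Definition R1 (z : C) : C := (- (tpi / 2) * ((1 + qpar z) / (1 - qpar z)))%C.

Lemma cder_R1 z : in_H z -> cder R1 z (- R2 z).
Proof.
  intros Hz. pose proof (qpar_neq1 z Hz) as N.
  apply (cder_ext (fun z => - (tpi / 2) * ((1 + qpar z) * / (1 - qpar z)))%C); [reflexivity|].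
  eapply cder_eqv.
  - apply cder_scal, cder_mult; [apply cder_plus; [apply cder_const | apply cder_qpar]|].
    apply (cder_comp Cinv (fun z => 1 - qpar z)%C); [now apply cder_inv|].
    apply cder_minus; [apply cder_const | apply cder_qpar].
  - unfold R2. field. exact N.
Qed.

Lemma exp_taylor4 t : Rabs t <= 1 -> Rabs (exp t - 1 - t - t ^ 2 / 2 - t ^ 3 / 6) <= 3 * Rabs t ^ 4.
Proof.
  revert t. apply (mvt_pow _ (fun t => exp t - 1 - t - t ^ 2 / 2)); [lra | | | exact exp_taylor].
  - intros t _. auto_derive; [trivial | field].
  - rewrite exp_0. field.
Qed.

Lemma coth_taylor u : 0 < u <= 1 / 4 ->
  Rabs (u * (1 + exp (- (2 * u))) / (1 - exp (- (2 * u))) - 1 - u ^ 2 / 3) <= 300 * u ^ 3.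
Proof.
  intros Hu. pose proof (exp_taylor4 (- (2 * u)) ltac:(rewrite Rabs_left; lra)) as H.
  rewrite (Rabs_left (- (2 * u))) in H by lra.
  set (q := exp (- (2 * u))) in *. set (r := q - 1 - - (2 * u) - (- (2 * u)) ^ 2 / 2 - (- (2 * u)) ^ 3 / 6) in *.
  assert (Eq : q = 1 - 2 * u + 2 * u ^ 2 - 4 / 3 * u ^ 3 + r) by (unfold r; field).
  replace (3 * (- - (2 * u)) ^ 4) with (48 * u ^ 4) in H by ring.
  assert (Hu2 : 0 < u ^ 2 <= 1 / 16) by nra. assert (Hu3 : 0 < u ^ 3 <= u / 16) by nra.
  assert (Hu4 : 0 < u ^ 4 <= u / 64) by nra.
  apply Rabs_le_between in H.
  assert (Hq : u / 4 <= 1 - q) by nra.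
  replace (u * (1 + q) / (1 - q) - 1 - u ^ 2 / 3) with ((u * (1 + q) - (1 + u ^ 2 / 3) * (1 - q)) / (1 - q)) by (field; lra).
  unfold Rdiv. rewrite Rabs_mult, Rabs_inv, (Rabs_pos_eq (1 - q)) by lra.
  apply (Rmult_le_reg_r (1 - q)); [lra|]. rewrite Rmult_assoc, Rinv_l, Rmult_1_r by lra.
  apply Rle_trans with (75 * u ^ 4); [|nra].
  replace (u * (1 + q) - (1 + u ^ 2 * / 3) * (1 - q)) with (- (2 / 3) * u ^ 4 - 4 / 9 * (u * u ^ 4) + r * (1 + u + u ^ 2 / 3))
    by (rewrite Eq; field).
  assert (Hr : Rabs (r * (1 + u + u ^ 2 / 3)) <= 48 * u ^ 4 * (3 / 2)).
  { rewrite Rabs_mult. apply Rmult_le_compat; try apply Rabs_pos; [now apply Rabs_le | rewrite Rabs_pos_eq; lra]. }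
  apply Rabs_le_between in Hr. assert (0 <= u * u ^ 4 <= u ^ 4) by nra. apply Rabs_le. lra.
Qed.

Lemma small_affine (a b B : R) : 0 <= B -> (forall e, 0 < e <= 1 / 16 -> Rabs (a + b * e) <= B * e ^ 2) -> a = 0 /\ b = 0.
Proof.
  intros HB H.
  assert (Ha : a = 0).
  { destruct (Req_dec a 0) as [|Ha]; [assumption|]. exfalso. pose proof (Rabs_pos_lt a Ha) as Hp.
    set (e := Rmin (1 / 16) (Rabs a / (2 * (B + Rabs b + 1)))). pose proof (Rabs_pos b) as Hb.
    assert (He : 0 < e) by (apply Rmin_glb_lt; [lra | apply Rdiv_lt_0_compat; lra]).
    assert (He1 : e <= 1 / 16) by apply Rmin_l.
    assert (He2 : e * (2 * (B + Rabs b + 1)) <= Rabs a).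
    { apply Rle_trans with (Rabs a / (2 * (B + Rabs b + 1)) * (2 * (B + Rabs b + 1)));
        [apply Rmult_le_compat_r; [lra | apply Rmin_r] | right; field; lra]. }
    specialize (H e ltac:(lra)). pose proof (Rabs_triang (a + b * e) (- (b * e))) as Ht.
    replace (a + b * e + - (b * e)) with a in Ht by ring. rewrite Rabs_Ropp, (Rabs_mult b), (Rabs_pos_eq e) in Ht by lra.
    assert (B * e ^ 2 <= B * e) by (apply Rmult_le_compat_l; nra). nra. }
  split; [exact Ha|]. subst a.
  destruct (Req_dec b 0) as [|Hb]; [assumption|]. exfalso. pose proof (Rabs_pos_lt b Hb) as Hp.
  set (e := Rmin (1 / 16) (Rabs b / (2 * (B + 1)))).
  assert (He : 0 < e) by (apply Rmin_glb_lt; [lra | apply Rdiv_lt_0_compat; lra]).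
  assert (He1 : e <= 1 / 16) by apply Rmin_l.
  assert (He2 : e * (2 * (B + 1)) <= Rabs b).
  { apply Rle_trans with (Rabs b / (2 * (B + 1)) * (2 * (B + 1)));
      [apply Rmult_le_compat_r; [lra | apply Rmin_r] | right; field; lra]. }
  specialize (H e ltac:(lra)). rewrite Rplus_0_l, Rabs_mult, (Rabs_pos_eq e) in H by lra.
  assert (Rabs b <= B * e) by (apply (Rmult_le_reg_r e); [exact He|]; lra). nra.
Qed.

(** The pair of poles at n and -n contributes -2 i e / (n^2 + e^2) at z = i e. Replacing 1 / (n^2 +
    e^2) by 1 / n^2 costs at most e^2 / n^2, and 2 bounds the sum of 1 / n^2. *)
Lemma L1_axis e : 0 < e <= 1 / 16 ->
  exists S, Rabs (S - Series isq) <= 2 * e ^ 2 /\ L 1 (Ci * e) = (/ (Ci * e) + - Ci * (2 * e * S))%C.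
Proof.
  intros He. exists (Series (fun n => / (INR (Datatypes.S n) ^ 2 + e ^ 2))).
  assert (Hb : forall n, 0 <= / (INR (S n) ^ 2 + e ^ 2) <= isq n).
  { intros n. pose proof (INR_S_ge1 n). split; [left; apply Rinv_0_lt_compat; nra|].
    apply Rinv_le_contravar; nra. }
  pose proof (ex_series_major _ _ Hb ex_isq) as Hex. split.
  - rewrite <- Series_minus by (exact Hex || exact ex_isq).
    assert (Hd : forall n, Rabs (/ (INR (S n) ^ 2 + e ^ 2) - isq n) <= e ^ 2 * isq n).
    { intros n. pose proof (INR_S_ge1 n). unfold isq. set (x := INR (S n)) in *.
      rewrite Rabs_left1; [|specialize (Hb n); unfold isq in Hb; fold x in Hb; lra].
      replace (- (/ (x ^ 2 + e ^ 2) - / x ^ 2)) with (e ^ 2 * / x ^ 2 * / (x ^ 2 + e ^ 2)) by (field; nra).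
      rewrite <- (Rmult_1_r (e ^ 2 * / x ^ 2)) at 2. apply Rmult_le_compat_l.
      - apply Rmult_le_pos; [nra | left; apply Rinv_0_lt_compat; nra].
      - rewrite <- Rinv_1. apply Rinv_le_contravar; nra. }
    eapply Rle_trans; [apply Series_Rabs, (ex_series_major _ (fun n => e ^ 2 * isq n))|].
    + intros n; split; [apply Rabs_pos | apply Hd].
    + apply ex_series_scalR, ex_isq.
    + eapply Rle_trans; [apply (Series_le _ (fun n => e ^ 2 * isq n))|].
      * intros n; split; [apply Rabs_pos | apply Hd].
      * apply ex_series_scalR, ex_isq.
      * rewrite Series_scal_l, Rmult_comm. apply Rmult_le_compat_r; [nra|].
        refine (is_lim_seq_le (fun n => rsum isq (S n)) (fun _ => 2) (Finite (Series isq)) (Finite 2) _ _ (is_lim_seq_const _)).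
        -- intros n. pose proof (rsum_isq_le n). pose proof (Rinv_0_lt_compat _ (INR_S_pos n)). lra.
        -- apply (is_lim_seq_incr_1 (rsum isq)). apply Series_lim, ex_isq.
  - unfold L. f_equal; [simpl; f_equal; ring|].
    rewrite (CSer_ext _ (fun n => (- Ci * (2 * e)) * RtoC (/ (INR (S n) ^ 2 + e ^ 2)))%C).
    + rewrite CSer_scal.
      * rewrite <- Cmult_assoc. f_equal. f_equal. apply C_ext; simpl; [reflexivity|].
        rewrite (Series_ext _ (fun _ => 0 * 0)) by (intros; ring). rewrite Series_scal_l. ring.
      * apply (asum_major _ isq); [|exact ex_isq]. intros n. rewrite Cmod_Rp; apply Hb.
    + intros n. pose proof (INR_S_ge1 n) as Hn. unfold Lt. set (x := INR (S n)) in *.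
      assert (N1 : (Ci * e + x)%C <> RtoC 0) by (intros E; apply (f_equal Re) in E; simpl in E; lra).
      assert (N2 : (Ci * e - x)%C <> RtoC 0) by (intros E; apply (f_equal Re) in E; simpl in E; lra).
      assert (N3 : RtoC (x ^ 2 + e ^ 2) <> RtoC 0) by (intros E; apply RtoC_inj in E; nra).
      rewrite RtoC_inv by nra.
      replace (/ (Ci * e + x) ^ 1 + / (Ci * e - x) ^ 1)%C with (2 * Ci * e / ((Ci * e + x) * (Ci * e - x)))%C
        by (simpl; field; split; assumption).
      replace ((Ci * e + x) * (Ci * e - x))%C with (- RtoC (x ^ 2 + e ^ 2))%C.
      * field. exact N3.
      * apply C_ext; simpl; ring.
Qed.

(** [L 1] and [R1] have the same derivative, so they differ by a constant kappa. Along z = i e both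
    expand up to O(e^2): the constant term forces kappa = 0, and the linear term evaluates zeta(2)
    at the same stroke. *)
Lemma cot_zeta2 : (forall z, in_H z -> L 1 z = R1 z) /\ Series isq = PI ^ 2 / 6.
Proof.
  assert (Hc : forall z, in_H z -> (L 1 z - R1 z)%C = (L 1 Ci - R1 Ci)%C).
  { intros z Hz. apply (cder_const_H (fun z => L 1 z - R1 z)%C); [|exact Hz | unfold in_H; simpl; lra].
    intros w Hw. eapply cder_eqv; [apply cder_minus; [apply cder_L; [lia | exact Hw] | now apply cder_R1]|].
    rewrite L2_eq by exact Hw. simpl INR. ring. }
  set (kappa := (L 1 Ci - R1 Ci)%C) in *. pose proof PI_RGT_0 as HPI. pose proof PI_4 as HPI4.
  assert (HH : forall e, 0 < e -> in_H (Ci * e)) by (intros e He; unfold in_H; simpl; lra).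
  assert (HE : forall e, 0 < e <= 1 / 16 -> exists S, Rabs (S - Series isq) <= 2 * e ^ 2 /\
     kappa = (Ci * RtoC (PI * (1 + exp (- (2 * (PI * e)))) / (1 - exp (- (2 * (PI * e)))) - / e - 2 * e * S))%C).
  { intros e He. destruct (L1_axis e He) as (S & HS & E). exists S. split; [exact HS|].
    rewrite <- (Hc (Ci * e)%C) by (apply HH; lra). rewrite E. unfold R1.
    assert (Eq : qpar (Ci * e) = RtoC (exp (- (2 * (PI * e))))).
    { unfold qpar; simpl. apply C_ext; simpl.
      - replace (2 * PI * (0 * e - 1 * 0)) with 0 by ring. rewrite cos_0, Rmult_1_r. f_equal. ring.
      - replace (2 * PI * (0 * e - 1 * 0)) with 0 by ring. rewrite sin_0. ring. }
    rewrite Eq. set (q := exp (- (2 * (PI * e)))).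
    assert (Hq : q < 1) by (unfold q; rewrite <- exp_0; apply exp_increasing; nra).
    assert (N : RtoC (1 - q) <> RtoC 0) by (intros E0; apply RtoC_inj in E0; lra).
    assert (Ne : RtoC e <> RtoC 0) by (intros E0; apply RtoC_inj in E0; lra).
    assert (Ni : Ci <> RtoC 0) by (intros E0; apply (f_equal Im) in E0; simpl in E0; lra).
    rewrite !RtoC_minus, RtoC_div, !RtoC_mult, RtoC_plus, RtoC_inv, RtoC_minus by lra. rewrite RtoC_minus in N.
    unfold tpi. replace (/ (Ci * e))%C with (- Ci * / e)%C; [field; split; assumption|].
    replace (- Ci)%C with (/ Ci)%C; [field; split; assumption|].
    apply (Cmult_cancel_l Ci); [exact Ni|]. rewrite Cinv_r by exact Ni. apply C_ext; simpl; ring. }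
  destruct (HE (1 / 16) ltac:(lra)) as (S0 & _ & E0).
  assert (Hk : kappa = (Ci * RtoC (Im kappa))%C).
  { rewrite E0. set (x := _ - _ - _). apply C_ext; simpl; ring. }
  (* 300 PI^3 is the error of [coth_taylor] at u = PI e after division by e; 4 pays for replacing S
     by its limit. *)
  destruct (small_affine (Im kappa) (2 * Series isq - PI ^ 2 / 3) (300 * PI ^ 3 + 4)) as [H1 H2].
  - assert (0 < PI ^ 3) by (apply pow_lt; lra). lra.
  - intros e He. destruct (HE e He) as (S & HS & E).
    apply (f_equal Im) in E. rewrite im_mult, im_RtoC, re_RtoC in E. simpl Re in E. simpl (Im Ci) in E.
    pose proof (coth_taylor (PI * e) ltac:(nra)) as HC.
    set (q := exp (- (2 * (PI * e)))) in *.
    assert (Hq : q < 1) by (unfold q; rewrite <- exp_0; apply exp_increasing; nra).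
    set (X := PI * e * (1 + q) / (1 - q) - 1 - (PI * e) ^ 2 / 3) in *.
    replace (Im kappa + (2 * Series isq - PI ^ 2 / 3) * e) with (X / e + - (2 * e * (S - Series isq)))
      by (rewrite E; unfold X; field; lra).
    eapply Rle_trans; [apply Rabs_triang|]. rewrite Rabs_Ropp, (Rabs_mult (2 * e)), (Rabs_pos_eq (2 * e)) by lra.
    unfold Rdiv. rewrite Rabs_mult, Rabs_inv, (Rabs_pos_eq e) by lra.
    assert (Rabs X * / e <= 300 * PI ^ 3 * e ^ 2).
    { apply (Rmult_le_reg_r e); [lra|]. rewrite Rmult_assoc, Rinv_l by lra.
      replace (300 * PI ^ 3 * e ^ 2 * e) with (300 * (PI * e) ^ 3) by ring. lra. }
    assert (2 * e * Rabs (S - Series isq) <= 2 * e * (2 * e ^ 2)) by (apply Rmult_le_compat_l; lra).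
    assert (2 * e * (2 * e ^ 2) <= 4 * e ^ 2) by nra. lra.
  - split; [|lra]. intros z Hz. apply Ceq_minus. rewrite (Hc z Hz), Hk, H1. ring.
Qed.

(** The value at 0 is forced to be 0, so that s = 0 gives the geometric series without its constant
    term. *)
Definition pows (s : nat) : nat -> C := fun n => match n with O => RtoC 0 | _ => RtoC (INR n ^ s) end.

Lemma PSc_bounded (a : nat -> C) : (forall n, Cmod (a n) <= 1) -> PSc a.
Proof.
  intros H r Hr. exists 1. intros n. rewrite <- (Rmult_1_r 1).
  apply Rmult_le_compat; [apply Cmod_ge_0 | apply pow_le; lra | apply H | apply pow_le1; lra].
Qed.

Lemma D_pows s n : D (pows s) n = pows (S s) n.
Proof. unfold D, pows. destruct n; [simpl; ring|]. rewrite <- RtoC_mult. reflexivity. Qed.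

Lemma PSc_pows s : PSc (pows s).
Proof.
  induction s as [|s IH].
  - apply PSc_bounded. intros [|n]; simpl; rewrite ?Cmod_0, ?Cmod_1; lra.
  - apply (PSc_le _ (D (pows s))); [now apply PSc_D|]. intros n. rewrite D_pows. lra.
Qed.

Lemma Ev_ones q : Cmod q < 1 -> (1 - q)%C <> RtoC 0 -> Ev (pows 0) q = (q / (1 - q))%C.
Proof.
  intros Hq N. pose proof (Ev_psh (pows 0) q (PSc_pows 0) Hq) as E. simpl (pows 0 0%nat) in E.
  assert (E2 : Ev (psh (pows 0)) q = (1 + Ev (pows 0) q)%C).
  { rewrite <- (Ev_one q), <- Ev_add by (apply PSc_one || apply PSc_pows || exact Hq).
    apply Ev_ext. intros [|n]; unfold padd, psh, pows, pone; cbn -[INR]; ring. }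
  rewrite E2 in E. apply (Cmult_cancel_l (1 - q)); [exact N|].
  transitivity q; [|field; exact N]. transitivity (Ev (pows 0) q - q * Ev (pows 0) q)%C; [ring|].
  rewrite E at 1. ring.
Qed.

(** Exponent 2 is the derivative of the cotangent identity [cot_zeta2]; each further exponent is one
    more differentiation of both sides. *)
Lemma lipschitz k z : in_H z ->
  L (k + 2) z = ((- tpi) ^ (k + 2) / INR (fact (k + 1)) * F (pows (k + 1)) z)%C.
Proof.
  revert z. induction k as [|k IH]; intros z Hz.
  - assert (E : (- INR 1 * L 2 z)%C = (0 - tpi * (tpi * F (D (pows 0)) z))%C).
    { apply (cder_H_eq (L 1) (fun z => - (tpi / 2) - tpi * F (pows 0) z)%C z); [|exact Hz | apply cder_L; [lia | exact Hz] |].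
      - intros x Hx. rewrite (proj1 cot_zeta2 x Hx). unfold R1, F.
        pose proof (qpar_neq1 x Hx) as N. rewrite Ev_ones by (exact N || now apply qpar_lt1). field. exact N.
      - apply cder_minus; [apply cder_const|]. apply cder_scal, cder_F; [apply PSc_pows | exact Hz]. }
    unfold F in *. rewrite (Ev_ext _ _ _ (D_pows 0)) in E. simpl INR in E. simpl.
    replace (L 2 z) with (- (- (1) * L 2 z))%C by ring. rewrite E. field.
  - assert (E : (- INR (k + 2) * L (S (k + 2)) z)%C
      = ((- tpi) ^ (k + 2) / INR (fact (k + 1)) * (tpi * F (D (pows (k + 1))) z))%C).
    { apply (cder_H_eq (L (k + 2)) (fun z => (- tpi) ^ (k + 2) / INR (fact (k + 1)) * F (pows (k + 1)) z)%C z);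
        [exact IH | exact Hz | apply cder_L; [lia | exact Hz] |].
      apply cder_scal, cder_F; [apply PSc_pows | exact Hz]. }
    unfold F in *. rewrite (Ev_ext _ _ _ (D_pows (k + 1))) in E.
    assert (N1 : RtoC (INR (k + 2)) <> RtoC 0) by (intros E1; apply RtoC_inj in E1; apply (not_0_INR (k + 2)); [lia | exact E1]).
    assert (N2 : RtoC (INR (fact (k + 1))) <> RtoC 0) by (intros E1; apply RtoC_inj in E1; now apply (INR_fact_neq_0 (k + 1))).
    replace (S k + 2)%nat with (S (k + 2)) by lia. replace (S k + 1)%nat with (S (k + 1)) by lia.
    replace (L (S (k + 2)) z) with (- (- INR (k + 2) * L (S (k + 2)) z) / INR (k + 2))%C by (field; exact N1).
    rewrite E. change (fact (S (k + 1))) with (S (k + 1) * fact (k + 1))%nat.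
    replace (S (k + 1)) with (k + 2)%nat by lia. rewrite mult_INR, RtoC_mult. simpl ((- tpi) ^ S (k + 2))%C.
    field. split; assumption.
Qed.

(** * Lambert series *)

Lemma csum_one (u : nat -> C) n : (0 < n)%nat -> (forall k, (0 < k < n)%nat -> u k = RtoC 0) -> csum u n = u O.
Proof.
  intros Hn H. destruct n as [|n]; [lia|]. rewrite csum_S, csum_zero; [ring|].
  intros k Hk. apply H. lia.
Qed.

Lemma CSer_stretch (v : nat -> C) m : (0 < m)%nat -> asum v ->
  asum (fun n => if (n mod m =? 0)%nat then v (n / m)%nat else RtoC 0) ->
  CSer (fun n => if (n mod m =? 0)%nat then v (n / m)%nat else RtoC 0) = CSer v.
Proof.
  intros Hm Hv Hw. set (w := fun n => if (n mod m =? 0)%nat then v (n / m)%nat else RtoC 0) in *.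
  apply (clim_unique (csum v)); [|now apply CSer_lim].
  apply (clim_ext (fun N => csum w (m * N))).
  - intros N. induction N as [|N IH]; [now rewrite Nat.mul_0_r|].
    rewrite Nat.mul_succ_r, csum_split, IH. cbn [csum]. f_equal. rewrite csum_one.
    + unfold w. rewrite Nat.add_0_r, Nat.mul_comm, Nat.Div0.mod_mul. simpl. now rewrite Nat.div_mul by lia.
    + exact Hm.
    + intros k Hk. unfold w. rewrite Nat.mul_comm, Nat.add_comm, Nat.Div0.mod_add, Nat.mod_small by lia.
      destruct (Nat.eqb_spec k 0); [lia | reflexivity].
  - apply (clim_sub (csum w)); [now apply CSer_lim|]. intros P [M HM]. exists M. intros n Hn. apply HM. nia.
Qed.

(** The divisor sum sigma_s(n): c stands for the divisor c + 1, and it is the complementary divisor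
    that is raised to the power s. *)
Definition sig (s n : nat) : C :=
  csum (fun c => if (n mod (S c) =? 0)%nat then pows s (n / S c) else RtoC 0) n.

Lemma pows_mod_le s c n : Cmod (if (n mod (S c) =? 0)%nat then pows s (n / S c) else RtoC 0) <= Cmod (pows s n).
Proof.
  destruct (n mod S c =? 0)%nat; [|rewrite Cmod_0; apply Cmod_ge_0].
  destruct n as [|n]; [rewrite Nat.Div0.div_0_l; lra|].
  unfold pows at 1. destruct (S n / S c)%nat as [|k] eqn:E; [rewrite Cmod_0; apply Cmod_ge_0|].
  unfold pows. rewrite !Cmod_Rp by (apply pow_le, pos_INR). apply pow_incr. split; [apply pos_INR|].
  apply le_INR. rewrite <- E. apply Nat.Div0.div_le_upper_bound. nia.
Qed.

Lemma Cmod_sig s n : Cmod (sig s n) <= INR n * Cmod (pows s n).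
Proof.
  eapply Rle_trans; [apply csum_mod|]. rewrite <- rsum_const. apply rsum_le. intros k _. apply pows_mod_le.
Qed.

Lemma PSc_sig s : PSc (sig s).
Proof.
  apply (PSc_le _ (D (pows s))); [apply PSc_D, PSc_pows|]. intros n. unfold D.
  rewrite Cmod_mult, (Cmod_Rp (INR n)) by apply pos_INR. apply Cmod_sig.
Qed.

Lemma in_H_scal n z : in_H z -> in_H (INR (S n) * z).
Proof. unfold in_H. intros H. rewrite im_scal_l. apply Rmult_lt_0_compat; [apply INR_S_pos | exact H]. Qed.

(** Rows and columns of one array, with entry (n / (c + 1))^s q^n when c + 1 divides n. Nonzero
    entries have c < n, so t^n = w^(2n) <= w^(c + n) provides the product bound for [fubini]. *)
Lemma lambert s z : in_H z ->
  asum (fun c => F (pows s) (INR (S c) * z)) /\ CSer (fun c => F (pows s) (INR (S c) * z)) = F (sig s) z.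
Proof.
  intros Hz. set (q := qpar z). assert (Hq : Cmod q < 1) by now apply qpar_lt1.
  set (u := fun c n => ((if (n mod (S c) =? 0)%nat then pows s (n / S c) else RtoC 0) * q ^ n)%C).
  destruct (PSc_geom (pows s) (Cmod q) (PSc_pows s)) as (A & t & HA & Ht & HB); [split; [apply Cmod_ge_0 | exact Hq]|].
  set (w := sqrt t).
  assert (Hw : 0 < w < 1) by (unfold w; split; [apply sqrt_lt_R0; lra | rewrite <- sqrt_1; apply sqrt_lt_1; lra]).
  assert (Hww : w * w = t) by (apply sqrt_sqrt; lra).
  assert (Hz0 : forall c n, (n <= c)%nat -> (if (n mod (S c) =? 0)%nat then pows s (n / S c) else RtoC 0) = RtoC 0).
  { intros c n Hcn. rewrite Nat.mod_small by lia. destruct (Nat.eqb_spec n 0) as [->|]; [|reflexivity].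
    now rewrite Nat.Div0.div_0_l. }
  assert (Hu : forall c n, Cmod (u c n) <= w ^ c * (A * w ^ n)).
  { intros c n. unfold u. destruct (le_lt_dec n c) as [Hcn|Hcn].
    - rewrite Hz0 by exact Hcn. rewrite Cmult_0_l, Cmod_0. apply Rmult_le_pos; [apply pow_le; lra|].
      apply Rmult_le_pos; [exact HA | apply pow_le; lra].
    - rewrite Cmod_mult, Cmod_pow. apply Rle_trans with (Cmod (pows s n) * Cmod q ^ n).
      + apply Rmult_le_compat_r; [apply pow_le, Cmod_ge_0 | apply pows_mod_le].
      + eapply Rle_trans; [apply HB|]. replace (w ^ c * (A * w ^ n)) with (A * w ^ (c + n)) by (rewrite pow_add; ring).
        apply Rmult_le_compat_l; [exact HA|]. rewrite <- Hww, Rpow_mult_distr, <- pow_add. apply pow_dec; [lra | lia]. }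
  assert (Ew : ex_series (fun n => w ^ n)) by (apply ex_series_geom; rewrite Rabs_pos_eq; lra).
  assert (Ew' : ex_series (fun n => A * w ^ n)) by (apply ex_series_geomR; lra).
  assert (Hrow : forall c, CSer (u c) = F (pows s) (INR (S c) * z)).
  { intros c. pose proof (fubini_row u _ _ Hu Ew' c) as Hs.
    assert (Hv : asum (fun d => pows s d * (q ^ S c) ^ d)%C).
    { apply PSc_asum; [apply PSc_pows|]. rewrite Cmod_pow. apply Rle_lt_trans with (Cmod q); [|exact Hq].
      rewrite <- (pow_1 (Cmod q)) at 2. apply pow_dec; [split; [apply Cmod_ge_0 | lra] | lia]. }
    unfold F, Ev. rewrite <- qpar_pow. fold q. rewrite <- (CSer_stretch _ (S c) ltac:(lia) Hv).
    - apply CSer_ext. intros n. unfold u. destruct (Nat.eqb_spec (n mod S c) 0) as [E|E]; [|ring].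
      rewrite <- Cpow_mult_r. do 2 f_equal. pose proof (Nat.div_mod_eq n (S c)). lia.
    - apply (asum_ext (u c)); [|exact Hs].
      intros n. unfold u. destruct (Nat.eqb_spec (n mod S c) 0) as [E|E]; [|ring].
      rewrite <- Cpow_mult_r. do 2 f_equal. pose proof (Nat.div_mod_eq n (S c)). lia. }
  split.
  - apply (asum_ext (fun c => CSer (u c))); [exact Hrow | apply (fubini_rows u _ _ Hu Ew Ew')].
  - rewrite <- (CSer_ext _ _ Hrow), (fubini u _ _ Hu Ew Ew'). apply CSer_ext. intros n.
    rewrite (CSer_finite _ n) by (intros c Hc; unfold u; rewrite Hz0 by exact Hc; ring).
    unfold u, sig. fold q. rewrite (Cmult_comm _ (q ^ n)), <- csum_scal. apply csum_ext. intros c _. ring.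
Qed.

(** * The transformation law of the Eisenstein series of weight 2 *)

Lemma lat2 z : in_H z -> exists c, 0 < c /\
  forall n (m : R), c * (INR (S n) + Rabs m) <= Cmod (INR (S n) * z + m).
Proof.
  intros Hz. destruct (lat_bound z Hz) as (c & Hc & H). exists c. split; [exact Hc|]. intros n m.
  pose proof (INR_S_pos n) as Hn. set (x := INR (S n)) in *.
  replace (x * z + m)%C with (x * (z + (m / x)%R))%C.
  - rewrite Cmod_mult, (Cmod_Rp x) by lra.
    replace (c * (x + Rabs m)) with (x * (c * (1 + Rabs (m / x)))).
    + apply Rmult_le_compat_l; [lra | apply H].
    + unfold Rdiv. rewrite Rabs_mult, Rabs_inv, (Rabs_pos_eq x) by lra. field. lra.
  - rewrite RtoC_div by lra. field. intros E. apply RtoC_inj in E. lra.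
Qed.

Lemma in_H_inv z : in_H z -> in_H (- / z).
Proof.
  unfold in_H. intros H. destruct z as [x y]. simpl in *.
  replace (- (- y / (x * (x * 1) + y * (y * 1)))) with (y / (x * x + y * y)) by (field; nra).
  apply Rdiv_lt_0_compat; nra.
Qed.

(** Eisenstein's comparison term: it differs from the summand of weight 2 by a term of order four
    and telescopes in m. Subtracting it makes the double sum absolutely convergent. *)
Definition Lb (z : C) (m : nat) : C :=
  (/ ((z + INR (S m)) ^ 2 - 1 / 4) + / ((z - INR (S m)) ^ 2 - 1 / 4))%C.

Section E2law.
Context (z : C) (Hz : in_H z).
Let a n m := Lt 2 (INR (S n) * z) m.
Let b n m := Lb (INR (S n) * z) m.

Lemma inv_sq_quarter (w : C) d X : 0 < d -> 0 < X -> d * X <= Cmod w -> d * X <= Cmod (w + (1 / 2)%R) -> d * X <= Cmod (w + (- (1 / 2))%R) ->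
  Cmod (/ w ^ 2 - / (w ^ 2 - 1 / 4)) <= / d ^ 4 * / X ^ 4.
Proof.
  intros Hd HX H0 H1 H2. assert (HdX : 0 < d * X) by nra.
  assert (N0 : w <> RtoC 0) by (apply Cmod_gt_0; lra).
  assert (E : (w ^ 2 - 1 / 4)%C = ((w + (1 / 2)%R) * (w + (- (1 / 2))%R))%C).
  { rewrite RtoC_opp, RtoC_div by lra. simpl. field. }
  assert (N1 : (w + (1 / 2)%R)%C <> RtoC 0) by (apply Cmod_gt_0; lra).
  assert (N2 : (w + (- (1 / 2))%R)%C <> RtoC 0) by (apply Cmod_gt_0; lra).
  assert (N3 : (w ^ 2 - 1 / 4)%C <> RtoC 0) by (rewrite E; now apply Cmult_neq_0).
  replace (/ w ^ 2 - / (w ^ 2 - 1 / 4))%C with ((- (1 / 4))%R * / (w * w * (w ^ 2 - 1 / 4)))%C.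
  - rewrite Cmod_mult, Cmod_R, Rabs_Ropp, Rabs_pos_eq, Cmod_inv by (lra || (apply Cmult_neq_0; [now apply Cmult_neq_0 | exact N3])).
    rewrite E, !Cmod_mult, <- Rinv_mult.
    assert (HH : d ^ 4 * X ^ 4 <= Cmod w * Cmod w * (Cmod (w + (1 / 2)%R) * Cmod (w + (- (1 / 2))%R))).
    { replace (d ^ 4 * X ^ 4) with (d * X * (d * X) * (d * X * (d * X))) by ring.
      apply Rmult_le_compat; try nra. }
    assert (0 < d ^ 4 * X ^ 4) by (apply Rmult_lt_0_compat; apply pow_lt; lra).
    pose proof (Rinv_le_contravar _ _ H HH) as HI.
    assert (0 < / (Cmod w * Cmod w * (Cmod (w + (1 / 2)%R) * Cmod (w + (- (1 / 2))%R)))) by (apply Rinv_0_lt_compat; lra).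
    lra.
  - transitivity (((w ^ 2 - 1 / 4) - w * w) * / (w * w * (w ^ 2 - 1 / 4)))%C.
    + f_equal. rewrite RtoC_opp, RtoC_div by lra. simpl. field.
    + set (f := (w ^ 2 - 1 / 4)%C) in *. clearbody f. simpl. field. split; assumption.
Qed.

(** The difference has order |c z + d|^(-4), and (c + d)^4 >= c^2 d^2 for positive c and d splits it
    into a product. *)
Lemma ab_bound : exists K, 0 <= K /\ forall n m, Cmod (a n m - b n m) <= (K * isq n) * isq m.
Proof.
  destruct (lat2 z Hz) as (c & Hc & H). exists (2 * / (c / 2) ^ 4).
  assert (Hd4 : 0 < / (c / 2) ^ 4) by (apply Rinv_0_lt_compat, pow_lt; lra). split; [lra|]. intros n m.
  set (x := INR (S n)) in *. set (y := INR (S m)) in *.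
  assert (Hx : 1 <= x) by apply INR_S_ge1. assert (Hy : 1 <= y) by apply INR_S_ge1.
  assert (HB : forall t : R, (t = y \/ t = - y) ->
    Cmod (/ (x * z + t) ^ 2 - / ((x * z + t) ^ 2 - 1 / 4)) <= / (c / 2) ^ 4 * / (x + y) ^ 4).
  { intros t Ht. assert (HT : forall e, Rabs e <= 1 / 2 -> c / 2 * (x + y) <= Cmod (x * z + (t + e)%R)).
    { intros e He. eapply Rle_trans; [|apply H]. fold x. assert (y - 1 / 2 <= Rabs (t + e)).
      { apply Rabs_le_between in He. destruct Ht as [-> | ->]; [rewrite Rabs_pos_eq | rewrite Rabs_left1]; lra. }
      nra. }
    apply inv_sq_quarter; [lra | lra | | |].
    - replace t with (t + 0) by ring. apply HT. rewrite Rabs_R0. lra.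
    - rewrite <- Cplus_assoc, <- RtoC_plus. apply HT. rewrite Rabs_pos_eq; lra.
    - rewrite <- Cplus_assoc, <- RtoC_plus. apply HT. rewrite Rabs_left; lra. }
  pose proof (HB y (or_introl eq_refl)) as B1. pose proof (HB (- y) (or_intror eq_refl)) as B2. rewrite RtoC_opp in B2.
  unfold a, b, Lt, Lb. fold x y.
  match goal with |- Cmod ?e <= _ => replace e with
    ((/ (x * z + y) ^ 2 - / ((x * z + y) ^ 2 - 1 / 4)) + (/ (x * z + - y) ^ 2 - / ((x * z + - y) ^ 2 - 1 / 4)))%C
    by (unfold Cminus; ring) end.
  eapply Rle_trans; [apply Cmod_triangle|].
  assert (/ (x + y) ^ 4 <= / x ^ 2 * / y ^ 2).
  { rewrite <- Rinv_mult. apply Rinv_le_contravar; [apply Rmult_lt_0_compat; nra|].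
    replace ((x + y) ^ 4) with ((x + y) ^ 2 * (x + y) ^ 2) by ring. apply Rmult_le_compat; nra. }
  unfold isq. fold x y. nra.
Qed.

Definition hh (w : C) (x : R) : C := (/ (w + x) - / (w - x))%C.

Lemma in_H_sub w (x : R) : in_H w -> in_H (w - x).
Proof. unfold in_H. rewrite im_minus, im_RtoC. lra. Qed.

(** (w + m)^2 - 1/4 is the product of w + m - 1/2 and w + m + 1/2, which differ by 1; partial
    fractions then telescope. *)
Lemma Lb_hh w k : in_H w -> Lb w k = (hh w (INR k + 1 / 2) - hh w (INR (S k) + 1 / 2))%C.
Proof.
  intros Hw.
  assert (HP : forall p q : C, p <> RtoC 0 -> q <> RtoC 0 -> q = (p + 1)%C -> (/ (p * q))%C = (/ p - / q)%C)
    by (intros p q Hp Hq ->; field; split; assumption).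
  pose proof (in_H_neq0 _ (in_H_add w (INR k + 1 / 2) Hw)) as H1. pose proof (in_H_neq0 _ (in_H_sub w (INR k + 1 / 2) Hw)) as H2.
  pose proof (in_H_neq0 _ (in_H_add w (INR (S k) + 1 / 2) Hw)) as H3. pose proof (in_H_neq0 _ (in_H_sub w (INR (S k) + 1 / 2) Hw)) as H4.
  unfold Lb, hh.
  rewrite S_INR in *. set (x := INR k) in *.
  rewrite ?RtoC_plus, ?RtoC_div in * by lra. set (X := RtoC x) in *. clearbody X.
  replace ((w + (X + 1)) ^ 2 - 1 / 4)%C with ((w + (X + 1 / 2)) * (w + (X + 1 + 1 / 2)))%C by (simpl; field).
  replace ((w - (X + 1)) ^ 2 - 1 / 4)%C with ((w - (X + 1 / 2)) * (w - (X + 1 + 1 / 2)))%C by (simpl; field).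
  rewrite (HP _ _ H1 H3) by ring. rewrite (Cmult_comm (w - (X + 1 / 2))), (HP _ _ H4 H2) by ring. ring.
Qed.

Lemma is_lim_inv_S : is_lim_seq (fun n => / INR (S n)) 0.
Proof.
  replace (Finite 0) with (Rbar_inv p_infty) by reflexivity. apply is_lim_seq_inv; [|discriminate].
  apply (is_lim_seq_incr_1 INR). apply is_lim_seq_INR.
Qed.

Lemma hh_lim w : in_H w -> clim (fun n => hh w (INR n + 1 / 2)) 0.
Proof.
  intros Hw. destruct (lat_bound w Hw) as (c & Hc & H).
  apply (clim_squeeze _ _ (fun n => 2 / c * / INR (S n))).
  - intros n. pose proof (pos_INR n) as Hn. rewrite S_INR. set (x := INR n) in *.
    replace (hh w (x + 1 / 2) - 0)%C with (hh w (x + 1 / 2)) by ring. unfold hh.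
    eapply Rle_trans; [apply Cmod_sub|].
    rewrite !Cmod_inv by (apply in_H_neq0; now apply in_H_add || apply in_H_sub).
    assert (HB : forall t, x + 1 <= 1 + Rabs t -> / Cmod (w + t) <= / c * / (x + 1)).
    { intros t Ht. rewrite <- Rinv_mult. apply Rinv_le_contravar; [nra|]. eapply Rle_trans; [|apply H]. nra. }
    pose proof (HB (x + 1 / 2)) as B1. pose proof (HB (- (x + 1 / 2))) as B2. rewrite RtoC_opp in B2.
    rewrite Rabs_pos_eq in B1 by lra. rewrite Rabs_left in B2 by lra.
    specialize (B1 ltac:(lra)). specialize (B2 ltac:(lra)). unfold Cminus. unfold Rdiv. lra.
  - replace (Finite 0) with (Rbar_mult (2 / c) 0) by (simpl; f_equal; ring).
    apply is_lim_seq_scal_l, is_lim_inv_S.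
Qed.

Lemma clim_const c : clim (fun _ => c) c.
Proof.
  apply (clim_squeeze _ _ (fun _ => 0)); [|apply is_lim_seq_const]. intros _.
  replace (c - c)%C with (RtoC 0) by ring. rewrite Cmod_0. lra.
Qed.
Lemma clim_plus_0 c v : clim v 0 -> clim (fun n => c + v n)%C c.
Proof.
  intros H. pose proof (clim_plus _ _ _ _ (clim_const c) H) as H'. now rewrite Cplus_0_r in H'.
Qed.
Lemma clim_scal_0 c v : clim v 0 -> clim (fun n => c * v n)%C 0.
Proof. intros H. pose proof (clim_scal c _ _ H) as H'. now rewrite Cmult_0_r in H'. Qed.

Lemma clim_telescope (u : nat -> C) : clim u 0 -> clim (csum (fun k => u k - u (S k))%C) (u O).
Proof.
  intros H. apply (clim_ext (fun n => u O + (RtoC (-1)) * u n)%C).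
  - intros n. induction n as [|n IH]; [simpl; ring|]. cbn [csum]. rewrite <- IH. ring.
  - now apply (clim_plus_0 (u O)), clim_scal_0.
Qed.

Lemma asum_b n : asum (b n).
Proof.
  destruct ab_bound as (K & HK & HB).
  apply (asum_ext (fun m => a n m - (a n m - b n m))%C); [intros; ring|].
  apply asum_minus; [apply asum_Lt; [now apply in_H_scal | lia]|].
  apply (asum_major _ _ (HB n)). apply ex_series_scalR, ex_isq.
Qed.

Lemma b_row n : CSer (b n) = hh (INR (S n) * z) (1 / 2).
Proof.
  pose proof (in_H_scal n z Hz) as Hn.
  apply (clim_unique (csum (b n))); [apply CSer_lim, asum_b|].
  replace (1 / 2) with (INR 0 + 1 / 2) by (simpl; ring).
  apply (clim_ext (csum (fun k => hh (INR (S n) * z) (INR k + 1 / 2) - hh (INR (S n) * z) (INR (S k) + 1 / 2))%C)).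
  - intros N. apply csum_ext. intros k _. symmetry. now apply Lb_hh.
  - apply (clim_telescope (fun k => hh (INR (S n) * z) (INR k + 1 / 2))). now apply hh_lim.
Qed.

Let v (x : R) : C := (x * - / z)%C.

Lemma in_H_v x : 0 < x -> in_H (v x).
Proof. intros Hx. pose proof (in_H_inv z Hz) as H. unfold in_H, v in *. rewrite im_scal_l. nra. Qed.

(** Division by z exchanges the two lattice directions: summed over the multiples of z, [hh] becomes
    a cotangent series at -x / z. *)
Lemma hh_v x m : 0 < x -> hh (INR (S m) * z) x = (- / z * Lt 1 (v x) m)%C.
Proof.
  intros Hx. pose proof (in_H_scal m z Hz) as Hm. pose proof (in_H_neq0 z Hz) as N.
  pose proof (in_H_neq0 _ (in_H_add _ x Hm)) as H1. pose proof (in_H_neq0 _ (in_H_sub _ x Hm)) as H2.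
  unfold hh, Lt, v. set (M := RtoC (INR (S m))) in *.
  replace (x * - / z + M)%C with ((M * z - x) * / z)%C by (field; exact N).
  replace (x * - / z - M)%C with (- ((M * z + x) * / z))%C by (field; exact N).
  simpl Cpow. field. repeat split; assumption.
Qed.

(** pi cot(pi w) without its pole at 0. *)
Definition Cot (w : C) : C := CSer (Lt 1 w).

Lemma hh_sum x : 0 < x -> asum (fun m => hh (INR (S m) * z) x) /\
  CSer (fun m => hh (INR (S m) * z) x) = (- / z * Cot (v x))%C.
Proof.
  intros Hx. assert (Ha : asum (Lt 1 (v x))) by (apply asum_Lt; [now apply in_H_v | lia]). split.
  - apply (asum_ext (fun m => - / z * Lt 1 (v x) m)%C); [intros; symmetry; now apply hh_v|]. now apply asum_scal.
  - rewrite (CSer_ext _ (fun m => - / z * Lt 1 (v x) m)%C) by (intros; now apply hh_v). now apply CSer_scal.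
Qed.

Lemma b_col n : CSer (fun m => b m n) = (- / z * Cot (v (INR n + 1 / 2)) - - / z * Cot (v (INR (S n) + 1 / 2)))%C.
Proof.
  pose proof (pos_INR n) as Hn.
  destruct (hh_sum (INR n + 1 / 2)) as [H1 E1]; [lra|].
  destruct (hh_sum (INR (S n) + 1 / 2)) as [H2 E2]; [rewrite S_INR; lra|].
  rewrite <- E1, <- E2, <- CSer_minus by assumption.
  apply CSer_ext. intros m. apply Lb_hh. now apply in_H_scal.
Qed.

(** pi cot(pi w) tends to -pi i as Im w grows, and the points [v] go up because Im(-1/z) > 0. *)
Lemma Cot_lim : clim (fun n => Cot (v (INR n + 1 / 2))) (- (tpi / 2)).
Proof.
  pose proof (in_H_inv z Hz) as Hi. pose proof (in_H_neq0 z Hz) as N.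
  assert (Hv : forall n, in_H (v (INR n + 1 / 2))) by (intros n; apply in_H_v; pose proof (pos_INR n); lra).
  set (r := Cmod (qpar (- / z))). assert (Hr : 0 < r < 1) by (unfold r; split; [apply Cmod_gt_0, qpar_neq0 | now apply qpar_lt1]).
  set (s := sqrt r). assert (Hs : 0 < s < 1).
  { unfold s. split; [apply sqrt_lt_R0; lra | rewrite <- sqrt_1; apply sqrt_lt_1; lra]. }
  assert (Hqv : forall n, Cmod (qpar (v (INR n + 1 / 2))) = r ^ n * s).
  { intros n. unfold v. replace ((INR n + 1 / 2)%R * - / z)%C with (INR n * - / z + (- / z) / 2)%C
      by (rewrite RtoC_plus, RtoC_div by lra; field; exact N).
    rewrite qpar_add, <- qpar_pow, Cmod_mult, Cmod_pow. fold r. f_equal. unfold s.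
    unfold r. rewrite (qpar_double (- / z)), Cmod_mult. symmetry. apply sqrt_square, Cmod_ge_0. }
  apply (clim_ext (fun n => - (tpi / 2) + (- tpi * (qpar (v (INR n + 1 / 2)) / (1 - qpar (v (INR n + 1 / 2)))) + - (1) * / v (INR n + 1 / 2)))%C).
  - intros n. pose proof (proj1 cot_zeta2 _ (Hv n)) as E. unfold L, R1 in E. fold (Cot (v (INR n + 1 / 2))) in E.
    pose proof (qpar_neq1 _ (Hv n)) as N1. pose proof (in_H_neq0 _ (Hv n)) as N2.
    set (q := qpar (v (INR n + 1 / 2))) in *. set (w := v (INR n + 1 / 2)) in *. clearbody q w.
    replace (Cot w) with ((/ w ^ 1 + Cot w) - / w)%C by (simpl; field; exact N2). rewrite E. field. split; assumption.
  - apply (clim_plus_0 (- (tpi / 2))). rewrite <- (Cplus_0_r 0).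
    apply clim_plus; apply clim_scal_0.
    + apply (clim_squeeze _ _ (fun n => / (1 - s) * r ^ n)).
      * intros n. pose proof (qpar_neq1 _ (Hv n)) as N1. rewrite <- (Hqv O) in Hs || idtac.
        replace (qpar (v (INR n + 1 / 2)) / (1 - qpar (v (INR n + 1 / 2))) - 0)%C
          with (qpar (v (INR n + 1 / 2)) / (1 - qpar (v (INR n + 1 / 2))))%C by ring.
        rewrite Cmod_div, Hqv by exact N1.
        pose proof (Cmod_sub_ge 1 (qpar (v (INR n + 1 / 2)))) as Hge. rewrite Cmod_1, Hqv in Hge.
        assert (0 < r ^ n <= 1) by (split; [apply pow_lt; lra | apply pow_le1; lra]).
        assert (Hsn : r ^ n * s <= s) by nra.
        unfold Rdiv. rewrite Rmult_comm. apply Rmult_le_compat.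
        -- left; apply Rinv_0_lt_compat. lra.
        -- nra.
        -- apply Rinv_le_contravar; lra.
        -- nra.
      * replace (Finite 0) with (Rbar_mult (/ (1 - s)) 0) by (simpl; f_equal; ring).
        apply is_lim_seq_scal_l, is_lim_seq_geom. rewrite Rabs_pos_eq; lra.
    + apply (clim_squeeze _ _ (fun n => 2 * Cmod z * / INR (S n))).
      * intros n. replace (/ v (INR n + 1 / 2) - 0)%C with (/ v (INR n + 1 / 2))%C by ring.
        rewrite Cmod_inv by (apply in_H_neq0, Hv). unfold v. pose proof (pos_INR n) as Hn.
        rewrite Cmod_mult, Cmod_opp, Cmod_inv, (Cmod_Rp (INR n + 1 / 2)), S_INR by (lra || exact N).
        pose proof (proj1 (Cmod_gt_0 z) N).
        replace (/ ((INR n + 1 / 2) * / Cmod z)) with (Cmod z * / (INR n + 1 / 2)) by (field; lra).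
        replace (2 * Cmod z * / (INR n + 1)) with (Cmod z * / ((INR n + 1) / 2)) by (field; lra).
        apply Rmult_le_compat_l; [lra|]. apply Rinv_le_contravar; lra.
      * replace (Finite 0) with (Rbar_mult (2 * Cmod z) 0) by (simpl; f_equal; ring).
        apply is_lim_seq_scal_l, is_lim_inv_S.
Qed.

Lemma L2_sum : asum (fun n => L 2 (INR (S n) * z)) /\
  CSer (fun n => L 2 (INR (S n) * z)) = (tpi * tpi * F (sig 1) z)%C.
Proof.
  destruct (lambert 1 z Hz) as [H1 H2].
  assert (E : forall n, L 2 (INR (S n) * z) = (tpi * tpi * F (pows 1) (INR (S n) * z))%C).
  { intros n. etransitivity; [exact (lipschitz 0 _ (in_H_scal n z Hz))|]. simpl. field. }
  split.
  - apply (asum_ext (fun n => tpi * tpi * F (pows 1) (INR (S n) * z))%C); [intros; now rewrite E|]. now apply asum_scal.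
  - rewrite (CSer_ext _ _ E), CSer_scal, H2 by exact H1. reflexivity.
Qed.

Lemma a_rows : asum (fun n => CSer (a n)) /\
  CSer (fun n => CSer (a n)) = (tpi * tpi * F (sig 1) z - Series isq * / z ^ 2)%C.
Proof.
  destruct L2_sum as [H1 H2]. pose proof (in_H_neq0 z Hz) as N.
  assert (Hi : asum (fun n => / z ^ 2 * isq n)%C).
  { apply asum_scal, (asum_major _ isq); [|exact ex_isq]. intros n. rewrite Cmod_Rp; [lra | apply Rlt_le, isq_pos]. }
  assert (E : forall n, CSer (a n) = (L 2 (INR (S n) * z) - / z ^ 2 * isq n)%C).
  { intros n. unfold L, a, isq. rewrite RtoC_inv, RtoC_pow by (apply pow_nonzero, not_0_INR; lia).
    assert (Nn : RtoC (INR (S n)) <> RtoC 0) by (intros E; apply RtoC_inj in E; pose proof (INR_S_pos n); lra).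
    change (fun m : nat => Lt 2 (INR (S n) * z) m) with (Lt 2 (INR (S n) * z)).
    rewrite Cpow_mult_l. generalize (CSer (Lt 2 (INR (S n) * z))). intros c0. field. split; assumption. }
  split.
  - apply (asum_ext (fun n => L 2 (INR (S n) * z) - / z ^ 2 * isq n)%C); [intros; now rewrite E|]. now apply asum_minus.
  - rewrite (CSer_ext _ _ E), CSer_minus, H2 by assumption. f_equal. f_equal.
    rewrite CSer_scal.
    + rewrite Cmult_comm. f_equal. apply C_ext; simpl; [reflexivity|].
      rewrite (Series_ext _ (fun _ => 0 * 0)) by (intros; ring). rewrite Series_scal_l. ring.
    + apply (asum_major _ isq); [|exact ex_isq]. intros n. rewrite Cmod_Rp; [lra | apply Rlt_le, isq_pos].
Qed.
End E2law.

(** c z + d = z (c - d (-1/z)); the sign of d is absorbed because terms are paired and the exponent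
    is even. *)
Lemma Lt_swap z s m n : in_H z -> Nat.Even s ->
  Lt s (INR (S m) * z) n = (/ z ^ s * Lt s (INR (S n) * - / z) m)%C.
Proof.
  intros Hz [t ->]. pose proof (in_H_neq0 z Hz) as N. pose proof (in_H_scal m z Hz) as Hm.
  pose proof (in_H_neq0 _ (in_H_add _ (INR (S n)) Hm)) as H1. pose proof (in_H_neq0 _ (in_H_sub _ (INR (S n)) Hm)) as H2.
  unfold Lt. set (M := RtoC (INR (S m))) in *. set (K := RtoC (INR (S n))) in *.
  replace (K * - / z + M)%C with ((M * z - K) * / z)%C by (field; exact N).
  replace (K * - / z - M)%C with (- (1) * ((M * z + K) * / z))%C by (field; exact N).
  rewrite !(Cpow_mult_l _ (_ * / z)), !(Cpow_mult_l _ (/ z)), Cpow_inv by exact N.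
  replace ((- (1)) ^ (2 * t))%C with (RtoC 1)
    by (rewrite Cpow_mult_r; simpl; replace (- (1) * (- (1) * 1))%C with (RtoC 1) by ring; now rewrite Cpow_1_l).
  field. repeat split; apply Cpow_nz; assumption.
Qed.

(** For [a] minus [b] both orders of summation agree by [fubini]. Summed by rows, [b] gives -1/z
    times a cotangent value; summed by columns, it telescopes to -1/z times that value minus the
    limit of the cotangent high up. The discrepancy is the term tpi / 2 * z. *)
Lemma T2_law z : in_H z ->
  (tpi * tpi * F (sig 1) (- / z) + Series isq)%C
  = (z ^ 2 * (tpi * tpi * F (sig 1) z + Series isq) - tpi / 2 * z)%C.
Proof.
  intros Hz. pose proof (in_H_inv z Hz) as Hi. pose proof (in_H_neq0 z Hz) as N.
  set (a := fun n m => Lt 2 (INR (S n) * z) m). set (b := fun n m => Lb (INR (S n) * z) m).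
  destruct (ab_bound z Hz) as (K & HK & HB). fold a b in HB.
  assert (HBK : ex_series (fun n => K * isq n)) by apply ex_series_scalR, ex_isq.
  pose proof (fubini (fun n m => a n m - b n m)%C _ _ HB HBK ex_isq) as HF.
  destruct (a_rows z Hz) as [A1 A2]. fold a in A1, A2.
  destruct (a_rows _ Hi) as [A3 A4].
  assert (HS : forall m n, a m n = (/ z ^ 2 * Lt 2 (INR (S n) * - / z) m)%C).
  { intros m n. apply Lt_swap; [exact Hz | now exists 1%nat]. }
  assert (Hac : forall n, asum (fun m => a m n)).
  { intros n. apply (asum_ext (fun m => / z ^ 2 * Lt 2 (INR (S n) * - / z) m)%C); [intros; now rewrite HS|].
    apply asum_scal, asum_Lt; [now apply in_H_scal | lia]. }
  assert (Ec : forall n, CSer (fun m => a m n) = (/ z ^ 2 * CSer (Lt 2 (INR (S n) * - / z)))%C).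
  { intros n. rewrite (CSer_ext _ _ (fun m => HS m n)). apply CSer_scal, asum_Lt; [now apply in_H_scal | lia]. }
  assert (Hbc : forall n, asum (fun m => b m n)).
  { intros n. apply (asum_ext (fun m => a m n - (a m n - b m n))%C); [intros; ring|].
    apply asum_minus; [apply Hac|]. apply (fubini_col (fun n m => a n m - b n m)%C _ _ HB HBK). }
  assert (R1 : asum (fun n => CSer (b n))).
  { apply (asum_ext (fun n => CSer (a n) - CSer (fun m => a n m - b n m))%C).
    - intros n. rewrite CSer_minus; [ring | apply asum_Lt; [now apply in_H_scal | lia] | now apply asum_b].
    - apply asum_minus; [exact A1|]. apply (fubini_rows _ _ _ HB HBK ex_isq). }
  assert (R2 : asum (fun n => CSer (fun m => a m n))).
  { apply (asum_ext (fun n => / z ^ 2 * CSer (Lt 2 (INR (S n) * - / z)))%C); [intros; now rewrite Ec|].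
    now apply asum_scal. }
  assert (R3 : asum (fun n => CSer (fun m => b m n))).
  { apply (asum_ext (fun n => CSer (fun m => a m n) - CSer (fun m => a m n - b m n))%C).
    - intros n. rewrite CSer_minus; [ring | apply Hac | apply Hbc].
    - apply asum_minus; [exact R2|]. apply (fubini_cols _ _ _ HB HBK ex_isq). }
  assert (B1 : CSer (fun n => CSer (b n)) = (- / z * Cot (/ 2 * - / z))%C).
  { etransitivity; [apply CSer_ext; exact (b_row z Hz)|]. rewrite (proj2 (hh_sum z Hz (1 / 2) ltac:(lra))).
    do 3 f_equal. rewrite RtoC_div by lra. field. }
  assert (B2 : CSer (fun n => CSer (fun m => b m n)) = (- / z * Cot (/ 2 * - / z) - / z * (tpi / 2))%C).
  { apply (clim_unique (csum (fun n => CSer (fun m => b m n)))); [now apply CSer_lim|].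
    set (u := fun n => (- / z * (Cot ((INR n + 1 / 2)%R * - / z) - - (tpi / 2)))%C).
    apply (clim_ext (csum (fun n => u n - u (S n))%C)).
    - intros M. apply csum_ext. intros n _. unfold b. rewrite (b_col z Hz n). unfold u. ring.
    - replace (- / z * Cot (/ 2 * - / z) - / z * (tpi / 2))%C with (u O).
      + apply clim_telescope. unfold u. apply clim_scal_0.
        apply (clim_ext (fun n => Cot ((INR n + 1 / 2)%R * - / z) + (tpi / 2))%C); [intros; ring|].
        replace (RtoC 0) with (- (tpi / 2) + tpi / 2)%C by ring.
        apply (clim_plus _ (fun _ => tpi / 2)%C); [apply (Cot_lim z Hz) | apply clim_const].
      + unfold u. simpl INR. replace (RtoC (0 + 1 / 2)) with (/ 2)%C by (rewrite Rplus_0_l, RtoC_div by lra; field).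
        ring. }
  assert (E1 : (CSer (fun n => CSer (a n)) - CSer (fun n => CSer (b n)))%C
     = (CSer (fun n => CSer (fun m => a m n)) - CSer (fun n => CSer (fun m => b m n)))%C).
  { rewrite <- !CSer_minus by assumption. etransitivity; [|etransitivity; [exact HF|]].
    - apply CSer_ext. intros n. rewrite CSer_minus; [reflexivity | apply asum_Lt; [now apply in_H_scal | lia] | now apply asum_b].
    - apply CSer_ext. intros n. rewrite CSer_minus; [reflexivity | apply Hac | apply Hbc]. }
  rewrite (CSer_ext _ _ Ec), CSer_scal, B1, B2 in E1 by exact A3.
  change (CSer (fun n => CSer (a n))) with (CSer (fun n => CSer (fun m => Lt 2 (INR (S n) * z) m))) in E1.
  change (CSer (fun n => CSer (Lt 2 (INR (S n) * - / z))))
    with (CSer (fun n => CSer (fun m => Lt 2 (INR (S n) * - / z) m))) in E1.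
  rewrite A4 in E1. unfold a in A2. rewrite A2 in E1.
  set (X := F (sig 1) z) in *. set (Y := F (sig 1) (- / z)) in *. set (Cz := Cot (/ 2 * - / z)) in *.
  set (zeta := RtoC (Series isq)) in *. clearbody X Y Cz zeta.
  assert (Ni : (- / z)%C <> RtoC 0) by now apply in_H_neq0.
  assert (E2 : (/ z ^ 2 * (tpi * tpi * Y - zeta * / (- / z) ^ 2))%C
     = (tpi * tpi * X - zeta * / z ^ 2 - / z * (tpi / 2))%C).
  { transitivity ((/ z ^ 2 * (tpi * tpi * Y - zeta * / (- / z) ^ 2)) - (- / z * Cz - / z * (tpi / 2))
       + (- / z * Cz - / z * (tpi / 2)))%C; [ring|]. rewrite <- E1. ring. }
  apply (f_equal (fun t => z ^ 2 * t + zeta + zeta * z ^ 2)%C) in E2.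
  transitivity (z ^ 2 * (/ z ^ 2 * (tpi * tpi * Y - zeta * / (- / z) ^ 2)) + zeta + zeta * z ^ 2)%C.
  - set (y := (- / z)%C) in *. assert (Ey : z = (- / y)%C) by (unfold y; field; exact N). clearbody y. subst z. simpl. field. exact Ni.
  - rewrite E2. simpl. field. exact N.
Qed.

Definition E2 : nat -> C := fun n => match n with O => RtoC 1 | _ => (RtoC (-24) * sig 1 n)%C end.

Lemma PSc_E2 : PSc E2.
Proof.
  apply (PSc_le _ (padd pone (pscal (RtoC (-24)) (sig 1)))); [apply PSc_add; [apply PSc_one | apply PSc_scal, PSc_sig]|].
  intros [|n]; unfold padd, pscal, pone, E2; simpl csum; unfold sig; simpl csum.
  - right. f_equal. simpl. ring.
  - right. f_equal. ring.
Qed.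

Lemma F_E2 z : in_H z -> F E2 z = (1 - 24 * F (sig 1) z)%C.
Proof.
  intros Hz. pose proof (qpar_lt1 z Hz) as Hq. unfold F.
  rewrite (Ev_ext E2 (padd pone (pscal (RtoC (-24)) (sig 1)))).
  - rewrite Ev_add, Ev_scal, Ev_one by (exact Hq || apply PSc_one || (try apply PSc_scal; apply PSc_sig)).
    replace (RtoC (-24)) with (- (24))%C by (rewrite <- RtoC_opp; reflexivity). ring.
  - intros [|n]; unfold padd, pscal, pone, E2; [unfold sig; simpl; ring | ring].
Qed.

(** [T2_law] divided by zeta(2) = - tpi^2 / 24, which normalises the constant term to 1. *)
Lemma E2_S z : in_H z -> F E2 (- / z) = (z ^ 2 * F E2 z + 12 / tpi * z)%C.
Proof.
  intros Hz. pose proof (T2_law z Hz) as E. rewrite (proj2 cot_zeta2) in E.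
  rewrite !F_E2 by (exact Hz || now apply in_H_inv).
  set (X := F (sig 1) z) in *. set (Y := F (sig 1) (- / z)) in *. clearbody X Y.
  assert (HP : RtoC PI <> RtoC 0) by (intros E0; apply RtoC_inj in E0; pose proof PI_RGT_0; lra).
  assert (Ni : Ci <> RtoC 0) by (intros E0; apply (f_equal Im) in E0; simpl in E0; lra).
  assert (E1 : RtoC (PI ^ 2 / 6) = (- (tpi * tpi) / 24)%C).
  { unfold tpi. apply C_ext; simpl; field. }
  rewrite E1 in E.
  apply (Cmult_cancel_l (- (tpi * tpi) / 24)).
  - intros E0. apply (f_equal Re) in E0. rewrite <- E1 in E0. simpl in E0. pose proof PI_RGT_0. nra.
  - transitivity (tpi * tpi * Y + - (tpi * tpi) / 24)%C; [field|]. rewrite E. field.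
    apply tpi_neq0.
Qed.

(** * Eisenstein series of weight at least 4 *)

Definition zeta (s : nat) : R := Series (fun n => / INR (S n) ^ s).

Lemma zeta_term s n : (2 <= s)%nat -> 0 < / INR (S n) ^ s <= isq n.
Proof.
  intros Hs. pose proof (INR_S_ge1 n). split; [apply Rinv_0_lt_compat, pow_lt; lra|].
  apply Rinv_le_contravar; [apply pow_lt; lra|]. now apply Rle_pow.
Qed.
Lemma ex_zeta s : (2 <= s)%nat -> ex_series (fun n => / INR (S n) ^ s).
Proof.
  intros Hs. apply (ex_series_major _ isq); [|exact ex_isq]. intros n. pose proof (zeta_term s n Hs). lra.
Qed.
Lemma zeta_ge1 s : (2 <= s)%nat -> 1 <= zeta s.
Proof.
  intros Hs. unfold zeta. eapply Rle_trans; [|apply (rsum_le_Series _ 1)].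
  - simpl. rewrite pow1. lra.
  - intros k. pose proof (zeta_term s k Hs). lra.
  - now apply ex_zeta.
Qed.
Lemma isq_le2 : 0 <= Series isq <= 2.
Proof.
  split; [apply Series_nonneg; [intros; apply Rlt_le, isq_pos | exact ex_isq]|].
  refine (is_lim_seq_le (fun n => rsum isq (S n)) (fun _ => 2) (Finite (Series isq)) (Finite 2) _ _ (is_lim_seq_const _)).
  - intros n. pose proof (rsum_isq_le n). pose proof (Rinv_0_lt_compat _ (INR_S_pos n)). lra.
  - apply (is_lim_seq_incr_1 (rsum isq)). apply Series_lim, ex_isq.
Qed.

Lemma CSer_RtoC (a : nat -> R) : CSer (fun n => RtoC (a n)) = RtoC (Series a).
Proof.
  apply C_ext; simpl; [reflexivity|].
  rewrite (Series_ext _ (fun _ => 0 * 0)) by (intros; ring). rewrite Series_scal_l. ring.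
Qed.

Section Lattice.
Context (t : nat) (z : C) (Ht : (2 <= t)%nat) (Hz : in_H z).
Let w := (2 * t)%nat.

Lemma Lt_lattice_bound : exists K, 0 <= K /\ forall n m, Cmod (Lt w (INR (S n) * z) m) <= (K * isq n) * isq m.
Proof.
  destruct (lat2 z Hz) as (c & Hc & H). exists (2 * / c ^ w).
  assert (Hcw : 0 < / c ^ w) by (apply Rinv_0_lt_compat, pow_lt; lra). split; [lra|]. intros n m.
  pose proof (INR_S_ge1 n) as Hx. pose proof (INR_S_ge1 m) as Hy.
  pose proof (H n (INR (S m))) as H1. pose proof (H n (- INR (S m))) as H2.
  rewrite Rabs_Ropp in H2. rewrite Rabs_pos_eq in H1, H2 by lra. rewrite RtoC_opp in H2.
  fold (Cminus (INR (S n) * z) (INR (S m))) in H2.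
  set (x := INR (S n)) in *. set (y := INR (S m)) in *.
  assert (HB : forall W : C, c * (x + y) <= Cmod W -> Cmod (/ W ^ w) <= / c ^ w * (/ x ^ 2 * / y ^ 2)).
  { intros W HW. assert (0 < Cmod W) by nra. rewrite Cmod_inv, Cmod_pow by (apply Cpow_nz, Cmod_gt_0; lra).
    rewrite <- !Rinv_mult. apply Rinv_le_contravar; [repeat apply Rmult_lt_0_compat; try apply pow_lt; lra|].
    apply Rle_trans with ((c * (x + y)) ^ w); [|apply pow_incr; nra].
    rewrite Rpow_mult_distr. apply Rmult_le_compat_l; [apply pow_le; lra|].
    apply Rle_trans with ((x + y) ^ 4); [|apply Rle_pow; [lra | unfold w; lia]].
    replace ((x + y) ^ 4) with ((x + y) ^ 2 * (x + y) ^ 2) by ring. apply Rmult_le_compat; nra. }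
  unfold Lt. fold x y. eapply Rle_trans; [apply Cmod_triangle|].
  pose proof (HB _ H1). pose proof (HB _ H2). unfold isq. fold x y. lra.
Qed.

(** The sum of (c z + d)^(-w) over c >= 1 and d <> 0. *)
Definition LL : C := CSer (fun n => CSer (Lt w (INR (S n) * z))).

Lemma LL_eq : (zeta w * / z ^ w + LL)%C
  = ((- tpi) ^ w / INR (fact (w - 1)) * F (sig (w - 1)) z)%C.
Proof.
  destruct Lt_lattice_bound as (K & HK & HB). pose proof (in_H_neq0 z Hz) as N.
  assert (HBK : ex_series (fun n => K * isq n)) by apply ex_series_scalR, ex_isq.
  destruct (lambert (w - 1) z Hz) as [H1 H2].
  rewrite <- H2, <- CSer_scal by exact H1. unfold LL, zeta. rewrite <- CSer_RtoC, Cmult_comm, <- CSer_scal, <- CSer_plus.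
  - apply CSer_ext. intros n. pose proof (lipschitz (w - 2) _ (in_H_scal n z Hz)) as E.
    replace (w - 2 + 2)%nat with w in E by (unfold w; lia). replace (w - 2 + 1)%nat with (w - 1)%nat in E by (unfold w; lia).
    rewrite <- E. unfold L. f_equal.
    assert (Nn : INR (S n) <> 0) by (pose proof (INR_S_pos n); lra).
    rewrite RtoC_inv, RtoC_pow by now apply pow_nonzero. rewrite Cpow_mult_l.
    field. split; apply Cpow_nz; [exact N|]. intros E0. now apply RtoC_inj in E0.
  - apply asum_scal. apply (asum_major _ isq); [|exact ex_isq]. intros n.
    pose proof (zeta_term w n ltac:(unfold w; lia)). rewrite Cmod_Rp; lra.
  - exact (fubini_rows _ _ _ HB HBK ex_isq).
  - apply (asum_major _ isq); [|exact ex_isq]. intros n.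
    pose proof (zeta_term w n ltac:(unfold w; lia)). rewrite Cmod_Rp; lra.
Qed.

(** From weight 4 on the double series converges absolutely, so [Lt_swap] and an interchange of the
    sums give the law directly. *)
Lemma LL_S : CSer (fun n => CSer (Lt w (INR (S n) * - / z))) = (z ^ w * LL)%C.
Proof.
  destruct Lt_lattice_bound as (K & HK & HB). pose proof (in_H_neq0 z Hz) as N.
  assert (HBK : ex_series (fun n => K * isq n)) by apply ex_series_scalR, ex_isq.
  unfold LL.
  change (CSer (fun n => CSer (Lt w (INR (S n) * z)))) with (CSer (fun n => CSer (fun m => Lt w (INR (S n) * z) m))).
  rewrite (fubini _ _ _ HB HBK ex_isq).
  rewrite <- CSer_scal by exact (fubini_cols _ _ _ HB HBK ex_isq).
  apply CSer_ext. intros n. rewrite <- CSer_scal by exact (fubini_col _ _ _ HB HBK n).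
  apply CSer_ext. intros m. rewrite (Lt_swap z w m n Hz) by now exists t.
  field. now apply Cpow_nz.
Qed.
End Lattice.

(** (2 pi i)^w / ((w - 1)! zeta(w)) for w = 2t, classically -2w / B_w. Keeping zeta avoids Bernoulli
    numbers. *)
Definition gam (t : nat) : R := (- (4 * PI ^ 2)) ^ t / INR (fact (2 * t - 1)) / zeta (2 * t).
Definition Eis (t : nat) : nat -> C := fun n => match n with O => RtoC 1 | _ => (gam t * sig (2 * t - 1) n)%C end.

Lemma Eis_split t n : Eis t n = padd pone (pscal (gam t) (sig (2 * t - 1))) n.
Proof. destruct n; unfold Eis, padd, pone, pscal; [unfold sig; simpl; ring | ring]. Qed.

Lemma PSc_Eis t : PSc (Eis t).
Proof.
  apply (PSc_le _ (padd pone (pscal (gam t) (sig (2 * t - 1))))).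
  - apply PSc_add; [apply PSc_one | apply PSc_scal, PSc_sig].
  - intros n. rewrite Eis_split. lra.
Qed.

Lemma Ev_Eis t q : Cmod q < 1 -> Ev (Eis t) q = (1 + gam t * Ev (sig (2 * t - 1)) q)%C.
Proof.
  intros Hq. rewrite (Ev_ext _ _ _ (Eis_split t)).
  now rewrite Ev_add, Ev_scal, Ev_one by (exact Hq || apply PSc_one || (try apply PSc_scal; apply PSc_sig)).
Qed.

Lemma F_Eis t z : (2 <= t)%nat -> in_H z ->
  F (Eis t) z = (1 + / z ^ (2 * t) + / zeta (2 * t) * LL t z)%C.
Proof.
  intros Ht Hz. unfold F. rewrite Ev_Eis by now apply qpar_lt1. fold (F (sig (2 * t - 1)) z).
  pose proof (LL_eq t z Ht Hz) as E. pose proof (zeta_ge1 (2 * t) ltac:(lia)) as Hze.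
  assert (Nz : RtoC (zeta (2 * t)) <> RtoC 0) by (intros E0; apply RtoC_inj in E0; lra).
  assert (Nf : INR (fact (2 * t - 1)) <> 0) by apply INR_fact_neq_0.
  assert (Nf' : RtoC (INR (fact (2 * t - 1))) <> RtoC 0) by (intros E0; now apply RtoC_inj in E0).
  assert (Eg : RtoC (gam t) = (/ zeta (2 * t) * ((- tpi) ^ (2 * t) / INR (fact (2 * t - 1))))%C).
  { unfold gam. rewrite !RtoC_div, RtoC_pow by (lra || exact Nf). rewrite Cpow_mult_r.
    replace ((- tpi) ^ 2)%C with (RtoC (- (4 * PI ^ 2))).
    - field. split; assumption.
    - unfold tpi. apply C_ext; simpl; ring. }
  rewrite Eg, <- Cplus_assoc. f_equal. rewrite <- Cmult_assoc, <- E.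
  pose proof (in_H_neq0 z Hz). field. split; [exact Nz | now apply Cpow_nz].
Qed.

Lemma Eis_S t z : (2 <= t)%nat -> in_H z -> F (Eis t) (- / z) = (z ^ (2 * t) * F (Eis t) z)%C.
Proof.
  intros Ht Hz. pose proof (in_H_inv z Hz) as Hi. rewrite !F_Eis by assumption.
  unfold LL at 1. rewrite (LL_S t z Ht Hz). pose proof (in_H_neq0 z Hz) as N.
  replace (/ (- / z) ^ (2 * t))%C with (z ^ (2 * t))%C.
  - pose proof (Cpow_nz z (2 * t) N) as Np. set (P := (z ^ (2 * t))%C) in *. clearbody P. field. split; [|exact Np].
    intros E0. apply RtoC_inj in E0. pose proof (zeta_ge1 (2 * t) ltac:(lia)). lra.
  - rewrite (Cpow_mult_r (- / z)). replace ((- / z) ^ 2)%C with ((/ z) ^ 2)%C by (simpl; ring).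
    rewrite <- Cpow_mult_r, Cpow_inv by exact N. field. now apply Cpow_nz.
Qed.

(* On the left arc only 1, z^(-w) and (z+1)^(-w) matter. *)
Lemma Eis_arc t z : (2 <= t)%nat -> in_H z -> Cmod z = 1 -> -(1/2) <= Re z <= 0 ->
  Cmod (F (Eis t) z - (1 + / z ^ (2 * t) + / (z + 1) ^ (2 * t))) <= 32 / 2 ^ t.
Proof.
  intros Ht Hz H1 Hx. rewrite F_Eis by assumption. set (w := (2 * t)%nat).
  pose proof (zeta_ge1 w ltac:(unfold w; lia)) as Hze.
  assert (Nz : RtoC (zeta w) <> RtoC 0) by (intros E0; apply RtoC_inj in E0; lra).
  destruct (Lt_lattice_bound t z Ht Hz) as (K & HK & HB). fold w in HB.
  assert (HBK : ex_series (fun n => K * isq n)) by apply ex_series_scalR, ex_isq.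
  (* The terms with d = c are c^(-w) (z + 1)^(-w) and sum to zeta(w) (z + 1)^(-w). Removing them
     leaves only terms with |c z + d|^2 >= 2. *)
  set (dg := fun n m : nat => if (n =? m)%nat then (/ (z + 1) ^ w * RtoC (/ INR (S n) ^ w))%C else RtoC 0).
  set (rs := fun n m => (Lt w (INR (S n) * z) m - dg n m)%C).
  assert (Hz1 : (z + 1)%C <> RtoC 0) by exact (in_H_neq0 _ (in_H_add z 1 Hz)).
  assert (Hz2 : (Re z) ^ 2 + (Im z) ^ 2 = 1) by (rewrite <- Cmod2_alt, H1; ring).
  assert (HR : forall n m, Cmod (rs n m) <= (2 / 2 ^ (t - 2) * isq n) * isq m).
  { intros n m. pose proof (INR_S_ge1 n) as Hn. pose proof (INR_S_ge1 m) as Hm. unfold rs, dg, Lt, isq.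
    set (x := INR (S n)) in *. set (y := INR (S m)) in *.
    assert (HT : forall s : R, (s = y \/ s = - y) -> (s = y -> n <> m) ->
       Cmod (/ (x * z + s) ^ w) <= / 2 ^ (t - 2) * (/ x ^ 2 * / y ^ 2)).
    { intros s Hs Hnm.
      assert (HM : Cmod (x * z + s) ^ 2 = x ^ 2 + s ^ 2 + 2 * (x * s) * Re z).
      { rewrite Cmod2_alt, re_plus, im_plus, re_scal_l, im_scal_l, re_RtoC, im_RtoC.
        replace (x ^ 2) with (x ^ 2 * (Re z ^ 2 + Im z ^ 2)) by (rewrite Hz2; ring). ring. }
      (* Since -1/2 <= Re z <= 0, the square is at least (c - d)^2 + c d when d > 0, where c and d
         differ, and at least 2 c |d| when d < 0. *)
      assert (HM2 : 2 <= Cmod (x * z + s) ^ 2 /\ x * y <= Cmod (x * z + s) ^ 2).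
      { rewrite HM. destruct Hs as [-> | ->].
        - assert (Hne : 1 <= (x - y) ^ 2).
          { specialize (Hnm eq_refl). destruct (Nat.lt_gt_cases n m) as [Hl _]. destruct (Hl Hnm) as [Hlt|Hlt];
              apply le_INR in Hlt; rewrite !S_INR in Hlt; unfold x, y; rewrite !S_INR; nra. }
          assert (Hxy : 1 <= x * y) by nra.
          assert (- (x * y) <= 2 * (x * y) * Re z) by nra.
          assert (HH : x ^ 2 + y ^ 2 = (x - y) ^ 2 + 2 * (x * y)) by ring. split; lra.
        - assert (Hxy : 1 <= x * y) by nra.
          assert (0 <= 2 * (x * - y) * Re z) by nra.
          assert (HH : x ^ 2 + (- y) ^ 2 = (x - y) ^ 2 + 2 * (x * y)) by ring.
          pose proof (pow2_ge_0 (x - y)). split; lra. }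
      destruct HM2 as [HM2 HM3].
      assert (Hne : (x * z + s)%C <> RtoC 0) by (apply Cmod_gt_0; pose proof (Cmod_ge_0 (x * z + s)); nra).
      rewrite Cmod_inv, Cmod_pow by now apply Cpow_nz. unfold w. rewrite pow_mult.
      rewrite <- !Rinv_mult. apply Rinv_le_contravar; [repeat apply Rmult_lt_0_compat; try apply pow_lt; lra|].
      replace t with (t - 2 + 2)%nat at 2 by lia. rewrite pow_add.
      apply Rmult_le_compat; [apply pow_le; lra | nra | apply pow_incr; lra|].
      replace (x ^ 2 * y ^ 2) with ((x * y) ^ 2) by ring. apply pow_incr. nra. }
    pose proof (HT (- y) (or_intror eq_refl) ltac:(lra)) as T2. rewrite RtoC_opp in T2. fold (Cminus (x * z) y) in T2.
    destruct (Nat.eqb_spec n m) as [E|E].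
    - subst m. fold x. fold x in y. unfold y in *.
      replace (/ (x * z + x) ^ w + / (x * z - x) ^ w - / (z + 1) ^ w * RtoC (/ x ^ w))%C with (/ (x * z - x) ^ w)%C.
      + unfold Rdiv. assert (0 < / 2 ^ (t - 2) * (/ x ^ 2 * / x ^ 2)).
        { repeat apply Rmult_lt_0_compat; apply Rinv_0_lt_compat, pow_lt; lra. }
        lra.
      + replace (x * z + x)%C with (x * (z + 1))%C by ring. rewrite Cpow_mult_l, RtoC_inv, RtoC_pow by (apply pow_nonzero; lra).
        assert (Hx0 : RtoC x <> RtoC 0) by (intros E0; apply RtoC_inj in E0; lra).
        pose proof (Cpow_nz _ w Hz1). pose proof (Cpow_nz _ w Hx0).
        generalize (/ (x * z - x) ^ w)%C. intros c0. field. split; assumption.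
    - pose proof (HT y (or_introl eq_refl) ltac:(auto)) as T1.
      replace (/ (x * z + y) ^ w + / (x * z - y) ^ w - 0)%C with (/ (x * z + y) ^ w + / (x * z - y) ^ w)%C by ring.
      eapply Rle_trans; [apply Cmod_triangle|]. unfold Rdiv. lra. }
  set (C2 := 2 / 2 ^ (t - 2)) in *.
  assert (HC2 : ex_series (fun n => C2 * isq n)) by apply ex_series_scalR, ex_isq.
  assert (Hdg : forall n, asum (dg n) /\ CSer (dg n) = (/ (z + 1) ^ w * RtoC (/ INR (S n) ^ w))%C).
  { intros n. assert (Hf : forall m, (S n <= m)%nat -> dg n m = RtoC 0).
    { intros m Hm. unfold dg. destruct (Nat.eqb_spec n m); [lia | reflexivity]. }
    split; [now apply (asum_finite _ (S n))|]. rewrite (CSer_finite _ (S n) Hf). cbn [csum].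
    rewrite csum_zero.
    - unfold dg. rewrite Nat.eqb_refl. ring.
    - intros k Hk. unfold dg. destruct (Nat.eqb_spec n k); [lia | reflexivity]. }
  assert (Hzs : asum (fun n => RtoC (/ INR (S n) ^ w))).
  { apply (asum_major _ isq); [|exact ex_isq]. intros n.
    pose proof (zeta_term w n ltac:(unfold w; lia)). rewrite Cmod_Rp; lra. }
  assert (ELL : LL t z = (zeta w * / (z + 1) ^ w + CSer (fun n => CSer (rs n)))%C).
  { unfold LL, zeta. rewrite <- CSer_RtoC, Cmult_comm, <- CSer_scal, <- CSer_plus.
    - apply CSer_ext. intros n. rewrite <- (proj2 (Hdg n)). fold w.
      rewrite <- CSer_plus; [|apply Hdg | exact (fubini_row _ _ _ HR ex_isq n)].
      apply CSer_ext. intros m. unfold rs. ring.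
    - now apply asum_scal.
    - exact (fubini_rows _ _ _ HR HC2 ex_isq).
    - exact Hzs. }
  rewrite ELL.
  match goal with |- Cmod ?e <= _ => replace e with (/ zeta w * CSer (fun n => CSer (rs n)))%C end.
  - rewrite Cmod_mult, Cmod_inv, (Cmod_Rp (zeta w)) by (lra || exact Nz).
    assert (HS : Cmod (CSer (fun n => CSer (rs n))) <= 2 * (C2 * 2)).
    { pose proof isq_le2 as H2.
      assert (HC20 : 0 < C2) by (unfold C2; apply Rdiv_lt_0_compat; [lra | apply pow_lt; lra]).
      eapply Rle_trans; [apply (CSer_bound _ (fun n => 2 * (C2 * isq n)))|].
      - intros n. eapply Rle_trans; [apply (CSer_bound _ _ (HR n)); apply ex_series_scalR, ex_isq|].
        rewrite Series_scal_l, Rmult_comm. apply Rmult_le_compat_r; [|lra].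
        pose proof (isq_pos n). nra.
      - apply ex_series_scalR, HC2.
      - rewrite !Series_scal_l. apply Rmult_le_compat_l; [lra|]. apply Rmult_le_compat_l; lra. }
    apply Rle_trans with (1 * (2 * (C2 * 2))).
    + apply Rmult_le_compat; [left; apply Rinv_0_lt_compat; lra | apply Cmod_ge_0 | | exact HS].
      rewrite <- Rinv_1. apply Rinv_le_contravar; lra.
    + right. unfold C2. replace (2 ^ t) with (2 ^ (t - 2) * 4).
      * field. apply pow_nonzero. lra.
      * replace 4 with (2 ^ 2) by ring. rewrite <- pow_add. f_equal. lia.
  - pose proof (in_H_neq0 z Hz) as N. pose proof (Cpow_nz _ w Hz1). pose proof (Cpow_nz _ w N).
    generalize (CSer (fun n => CSer (rs n))). intros c0. field. repeat split; assumption.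
Qed.

(** |c z + d|^2 = 4 c^2 + d^2 >= 4 c |d| at z = 2 i. This value is the source of the bounds on the
    Delta-coefficients of the Eisenstein series. *)
Lemma Eis_2i t : (2 <= t)%nat -> Cmod (F (Eis t) (2 * Ci) - 1) <= 9 / 4 ^ t.
Proof.
  intros Ht. assert (Hz : in_H (2 * Ci)) by (unfold in_H; simpl; lra).
  rewrite F_Eis by assumption. set (w := (2 * t)%nat).
  pose proof (zeta_ge1 w ltac:(unfold w; lia)) as Hze.
  assert (Nz : RtoC (zeta w) <> RtoC 0) by (intros E0; apply RtoC_inj in E0; lra).
  assert (HR : forall n m, Cmod (Lt w (INR (S n) * (2 * Ci)) m) <= (2 / 4 ^ t * isq n) * isq m).
  { intros n m. pose proof (INR_S_ge1 n) as Hn. pose proof (INR_S_ge1 m) as Hm. unfold Lt, isq.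
    set (x := INR (S n)) in *. set (y := INR (S m)) in *.
    assert (HT : forall s : R, s ^ 2 = y ^ 2 -> Cmod (/ (x * (2 * Ci) + s) ^ w) <= / 4 ^ t * (/ x ^ 2 * / y ^ 2)).
    { intros s Hs. assert (HM : Cmod (x * (2 * Ci) + s) ^ 2 = 4 * x ^ 2 + y ^ 2)
        by (rewrite Cmod2_alt, <- Hs; simpl; ring).
      assert (Hne : (x * (2 * Ci) + s)%C <> RtoC 0) by (apply Cmod_gt_0; pose proof (Cmod_ge_0 (x * (2 * Ci) + s)); nra).
      rewrite Cmod_inv, Cmod_pow by now apply Cpow_nz. unfold w. rewrite pow_mult, HM.
      rewrite <- !Rinv_mult. apply Rinv_le_contravar; [repeat apply Rmult_lt_0_compat; try apply pow_lt; lra|].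
      replace t with (t - 2 + 2)%nat by lia. rewrite !pow_add, Rmult_assoc.
      apply Rmult_le_compat; [apply pow_le; lra | nra | apply pow_incr; nra|].
      replace (4 ^ 2 * (x ^ 2 * y ^ 2)) with ((4 * (x * y)) ^ 2) by ring. apply pow_incr. pose proof (pow2_ge_0 (2 * x - y)). split; nra. }
    pose proof (HT y eq_refl) as T1. pose proof (HT (- y) ltac:(ring)) as T2.
    rewrite RtoC_opp in T2. fold (Cminus (x * (2 * Ci)) y) in T2.
    eapply Rle_trans; [apply Cmod_triangle|]. unfold Rdiv. lra. }
  assert (H4 : 0 < / 4 ^ t) by (apply Rinv_0_lt_compat, pow_lt; lra).
  assert (HC2 : ex_series (fun n => 2 / 4 ^ t * isq n)) by apply ex_series_scalR, ex_isq.
  match goal with |- Cmod ?e <= _ => replace e with (/ (2 * Ci) ^ w + / zeta w * LL t (2 * Ci))%C by ring end.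
  eapply Rle_trans; [apply Cmod_triangle|].
  assert (E1 : Cmod (/ (2 * Ci) ^ w) = / 4 ^ t).
  { rewrite Cmod_inv, Cmod_pow, Cmod_mult, Cmod_Ci, Cmod_Rp by (lra || now apply Cpow_nz, in_H_neq0).
    rewrite Rmult_1_r. unfold w. rewrite pow_mult. f_equal. f_equal. ring. }
  rewrite E1, Cmod_mult, Cmod_inv, (Cmod_Rp (zeta w)) by (lra || exact Nz).
  pose proof isq_le2 as H2.
  assert (HS : Cmod (LL t (2 * Ci)) <= 2 * (2 / 4 ^ t * 2)).
  { eapply Rle_trans; [apply (CSer_bound _ (fun n => 2 * (2 / 4 ^ t * isq n)))|].
    - intros n. fold w. eapply Rle_trans; [apply (CSer_bound _ _ (HR n)); apply ex_series_scalR, ex_isq|].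
      rewrite Series_scal_l, Rmult_comm. apply Rmult_le_compat_r; [|lra].
      pose proof (isq_pos n). unfold Rdiv. nra.
    - apply ex_series_scalR, HC2.
    - rewrite !Series_scal_l. unfold Rdiv. nra. }
  assert (/ zeta w * Cmod (LL t (2 * Ci)) <= 1 * (2 * (2 / 4 ^ t * 2))).
  { apply Rmult_le_compat; [left; apply Rinv_0_lt_compat; lra | apply Cmod_ge_0 | | exact HS].
    rewrite <- Rinv_1. apply Rinv_le_contravar; lra. }
  unfold Rdiv in *. lra.
Qed.

Lemma pser_sig s : pser (sig s).
Proof.
  intros n. apply csum_pos. intros k _. destruct (n mod S k =? 0)%nat; [|simpl; lra].
  unfold pows. destruct (n / S k)%nat as [|j]; [simpl; lra|]. rewrite im_RtoC, re_RtoC.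
  split; [reflexivity | apply pow_le, pos_INR].
Qed.

(** * The discriminant and the forms of weight 4 and 6 *)

Lemma clim_mult u v l m : clim u l -> clim v m -> clim (fun n => u n * v n)%C (l * m).
Proof.
  intros Hu Hv.
  apply (clim_squeeze _ _ (fun n => Cmod (u n - l) * Cmod (v n - m) + (Cmod l * Cmod (v n - m) + Cmod m * Cmod (u n - l)))).
  - intros n. replace (u n * v n - l * m)%C with ((u n - l) * (v n - m) + (l * (v n - m) + m * (u n - l)))%C by ring.
    eapply Rle_trans; [apply Cmod_triangle|]. rewrite Cmod_mult. apply Rplus_le_compat_l.
    eapply Rle_trans; [apply Cmod_triangle|]. rewrite !Cmod_mult. lra.
  - replace (Finite 0) with (Finite (0 * 0 + (Cmod l * 0 + Cmod m * 0))) by (f_equal; ring).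
    apply is_lim_seq_plus'; [now apply is_lim_seq_mult'|].
    apply is_lim_seq_plus'; apply (is_lim_seq_mult' (fun _ => _)); try apply is_lim_seq_const; assumption.
Qed.

Lemma clim_cexp u : clim u 0 -> clim (fun n => cexp (u n)) 1.
Proof.
  intros H.
  assert (H0 : is_lim_seq (fun n => Cmod (u n)) 0) by (apply (is_lim_seq_ext (fun n => Cmod (u n - 0))); [intros n; f_equal; ring | exact H]).
  apply (is_lim_seq_le_le_loc (fun _ => 0) _ (fun n => 15 * Cmod (u n))).
  - apply is_lim_seq_spec in H0. destruct (H0 (mkposreal 1 Rlt_0_1)) as [N HN]. exists N. intros n Hn.
    specialize (HN n Hn). simpl in HN. rewrite Rminus_0_r, Rabs_pos_eq in HN by apply Cmod_ge_0.
    split; [apply Cmod_ge_0|]. set (w := u n) in *. pose proof (cexp_taylor w ltac:(lra)) as HT.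
    replace (cexp w - 1)%C with ((cexp w - 1 - w - w * w / 2) + (w + w * w / 2))%C by ring.
    eapply Rle_trans; [apply Cmod_triangle|].
    pose proof (Cmod_triangle w (w * w / 2)) as Ht2.
    rewrite Cmod_div, Cmod_mult, (Cmod_Rp 2) in Ht2 by (try lra; intros E; apply RtoC_inj in E; lra).
    pose proof (Cmod_ge_0 w). simpl in HT.
    assert (Cmod w * Cmod w <= Cmod w) by nra. assert (Cmod w * (Cmod w * (Cmod w * 1)) <= Cmod w) by nra. lra.
  - apply is_lim_seq_const.
  - replace (Finite 0) with (Finite (15 * 0)) by (f_equal; ring).
    apply (is_lim_seq_mult' (fun _ => 15)); [apply is_lim_seq_const | exact H0].
Qed.

Lemma clim_F a z : PSc a -> in_H z -> clim (fun n => F a (INR (S n) * z)) (a O).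
Proof.
  intros Ha Hz. pose proof (qpar_lt1 z Hz) as Hq. set (r := Cmod (qpar z)) in *.
  assert (Hr0 : 0 <= r) by apply Cmod_ge_0.
  pose proof (PSc_psh a Ha) as Hp.
  apply (clim_squeeze _ _ (fun n => Series (fun k => Cmod (psh a k) * r ^ k) * r ^ S n)).
  - intros n. unfold F. rewrite <- qpar_pow.
    assert (Hn : Cmod (qpar z ^ S n) <= r).
    { rewrite Cmod_pow. fold r. rewrite <- (pow_1 r) at 2. apply pow_dec; [lra | lia]. }
    rewrite Ev_psh by (exact Ha || (eapply Rle_lt_trans; [exact Hn | exact Hq])).
    match goal with |- Cmod ?e <= _ => replace e with (qpar z ^ S n * Ev (psh a) (qpar z ^ S n))%C by ring end.
    rewrite Cmod_mult, (Rmult_comm (Series _)). rewrite Cmod_pow at 1. fold r.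
    apply Rmult_le_compat_l; [now apply pow_le|]. apply Ev_bound; [exact Hp | lra].
  - apply (is_lim_seq_incr_1 (fun n => Series (fun k => Cmod (psh a k) * r ^ k) * r ^ n)).
    replace (Finite 0) with (Rbar_mult (Series (fun k => Cmod (psh a k) * r ^ k)) 0) by (simpl; f_equal; ring).
    apply is_lim_seq_scal_l, is_lim_seq_geom. rewrite Rabs_pos_eq; lra.
Qed.

(* [pexp c] is the series with constant term 1 solving D e = c * (sum of sigma_1(n) q^n) * e. *)
Fixpoint pex (c : R) (N n : nat) : C :=
  match N with
  | O => RtoC 0
  | S N' => match n with
            | O => RtoC 1
            | S _ => ((c / INR n)%R * csum (fun k => sig 1 (n - k) * pex c N' k) n)%C
            end
  end.
Definition pexp (c : R) (n : nat) : C := pex c (S n) n.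

Lemma pex_indep c N M n : (n < N)%nat -> (n < M)%nat -> pex c N n = pex c M n.
Proof.
  revert M n. induction N as [|N IH]; intros M n H1 H2; [lia|].
  destruct M as [|M]; [lia|]. destruct n as [|n]; [reflexivity|]. cbn [pex]. f_equal.
  apply csum_ext. intros k Hk. f_equal. apply IH; lia.
Qed.

Lemma pexp_S c n : (INR (S n) * pexp c (S n))%C = (c * csum (fun k => sig 1 (S n - k) * pexp c k) (S n))%C.
Proof.
  unfold pexp at 1. change (pex c (S (S n)) (S n))
    with ((c / INR (S n))%R * csum (fun k => sig 1 (S n - k) * pex c (S n) k) (S n))%C.
  pose proof (INR_S_pos n) as Hp.
  rewrite (csum_ext _ (fun k => sig 1 (S n - k) * pexp c k)%C).
  - rewrite RtoC_div by lra. field. intros E. apply RtoC_inj in E. lra.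
  - intros k Hk. f_equal. apply pex_indep; lia.
Qed.

(** The recursion gives n b_n <= K max(b_k : k < n) for the terms b_n at radius r, so the maximum
    stops growing once n exceeds K. *)
Lemma PSc_pexp c : PSc (pexp c).
Proof.
  intros r Hr. destruct (PSc_geom (sig 1) r (PSc_sig 1)) as (A & t & HA & Ht & HB); [lra|].
  set (b := fun n => Cmod (pexp c n) * r ^ n).
  assert (Hb0 : forall n, 0 <= b n) by (intros; apply Rmult_le_pos; [apply Cmod_ge_0 | apply pow_le; lra]).
  set (K := Rabs c * A / (1 - t)).
  assert (HK : 0 <= K) by (apply Rmult_le_pos; [apply Rmult_le_pos; [apply Rabs_pos | exact HA] | left; apply Rinv_0_lt_compat; lra]).
  destruct (INR_unbounded K) as [N HN].
  exists (rsum b (S N)). fold (b 0%nat).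
  assert (HM : forall k, (k <= N)%nat -> b k <= rsum b (S N)).
  { intros k Hk. replace (S N) with (S k + (N - k))%nat by lia.
    assert (Hmono : forall j, rsum b (S k) <= rsum b (S k + j)).
    { induction j as [|j IHj]; [rewrite Nat.add_0_r; lra|]. rewrite Nat.add_succ_r.
      change (rsum b (S (S k + j))) with (rsum b (S k + j) + b (S k + j)%nat). specialize (Hb0 (S k + j)%nat). lra. }
    eapply Rle_trans; [|apply Hmono]. simpl. pose proof (rsum_nonneg b k ltac:(auto)). lra. }
  intros n. fold (b n). induction n as [n IH] using lt_wf_ind.
  destruct (le_lt_dec n N) as [Hn|Hn]; [now apply HM|]. destruct n as [|n]; [lia|].
  set (M := rsum b (S N)) in *. assert (HM0 : 0 <= M) by (apply rsum_nonneg; auto).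
  assert (E : INR (S n) * b (S n) <= K * M).
  { unfold b. rewrite <- (Cmod_Rp (INR (S n))) by apply pos_INR.
    rewrite <- Rmult_assoc, <- Cmod_mult, pexp_S, Cmod_mult, Cmod_R, Rmult_assoc.
    unfold K, Rdiv. rewrite !Rmult_assoc. apply Rmult_le_compat_l; [apply Rabs_pos|].
    apply Rle_trans with (rsum (fun k => A * M * t ^ (S n - k)) (S n)).
    - rewrite Rmult_comm. eapply Rle_trans; [apply Rmult_le_compat_l; [apply pow_le; lra | apply csum_mod]|].
      rewrite <- rsum_scal. apply rsum_le. intros k Hk.
      rewrite Cmod_mult. replace (r ^ S n) with (r ^ (S n - k) * r ^ k) by (rewrite <- pow_add; f_equal; lia).
      replace (r ^ (S n - k) * r ^ k * (Cmod (sig 1 (S n - k)) * Cmod (pexp c k)))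
        with ((Cmod (sig 1 (S n - k)) * r ^ (S n - k)) * b k) by (unfold b; ring).
      replace (A * M * t ^ (S n - k)) with ((A * t ^ (S n - k)) * M) by ring.
      apply Rmult_le_compat; [apply Rmult_le_pos; [apply Cmod_ge_0 | apply pow_le; lra] | apply Hb0 | apply HB | apply IH; lia].
    - rewrite rsum_scal, Rmult_assoc, (Rmult_comm (/ (1 - t))). apply Rmult_le_compat_l; [exact HA|].
      apply Rmult_le_compat_l; [exact HM0|].
      apply Rle_trans with (rsum (fun k => t ^ k) (S n)); [|apply rsum_geom; lra].
      assert (HR : forall m, rsum (fun k => t ^ (m - k)) m <= rsum (fun k => t ^ k) m).
      { induction m as [|m IHm]; [simpl; lra|].
        assert (EE : forall j, rsum (fun k => t ^ (S j - k)) (S j) = t * (rsum (fun k => t ^ (j - k)) j + 1)).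
        { intros j. cbn [rsum]. rewrite (rsum_ext _ (fun k => t * t ^ (j - k))).
          - rewrite rsum_scal. replace (S j - j)%nat with 1%nat by lia. simpl. ring.
          - intros k Hk. replace (S j - k)%nat with (S (j - k)) by lia. reflexivity. }
        assert (E2 : forall j, rsum (fun k => t ^ k) (S j) = 1 + t * rsum (fun k => t ^ k) j).
        { induction j as [|j IHj]; [simpl; ring|]. cbn [rsum] in *. rewrite IHj at 1. simpl. ring. }
        rewrite EE, E2. nra. }
      apply HR. }
  assert (HNS : K <= INR (S n)) by (apply Rlt_le, Rlt_trans with (1 := HN), lt_INR; lia).
  pose proof (INR_S_pos n). assert (K * M <= INR (S n) * M) by (apply Rmult_le_compat_r; lra).
  apply (Rmult_le_reg_l (INR (S n))); lra.
Qed.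

(** The product of the (1 - q^n)^24, that is Delta / q and not the Dedekind eta function. Its
    inverse [ieta] has nonnegative coefficients, which all size estimates below rest on. *)
Definition eta : nat -> C := pexp (-24).
Definition ieta : nat -> C := pexp 24.
(* Delta = q exp(-24 lg). *)
Definition lg : nat -> C := fun n => match n with O => RtoC 0 | _ => (sig 1 n * (/ INR n)%R)%C end.

Lemma D_lg n : D lg n = sig 1 n.
Proof.
  unfold D, lg. destruct n as [|n]; [unfold sig; simpl; ring|]. pose proof (INR_S_pos n).
  rewrite RtoC_inv by lra. field. intros E. apply RtoC_inj in E. lra.
Qed.
Lemma PSc_lg : PSc lg.
Proof.
  apply (PSc_le _ (sig 1)); [apply PSc_sig|]. intros [|n]; unfold lg; [rewrite Cmod_0; apply Cmod_ge_0|].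
  pose proof (INR_S_ge1 n). rewrite Cmod_mult, Cmod_Rp by (left; apply Rinv_0_lt_compat; lra).
  rewrite <- (Rmult_1_r (Cmod (sig 1 (S n)))) at 2. apply Rmult_le_compat_l; [apply Cmod_ge_0|].
  rewrite <- Rinv_1. apply Rinv_le_contravar; lra.
Qed.

Lemma cder_lg z : in_H z -> cder (F lg) z (tpi * F (sig 1) z).
Proof.
  intros Hz. eapply cder_eqv; [apply cder_F; [apply PSc_lg | exact Hz]|].
  unfold F. now rewrite (Ev_ext _ _ _ D_lg).
Qed.

Lemma D_pexp c n : D (pexp c) n = pscal c (conv (pexp c) (sig 1)) n.
Proof.
  unfold D, pscal, conv. destruct n as [|n]; [unfold sig; simpl; ring|].
  rewrite pexp_S. f_equal. cbn [csum]. replace (S n - S n)%nat with O by lia.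
  replace (sig 1 0) with (RtoC 0) by reflexivity. rewrite Cmult_0_r, Cplus_0_r.
  f_equal; [apply csum_ext; intros|]; ring.
Qed.

(** The series times exp(- c lg) has zero derivative, and it tends to 1 along the multiples of z. *)
Lemma F_pexp c z : in_H z -> F (pexp c) z = cexp (c * F lg z).
Proof.
  intros Hz. set (h := fun z => (F (pexp c) z * cexp (- (c * F lg z)))%C).
  assert (Hc : forall w, in_H w -> h w = h z).
  { intros w Hw. apply (cder_const_H h); [|exact Hw | exact Hz]. intros x Hx. pose proof (qpar_lt1 x Hx) as Hq.
    eapply cder_eqv.
    - apply cder_mult; [apply cder_F; [apply PSc_pexp | exact Hx]|].
      apply (cder_comp cexp (fun z => - (c * F lg z))%C); [apply cder_cexp|].
      apply (cder_ext (fun z => (- c) * F lg z)%C); [intros; ring|]. apply cder_scal, cder_lg, Hx.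
    - unfold F. rewrite (Ev_ext _ _ _ (D_pexp c)), Ev_scal, Ev_conv
        by (exact Hq || apply PSc_sig || apply PSc_pexp || (apply PSc_conv; [apply PSc_pexp | apply PSc_sig])).
      ring. }
  assert (H1 : h z = RtoC 1).
  { apply (clim_unique (fun n => h (INR (S n) * z)%C)).
    - apply (clim_ext (fun _ => h z)); [intros n; symmetry; apply Hc; now apply in_H_scal | apply clim_const].
    - replace (RtoC 1) with (1 * 1)%C by ring. unfold h. apply clim_mult.
      + apply (clim_F (pexp c) z (PSc_pexp c) Hz).
      + apply clim_cexp. apply (clim_ext (fun n => (- c) * F lg (INR (S n) * z))%C); [intros; ring|].
        apply clim_scal_0. apply (clim_F lg z PSc_lg Hz). }
  unfold h in H1. transitivity (F (pexp c) z * cexp (- (c * F lg z)) * cexp (c * F lg z))%C.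
  - rewrite <- Cmult_assoc, <- cexp_add. replace (- (c * F lg z) + c * F lg z)%C with (RtoC 0) by ring.
    rewrite cexp_0. ring.
  - rewrite H1. ring.
Qed.

(** As an exponential it has no zero, its logarithmic derivative is tpi * E2, and its argument is
    available in closed form. *)
Definition Delta (z : C) : C := cexp (tpi * z - 24 * F lg z).
Definition iDelta (z : C) : C := cexp (- (tpi * z - 24 * F lg z)).

Lemma Delta_inv z : (Delta z * iDelta z)%C = RtoC 1.
Proof.
  unfold Delta, iDelta. rewrite <- cexp_add, <- cexp_0. f_equal. ring.
Qed.
Lemma Delta_neq0 z : Delta z <> RtoC 0.
Proof.
  intros E. pose proof (Delta_inv z) as H. rewrite E, Cmult_0_l in H. apply RtoC_inj in H. lra.
Qed.
Lemma Delta_eta z : in_H z -> Delta z = (qpar z * F eta z)%C.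
Proof.
  intros Hz. unfold eta. rewrite F_pexp by exact Hz. rewrite qpar_cexp, <- cexp_add. unfold Delta. f_equal.
  replace (RtoC (-24)) with (- (24))%C by (rewrite <- RtoC_opp; reflexivity). ring.
Qed.
Lemma eta_ieta z : in_H z -> (F eta z * F ieta z)%C = RtoC 1.
Proof.
  intros Hz. unfold eta, ieta. rewrite !F_pexp by exact Hz. rewrite <- cexp_add, <- cexp_0. f_equal.
  replace (RtoC (-24)) with (- (24))%C by (rewrite <- RtoC_opp; reflexivity). ring.
Qed.

Lemma cder_arg z : in_H z -> cder (fun z => tpi * z - 24 * F lg z)%C z (tpi * F E2 z).
Proof.
  intros Hz. eapply cder_eqv.
  - apply cder_minus; [apply cder_scal, cder_id | apply cder_scal, cder_lg, Hz].
  - rewrite F_E2 by exact Hz. ring.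
Qed.
Lemma cder_Delta z : in_H z -> cder Delta z (tpi * F E2 z * Delta z).
Proof.
  intros Hz. eapply cder_eqv.
  - apply (cder_comp cexp (fun z => tpi * z - 24 * F lg z)%C); [apply cder_cexp | now apply cder_arg].
  - unfold Delta. ring.
Qed.
Lemma cder_iDelta z : in_H z -> cder iDelta z (- (tpi * F E2 z) * iDelta z).
Proof.
  intros Hz. eapply cder_eqv.
  - apply (cder_comp cexp (fun z => - (tpi * z - 24 * F lg z))%C); [apply cder_cexp|].
    apply (cder_ext (fun z => (RtoC (-1)) * (tpi * z - 24 * F lg z))%C); [intros; ring|].
    apply cder_scal, cder_arg, Hz.
  - unfold iDelta. ring.
Qed.

Lemma cder_S f z l : in_H z -> cder f (- / z) l -> cder (fun z => f (- / z)%C) z (l * / (z * z)).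
Proof.
  intros Hz H. pose proof (in_H_neq0 z Hz) as N. apply (cder_comp f (fun z => - / z)%C); [exact H|].
  apply (cder_ext (fun z => (RtoC (-1)) * / z)%C); [intros; ring|].
  eapply cder_eqv; [apply cder_scal, cder_inv, N | ring].
Qed.

(** The extra term in the law of E2 cancels the logarithmic derivative of z^12, so the quotient of
    the two sides is constant; it is evaluated at the fixed point i, where i^12 = 1. *)
Lemma Delta_S z : in_H z -> Delta (- / z) = (z ^ 12 * Delta z)%C.
Proof.
  intros Hz. set (h := fun z => (Delta (- / z) * (/ z) ^ 12 * iDelta z)%C).
  assert (HC : in_H Ci) by (unfold in_H; simpl; lra).
  assert (Hc : h z = h Ci).
  { apply (cder_const_H h); [|exact Hz | exact HC]. intros x Hx. pose proof (in_H_neq0 x Hx) as N.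
    eapply cder_eqv.
    - apply cder_mult; [apply cder_mult|].
      + apply cder_S; [exact Hx|]. apply cder_Delta. now apply in_H_inv.
      + apply (cder_pow Cinv x (- / (x * x)) 11). now apply cder_inv.
      + now apply cder_iDelta.
    - rewrite E2_S by exact Hx. rewrite !Cpow_inv by exact N. replace (INR 12) with 12 by (simpl; ring). simpl Cpow.
      field. split; [exact N | apply tpi_neq0]. }
  assert (Ni : Ci <> RtoC 0) by (now apply in_H_neq0).
  assert (HCi : (- / Ci)%C = Ci).
  { apply (Cmult_cancel_l Ci); [exact Ni|]. replace (Ci * - / Ci)%C with (- (1))%C by (field; exact Ni).
    apply C_ext; simpl; ring. }
  unfold h in Hc. rewrite HCi in Hc.
  replace (Delta Ci * (/ Ci) ^ 12 * iDelta Ci)%C with (RtoC 1) in Hc.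
  - pose proof (in_H_neq0 z Hz) as N. transitivity (z ^ 12 * Delta z * (Delta (- / z) * (/ z) ^ 12 * iDelta z))%C.
    + rewrite Cpow_inv by exact N.
      transitivity (Delta (- / z) * (Delta z * iDelta z))%C; [rewrite Delta_inv; ring|].
      field. exact N.
    + rewrite Hc. ring.
  - transitivity (Delta Ci * iDelta Ci * (/ Ci) ^ 12)%C; [|ring]. rewrite Delta_inv.
    replace (/ Ci)%C with (- Ci)%C by (rewrite <- HCi at 1; ring).
    apply C_ext; simpl; ring.
Qed.

(** Ramanujan's equations D E2 = (E2^2 - E4) / 12 and D E4 = (E2 E4 - E6) / 3, taken as definitions.
    The laws under inversion and the derivative of j then follow from the law of E2 alone. *)
Definition E4 : nat -> C := padd (conv E2 E2) (pscal (RtoC (-12)) (D E2)).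
Definition E6 : nat -> C := padd (conv E2 E4) (pscal (RtoC (-3)) (D E4)).

Lemma PSc_E4 : PSc E4.
Proof. apply PSc_add; [apply PSc_conv; apply PSc_E2 | apply PSc_scal, PSc_D, PSc_E2]. Qed.
Lemma PSc_E6 : PSc E6.
Proof. apply PSc_add; [apply PSc_conv; [apply PSc_E2 | apply PSc_E4] | apply PSc_scal, PSc_D, PSc_E4]. Qed.

Lemma F_E4 z : in_H z -> F E4 z = (F E2 z * F E2 z - 12 * F (D E2) z)%C.
Proof.
  intros Hz. pose proof (qpar_lt1 z Hz) as Hq. pose proof PSc_E2 as H2. pose proof (PSc_D _ H2) as H3.
  unfold F, E4. rewrite Ev_add, Ev_conv, Ev_scal
    by (try apply PSc_conv; try apply PSc_scal; assumption).
  replace (RtoC (-12)) with (- (12))%C by (rewrite <- RtoC_opp; reflexivity). ring.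
Qed.
Lemma F_E6 z : in_H z -> F E6 z = (F E2 z * F E4 z - 3 * F (D E4) z)%C.
Proof.
  intros Hz. pose proof (qpar_lt1 z Hz) as Hq. pose proof PSc_E2 as H2. pose proof PSc_E4 as H4. pose proof (PSc_D _ H4) as H3.
  unfold F, E6. rewrite Ev_add, Ev_conv, Ev_scal
    by (try apply PSc_conv; try apply PSc_scal; assumption).
  replace (RtoC (-3)) with (- (3))%C by (rewrite <- RtoC_opp; reflexivity). ring.
Qed.

Lemma DE2_S z : in_H z -> F (D E2) (- / z) = (z ^ 2 * (2 * z * F E2 z + z ^ 2 * tpi * F (D E2) z + 12 / tpi) / tpi)%C.
Proof.
  intros Hz. pose proof (in_H_neq0 z Hz) as N.
  assert (E : (tpi * F (D E2) (- / z) * / (z * z))%C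
     = (INR 2 * z ^ 1 * 1 * F E2 z + z ^ 2 * (tpi * F (D E2) z) + 12 / tpi * 1)%C).
  { apply (cder_H_eq (fun z => F E2 (- / z)%C) (fun z => z ^ 2 * F E2 z + 12 / tpi * z)%C z).
    - intros x Hx. now apply E2_S.
    - exact Hz.
    - apply cder_S; [exact Hz|]. apply cder_F; [apply PSc_E2 | now apply in_H_inv].
    - apply cder_plus; [|apply cder_scal, cder_id]. apply cder_mult; [apply (cder_pow (fun z => z) z 1 1), cder_id|].
      apply cder_F; [apply PSc_E2 | exact Hz]. }
  replace (INR 2) with 2 in E by (simpl; ring).
  apply (Cmult_cancel_l (tpi * / (z * z))).
  - apply Cmult_neq_0; [apply tpi_neq0|]. intros E0. apply (f_equal (fun t => z * z * t)%C) in E0.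
    rewrite Cinv_r, Cmult_0_r in E0 by now apply Cmult_neq_0. apply RtoC_inj in E0. lra.
  - transitivity (tpi * F (D E2) (- / z) * / (z * z))%C; [ring|]. rewrite E. simpl. field. split; [apply tpi_neq0 | exact N].
Qed.

Lemma E4_S z : in_H z -> F E4 (- / z) = (z ^ 4 * F E4 z)%C.
Proof.
  intros Hz. rewrite !F_E4, DE2_S, E2_S by (exact Hz || now apply in_H_inv). simpl Cpow. field. apply tpi_neq0.
Qed.

Lemma DE4_S z : in_H z -> F (D E4) (- / z) = (z ^ 2 * (4 * z ^ 3 * F E4 z + z ^ 4 * tpi * F (D E4) z) / tpi)%C.
Proof.
  intros Hz. pose proof (in_H_neq0 z Hz) as N.
  assert (E : (tpi * F (D E4) (- / z) * / (z * z))%C = (INR 4 * z ^ 3 * 1 * F E4 z + z ^ 4 * (tpi * F (D E4) z))%C).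
  { apply (cder_H_eq (fun z => F E4 (- / z)%C) (fun z => z ^ 4 * F E4 z)%C z).
    - intros x Hx. now apply E4_S.
    - exact Hz.
    - apply cder_S; [exact Hz|]. apply cder_F; [apply PSc_E4 | now apply in_H_inv].
    - apply cder_mult; [apply (cder_pow (fun z => z) z 1 3), cder_id|].
      apply cder_F; [apply PSc_E4 | exact Hz]. }
  replace (INR 4) with 4 in E by (simpl; ring).
  apply (Cmult_cancel_l (tpi * / (z * z))).
  - apply Cmult_neq_0; [apply tpi_neq0|]. intros E0. apply (f_equal (fun t => z * z * t)%C) in E0.
    rewrite Cinv_r, Cmult_0_r in E0 by now apply Cmult_neq_0. apply RtoC_inj in E0. lra.
  - transitivity (tpi * F (D E4) (- / z) * / (z * z))%C; [ring|]. rewrite E. simpl. field. split; [apply tpi_neq0 | exact N].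
Qed.

Lemma E6_S z : in_H z -> F E6 (- / z) = (z ^ 6 * F E6 z)%C.
Proof.
  intros Hz. rewrite !F_E6, DE4_S, E2_S, E4_S by (exact Hz || now apply in_H_inv). simpl Cpow. field. apply tpi_neq0.
Qed.

Lemma rser_sig s : rser (sig s).
Proof. intros n. apply pser_sig. Qed.
Lemma rser_E2 : rser E2.
Proof. intros [|n]; [reflexivity|]. unfold E2. rewrite im_scal_l, rser_sig. ring. Qed.
Lemma rser_E4 : rser E4.
Proof.
  intros n. unfold E4, padd, pscal, D. rewrite im_plus, (rser_conv _ _ rser_E2 rser_E2), !im_scal_l, rser_E2. ring.
Qed.
Lemma rser_E6 : rser E6.
Proof.
  intros n. unfold E6, padd, pscal, D. rewrite im_plus, (rser_conv _ _ rser_E2 rser_E4), !im_scal_l, rser_E4. ring.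
Qed.
Lemma pser_ieta : pser ieta.
Proof.
  assert (H : forall N n, Im (pex 24 N n) = 0 /\ 0 <= Re (pex 24 N n)).
  { induction N as [|N IH]; intros n; [simpl; lra|]. destruct n as [|n]; [simpl; lra|]. cbn [pex].
    rewrite re_scal_l, im_scal_l.
    assert (Hc : Im (csum (fun k => sig 1 (S n - k) * pex 24 N k)%C (S n)) = 0 /\ 0 <= Re (csum (fun k => sig 1 (S n - k) * pex 24 N k)%C (S n))).
    { apply csum_pos. intros k _. rewrite re_mult, im_mult. destruct (pser_sig 1 (S n - k)%nat) as [-> ?].
      destruct (IH k) as [-> ?]. split; [ring | nra]. }
    destruct Hc as [-> Hc]. split; [ring|]. apply Rmult_le_pos; [|exact Hc].
    apply Rlt_le, Rdiv_lt_0_compat; [lra | apply INR_S_pos]. }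
  intros n. apply H.
Qed.

Lemma exp_pow x n : exp x ^ n = exp (INR n * x).
Proof.
  induction n as [|n IH]; [simpl; rewrite Rmult_0_l, exp_0; reflexivity|].
  rewrite S_INR, Rmult_plus_distr_r, exp_plus, <- IH. simpl. rewrite Rmult_1_l. ring.
Qed.

(** * Vanishing of forms of high order at the cusp *)

Lemma F_half_shift z : qpar (z + (1 / 2)%R) = (- qpar z)%C.
Proof.
  rewrite qpar_add. replace (qpar (1 / 2)%R) with (RtoC (-1)); [ring|].
  unfold qpar; simpl. rewrite !Rmult_0_r, Ropp_0, exp_0, !Rmult_1_l.
  replace (2 * PI * (1 / 2)) with PI by field. rewrite cos_PI, sin_PI. reflexivity.
Qed.

Lemma PSc_dilate a m : (0 < m)%nat -> PSc a -> PSc (fun n => a (m * n)%nat).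
Proof.
  intros Hm Ha r Hr. assert (E : INR m <> 0) by (apply not_0_INR; lia).
  set (rho := exp (ln r / INR m)).
  assert (Hrho : rho ^ m = r).
  { unfold rho. rewrite exp_pow.
    replace (INR m * (ln r / INR m)) with (ln r) by (field; exact E). apply exp_ln; lra. }
  assert (Hrho1 : 0 < rho < 1).
  { split; [apply exp_pos|]. unfold rho. rewrite <- exp_0. apply exp_increasing.
    assert (ln r < 0) by (rewrite <- ln_1; apply ln_increasing; lra).
    assert (0 < INR m) by (apply lt_0_INR; exact Hm).
    assert (0 < / INR m) by now apply Rinv_0_lt_compat. unfold Rdiv. nra. }
  destruct (Ha rho Hrho1) as [D0 HD]. exists D0. intros n. rewrite <- Hrho, <- pow_mult. apply HD.
Qed.

(** Shifting z by 1/2 changes the sign of q, so the odd terms cancel and q^2 becomes the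
    parameter. *)
Lemma F_even a z : PSc a -> in_H z ->
  (F a z + F a (z + (1 / 2)%R))%C = (2 * F (fun n => a (2 * n)%nat) (2 * z))%C.
Proof.
  intros Ha Hz. pose proof (qpar_lt1 z Hz) as Hq. unfold F. rewrite F_half_shift.
  replace (qpar (2 * z)) with (qpar z ^ 2)%C by (rewrite qpar_pow; f_equal; simpl; ring).
  set (q := qpar z) in *.
  assert (Hq' : Cmod (- q) < 1) by now rewrite Cmod_opp.
  assert (Hq2 : Cmod (q ^ 2) < 1).
  { rewrite Cmod_pow. pose proof (Cmod_ge_0 q). simpl. nra. }
  pose proof (PSc_dilate a 2 ltac:(lia) Ha) as Hd.
  pose proof (PSc_asum a q Ha Hq) as S1. pose proof (PSc_asum a _ Ha Hq') as S2.
  pose proof (PSc_asum _ _ Hd Hq2) as S3. pose proof (asum_plus _ _ S1 S2) as S4.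
  unfold Ev. rewrite <- CSer_plus, <- CSer_scal by assumption.
  assert (HE : forall n, (a n * q ^ n + a n * (- q) ^ n)%C
     = if (n mod 2 =? 0)%nat then (2 * (a (2 * (n / 2))%nat * (q ^ 2) ^ (n / 2)))%C else RtoC 0).
  { intros n. pose proof (Nat.div_mod_eq n 2) as En. pose proof (Nat.mod_upper_bound n 2 ltac:(lia)) as Hlt.
    assert (Hm : ((- q) ^ 2)%C = (q ^ 2)%C) by (simpl; ring).
    destruct (Nat.eqb_spec (n mod 2) 0) as [E|E].
    - assert (En' : n = (2 * (n / 2))%nat) by lia. rewrite En' at 1 2 3 4. rewrite !Cpow_mult_r, Hm. ring.
    - assert (En' : n = S (2 * (n / 2))) by lia. rewrite En'. rewrite !Cpow_S, !Cpow_mult_r, Hm. ring. }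
  rewrite (CSer_ext _ _ HE).
  apply (CSer_stretch (fun k => 2 * (a (2 * k)%nat * (q ^ 2) ^ k))%C 2); [lia | now apply asum_scal |].
  apply (asum_ext _ _ HE S4).
Qed.

(** A substitute for Cauchy's estimate. Iterating [F_even] averages over 2^p points at height y, so
    e bounds the series of the coefficients with index divisible by 2^p at height 2^p y; as p grows
    only the constant term survives. *)
Lemma coef0_bound a y e : PSc a -> 0 < y -> (forall z, Im z = y -> Cmod (F a z) <= e) -> Cmod (a O) <= e.
Proof.
  intros Ha Hy He.
  assert (HP : forall p z, Im z = 2 ^ p * y -> Cmod (F (fun n => a (2 ^ p * n)%nat) z) <= e).
  { induction p as [|p IH]; intros z Hz.
    - unfold F. rewrite (Ev_ext _ a) by (intros; f_equal; simpl; lia).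
      apply He. rewrite Hz. ring.
    - assert (Hz2 : Im (z / 2) = 2 ^ p * y).
      { unfold Cdiv. rewrite <- RtoC_inv, Cmult_comm, im_scal_l, Hz by lra. simpl. field. }
      assert (Hzh : in_H (z / 2)) by (unfold in_H; rewrite Hz2; apply Rmult_lt_0_compat; [apply pow_lt; lra | exact Hy]).
      assert (H2p : (0 < 2 ^ p)%nat) by (apply Nat.neq_0_lt_0, Nat.pow_nonzero; lia).
      pose proof (F_even _ _ (PSc_dilate a (2 ^ p) H2p Ha) Hzh) as E.
      replace (2 * (z / 2))%C with z in E by field.
      pose proof (IH (z / 2)%C Hz2) as I1. pose proof (IH (z / 2 + (1 / 2)%R)%C) as I2.
      rewrite im_plus, im_RtoC, Rplus_0_r in I2. specialize (I2 Hz2).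
      pose proof (Cmod_triangle (F (fun n => a (2 ^ p * n)%nat) (z / 2)) (F (fun n => a (2 ^ p * n)%nat) (z / 2 + (1 / 2)%R))) as Ht.
      rewrite E, Cmod_mult, Cmod_Rp in Ht by lra.
      unfold F at 1. rewrite (Ev_ext _ (fun n => a (2 ^ p * (2 * n))%nat)) by (intros; f_equal; simpl; lia).
      fold (F (fun n => a (2 ^ p * (2 * n))%nat) z). lra. }
  set (r := exp (- (2 * PI * y))). pose proof PI_RGT_0 as HPI.
  assert (Hr : 0 <= r < 1).
  { unfold r. split; [apply Rlt_le, exp_pos|]. rewrite <- exp_0. apply exp_increasing. nra. }
  destruct (PSc_geom a r Ha Hr) as (A & t & HA & Ht & HB).
  assert (Hfin : forall p, Cmod (a O) <= e + / (1 - t) * A * t ^ p).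
  { intros p. set (N := (2 ^ p)%nat). assert (HN : (p <= N)%nat) by (apply Nat.lt_le_incl, Nat.pow_gt_lin_r; lia).
    assert (HN0 : (0 < N)%nat) by (apply Nat.neq_0_lt_0, Nat.pow_nonzero; lia).
    set (z := (0, 2 ^ p * y) : C). specialize (HP p z eq_refl).
    assert (Hz : in_H z) by (unfold in_H, z; simpl; apply Rmult_lt_0_compat; [apply pow_lt; lra | exact Hy]).
    pose proof (PSc_dilate a N HN0 Ha) as Hd. unfold F in HP. rewrite Ev_psh in HP by (exact Hd || now apply qpar_lt1).
    rewrite Nat.mul_0_r in HP.
    assert (Hq : Cmod (qpar z) = r ^ N).
    { rewrite Cmod_qpar. unfold z, r, N. rewrite exp_pow, pow_INR. replace (INR 2) with 2 by (simpl; ring). f_equal. simpl. ring. }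
    assert (HT : Cmod (qpar z * Ev (psh (fun n => a (N * n)%nat)) (qpar z)) <= / (1 - t) * A * t ^ p).
    { unfold Ev. rewrite <- CSer_scal by (apply PSc_asum; [now apply PSc_psh | now apply qpar_lt1]).
      eapply Rle_trans; [apply (CSer_bound _ (fun k => A * t ^ p * t ^ k))|].
      - intros k. unfold psh. rewrite !Cmod_mult, Cmod_pow, Hq.
        replace (r ^ N * (Cmod (a (N * S k)%nat) * (r ^ N) ^ k)) with (Cmod (a (N * S k)%nat) * r ^ (N * S k)).
        + eapply Rle_trans; [apply HB|]. rewrite Rmult_assoc. apply Rmult_le_compat_l; [exact HA|].
          rewrite <- pow_add. apply pow_dec; [lra | nia].
        + rewrite pow_mult. simpl. ring.
      - apply ex_series_scalR, ex_series_geom. rewrite Rabs_pos_eq; lra.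
      - rewrite Series_scal_l, Series_geom by (rewrite Rabs_pos_eq; lra). right; ring. }
    pose proof (Cmod_sub_ge (a O) (- (qpar z * Ev (psh (fun n => a (N * n)%nat)) (qpar z)))) as Hs.
    rewrite Cmod_opp in Hs.
    replace (a O - - (qpar z * Ev (psh (fun n => a (N * n)%nat)) (qpar z)))%C
      with (a O + qpar z * Ev (psh (fun n => a (N * n)%nat)) (qpar z))%C in Hs by ring. fold N in HP. lra. }
  refine (is_lim_seq_le (fun _ => Cmod (a O)) (fun p => e + / (1 - t) * A * t ^ p) (Cmod (a O)) (Finite e) Hfin (is_lim_seq_const _) _).
  replace (Finite e) with (Finite (e + / (1 - t) * A * 0)) by (f_equal; ring).
  apply is_lim_seq_plus'; [apply is_lim_seq_const|]. apply (is_lim_seq_mult' (fun _ => _)); [apply is_lim_seq_const|].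
  apply is_lim_seq_geom. rewrite Rabs_pos_eq; lra.
Qed.

Definition pshn (n : nat) (a : nat -> C) : nat -> C := fun k => a (n + k)%nat.
Lemma PSc_pshn n a : PSc a -> PSc (pshn n a).
Proof.
  intros Ha r Hr. destruct (Ha r Hr) as [A HA]. exists (A / r ^ n). intros k.
  assert (0 < r ^ n) by (apply pow_lt; lra). apply (Rmult_le_reg_r (r ^ n)); [assumption|].
  unfold Rdiv. rewrite (Rmult_assoc A), Rinv_l, Rmult_1_r by lra.
  specialize (HA (n + k)%nat). rewrite pow_add in HA. unfold pshn. lra.
Qed.
Lemma F_pshn n a z : PSc a -> in_H z -> (forall k, (k < n)%nat -> a k = RtoC 0) ->
  F a z = (qpar z ^ n * F (pshn n a) z)%C.
Proof.
  intros Ha Hz H. pose proof (qpar_lt1 z Hz) as Hq. unfold F, Ev.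
  rewrite (CSer_tail _ n) by now apply PSc_asum.
  rewrite csum_zero, Cplus_0_l by (intros k Hk; rewrite H by exact Hk; ring).
  rewrite <- CSer_scal by (apply PSc_asum; [now apply PSc_pshn | exact Hq]).
  apply CSer_ext. intros k. unfold pshn. rewrite Cpow_add_r. ring.
Qed.

(** If the coefficients below n vanish, f / q^n has constant term a_n, and [coef0_bound] at height y
    gives |a_n| <= sqrt(B y) e^(2 pi n y); then y tends to 0. *)
Lemma small_form_zero a B : PSc a -> 0 <= B ->
  (forall z, in_H z -> Im z <= 1 -> Cmod (F a z) ^ 2 <= B * Im z) -> forall n, a n = RtoC 0.
Proof.
  intros Ha HB H n. induction n as [n IH] using lt_wf_ind.
  apply Cmod_eq_0, Rle_antisym; [|apply Cmod_ge_0].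
  pose proof PI_RGT_0 as HPI. set (E := exp (2 * PI * INR n)).
  assert (HE : 0 < E) by apply exp_pos.
  assert (Hb : forall y, 0 < y <= 1 -> Cmod (a n) <= sqrt (B * y) * E).
  { intros y Hy. replace (a n) with (pshn n a O) by (unfold pshn; now rewrite Nat.add_0_r).
    apply (coef0_bound _ y); [now apply PSc_pshn | lra|]. intros z Hz.
    assert (HzH : in_H z) by (unfold in_H; lra).
    pose proof (F_pshn n a z Ha HzH IH) as EF. specialize (H z HzH ltac:(lra)). rewrite EF, Hz in H.
    rewrite Cmod_mult, Cmod_pow, Cmod_qpar, Hz in H.
    set (f := Cmod (F (pshn n a) z)) in *. assert (Hf : 0 <= f) by apply Cmod_ge_0.
    assert (Hexp : exp (- (2 * PI * y)) ^ n * E >= 1).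
    { unfold E. rewrite exp_pow, <- exp_plus.
      apply Rle_ge. rewrite <- exp_0. apply exp_mono. pose proof (pos_INR n).
      assert (0 <= 2 * PI * INR n) by (apply Rmult_le_pos; lra). nra. }
    set (p := exp (- (2 * PI * y)) ^ n) in *. assert (0 <= p) by (apply pow_le, Rlt_le, exp_pos).
    assert (p * f <= sqrt (B * y)).
    { apply Rsqr_incr_0_var; [|apply sqrt_pos]. rewrite Rsqr_sqrt by (apply Rmult_le_pos; lra). unfold Rsqr. simpl in H. lra. }
    assert (p * f * E <= sqrt (B * y) * E) by (apply Rmult_le_compat_r; lra).
    assert (1 * f <= p * E * f) by (apply Rmult_le_compat_r; lra). lra. }
  refine (is_lim_seq_le (fun _ => Cmod (a n)) (fun k => sqrt (B * / INR (S k)) * E) (Cmod (a n)) (Finite 0) _ (is_lim_seq_const _) _).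
  - intros k. apply Hb. pose proof (INR_S_ge1 k). split; [apply Rinv_0_lt_compat; lra|].
    rewrite <- Rinv_1. apply Rinv_le_contravar; lra.
  - replace (Finite 0) with (Finite (0 * E)) by (f_equal; ring).
    apply (is_lim_seq_mult' _ (fun _ => E)); [|apply is_lim_seq_const].
    replace 0 with (sqrt 0) by apply sqrt_0.
    apply (is_lim_seq_continuous sqrt (fun k => B * / INR (S k)) 0); [apply continuity_pt_sqrt; lra|].
    replace (Finite 0) with (Finite (B * 0)) by (f_equal; ring).
    apply (is_lim_seq_mult' (fun _ => B)); [apply is_lim_seq_const | apply is_lim_inv_S].
Qed.

Lemma F_zero_coef a : PSc a -> (forall z, in_H z -> F a z = RtoC 0) -> forall n, a n = RtoC 0.
Proof.
  intros Ha H. apply (small_form_zero a 0 Ha); [lra|]. intros z Hz _. rewrite H, Cmod_0 by exact Hz. simpl. lra.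
Qed.

Lemma F_periodic_int a z : forall n, F a (z + INR n) = F a z.
Proof.
  induction n as [|n IH]; [simpl; f_equal; ring|].
  rewrite S_INR, RtoC_plus, Cplus_assoc, F_T. exact IH.
Qed.

Lemma translate_strip a z : exists w, Im w = Im z /\ Rabs (Re w) <= 1 / 2 /\ F a w = F a z.
Proof.
  set (m := up (Re z - 1 / 2)). pose proof (archimed (Re z - 1 / 2)) as [H1 H2]. fold m in H1, H2.
  assert (HZ : exists n : nat, IZR m = INR n \/ IZR m = - INR n).
  { destruct (Z_le_gt_dec 0 m) as [Hm|Hm].
    - exists (Z.to_nat m). left. now rewrite INR_IZR_INZ, Z2Nat.id.
    - exists (Z.to_nat (- m)). right. rewrite INR_IZR_INZ, Z2Nat.id by lia. rewrite opp_IZR. ring. }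
  destruct HZ as [n Hn]. exists (z - IZR m)%C. split; [rewrite im_minus, im_RtoC; ring|]. split.
  - rewrite re_minus, re_RtoC. apply Rabs_le. lra.
  - destruct Hn as [-> | ->].
    + rewrite <- (F_periodic_int a _ n). f_equal. ring.
    + rewrite RtoC_opp. replace (z - - INR n)%C with (z + INR n)%C by ring. apply F_periodic_int.
Qed.

Lemma im_inv z : in_H z -> Im (- / z) = Im z / Cmod z ^ 2.
Proof.
  intros Hz. rewrite Cmod2_alt. unfold in_H in Hz. destruct z as [x y]. simpl in *. field. nra.
Qed.

(* |f|^2 / Im^m is invariant and bounded high up, and inverting raises points with |Re| <= 1/2 and Im < 4/5 by a definite factor. *)
Lemma neg_weight_zero a m : PSc a -> (1 <= m)%nat ->
  (forall z, in_H z -> (z ^ m * F a (- / z))%C = F a z) -> forall n, a n = RtoC 0.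
Proof.
  intros Ha Hm HS. pose proof PI_RGT_0 as HPI.
  set (r := exp (- (2 * PI * (4 / 5)))).
  assert (Hr : 0 <= r < 1) by (unfold r; split; [apply Rlt_le, exp_pos | rewrite <- exp_0; apply exp_increasing; lra]).
  set (M := Series (fun n => Cmod (a n) * r ^ n)). set (B := M ^ 2 / (4 / 5) ^ m).
  assert (H45 : 0 < (4 / 5) ^ m) by (apply pow_lt; lra).
  assert (HB : 0 <= B) by (unfold B; apply Rmult_le_pos; [apply pow2_ge_0 | left; now apply Rinv_0_lt_compat]).
  assert (Hmain : forall j z, in_H z -> (4 / 5) * (9 / 10) ^ j <= Im z -> Cmod (F a z) ^ 2 <= B * Im z ^ m).
  { assert (Hhigh : forall z, 4 / 5 <= Im z -> Cmod (F a z) ^ 2 <= B * Im z ^ m).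
    { intros z Hy. assert (HM : Cmod (F a z) <= M).
      { apply Ev_bound; [exact Ha|]. split; [|apply Hr]. rewrite Cmod_qpar. apply exp_mono. nra. }
      apply Rle_trans with (M ^ 2); [apply pow_incr; split; [apply Cmod_ge_0 | exact HM]|].
      assert ((4 / 5) ^ m <= Im z ^ m) by (apply pow_incr; lra).
      apply Rle_trans with (B * (4 / 5) ^ m); [right; unfold B; field; lra | now apply Rmult_le_compat_l]. }
    induction j as [|j IH]; intros z0 Hz0 Hy0; [apply Hhigh; simpl in Hy0; lra|].
    destruct (translate_strip a z0) as (z & Ei & Hx & EF). rewrite <- EF, <- Ei. rewrite <- Ei in Hy0.
    assert (Hz : in_H z) by (unfold in_H in *; lra).
    destruct (Rle_or_lt (4 / 5) (Im z)) as [Hy|Hy]; [now apply Hhigh|].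
    pose proof (in_H_inv z Hz) as Hi. pose proof (in_H_neq0 z Hz) as N. pose proof (proj1 (Cmod_gt_0 z) N) as HN.
    (* 1/4 + 16/25 = 0.89, so inversion multiplies the height by at least 10/9. *)
    assert (Hz2 : Cmod z ^ 2 <= 9 / 10).
    { rewrite Cmod2_alt. apply Rabs_le_between in Hx. unfold in_H in Hz. nra. }
    assert (HI : (4 / 5) * (9 / 10) ^ j <= Im (- / z)).
    { rewrite im_inv by exact Hz. apply (Rmult_le_reg_r (Cmod z ^ 2)); [nra|].
      replace (Im z / Cmod z ^ 2 * Cmod z ^ 2) with (Im z) by (field; nra).
      apply Rle_trans with (4 / 5 * (9 / 10) ^ j * (9 / 10)); [|simpl in Hy0; lra].
      apply Rmult_le_compat_l; [apply Rmult_le_pos; [lra | apply pow_le; lra] | exact Hz2]. }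
    specialize (IH (- / z)%C Hi HI). rewrite <- (HS z Hz), Cmod_mult, Cmod_pow, Rpow_mult_distr.
    rewrite im_inv in IH by exact Hz.
    apply Rle_trans with ((Cmod z ^ m) ^ 2 * (B * (Im z / Cmod z ^ 2) ^ m)).
    - apply Rmult_le_compat_l; [apply pow2_ge_0 | exact IH].
    - right. unfold Rdiv. rewrite Rpow_mult_distr, pow_inv, <- !pow_mult, (Nat.mul_comm m 2).
      field. apply pow_nonzero. lra. }
  apply (small_form_zero a B Ha HB). intros z Hz Hz1.
  assert (Hl : is_lim_seq (fun j => (9 / 10) ^ j) 0) by (apply is_lim_seq_geom; rewrite Rabs_pos_eq; lra).
  apply is_lim_seq_spec in Hl. destruct (Hl (mkposreal _ Hz)) as [N HN]. specialize (HN N (Nat.le_refl N)). simpl in HN.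
  rewrite Rminus_0_r in HN. apply Rabs_def2 in HN. unfold in_H in Hz.
  eapply Rle_trans; [apply (Hmain N z Hz); lra|]. apply Rmult_le_compat_l; [exact HB|].
  rewrite <- (pow_1 (Im z)) at 2. apply pow_dec; [lra | exact Hm].
Qed.

Fixpoint cpw (a : nat -> C) (n : nat) : nat -> C :=
  match n with O => pone | S m => conv a (cpw a m) end.
Lemma PSc_cpw a n : PSc a -> PSc (cpw a n).
Proof. intros Ha. induction n as [|n IH]; [apply PSc_one | now apply PSc_conv]. Qed.
Lemma F_conv a b z : PSc a -> PSc b -> in_H z -> F (conv a b) z = (F a z * F b z)%C.
Proof. intros Ha Hb Hz. apply Ev_conv; [exact Ha | exact Hb | now apply qpar_lt1]. Qed.
Lemma F_cpw a n z : PSc a -> in_H z -> F (cpw a n) z = (F a z ^ n)%C.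
Proof.
  intros Ha Hz. induction n as [|n IH]; [apply Ev_one|].
  simpl. rewrite F_conv, IH by (exact Hz || exact Ha || now apply PSc_cpw). reflexivity.
Qed.

Lemma PSc_ieta : PSc ieta. Proof. apply PSc_pexp. Qed.
Lemma PSc_eta : PSc eta. Proof. apply PSc_pexp. Qed.

(** Division by Delta^n on coefficients: shift by n, then multiply by the n-th power of [ieta]. *)
Lemma div_Delta a n z : PSc a -> in_H z -> (forall k, (k < n)%nat -> a k = RtoC 0) ->
  F a z = (Delta z ^ n * F (conv (pshn n a) (cpw ieta n)) z)%C.
Proof.
  intros Ha Hz H. rewrite F_conv, F_cpw by (exact Hz || apply PSc_ieta || (now apply PSc_pshn) || apply PSc_cpw, PSc_ieta).
  rewrite (F_pshn n a z Ha Hz H), Delta_eta, Cpow_mult_l by exact Hz.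
  transitivity (qpar z ^ n * F (pshn n a) z * (F eta z * F ieta z) ^ n)%C.
  - rewrite eta_ieta, Cpow_1_l by exact Hz. ring.
  - rewrite Cpow_mult_l. ring.
Qed.

Lemma F_Eis2_i : F (Eis 2) Ci <> RtoC 0.
Proof.
  assert (Hi : in_H Ci) by (unfold in_H; simpl; lra). intros E.
  pose proof (qpar_lt1 Ci Hi) as Hq. unfold F in E. rewrite Ev_Eis in E by exact Hq.
  assert (Eq : qpar Ci = RtoC (exp (- (2 * PI)))).
  { unfold qpar. simpl. rewrite Rmult_0_r, cos_0, sin_0, Rmult_0_r, !Rmult_1_r. reflexivity. }
  pose proof PI_RGT_0 as HPI.
  assert (Hr : 0 <= exp (- (2 * PI)) < 1) by (split; [apply Rlt_le, exp_pos | rewrite <- exp_0; apply exp_increasing; lra]).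
  rewrite Eq in E. rewrite (proj1 (Ev_pos _ _ (pser_sig _) (PSc_sig _) Hr)) in E.
  rewrite <- RtoC_mult, <- RtoC_plus in E. apply RtoC_inj in E.
  assert (0 <= Series (fun n => Re (sig (2 * 2 - 1) n) * exp (- (2 * PI)) ^ n)).
  { apply Series_nonneg; [|apply Ev_pos; [apply pser_sig | apply PSc_sig | exact Hr]].
    intros k. apply Rmult_le_pos; [apply pser_sig | apply pow_le; lra]. }
  assert (0 <= gam 2); [|nra]. unfold gam. pose proof (zeta_ge1 (2 * 2) ltac:(lia)).
  apply Rmult_le_pos; [apply Rmult_le_pos|]; [nra | left; apply Rinv_0_lt_compat; apply INR_fact_lt_0 | left; apply Rinv_0_lt_compat; lra].
Qed.

Lemma Ci_inv : (- / Ci)%C = Ci.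
Proof.
  assert (Ni : Ci <> RtoC 0) by (intros E; apply (f_equal Im) in E; simpl in E; lra).
  apply (Cmult_cancel_l Ci); [exact Ni|]. replace (Ci * - / Ci)%C with (- (1))%C by (field; exact Ni).
  apply C_ext; simpl; ring.
Qed.

(** f^2 - a_0^2 E4 vanishes at the cusp, and divided by Delta it has weight -8, hence is 0.
    Inversion at the fixed point i gives f(i) = -f(i), so E4(i) <> 0 forces a_0 = 0, and then f^2 =
    0. *)
Lemma weight2_zero a : PSc a -> (forall z, in_H z -> F a (- / z) = (z ^ 2 * F a z)%C) -> forall n, a n = RtoC 0.
Proof.
  intros Ha HS. set (c := (a O * a O)%C).
  set (b := padd (conv a a) (pscal (- c) (Eis 2))).
  assert (Hb : PSc b) by (apply PSc_add; [now apply PSc_conv | apply PSc_scal, PSc_Eis]).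
  assert (Fb : forall z, in_H z -> F b z = (F a z * F a z - c * F (Eis 2) z)%C).
  { intros z Hz. pose proof (qpar_lt1 z Hz). unfold b, F.
    rewrite Ev_add, Ev_scal, Ev_conv by (try apply PSc_scal; try apply PSc_Eis; try apply PSc_conv; assumption). ring. }
  assert (Hb0 : forall k, (k < 1)%nat -> b k = RtoC 0).
  { intros k Hk. replace k with O by lia. unfold b, padd, pscal, conv, c. simpl. ring. }
  set (d := conv (pshn 1 b) (cpw ieta 1)).
  assert (Hd : PSc d) by (apply PSc_conv; [now apply PSc_pshn | apply PSc_cpw, PSc_ieta]).
  assert (Fd : forall z, in_H z -> F b z = (Delta z * F d z)%C).
  { intros z Hz. rewrite (div_Delta b 1 z Hb Hz Hb0). fold d. ring. }
  assert (Hd0 : forall n, d n = RtoC 0).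
  { apply (neg_weight_zero d 8 Hd); [lia|]. intros z Hz. pose proof (in_H_inv z Hz) as Hi. pose proof (in_H_neq0 z Hz) as N.
    apply (Cmult_cancel_l (z ^ 4 * Delta z)); [apply Cmult_neq_0; [now apply Cpow_nz | apply Delta_neq0]|].
    transitivity (F b (- / z)).
    - rewrite (Fd _ Hi), Delta_S by exact Hz. ring.
    - rewrite Fb, HS, (Eis_S 2 z) by (exact Hi || exact Hz || lia).
      transitivity (z ^ 4 * (Delta z * F d z))%C; [|ring]. rewrite <- Fd, Fb by exact Hz. simpl. ring. }
  assert (Fa : forall z, in_H z -> (F a z * F a z)%C = (c * F (Eis 2) z)%C).
  { intros z Hz. apply Ceq_minus. rewrite <- Fb, Fd by exact Hz. unfold F at 1.
    unfold Ev. rewrite CSer_zero; [ring|]. intros n. rewrite Hd0. ring. }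
  assert (Hi : in_H Ci) by (unfold in_H; simpl; lra).
  assert (F0 : F a Ci = RtoC 0).
  { pose proof (HS Ci Hi) as E. rewrite Ci_inv in E.
    replace (Ci ^ 2)%C with (RtoC (-1)) in E by (apply C_ext; simpl; ring).
    destruct (F a Ci) as [x y]. apply C_ext; [apply (f_equal Re) in E | apply (f_equal Im) in E]; simpl in *; lra. }
  assert (Hc : c = RtoC 0).
  { pose proof (Fa Ci Hi) as E. rewrite F0 in E. apply (Cmult_cancel_l (F (Eis 2) Ci)); [exact F_Eis2_i|].
    rewrite (Cmult_comm _ c), <- E. ring. }
  apply F_zero_coef; [exact Ha|]. intros z Hz. pose proof (Fa z Hz) as E. rewrite Hc, Cmult_0_l in E.
  apply Cmod_eq_0. apply (f_equal Cmod) in E. rewrite Cmod_mult, Cmod_0 in E. nra.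
Qed.

(** Division by Delta^(l + 1) leaves the weight k - 12 (l + 1), which is negative, or equal to 2 in
    the case k' = 14. *)
Lemma vanish k l a : Nat.Even k -> (k < 12 * (l + 1) \/ k = 12 * (l + 1) + 2)%nat -> PSc a ->
  (forall z, in_H z -> F a (- / z) = (z ^ k * F a z)%C) -> (forall n, (n <= l)%nat -> a n = RtoC 0) ->
  forall z, in_H z -> F a z = RtoC 0.
Proof.
  intros Hev Hk Ha HS H0. set (d := conv (pshn (l + 1) a) (cpw ieta (l + 1))).
  assert (Hd : PSc d) by (apply PSc_conv; [now apply PSc_pshn | apply PSc_cpw, PSc_ieta]).
  assert (Fd : forall z, in_H z -> F a z = (Delta z ^ (l + 1) * F d z)%C).
  { intros z Hz. apply div_Delta; [exact Ha | exact Hz |]. intros j Hj. apply H0. lia. }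
  assert (HD : forall z, in_H z -> (z ^ (12 * (l + 1)) * F d (- / z))%C = (z ^ k * F d z)%C).
  { intros z Hz. pose proof (in_H_inv z Hz) as Hi.
    apply (Cmult_cancel_l (Delta z ^ (l + 1))); [apply Cpow_nz, Delta_neq0|].
    transitivity (F a (- / z)).
    - rewrite (Fd _ Hi), Delta_S, Cpow_mult_l, Cpow_mult_r by exact Hz. ring.
    - rewrite HS, (Fd z Hz) by exact Hz. ring. }
  assert (Hd0 : forall n, d n = RtoC 0).
  { destruct Hk as [Hk | Hk].
    - apply (neg_weight_zero d (12 * (l + 1) - k) Hd); [lia|]. intros z Hz. pose proof (in_H_neq0 z Hz) as N.
      apply (Cmult_cancel_l (z ^ k)); [now apply Cpow_nz|]. rewrite <- (HD z Hz).
      rewrite Cmult_assoc, <- Cpow_add_r. do 2 f_equal. lia.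
    - apply weight2_zero; [exact Hd|]. intros z Hz. pose proof (in_H_neq0 z Hz) as N.
      apply (Cmult_cancel_l (z ^ (12 * (l + 1)))); [now apply Cpow_nz|].
      rewrite (HD z Hz), Hk, Cpow_add_r. ring. }
  intros z Hz. rewrite (Fd z Hz). unfold F, Ev. rewrite CSer_zero; [ring|]. intros n. rewrite Hd0. ring.
Qed.

Lemma eq_forms k l a b : Nat.Even k -> (k < 12 * (l + 1) \/ k = 12 * (l + 1) + 2)%nat -> PSc a -> PSc b ->
  (forall z, in_H z -> F a (- / z) = (z ^ k * F a z)%C) ->
  (forall z, in_H z -> F b (- / z) = (z ^ k * F b z)%C) ->
  (forall n, (n <= l)%nat -> a n = b n) -> forall z, in_H z -> F a z = F b z.
Proof.
  intros Hev Hk Ha Hb HSa HSb H0. set (d := padd a (pscal (RtoC (-1)) b)).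
  assert (Hd : PSc d) by (apply PSc_add; [exact Ha | now apply PSc_scal]).
  assert (Fd : forall z, in_H z -> F d z = (F a z - F b z)%C).
  { intros z Hz. pose proof (qpar_lt1 z Hz). unfold d, F. rewrite Ev_add, Ev_scal by (try apply PSc_scal; assumption).
    replace (RtoC (-1)) with (- (1))%C by (rewrite <- RtoC_opp; reflexivity). ring. }
  intros z Hz. apply Ceq_minus. rewrite <- Fd by exact Hz. apply (vanish k l d Hev Hk Hd); [| |exact Hz].
  - intros x Hx. rewrite !Fd, HSa, HSb by (exact Hx || now apply in_H_inv). ring.
  - intros n Hn. unfold d, padd, pscal. rewrite H0 by exact Hn.
    replace (RtoC (-1)) with (- (1))%C by (rewrite <- RtoC_opp; reflexivity). ring.
Qed.

Lemma eq_coef a b : PSc a -> PSc b -> (forall z, in_H z -> F a z = F b z) -> forall n, a n = b n.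
Proof.
  intros Ha Hb H n. apply Ceq_minus.
  assert (H0 : padd a (pscal (RtoC (-1)) b) n = RtoC 0).
  { apply F_zero_coef; [apply PSc_add; [exact Ha | now apply PSc_scal]|]. intros z Hz. pose proof (qpar_lt1 z Hz). unfold F.
    rewrite Ev_add, Ev_scal by (try apply PSc_scal; assumption). fold (F a z) (F b z). rewrite H by exact Hz.
    replace (RtoC (-1)) with (- (1))%C by (rewrite <- RtoC_opp; reflexivity). ring. }
  rewrite <- H0. unfold padd, pscal. replace (RtoC (-1)) with (- (1))%C by (rewrite <- RtoC_opp; reflexivity). ring.
Qed.

Lemma sig_1 s : sig s 1 = RtoC 1.
Proof. unfold sig. simpl. rewrite pow1. ring. Qed.

(** [E4] and [Eis 2] share weight 4 and constant term 1, hence coincide. The coefficient of q,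
    computable from the definition of [E4], then gives [gam 2] = 240 without evaluating zeta(4). *)
Lemma E4_coef n : (1 <= n)%nat -> E4 n = (240 * sig 3 n)%C.
Proof.
  assert (H : forall n, E4 n = Eis 2 n).
  { apply eq_coef; [apply PSc_E4 | apply PSc_Eis|].
    apply (eq_forms 4 0); [now exists 2%nat | lia | apply PSc_E4 | apply PSc_Eis | exact E4_S | intros; now apply (Eis_S 2)|].
    intros k Hk. replace k with O by lia. unfold E4, padd, pscal, conv, D. simpl. ring. }
  assert (HE1 : E4 1 = RtoC 240).
  { unfold E4, padd, pscal, conv, D. cbn [csum]. replace (1 - 1)%nat with O by lia. replace (1 - 0)%nat with 1%nat by lia.
    unfold E2. rewrite sig_1. apply C_ext; simpl; ring. }
  pose proof (H 1%nat) as H1. rewrite HE1 in H1. unfold Eis in H1. rewrite sig_1, Cmult_1_r in H1.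
  intros Hn. rewrite H. destruct n as [|n]; [lia|]. unfold Eis. rewrite <- H1. reflexivity.
Qed.

Lemma E6_coef n : (1 <= n)%nat -> E6 n = (RtoC (-504) * sig 5 n)%C.
Proof.
  assert (H : forall n, E6 n = Eis 3 n).
  { apply eq_coef; [apply PSc_E6 | apply PSc_Eis|].
    apply (eq_forms 6 0); [now exists 3%nat | lia | apply PSc_E6 | apply PSc_Eis | exact E6_S | intros; apply (Eis_S 3); [lia | assumption]|].
    intros k Hk. replace k with O by lia. unfold E6, E4, padd, pscal, conv, D. simpl. ring. }
  assert (HE1 : E6 1 = RtoC (-504)).
  { unfold E6, padd, pscal, D, conv. cbn [csum]. replace (1 - 1)%nat with O by lia. replace (1 - 0)%nat with 1%nat by lia.
    rewrite E4_coef by lia. unfold E4, padd, pscal, D, conv, E2. cbn [csum]. rewrite !sig_1. apply C_ext; simpl; ring. }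
  pose proof (H 1%nat) as H1. rewrite HE1 in H1. unfold Eis in H1. rewrite sig_1, Cmult_1_r in H1.
  intros Hn. rewrite H. destruct n as [|n]; [lia|]. unfold Eis. rewrite <- H1. reflexivity.
Qed.

(** * Expansion in powers of the discriminant *)

(** The quotient (a - a_0) / Delta: the tail of [a] divided by q, times q / Delta = [ieta]. *)
Definition next (a : nat -> C) : nat -> C := conv (psh a) ieta.
(** The remainder after n steps of expanding q / Delta as a sum of d_m Delta^m B_m; each step
    removes the constant term with the next B. *)
Fixpoint res (B : nat -> nat -> C) (n : nat) : nat -> C :=
  match n with
  | O => ieta
  | S m => next (padd (res B m) (pscal (- res B m O) (B m)))
  end.
Definition dcf (B : nat -> nat -> C) (n : nat) : C := res B n O.

Lemma PSc_next a : PSc a -> PSc (next a).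
Proof. intros Ha. apply PSc_conv; [now apply PSc_psh | apply PSc_ieta]. Qed.

Lemma F_next a z : PSc a -> in_H z -> F a z = (a O + Delta z * F (next a) z)%C.
Proof.
  intros Ha Hz. unfold next. rewrite F_conv by (exact Hz || apply PSc_ieta || now apply PSc_psh).
  unfold F at 1. rewrite Ev_psh by (exact Ha || now apply qpar_lt1). fold (F (psh a) z). rewrite Delta_eta by exact Hz.
  transitivity (a O + qpar z * F (psh a) z * (F eta z * F ieta z))%C; [rewrite eta_ieta by exact Hz|]; ring.
Qed.

Lemma PSc_res B n : (forall m, PSc (B m)) -> PSc (res B n).
Proof.
  intros HB. induction n as [|n IH]; [apply PSc_ieta|].
  apply PSc_next, PSc_add; [exact IH | now apply PSc_scal].
Qed.

Lemma F_padd a b z : PSc a -> PSc b -> in_H z -> F (padd a b) z = (F a z + F b z)%C.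
Proof. intros Ha Hb Hz. apply Ev_add; [exact Ha | exact Hb | now apply qpar_lt1]. Qed.
Lemma F_pscal c a z : PSc a -> in_H z -> F (pscal c a) z = (c * F a z)%C.
Proof. intros Ha Hz. apply Ev_scal; [exact Ha | now apply qpar_lt1]. Qed.

Lemma q_expand B N z : (forall m, PSc (B m)) -> (forall m, B m O = RtoC 1) -> in_H z ->
  qpar z = (csum (fun m => dcf B m * Delta z ^ S m * F (B m) z) N + Delta z ^ S N * F (res B N) z)%C.
Proof.
  intros HB HB1 Hz. induction N as [|N IH].
  - simpl. rewrite Delta_eta by exact Hz.
    transitivity (qpar z * (F eta z * F ieta z))%C; [rewrite eta_ieta by exact Hz; ring | ring].
  - rewrite IH at 1. cbn [csum]. pose proof (PSc_res B N HB) as HR.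
    assert (HA : PSc (padd (res B N) (pscal (- res B N O) (B N)))) by (apply PSc_add; [exact HR | now apply PSc_scal]).
    pose proof (F_next _ z HA Hz) as E. rewrite F_padd, F_pscal in E by (exact Hz || exact HR || apply HB || apply PSc_scal, HB).
    replace (padd (res B N) (pscal (- res B N O) (B N)) O) with (RtoC 0) in E
      by (unfold padd, pscal; rewrite HB1; ring).
    cbn [res]. unfold dcf.
    replace (F (res B N) z) with (res B N O * F (B N) z + (F (res B N) z + - res B N O * F (B N) z))%C by ring.
    rewrite E. simpl Cpow. ring.
Qed.

Definition pX : nat -> C := fun n => match n with 1 => RtoC 1 | _ => RtoC 0 end.
Definition pup (n : nat) (a : nat -> C) : nat -> C := fun k => if (k <? n)%nat then RtoC 0 else a (k - n)%nat.

Lemma PSc_pX : PSc pX.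
Proof. apply PSc_bounded. intros [|[|n]]; simpl; rewrite ?Cmod_0, ?Cmod_1; lra. Qed.
Lemma F_pX z : F pX z = qpar z.
Proof.
  unfold F, Ev. rewrite (CSer_finite _ 2); [simpl; ring|].
  intros [|[|n]] Hn; [lia | lia | simpl; ring].
Qed.
Lemma PSc_pup n a : PSc a -> PSc (pup n a).
Proof.
  intros Ha r Hr. destruct (Ha r Hr) as [A HA]. exists A. intros k. unfold pup.
  assert (HA0 : 0 <= A) by (specialize (HA O); pose proof (Cmod_ge_0 (a O)); simpl in HA; lra).
  destruct (Nat.ltb_spec k n); [rewrite Cmod_0; lra|].
  eapply Rle_trans; [|apply (HA (k - n)%nat)]. apply Rmult_le_compat_l; [apply Cmod_ge_0|].
  apply pow_dec; [lra | lia].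
Qed.
Lemma F_pup n a z : PSc a -> in_H z -> F (pup n a) z = (qpar z ^ n * F a z)%C.
Proof.
  intros Ha Hz. rewrite (F_pshn n (pup n a) z (PSc_pup n a Ha) Hz).
  - f_equal. apply Ev_ext. intros k. unfold pshn, pup. destruct (Nat.ltb_spec (n + k) n); [lia|]. f_equal. lia.
  - intros k Hk. unfold pup. destruct (Nat.ltb_spec k n); [reflexivity | lia].
Qed.

Lemma csum_mult_l c u n : (c * csum u n)%C = csum (fun k => c * u k)%C n.
Proof. symmetry. apply csum_scal. Qed.

(* The Miller form q + O(q^(l+1)) in terms of any forms B_m = 1 + O(q) of weight k - 12(m+1). *)
Lemma miller_expand B k l a : Nat.Even k -> (k < 12 * (l + 1) \/ k = 12 * (l + 1) + 2)%nat -> (12 * l <= k)%nat -> (1 <= l)%nat ->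
  (forall m, PSc (B m)) -> (forall m, B m O = RtoC 1) ->
  (forall m z, (m < l)%nat -> in_H z -> F (B m) (- / z) = (z ^ (k - 12 * S m) * F (B m) z)%C) ->
  PSc a -> (forall z, in_H z -> F a (- / z) = (z ^ k * F a z)%C) ->
  a O = RtoC 0 -> a 1%nat = RtoC 1 -> (forall n, (2 <= n <= l)%nat -> a n = RtoC 0) ->
  forall z, in_H z -> F a z = csum (fun m => dcf B m * Delta z ^ S m * F (B m) z)%C l.
Proof.
  intros Hev Hk Hkl Hl HB HB1 HBS Ha HaS H0 H1 Hn.
  pose proof (PSc_res B l HB) as HR.
  assert (HC : PSc (conv (cpw eta (S l)) (res B l))) by (apply PSc_conv; [apply PSc_cpw, PSc_eta | exact HR]).
  (* The truncated expansion, rewritten as q minus a multiple of q^(l + 1): its coefficients up to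
     index l are then visible. *)
  set (b := padd pX (pscal (RtoC (-1)) (pup (S l) (conv (cpw eta (S l)) (res B l))))).
  assert (Hb : PSc b) by (apply PSc_add; [apply PSc_pX | now apply PSc_scal, PSc_pup]).
  assert (Fb : forall z, in_H z -> F b z = csum (fun m => dcf B m * Delta z ^ S m * F (B m) z)%C l).
  { intros z Hz. unfold b.
    rewrite F_padd, F_pscal, F_pX, F_pup, F_conv, F_cpw
      by (exact Hz || exact HC || exact HR || apply PSc_pX || apply PSc_eta || (apply PSc_cpw, PSc_eta) || (try apply PSc_scal; now apply PSc_pup)).
    rewrite (q_expand B l z HB HB1 Hz) at 1. rewrite Delta_eta, Cpow_mult_l by exact Hz.
    replace (RtoC (-1)) with (- (1))%C by (rewrite <- RtoC_opp; reflexivity). ring. }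
  intros z Hz. rewrite <- Fb by exact Hz. apply (eq_forms k l a b Hev Hk Ha Hb HaS); [| |exact Hz].
  - intros x Hx. rewrite !Fb by (exact Hx || now apply in_H_inv). rewrite csum_mult_l. apply csum_ext. intros m Hm.
    rewrite HBS, Delta_S, Cpow_mult_l, <- Cpow_mult_r by assumption.
    replace (x ^ k)%C with (x ^ (12 * S m) * x ^ (k - 12 * S m))%C by (rewrite <- Cpow_add_r; f_equal; lia). ring.
  - intros n Hnl. unfold b, padd, pscal, pup. destruct (Nat.ltb_spec n (S l)); [|lia].
    destruct n as [|[|n]]; unfold pX; [rewrite H0; ring | rewrite H1; ring | rewrite Hn by lia; ring].
Qed.

(** * Size of the coefficients *)

(** The coefficient of Delta^j when the series [a] is expanded in powers of Delta. *)
Definition tj (j : nat) (a : nat -> C) : C := Nat.iter j next a O.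

Lemma conv_lin_l c a b e n : conv (padd a (pscal c b)) e n = (conv a e n + c * conv b e n)%C.
Proof.
  unfold conv. rewrite csum_mult_l, <- csum_plus. apply csum_ext. intros k _. unfold padd, pscal. ring.
Qed.
Lemma next_lin c a b n : next (padd a (pscal c b)) n = (next a n + c * next b n)%C.
Proof. exact (conv_lin_l c (psh a) (psh b) ieta n). Qed.
Lemma next_ext a b : (forall n, a n = b n) -> forall n, next a n = next b n.
Proof. intros H n. unfold next, conv. apply csum_ext. intros k _. unfold psh. now rewrite H. Qed.
Lemma iter_next_ext j : forall a b, (forall n, a n = b n) -> forall n, Nat.iter j next a n = Nat.iter j next b n.
Proof. induction j as [|j IH]; intros a b H n; [apply H|]. simpl. apply next_ext. now apply IH. Qed.
Lemma iter_next_lin j c a b n :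
  Nat.iter j next (padd a (pscal c b)) n = (Nat.iter j next a n + c * Nat.iter j next b n)%C.
Proof.
  revert n. induction j as [|j IH]; intros n; [reflexivity|].
  simpl. rewrite (next_ext _ (padd (Nat.iter j next a) (pscal c (Nat.iter j next b)))) by exact IH. apply next_lin.
Qed.

Lemma iter_S_r j (a : nat -> C) : Nat.iter (S j) next a = Nat.iter j next (next a).
Proof. induction j as [|j IH]; [reflexivity|]. simpl in *. now rewrite IH. Qed.

Lemma res_expand B j n :
  Nat.iter j next (res B n) O = (tj (n + j) ieta - csum (fun i => dcf B i * tj (n - i + j) (B i)) n)%C.
Proof.
  revert j. induction n as [|n IH]; intros j; [simpl; unfold tj; ring|].
  cbn [res]. rewrite <- iter_S_r, iter_next_lin, IH. fold (dcf B n). fold (tj (S j) (B n)).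
  replace (n + S j)%nat with (S n + j)%nat by lia. cbn [csum].
  replace (S n - n + j)%nat with (S j) by lia.
  rewrite (csum_ext (fun i => dcf B i * tj (n - i + S j) (B i))%C (fun i => dcf B i * tj (S n - i + j) (B i))%C);
    [ring|].
  intros i Hi. do 2 f_equal. lia.
Qed.

(** Comparison of the coefficients of Delta^n in q / Delta = sum of d_i Delta^i B_i, solved for the
    last one. *)
Lemma dcf_rec B n : dcf B n = (tj n ieta - csum (fun i => dcf B i * tj (n - i) (B i)) n)%C.
Proof.
  pose proof (res_expand B 0 n) as E. simpl Nat.iter in E. fold (dcf B n) in E. rewrite E, Nat.add_0_r.
  f_equal. f_equal. extensionality i. now rewrite Nat.add_0_r.
Qed.

Lemma pser_next a : pser a -> pser (next a).
Proof. intros Ha. apply pser_conv; [intros n; apply Ha | exact pser_ieta]. Qed.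
Lemma pser_iter a j : pser a -> pser (Nat.iter j next a).
Proof. intros Ha. induction j as [|j IH]; [exact Ha | now apply pser_next]. Qed.
Lemma PSc_iter a j : PSc a -> PSc (Nat.iter j next a).
Proof. intros Ha. induction j as [|j IH]; [exact Ha | now apply PSc_next]. Qed.

Lemma in_H_axis (y : R) : 0 < y -> in_H (Ci * y).
Proof. unfold in_H. simpl. lra. Qed.
Lemma qpar_axis (y : R) : qpar (Ci * y) = RtoC (exp (- (2 * PI * y))).
Proof.
  unfold qpar. simpl. replace (2 * PI * (0 * y - 1 * 0)) with 0 by ring.
  rewrite cos_0, sin_0, Rmult_0_r, Rmult_1_r. apply C_ext; simpl; [f_equal|]; ring.
Qed.
Lemma exp_neg_range y : 0 < y -> 0 <= exp (- (2 * PI * y)) < 1.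
Proof.
  intros Hy. pose proof PI_RGT_0. split; [apply Rlt_le, exp_pos|]. rewrite <- exp_0. apply exp_increasing. nra.
Qed.
Lemma F_axis_pos a (y : R) : pser a -> PSc a -> 0 < y -> exists x, 0 <= x /\ F a (Ci * y) = RtoC x.
Proof.
  intros Hp Ha Hy. unfold F. rewrite qpar_axis.
  destruct (Ev_pos a _ Hp Ha (exp_neg_range y Hy)) as [E Hex].
  exists (Series (fun n => Re (a n) * exp (- (2 * PI * y)) ^ n)). split; [|exact E].
  apply Series_nonneg; [|exact Hex]. intros k. apply Rmult_le_pos; [apply Hp | apply pow_le, exp_neg_range, Hy].
Qed.

Lemma pser_lg : pser lg.
Proof.
  intros [|n]; [simpl; lra|]. unfold lg. rewrite re_scal_r. destruct (pser_sig 1 (S n)) as [H1 H2]. pose proof (INR_S_pos n).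
  split; [rewrite im_mult, H1, im_RtoC; ring | apply Rmult_le_pos; [exact H2 | left; now apply Rinv_0_lt_compat]].
Qed.

Definition dl (y : R) : R := exp (- (2 * PI * y) - 24 * Re (F lg (Ci * y))).
Lemma Delta_axis (y : R) : 0 < y -> Delta (Ci * y) = RtoC (dl y).
Proof.
  intros Hy. unfold Delta, dl. destruct (F_axis_pos lg y pser_lg PSc_lg Hy) as (x & Hx & E). rewrite E, re_RtoC.
  replace (tpi * (Ci * y) - 24 * x)%C with (RtoC (- (2 * PI * y) - 24 * x)).
  - unfold cexp. rewrite re_RtoC, im_RtoC, cos_0, sin_0. apply C_ext; simpl; ring.
  - unfold tpi. apply C_ext; simpl; ring.
Qed.

Lemma tj_pos j a : pser a -> Im (tj j a) = 0 /\ 0 <= Re (tj j a).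
Proof. intros Ha. exact (pser_iter a j Ha O). Qed.

(** [next] preserves nonnegativity because [ieta] is nonnegative. On the imaginary axis all terms
    and remainders of the Delta-expansion are therefore nonnegative, and partial sums stay below the
    value. *)
Lemma tj_sum_le a (y : R) N : pser a -> PSc a -> 0 < y ->
  rsum (fun j => Re (tj j a) * dl y ^ j) N <= Re (F a (Ci * y)).
Proof.
  intros Hp Ha Hy. pose proof (in_H_axis y Hy) as HH.
  assert (Hd : 0 < dl y) by apply exp_pos.
  assert (E : forall N, Re (F a (Ci * y)) = rsum (fun j => Re (tj j a) * dl y ^ j) N + dl y ^ N * Re (F (Nat.iter N next a) (Ci * y))).
  { intros M. induction M as [|M IH]; [simpl; ring|].
    rewrite IH. cbn [rsum]. rewrite (F_next (Nat.iter M next a) _ (PSc_iter a M Ha) HH), Delta_axis by exact Hy.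
    fold (tj M a). rewrite re_plus, re_scal_l. simpl. ring. }
  rewrite (E N). destruct (F_axis_pos _ y (pser_iter a N Hp) (PSc_iter a N Ha) Hy) as (x & Hx & Ex). rewrite Ex, re_RtoC.
  pose proof (pow_le (dl y) N ltac:(lra)). nra.
Qed.

Lemma tj_le a (y : R) j : pser a -> PSc a -> 0 < y -> Re (tj j a) * dl y ^ j <= Re (F a (Ci * y)).
Proof.
  intros Hp Ha Hy. eapply Rle_trans; [|apply (tj_sum_le a y (S j) Hp Ha Hy)]. cbn [rsum].
  assert (Hd : 0 < dl y) by apply exp_pos.
  pose proof (rsum_nonneg (fun j => Re (tj j a) * dl y ^ j) j) as H.
  assert (0 <= rsum (fun j => Re (tj j a) * dl y ^ j) j); [|lra].
  apply H. intros k _. apply Rmult_le_pos; [apply tj_pos, Hp | apply pow_le; lra].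
Qed.

Lemma F_ieta_axis (y : R) : 0 < y -> Re (F ieta (Ci * y)) = exp (- (2 * PI * y)) / dl y.
Proof.
  intros Hy. pose proof (in_H_axis y Hy) as HH.
  pose proof (q_expand (fun _ => pone) 0 (Ci * y) (fun _ => PSc_one) (fun _ => eq_refl) HH) as E.
  rewrite qpar_axis in E. simpl in E. rewrite Delta_axis in E by exact Hy.
  apply (f_equal Re) in E. rewrite re_RtoC, Cplus_0_l, Cmult_1_r, re_scal_l in E.
  assert (0 < dl y) by apply exp_pos. rewrite E. field. lra.
Qed.

(** For j >= 1 the constant 1 contributes nothing, and the rest is [gam t] times a nonnegative
    series, each of whose terms is at most its value at 2 i. The product is bounded by |E(2 i) -
    1|. *)
Lemma tj_Eis_bound t j : (2 <= t)%nat -> (1 <= j)%nat -> Cmod (tj j (Eis t)) * dl 2 ^ j <= 9 / 4 ^ t.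
Proof.
  intros Ht Hj.
  assert (E : tj j (Eis t) = (gam t * tj j (sig (2 * t - 1)))%C).
  { unfold tj. rewrite (iter_next_ext j _ _ (Eis_split t)), iter_next_lin.
    destruct j as [|j]; [lia|]. rewrite iter_S_r.
    assert (Hz : forall i n, Nat.iter i next (next pone) n = RtoC 0).
    { induction i as [|i IH]; intros n; simpl.
      - unfold next, conv. apply csum_zero. intros k _. unfold psh, pone. ring.
      - unfold next at 1, conv. apply csum_zero. intros k _. unfold psh. rewrite IH. ring. }
    rewrite Hz. ring. }
  assert (H2 : in_H (Ci * 2)) by (apply in_H_axis; lra).
  pose proof (tj_le (sig (2 * t - 1)) 2 j (pser_sig _) (PSc_sig _) ltac:(lra)) as HT.
  destruct (tj_pos j _ (pser_sig (2 * t - 1))) as [HI HR].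
  destruct (F_axis_pos (sig (2 * t - 1)) 2 (pser_sig _) (PSc_sig _) ltac:(lra)) as (x & Hx & Ex).
  rewrite Ex, re_RtoC in HT.
  pose proof (Eis_2i t Ht) as HB. replace (2 * Ci)%C with (Ci * 2)%C in HB by ring. unfold F in HB.
  rewrite Ev_Eis in HB by now apply qpar_lt1. fold (F (sig (2 * t - 1)) (Ci * 2)) in HB. rewrite Ex in HB.
  replace (1 + gam t * x - 1)%C with (gam t * x)%C in HB by ring. rewrite Cmod_mult, (Cmod_Rp x Hx) in HB.
  rewrite E, Cmod_mult, (C_real _ HI), (Cmod_Rp _ HR), Rmult_assoc.
  eapply Rle_trans; [|exact HB]. apply Rmult_le_compat_l; [apply Cmod_ge_0 | exact HT].
Qed.

(** * Numerical bounds *)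

Lemma PI_lo : 3.14 < PI.
Proof.
  destruct (PI_2_3_7_ineq 2) as [H _]. unfold PI_2_3_7_tg, Ratan_seq, tg_alt in H. simpl in H. lra.
Qed.
Lemma PI_hi : PI < 3.142.
Proof.
  destruct (PI_2_3_7_ineq 2) as [_ H]. unfold PI_2_3_7_tg, Ratan_seq, tg_alt in H. simpl in H. lra.
Qed.

Lemma mvt_nonneg (f f' : R -> R) : (forall t, 0 <= t -> is_derive f t (f' t)) -> f 0 = 0 ->
  (forall t, 0 <= t -> 0 <= f' t) -> forall t, 0 <= t -> 0 <= f t.
Proof.
  intros Hd H0 Hf t Ht. destruct (MVT_gen f 0 t f') as (c & Hc & E).
  - intros x Hx. rewrite Rmin_left in Hx by lra. apply Hd. lra.
  - intros x Hx. rewrite Rmin_left in Hx by lra. apply derivable_continuous_pt. exists (f' x). apply is_derive_Reals, Hd. lra.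
  - rewrite Rmin_left in Hc by lra. rewrite H0, !Rminus_0_r in E. rewrite E. apply Rmult_le_pos; [apply Hf|]; lra.
Qed.

Lemma exp_lo3 t : 0 <= t -> 1 + t + t ^ 2 / 2 + t ^ 3 / 6 <= exp t.
Proof.
  intros Ht. assert (0 <= exp t - 1 - t - t ^ 2 / 2 - t ^ 3 / 6); [|lra]. revert t Ht.
  apply (mvt_nonneg _ (fun t => exp t - 1 - t - t ^ 2 / 2)).
  - intros t _. auto_derive; [trivial | field].
  - rewrite exp_0. field.
  - apply (mvt_nonneg _ (fun t => exp t - 1 - t)).
    + intros t _. auto_derive; [trivial | field].
    + rewrite exp_0. field.
    + intros t _. pose proof (exp_ineq1_le t). lra.
Qed.
Lemma exp_neg_lo3 t : 0 <= t -> 1 - t + t ^ 2 / 2 - t ^ 3 / 6 <= exp (- t).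
Proof.
  intros Ht. assert (0 <= exp (- t) - 1 + t - t ^ 2 / 2 + t ^ 3 / 6); [|lra]. revert t Ht.
  apply (mvt_nonneg _ (fun t => - exp (- t) + 1 - t + t ^ 2 / 2)).
  - intros t _. auto_derive; [trivial | field].
  - rewrite Ropp_0, exp_0. field.
  - apply (mvt_nonneg _ (fun t => exp (- t) - 1 + t)).
    + intros t _. auto_derive; [trivial | field].
    + rewrite Ropp_0, exp_0. field.
    + intros t _. pose proof (exp_ineq1_le (- t)). lra.
Qed.
Lemma exp_hi3 t : 0 <= t <= 1 -> exp t <= / (1 - t + t ^ 2 / 2 - t ^ 3 / 6).
Proof.
  intros Ht. pose proof (exp_neg_lo3 t ltac:(lra)) as H. rewrite exp_Ropp in H.
  rewrite <- (Rinv_inv (exp t)). apply Rinv_le_contravar; [nra | exact H].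
Qed.
Lemma exp1_bounds : 2.716 <= exp 1 <= 2.721.
Proof.
  replace 1 with (INR 4 * (1 / 4)) at 1 2 by (simpl; field). rewrite <- exp_pow.
  pose proof (exp_lo3 (1 / 4) ltac:(lra)) as H1. pose proof (exp_hi3 (1 / 4) ltac:(lra)) as H2.
  replace (/ (1 - 1 / 4 + (1 / 4) ^ 2 / 2 - (1 / 4) ^ 3 / 6)) with (384 / 299) in H2 by field.
  split.
  - apply Rle_trans with (1.2838 ^ 4); [lra|]. apply pow_incr. lra.
  - apply Rle_trans with ((384 / 299) ^ 4); [|lra]. apply pow_incr. split; [apply Rlt_le, exp_pos | exact H2].
Qed.
Lemma exp_lo n t : 0 <= t -> 2.716 ^ n * (1 + t + t ^ 2 / 2 + t ^ 3 / 6) <= exp (INR n + t).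
Proof.
  intros Ht. rewrite exp_plus. replace (INR n) with (INR n * 1) by ring. rewrite <- exp_pow.
  pose proof exp1_bounds. pose proof (exp_lo3 t Ht). pose proof (pow_le t 3 Ht). pose proof (pow_le t 2 Ht).
  apply Rmult_le_compat; [apply pow_le; lra | lra | apply pow_incr; lra | assumption].
Qed.
Lemma exp_hi n t : 0 <= t <= 1 -> exp (INR n + t) <= 2.721 ^ n * / (1 - t + t ^ 2 / 2 - t ^ 3 / 6).
Proof.
  intros Ht. rewrite exp_plus. replace (INR n) with (INR n * 1) by ring. rewrite <- exp_pow.
  pose proof exp1_bounds. apply Rmult_le_compat; try (apply pow_le; left; apply exp_pos) || (left; apply exp_pos).
  - apply pow_incr. split; [left; apply exp_pos | lra].
  - now apply exp_hi3.
Qed.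

Lemma exp_neg_le x b : 0 < b -> b <= exp x -> exp (- x) <= / b.
Proof. intros Hb H. rewrite exp_Ropp. now apply Rinv_le_contravar. Qed.

(** The modulus of q at height y. *)
Definition rq (y : R) : R := exp (- (2 * PI * y)).

Lemma rq_range y : 0 < y -> 0 < rq y < 1.
Proof. intros Hy. pose proof (exp_neg_range y Hy). split; [apply exp_pos | apply H]. Qed.
Lemma rq_mono x y : x <= y -> rq y <= rq x.
Proof. intros H. apply exp_mono. pose proof PI_RGT_0. nra. Qed.

Lemma rq_82 : 0.0057 <= rq 0.82 <= 0.00583.
Proof.
  unfold rq. pose proof PI_lo. pose proof PI_hi. split.
  - apply Rle_trans with (exp (- (INR 5 + 0.153))); [|apply exp_mono; simpl; lra].
    rewrite exp_Ropp. pose proof (exp_hi 5 0.153 ltac:(lra)) as HH.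
    apply Rle_trans with (/ (2.721 ^ 5 * / (1 - 0.153 + 0.153 ^ 2 / 2 - 0.153 ^ 3 / 6))); [lra|].
    apply Rinv_le_contravar; [apply exp_pos | exact HH].
  - apply Rle_trans with (exp (- (INR 5 + 0.149))); [apply exp_mono; simpl; lra|].
    eapply Rle_trans; [apply exp_neg_le; [|apply (exp_lo 5 0.149); lra]; lra|]. lra.
Qed.
Lemma rq_866 : rq 0.866 <= 0.00438.
Proof.
  unfold rq. pose proof PI_lo.
  apply Rle_trans with (exp (- (INR 5 + 0.438))); [apply exp_mono; simpl; lra|].
  eapply Rle_trans; [apply exp_neg_le; [|apply (exp_lo 5 0.438); lra]; lra|]. lra.
Qed.
Lemma rq_66 : rq 0.66 <= 0.016.
Proof.
  unfold rq. pose proof PI_lo.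
  apply Rle_trans with (exp (- (INR 4 + 0.144))); [apply exp_mono; simpl; lra|].
  eapply Rle_trans; [apply exp_neg_le; [|apply (exp_lo 4 0.144); lra]; lra|]. lra.
Qed.

Lemma F_pows1 z : in_H z -> F (pows 1) z = (qpar z / ((1 - qpar z) * (1 - qpar z)))%C.
Proof.
  intros Hz. pose proof (L2_eq z Hz) as E. pose proof (lipschitz 0 z Hz) as E2. simpl in E2.
  rewrite E in E2. unfold R2 in E2. pose proof (qpar_neq1 z Hz) as N. pose proof tpi_neq0 as Nt.
  apply (Cmult_cancel_l (tpi * tpi)); [now apply Cmult_neq_0|].
  transitivity (- tpi * (- tpi * 1) / 1 * F (pows 1) z)%C; [field|]. rewrite <- E2. field. exact N.
Qed.

(** The coefficient sigma_1(n) / n of [lg] is at most n, and the sum of n r^n is r / (1 - r)^2. *)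
Lemma lg_bound z y : 0 < y -> y <= Im z -> Cmod (F lg z) <= rq y / (1 - rq y) ^ 2.
Proof.
  intros Hy Hz. pose proof (rq_range y Hy) as Hr.
  assert (E : rq y / (1 - rq y) ^ 2 = Series (fun n => Re (pows 1 n) * rq y ^ n)).
  { assert (Hp : pser (pows 1)) by (intros [|n]; simpl; [lra | rewrite Rmult_1_r; split; [reflexivity | apply (pos_INR (S n))]]).
    pose proof (proj1 (Ev_pos _ (rq y) Hp (PSc_pows 1) ltac:(lra))) as E. unfold rq in E at 1. rewrite <- qpar_axis in E.
    fold (F (pows 1) (Ci * y)) in E. rewrite F_pows1, qpar_axis in E by now apply in_H_axis. fold (rq y) in E.
    apply RtoC_inj. rewrite <- E. rewrite RtoC_div, RtoC_pow, RtoC_minus by (apply pow_nonzero; lra).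
    simpl. rewrite Cmult_1_r. reflexivity. }
  rewrite E.
  assert (Hex : ex_series (fun n => Re (pows 1 n) * rq y ^ n)).
  { apply Ev_pos; [|apply PSc_pows | lra].
    intros [|n]; simpl; [lra | rewrite Rmult_1_r; split; [reflexivity | apply (pos_INR (S n))]]. }
  apply CSer_bound; [|exact Hex]. intros n. rewrite Cmod_mult, Cmod_pow.
  apply Rmult_le_compat; [apply Cmod_ge_0 | apply pow_le, Cmod_ge_0 | |].
  - destruct n as [|n]; [simpl; rewrite Cmod_0; lra|]. unfold lg.
    pose proof (Cmod_sig 1 (S n)) as Hs. pose proof (INR_S_pos n) as Hn.
    rewrite Cmod_mult, (Cmod_Rp (/ INR (S n))) by (left; now apply Rinv_0_lt_compat).
    unfold pows in *. rewrite pow_1 in *. rewrite (Cmod_Rp (INR (S n))) in Hs by lra. rewrite re_RtoC.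
    apply (Rmult_le_reg_r (INR (S n))); [exact Hn|]. rewrite Rmult_assoc, Rinv_l, Rmult_1_r by lra. exact Hs.
  - apply pow_incr. split; [apply Cmod_ge_0|]. rewrite Cmod_qpar. now apply rq_mono.
Qed.

Definition La (y : R) : R := Re (F lg (Ci * y)).
Lemma La_hi y b : 0 < y -> rq y <= b < 1 -> 0 <= La y <= b / (1 - b) ^ 2.
Proof.
  intros Hy Hb. unfold La. destruct (F_axis_pos lg y pser_lg PSc_lg Hy) as (x & Hx & E).
  pose proof (lg_bound (Ci * y) y Hy) as H. rewrite E, (Cmod_Rp x Hx) in H. rewrite E, re_RtoC. split; [exact Hx|].
  eapply Rle_trans; [apply H; simpl; lra|]. pose proof (rq_range y Hy). unfold Rdiv.
  apply Rmult_le_compat; [lra | left; apply Rinv_0_lt_compat, pow_lt; lra | lra|].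
  apply Rinv_le_contravar; [apply pow_lt; lra | apply pow_incr; lra].
Qed.
Lemma La_lo y : 0 < y -> rq y <= La y.
Proof.
  intros Hy. unfold La, F. rewrite qpar_axis. fold (rq y). pose proof (rq_range y Hy).
  destruct (Ev_pos lg (rq y) pser_lg PSc_lg ltac:(lra)) as [-> Hex]. rewrite re_RtoC.
  eapply Rle_trans; [|apply (rsum_le_Series _ 2); [|exact Hex]].
  - cbn [rsum pow]. replace (Re (lg 1)) with 1 by (unfold lg; rewrite sig_1; simpl; field).
    replace (Re (lg 0)) with 0 by reflexivity. lra.
  - intros k. apply Rmult_le_pos; [apply pser_lg | apply pow_le; lra].
Qed.
Lemma dl_eq y : dl y = exp (- (2 * PI * y) - 24 * La y).
Proof. reflexivity. Qed.

Lemma La_82 : 0.0057 <= La 0.82 <= 0.0059.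
Proof.
  pose proof rq_82. pose proof (La_lo 0.82 ltac:(lra)). pose proof (La_hi 0.82 0.00583 ltac:(lra) ltac:(lra)). split; [lra|].
  eapply Rle_trans; [apply H1|]. lra.
Qed.
Lemma La_66 : 0 <= La 0.66 <= 0.01653.
Proof.
  pose proof rq_66. pose proof (La_hi 0.66 0.016 ltac:(lra) ltac:(lra)). split; [lra|].
  eapply Rle_trans; [apply H0|]. lra.
Qed.
Lemma La_2 : 0 <= La 2 <= 0.0001.
Proof.
  assert (H : rq 2 <= 0.00004).
  { unfold rq. pose proof PI_lo. apply Rle_trans with (exp (- (INR 12 + 0))); [apply exp_mono; simpl; lra|].
    eapply Rle_trans; [apply exp_neg_le; [|apply (exp_lo 12 0); lra]; lra|]. lra. }
  pose proof (La_hi 2 0.00004 ltac:(lra) ltac:(lra)). split; [lra|]. eapply Rle_trans; [apply H0|]. lra.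
Qed.

(** A bound for |Delta| on the arc, realised as a value on the imaginary axis so that the positivity
    estimates apply. The height lies below 0.866 because |Delta| is larger at the corner, where q <
    0, than at the same height on the axis. *)
Definition d0 : R := dl 0.82.
Lemma d0_pos : 0 < d0. Proof. apply exp_pos. Qed.

(** The cost of rescaling from height 2 to the scale [d0]. It has to stay below 4^6 = 4096, the gain
    of the Eisenstein bound for each 12 in the weight. *)
Lemma ratio_bounds : 1000 * dl 2 <= d0 <= 1700 * dl 2.
Proof.
  unfold d0. rewrite !dl_eq. pose proof La_82. pose proof La_2. pose proof PI_lo. pose proof PI_hi.
  set (x := - (2 * PI * 2) - 24 * La 2). set (X := - (2 * PI * 0.82) - 24 * La 0.82 - x).
  replace (- (2 * PI * 0.82) - 24 * La 0.82) with (X + x) by (unfold X; ring).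
  rewrite exp_plus. pose proof (exp_pos x). split; apply Rmult_le_compat_r; try lra.
  - apply Rle_trans with (exp (INR 7 + 0)); [|apply exp_mono; unfold X, x; simpl; lra].
    eapply Rle_trans; [|apply exp_lo; lra]. lra.
  - apply Rle_trans with (exp (INR 7 + 0.42)); [apply exp_mono; unfold X, x; simpl; lra|].
    eapply Rle_trans; [apply exp_hi; lra|]. lra.
Qed.

(** Height 0.66 is low enough for Delta to double and high enough for q / Delta to stay below 1.5;
    this gives the geometric decay of [tau]. *)
Lemma d1_bound : 2 * d0 <= dl 0.66.
Proof.
  unfold d0. rewrite !dl_eq. pose proof La_82. pose proof La_66. pose proof PI_lo.
  set (x := - (2 * PI * 0.82) - 24 * La 0.82). set (X := - (2 * PI * 0.66) - 24 * La 0.66 - x).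
  replace (- (2 * PI * 0.66) - 24 * La 0.66) with (X + x) by (unfold X; ring).
  rewrite exp_plus. pose proof (exp_pos x). apply Rmult_le_compat_r; [lra|].
  apply Rle_trans with (exp 0.74); [|apply exp_mono; unfold X, x; lra].
  eapply Rle_trans; [|apply exp_lo3; lra]. lra.
Qed.

Lemma ieta_66 : Re (F ieta (Ci * 0.66)) <= 1.5.
Proof.
  rewrite F_ieta_axis, dl_eq by lra. pose proof La_66. unfold Rdiv. rewrite <- exp_Ropp, <- exp_plus.
  apply Rle_trans with (exp 0.397); [apply exp_mono; lra|]. eapply Rle_trans; [apply exp_hi3; lra|]. lra.
Qed.
Lemma ieta_82 : Re (F ieta (Ci * 0.82)) <= 1.153.
Proof.
  rewrite F_ieta_axis, dl_eq by lra. pose proof La_82. unfold Rdiv. rewrite <- exp_Ropp, <- exp_plus.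
  apply Rle_trans with (exp 0.1416); [apply exp_mono; lra|]. eapply Rle_trans; [apply exp_hi3; lra|]. lra.
Qed.

Lemma Cmod_Delta z : Cmod (Delta z) = exp (- (2 * PI * Im z) - 24 * Re (F lg z)).
Proof.
  unfold Delta. rewrite Cmod_cexp. f_equal. rewrite re_minus, re_scal_l. f_equal.
  unfold tpi. destruct z; simpl; ring.
Qed.

Lemma Delta_small z : 0.866 <= Im z -> Cmod (Delta z) <= d0.
Proof.
  intros Hz. rewrite Cmod_Delta. unfold d0. rewrite dl_eq. apply exp_mono.
  pose proof La_82. pose proof PI_lo. pose proof rq_866. pose proof (rq_range 0.866 ltac:(lra)) as Hr.
  pose proof (lg_bound z 0.866 ltac:(lra) Hz) as HB.
  assert (HB2 : rq 0.866 / (1 - rq 0.866) ^ 2 <= 0.00442).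
  { unfold Rdiv. apply Rle_trans with (0.00438 * / (1 - 0.00438) ^ 2); [|lra].
    apply Rmult_le_compat; [lra | left; apply Rinv_0_lt_compat, pow_lt; lra | lra|].
    apply Rinv_le_contravar; [apply pow_lt; lra | apply pow_incr; lra]. }
  pose proof (re_le_Cmod (F lg z)) as HRe. assert (HR : Rabs (Re (F lg z)) <= 0.00442) by lra.
  apply Rabs_le_between in HR. assert (2 * PI * 0.866 <= 2 * PI * Im z) by (apply Rmult_le_compat_l; lra). lra.
Qed.

(** * The coefficients of the expansion in Eisenstein series *)

(** Weight 12 (l - 1 - m) + 2 kap, with the constant 1 in weight 0. The condition on [kap] imposed
    below excludes weight 2. *)
Definition EB (kap l m : nat) : nat -> C :=
  let t := (6 * (l - 1 - m) + kap)%nat in if (t =? 0)%nat then pone else Eis t.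

(** First approximation to |d_n| d0^n, coming from q / Delta alone. *)
Definition tau (n : nat) : R := Re (tj n ieta) * d0 ^ n.

Lemma tau_nonneg n : 0 <= tau n.
Proof. apply Rmult_le_pos; [apply tj_pos, pser_ieta | apply pow_le, Rlt_le, d0_pos]. Qed.
Lemma tau_geom n : tau n <= 1.5 * (1 / 2) ^ n.
Proof.
  pose proof (tj_le ieta 0.66 n pser_ieta PSc_ieta ltac:(lra)) as H. pose proof ieta_66. pose proof d1_bound as Hd. pose proof d0_pos.
  unfold tau. destruct (tj_pos n ieta pser_ieta) as [_ HR].
  apply Rle_trans with (Re (tj n ieta) * dl 0.66 ^ n * (1 / 2) ^ n).
  - rewrite Rmult_assoc, <- Rpow_mult_distr. apply Rmult_le_compat_l; [exact HR|]. apply pow_incr. lra.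
  - apply Rmult_le_compat_r; [apply pow_le; lra | lra].
Qed.
(** The bound 1.153 for q / Delta at height 0.82, less the term 1 of index 0. *)
Lemma tau_sum N : rsum (fun n => tau (S n)) N <= 0.153.
Proof.
  pose proof (tj_sum_le ieta 0.82 (S N) pser_ieta PSc_ieta ltac:(lra)) as H. pose proof ieta_82.
  fold d0 in H. change (rsum tau (S N) <= Re (F ieta (Ci * 0.82))) in H.
  assert (E : forall M, rsum tau (S M) = tau 0 + rsum (fun n => tau (S n)) M).
  { induction M as [|M IH]; [simpl; ring|]. change (rsum tau (S (S M))) with (rsum tau (S M) + tau (S M)). rewrite IH. simpl. ring. }
  rewrite E in H. unfold tau at 1 in H. unfold tj in H. change (Nat.iter 0 next ieta O) with (ieta O) in H.
  change (ieta O) with (RtoC 1) in H. rewrite re_RtoC in H. simpl pow in H. lra.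
Qed.

Section Coefficients.
Context (kap Lm : nat) (Hk : kap = O \/ (2 <= kap)%nat).
Let B := EB kap (S Lm).
Let T n := Cmod (dcf B n) * d0 ^ n.

(** The bound at 2 i is rescaled by A^(n - i) with A = d0 / dl 2. Writing this as A^(Lm - i) A^(-(Lm
    - n)), each factor A / 4096 is below 0.416 and each 1 / A at most 0.001. *)
Lemma B_coef_bound i n : (i < n <= Lm)%nat ->
  Cmod (tj (n - i) (B i)) * d0 ^ (n - i) <= 9 * 0.416 ^ (Lm - i) * 0.001 ^ (Lm - n).
Proof.
  intros Hin. unfold B, EB. replace (S Lm - 1 - i)%nat with (Lm - i)%nat by lia.
  set (t := (6 * (Lm - i) + kap)%nat). assert (Ht : (6 <= t)%nat) by (unfold t; lia).
  destruct (Nat.eqb_spec t 0) as [E|_]; [lia|].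
  pose proof (tj_Eis_bound t (n - i) ltac:(lia) ltac:(lia)) as H. pose proof ratio_bounds as HA.
  assert (Hd2 : 0 < dl 2) by apply exp_pos. set (A := d0 / dl 2).
  assert (HA' : 1000 <= A <= 1700).
  { unfold A. split; apply (Rmult_le_reg_r (dl 2)); try exact Hd2; unfold Rdiv; rewrite Rmult_assoc, Rinv_l; lra. }
  replace d0 with (dl 2 * A) by (unfold A; field; lra). rewrite Rpow_mult_distr, <- Rmult_assoc.
  apply Rle_trans with (9 / 4 ^ t * A ^ (n - i)); [apply Rmult_le_compat_r; [apply pow_le; lra | exact H]|].
  assert (H4 : / 4 ^ t <= / 4096 ^ (Lm - i)).
  { apply Rinv_le_contravar; [apply pow_lt; lra|]. unfold t. rewrite pow_add, pow_mult.
    replace (4 ^ 6) with 4096 by ring. rewrite <- (Rmult_1_r (4096 ^ (Lm - i))) at 1.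
    apply Rmult_le_compat_l; [apply pow_le; lra | apply pow_R1_Rle; lra]. }
  apply Rle_trans with (9 * (/ 4096 ^ (Lm - i) * A ^ (n - i))).
  { unfold Rdiv. rewrite Rmult_assoc. apply Rmult_le_compat_l; [lra|]. apply Rmult_le_compat_r; [apply pow_le; lra | exact H4]. }
  rewrite Rmult_assoc. apply Rmult_le_compat_l; [lra|].
  assert (EA : A ^ (n - i) = A ^ (Lm - i) * (/ A) ^ (Lm - n)).
  { replace (Lm - i)%nat with (n - i + (Lm - n))%nat by lia. rewrite pow_add, pow_inv. field. apply pow_nonzero. lra. }
  rewrite EA, <- Rmult_assoc, <- pow_inv, <- Rpow_mult_distr.
  apply Rmult_le_compat; try (apply pow_le); try (apply Rmult_le_pos); try lra; try (left; apply Rinv_0_lt_compat; lra).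
  - apply pow_incr. lra.
  - apply pow_incr. split; [left; apply Rinv_0_lt_compat; lra|].
    replace 0.001 with (/ 1000) by lra. apply Rinv_le_contravar; lra.
Qed.

(** 0.832 = 2 * 0.416, and 0.832 / 0.168 < 4.953. *)
Lemma geom_832 n : rsum (fun i => 0.832 ^ (n - i)) n <= 4.953.
Proof.
  assert (H : rsum (fun i => 0.832 ^ (n - i)) n = 0.832 * (1 - 0.832 ^ n) / 0.168).
  { induction n as [|n IH]; [simpl; lra|]. cbn [rsum]. rewrite (rsum_ext _ (fun i => 0.832 * 0.832 ^ (n - i))).
    - rewrite rsum_scal, IH. replace (S n - n)%nat with 1%nat by lia. simpl. lra.
    - intros k Hkn. replace (S n - k)%nat with (S (n - k)) by lia. reflexivity. }
  rewrite H. pose proof (pow_le 0.832 n ltac:(lra)). lra.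
Qed.

(** By [dcf_rec], d_n is the coefficient of q / Delta corrected by earlier d_i times Eisenstein
    coefficients, which are tiny unless n is close to Lm. The induction closes because 13.86 * 4.953
    < 70. *)
Lemma T_bound n : (n <= Lm)%nat -> T n <= tau n + 70 * 0.000416 ^ (Lm - n) * (1 / 2) ^ n.
Proof.
  induction n as [n IH] using lt_wf_ind. intros Hn. unfold T. rewrite dcf_rec.
  pose proof d0_pos as Hd.
  eapply Rle_trans; [apply Rmult_le_compat_r; [apply pow_le; lra | apply Cmod_sub]|].
  rewrite Rmult_plus_distr_r. apply Rplus_le_compat.
  - unfold tau. destruct (tj_pos n ieta pser_ieta) as [HI HR]. rewrite (C_real _ HI), Cmod_Rp, re_RtoC by exact HR. lra.
  - rewrite Rmult_comm. eapply Rle_trans; [apply Rmult_le_compat_l; [apply pow_le; lra | apply csum_mod]|].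
    rewrite <- rsum_scal.
    apply Rle_trans with (rsum (fun i => (13.86 * 0.000416 ^ (Lm - n) * (1 / 2) ^ n) * 0.832 ^ (n - i)) n).
    + apply rsum_le. intros i Hi. rewrite Cmod_mult.
      replace (d0 ^ n) with (d0 ^ i * d0 ^ (n - i)) by (rewrite <- pow_add; f_equal; lia).
      replace (d0 ^ i * d0 ^ (n - i) * (Cmod (dcf B i) * Cmod (tj (n - i) (B i))))
        with (T i * (Cmod (tj (n - i) (B i)) * d0 ^ (n - i))) by (unfold T; ring).
      (* Since i < Lm, the bound for T i carries at least one factor 0.000416, and 1.5 + 70 *
         0.000416 < 1.54. *)
      apply Rle_trans with (1.54 * (1 / 2) ^ i * (9 * 0.416 ^ (Lm - i) * 0.001 ^ (Lm - n))).
      * apply Rmult_le_compat; [apply Rmult_le_pos; [apply Cmod_ge_0 | apply pow_le; lra]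
          | apply Rmult_le_pos; [apply Cmod_ge_0 | apply pow_le; lra] | | apply B_coef_bound; lia].
        eapply Rle_trans; [apply IH; lia|]. pose proof (tau_geom i).
        assert (0.000416 ^ (Lm - i) <= 0.000416).
        { rewrite <- (pow_1 0.000416) at 2. apply pow_dec; [lra | lia]. }
        pose proof (pow_lt (1 / 2) i ltac:(lra)). nra.
      * right. replace (Lm - i)%nat with (Lm - n + (n - i))%nat by lia. rewrite pow_add.
        replace 0.000416 with (0.416 * 0.001) by lra. rewrite Rpow_mult_distr.
        replace ((1 / 2) ^ n) with ((1 / 2) ^ i * (1 / 2) ^ (n - i)) by (rewrite <- pow_add; f_equal; lia).
        replace (0.416 ^ (n - i)) with ((1 / 2) ^ (n - i) * 0.832 ^ (n - i)) by (rewrite <- Rpow_mult_distr; f_equal; lra).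
        replace 13.86 with (1.54 * 9) by lra. ring.
    + rewrite rsum_scal. pose proof (geom_832 n).
      assert (0 <= 0.000416 ^ (Lm - n) * (1 / 2) ^ n) by (apply Rmult_le_pos; apply pow_le; lra). nra.
Qed.
End Coefficients.

(** * Signs on the arc *)

Definition eit (th : R) : C := (cos th, sin th).

Lemma eit_cexp th : eit th = cexp (Ci * th).
Proof.
  unfold eit, cexp. destruct (Ci * th)%C as [x y] eqn:E.
  assert (Ex : x = 0) by (change x with (Re (x, y)); rewrite <- E; simpl; ring).
  assert (Ey : y = th) by (change y with (Im (x, y)); rewrite <- E; simpl; ring).
  simpl. subst. rewrite exp_0. apply C_ext; simpl; ring.
Qed.
Lemma Cmod_eit th : Cmod (eit th) = 1.
Proof. rewrite eit_cexp, Cmod_cexp, <- exp_0. f_equal. simpl. ring. Qed.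
Lemma eit_neq0 th : eit th <> RtoC 0.
Proof. apply Cmod_gt_0. rewrite Cmod_eit. lra. Qed.
Lemma eit_pow th n : (eit th ^ n)%C = eit (INR n * th).
Proof.
  rewrite !eit_cexp. induction n as [|n IH].
  - simpl. rewrite <- cexp_0. f_equal. rewrite Rmult_0_l. ring.
  - rewrite Cpow_S, IH, <- cexp_add. f_equal. rewrite S_INR, !RtoC_mult, RtoC_plus. ring.
Qed.
Lemma eit_conj th : Cconj (eit th) = (/ eit th)%C.
Proof.
  apply (Cmult_cancel_l (eit th)); [apply eit_neq0|]. rewrite Cinv_r by apply eit_neq0.
  pose proof (sin2_cos2 th) as H. unfold Rsqr in H. apply C_ext; simpl; lra.
Qed.

Lemma arc_range th : PI / 2 <= th <= 2 * PI / 3 -> -(1/2) <= cos th <= 0 /\ 0.866 <= sin th.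
Proof.
  intros H. pose proof PI_RGT_0.
  assert (Hc : -(1/2) <= cos th <= 0).
  { split.
    - replace (-(1/2)) with (cos (2 * (PI / 3))) by (rewrite cos_2PI3; field).
      replace (2 * (PI / 3)) with (2 * PI / 3) by field.
      destruct (Req_dec th (2 * PI / 3)) as [->|]; [lra|]. apply Rlt_le, cos_decreasing_1; lra.
    - apply cos_le_0; lra. }
  split; [exact Hc|]. assert (0 <= sin th) by (apply sin_ge_0; lra).
  pose proof (sin2_cos2 th) as HH. unfold Rsqr in HH. assert (sin th * sin th >= 3 / 4) by nra. nra.
Qed.

Lemma arc_H th : PI / 2 <= th <= 2 * PI / 3 -> in_H (eit th).
Proof. intros H. destruct (arc_range th H). unfold in_H, eit. simpl. lra. Qed.

Lemma Cmod_z1_ge th : PI / 2 <= th <= 2 * PI / 3 -> 1 <= Cmod (eit th + 1).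
Proof.
  intros H. destruct (arc_range th H) as [Hc _]. pose proof (sin2_cos2 th) as HH. unfold Rsqr in HH.
  assert (E : Cmod (eit th + 1) ^ 2 = 2 + 2 * cos th) by (rewrite Cmod2_alt; simpl; lra).
  pose proof (Cmod_ge_0 (eit th + 1)). nra.
Qed.

Lemma pow_inv_le1 x n : 1 <= x -> / x ^ n <= 1.
Proof. intros H. rewrite <- Rinv_1. apply Rinv_le_contravar; [lra | now apply pow_R1_Rle]. Qed.

Lemma Eis_arc_bound t th : (2 <= t)%nat -> PI / 2 <= th <= 2 * PI / 3 ->
  Cmod (F (Eis t) (eit th)) <= 3 + 32 / 2 ^ t.
Proof.
  intros Ht H. destruct (arc_range th H) as [Hc _]. pose proof (arc_H th H) as HH.
  pose proof (Eis_arc t (eit th) Ht HH (Cmod_eit th) Hc) as HE.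
  set (m := (1 + / eit th ^ (2 * t) + / (eit th + 1) ^ (2 * t))%C) in *.
  pose proof (Cmod_triangle (F (Eis t) (eit th) - m) m) as Ht2.
  replace (F (Eis t) (eit th) - m + m)%C with (F (Eis t) (eit th)) in Ht2 by ring.
  assert (Hm : Cmod m <= 3); [|lra]. unfold m.
  pose proof (in_H_neq0 _ (in_H_add _ 1 HH)) as N1.
  eapply Rle_trans; [apply Cmod_triangle|]. eapply Rle_trans; [apply Rplus_le_compat_r, Cmod_triangle|].
  rewrite !Cmod_inv, !Cmod_pow, Cmod_eit, Cmod_1 by (apply Cpow_nz; exact N1 || apply eit_neq0).
  pose proof (pow_inv_le1 1 (2 * t) (Rle_refl 1)). pose proof (pow_inv_le1 _ (2 * t) (Cmod_z1_ge th H)). lra.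
Qed.

(** z^t + z^(-t) = 2 cos(t th), while (z + 1)^2 / z = 2 + 2 cos th turns the third main term into a
    real number between 0 and 1. Its sign makes the two bounds asymmetric. *)
Lemma Eis_arc_main t th : (2 <= t)%nat -> PI / 2 <= th <= 2 * PI / 3 ->
  2 * cos (INR t * th) - 32 / 2 ^ t <= Re (eit th ^ t * F (Eis t) (eit th)) <= 2 * cos (INR t * th) + 1 + 32 / 2 ^ t.
Proof.
  intros Ht H. destruct (arc_range th H) as [Hc _]. pose proof (arc_H th H) as HH.
  pose proof (Eis_arc t (eit th) Ht HH (Cmod_eit th) Hc) as HE.
  set (z := eit th) in *. pose proof (eit_neq0 th) as N. fold z in N.
  pose proof (in_H_neq0 _ (in_H_add _ 1 HH)) as N1. fold z in N1.
  set (er := (F (Eis t) z - (1 + / z ^ (2 * t) + / (z + 1) ^ (2 * t)))%C) in *.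
  assert (E : (z ^ t * F (Eis t) z)%C = (z ^ t + / z ^ t + RtoC ((/ (2 + 2 * cos th)) ^ t) + z ^ t * er)%C).
  { replace (F (Eis t) z) with (1 + / z ^ (2 * t) + / (z + 1) ^ (2 * t) + er)%C by (unfold er; ring).
    replace (RtoC ((/ (2 + 2 * cos th)) ^ t)) with (z ^ t * / (z + 1) ^ (2 * t))%C.
    - replace (z ^ (2 * t))%C with (z ^ t * z ^ t)%C by (rewrite <- Cpow_add_r; f_equal; lia).
      pose proof (Cpow_nz _ t N). pose proof (Cpow_nz _ (2 * t) N1). field. split; assumption.
    - rewrite RtoC_pow, RtoC_inv by lra.
      assert (Ez : RtoC (2 + 2 * cos th) = ((z + 1) ^ 2 * / z)%C).
      { replace ((z + 1) ^ 2 * / z)%C with (z + / z + 2)%C by (simpl; field; exact N). unfold z. rewrite <- eit_conj.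
        apply C_ext; simpl; ring. }
      rewrite Ez, Cpow_mult_r. rewrite <- Cpow_inv, <- Cpow_mult_l by (now apply Cpow_nz). f_equal. simpl. field.
      split; assumption. }
  rewrite E, !re_plus, re_RtoC.
  assert (E1 : Re (z ^ t) = cos (INR t * th)) by (unfold z; now rewrite eit_pow).
  assert (E2 : Re (/ z ^ t) = cos (INR t * th)) by (unfold z; rewrite eit_pow, <- eit_conj, re_conj; reflexivity).
  rewrite E1, E2.
  assert (HP : 0 <= (/ (2 + 2 * cos th)) ^ t <= 1).
  { assert (0 < / (2 + 2 * cos th)) by (apply Rinv_0_lt_compat; lra).
    split; [apply pow_le; lra|]. apply pow_le1. split; [lra|]. rewrite <- Rinv_1. apply Rinv_le_contravar; lra. }
  assert (HR : Rabs (Re (z ^ t * er)) <= 32 / 2 ^ t).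
  { eapply Rle_trans; [apply re_le_Cmod|]. rewrite Cmod_mult, Cmod_pow. unfold z at 1. rewrite Cmod_eit, pow1, Rmult_1_l. exact HE. }
  apply Rabs_le_between in HR. lra.
Qed.

(** 3 + 32 / 2^2 = 11 covers the last index, where t can be 2; before it t >= 6, and 3 + 32 / 2^6 =
    3.5. *)
Lemma EB_arc_bound kap Lm m th : (kap = 0 \/ 2 <= kap)%nat -> (m <= Lm)%nat -> PI / 2 <= th <= 2 * PI / 3 ->
  Cmod (F (EB kap (S Lm) m) (eit th)) <= 11 /\ ((m < Lm)%nat -> Cmod (F (EB kap (S Lm) m) (eit th)) <= 3.5).
Proof.
  intros Hk Hm Hth. unfold EB. replace (S Lm - 1 - m)%nat with (Lm - m)%nat by lia.
  set (t := (6 * (Lm - m) + kap)%nat).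
  destruct (Nat.eqb_spec t 0) as [E|E].
  - unfold F. rewrite Ev_one, Cmod_1. split; [lra | intros; unfold t in E; lia].
  - assert (H2 : (2 <= t)%nat) by (unfold t in *; lia). pose proof (Eis_arc_bound t th H2 Hth) as HB. split.
    + assert (/ 2 ^ t <= / 2 ^ 2) by (apply Rinv_le_contravar; [lra | apply Rle_pow; [lra | exact H2]]).
      unfold Rdiv in HB. lra.
    + intros Hl. assert (/ 2 ^ t <= / 2 ^ 6) by (apply Rinv_le_contravar; [lra | apply Rle_pow; [lra | unfold t; lia]]).
      unfold Rdiv in HB. lra.
Qed.

Lemma half_pow_le n m : (m <= n)%nat -> (1 / 2) ^ n <= (1 / 2) ^ m.
Proof. intros H. apply pow_dec; [lra | exact H]. Qed.

(** 782 is needed for n = Lm, where it covers 11 * 70 + (11 - 3.5) * 1.5. For smaller n, 0.000416 <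
    1/4 pays for the powers of 1/2. *)
Lemma term_bound kap Lm n th : (kap = 0 \/ 2 <= kap)%nat -> (1 <= n <= Lm)%nat -> PI / 2 <= th <= 2 * PI / 3 ->
  Cmod (dcf (EB kap (S Lm)) n) * d0 ^ n * Cmod (F (EB kap (S Lm) n) (eit th))
  <= 3.5 * tau n + 782 * (1 / 2) ^ Lm * (1 / 2) ^ (Lm - n).
Proof.
  intros Hk Hn Hth. pose proof (T_bound kap Lm Hk n ltac:(lia)) as HT.
  destruct (EB_arc_bound kap Lm n th Hk ltac:(lia) Hth) as [H11 H35].
  pose proof (tau_nonneg n) as Ht0. pose proof (tau_geom n) as Ht1. pose proof (pow_lt (1 / 2) Lm ltac:(lra)) as HL.
  set (T := Cmod (dcf (EB kap (S Lm)) n) * d0 ^ n) in *. set (e := Cmod (F (EB kap (S Lm) n) (eit th))) in *.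
  assert (HT0 : 0 <= T) by (apply Rmult_le_pos; [apply Cmod_ge_0 | apply pow_le, Rlt_le, d0_pos]).
  assert (He0 : 0 <= e) by apply Cmod_ge_0.
  destruct (Nat.eq_dec n Lm) as [->|Hne].
  - rewrite Nat.sub_diag in *. simpl pow in HT |- * at 1. rewrite !Rmult_1_r in *.
    apply Rle_trans with ((tau Lm + 70 * (1 / 2) ^ Lm) * 11); [apply Rmult_le_compat; lra|]. lra.
  - specialize (H35 ltac:(lia)).
    apply Rle_trans with ((tau n + 70 * 0.000416 ^ (Lm - n) * (1 / 2) ^ n) * 3.5); [apply Rmult_le_compat; lra|].
    assert (HX : 0.000416 ^ (Lm - n) * (1 / 2) ^ n <= (1 / 2) ^ Lm * (1 / 2) ^ (Lm - n)).
    { replace ((1 / 2) ^ Lm * (1 / 2) ^ (Lm - n)) with (((1 / 2) * (1 / 2)) ^ (Lm - n) * (1 / 2) ^ n).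
      - apply Rmult_le_compat_r; [apply pow_le; lra|]. apply pow_incr. lra.
      - rewrite Rpow_mult_distr. replace ((1 / 2) ^ Lm) with ((1 / 2) ^ n * (1 / 2) ^ (Lm - n)) by (rewrite <- pow_add; f_equal; lia). ring. }
    assert (0 <= (1 / 2) ^ Lm * (1 / 2) ^ (Lm - n)) by (apply Rmult_le_pos; apply pow_le; lra). lra.
Qed.

(** For z = e^(i th) and u = z^6 Delta(z) this is z^(k/2) g(z) / u with k = 12 (Lm + 1) + 2 kap:
    every Delta absorbs z^6, every Eisenstein series half its weight in z. *)
Definition arcsum (kap Lm : nat) (th : R) (u : C) : C :=
  csum (fun m => dcf (EB kap (S Lm)) m * u ^ m * (eit th ^ (6 * (Lm - m) + kap) * F (EB kap (S Lm) m) (eit th)))%C (S Lm).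

Lemma arcsum_main kap Lm th u : (kap = 0 \/ 2 <= kap)%nat -> (12 <= Lm)%nat -> PI / 2 <= th <= 2 * PI / 3 -> Cmod u <= d0 ->
  2 * cos (INR (6 * Lm + kap) * th) - 0.95 <= Re (arcsum kap Lm th u) <= 2 * cos (INR (6 * Lm + kap) * th) + 1.95.
Proof.
  intros Hk HLm Hth Hu. unfold arcsum. rewrite csum_S, re_plus.
  set (t0 := (6 * Lm + kap)%nat).
  assert (E0 : dcf (EB kap (S Lm)) 0 = RtoC 1) by reflexivity. rewrite E0.
  replace (Lm - 0)%nat with Lm by lia. fold t0.
  assert (EF : EB kap (S Lm) 0 = Eis t0).
  { unfold EB. replace (S Lm - 1 - 0)%nat with Lm by lia. fold t0. destruct (Nat.eqb_spec t0 0); [unfold t0 in *; lia | reflexivity]. }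
  rewrite EF. replace (1 * u ^ 0 * (eit th ^ t0 * F (Eis t0) (eit th)))%C with (eit th ^ t0 * F (Eis t0) (eit th))%C by (simpl; ring).
  pose proof (Eis_arc_main t0 th ltac:(unfold t0; lia) Hth) as HM.
  assert (Hsm : 32 / 2 ^ t0 <= 0.001).
  { unfold Rdiv. assert (/ 2 ^ t0 <= / 2 ^ 20) by (apply Rinv_le_contravar; [apply pow_lt; lra | apply Rle_pow; [lra | unfold t0; lia]]). lra. }
  set (R0 := csum _ Lm).
  (* 3.5 * 0.153 + 782 * 2 / 2^12 < 0.92; the hypothesis 12 <= Lm enters here. *)
  assert (HR : Cmod R0 <= 0.92).
  { eapply Rle_trans; [apply csum_mod|].
    apply Rle_trans with (rsum (fun j => 3.5 * tau (S j) + 782 * (1 / 2) ^ Lm * (1 / 2) ^ (Lm - S j)) Lm).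
    - apply rsum_le. intros j Hj. rewrite !Cmod_mult, !Cmod_pow, Cmod_eit, pow1, Rmult_1_l.
      eapply Rle_trans; [|apply (term_bound kap Lm (S j) th Hk ltac:(lia) Hth)].
      apply Rmult_le_compat_r; [apply Cmod_ge_0|]. apply Rmult_le_compat_l; [apply Cmod_ge_0|].
      apply pow_incr. split; [apply Cmod_ge_0 | exact Hu].
    - rewrite rsum_plus, !rsum_scal. pose proof (tau_sum Lm).
      assert (HG : rsum (fun j => (1 / 2) ^ (Lm - S j)) Lm <= 2).
      { assert (HE : forall M, rsum (fun j => (1 / 2) ^ (M - S j)) M = 2 - 2 * (1 / 2) ^ M).
        { induction M as [|M IH]; [simpl; lra|]. cbn [rsum].
          rewrite (rsum_ext _ (fun j => (1 / 2) * (1 / 2) ^ (M - S j))).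
          - rewrite rsum_scal, IH. replace (S M - S M)%nat with O by lia. simpl. lra.
          - intros k Hkm. replace (S M - S k)%nat with (S (M - S k)) by lia. reflexivity. }
        rewrite HE. pose proof (pow_le (1 / 2) Lm ltac:(lra)). lra. }
      pose proof (half_pow_le Lm 12 HLm) as HP. pose proof (pow_lt (1 / 2) Lm ltac:(lra)).
      assert (rsum (fun j => (1 / 2) ^ (Lm - S j)) Lm * (1 / 2) ^ Lm <= 2 * (1 / 2) ^ 12).
      { apply Rmult_le_compat; [apply rsum_nonneg; intros; apply pow_le; lra | lra | exact HG | exact HP]. }
      lra. }
  pose proof (re_le_Cmod R0) as HRe. assert (HR' : Rabs (Re R0) <= 0.92) by lra. apply Rabs_le_between in HR'. lra.
Qed.

(** * Reality on the arc *)

Lemma qpar_refl z : qpar (- Cconj z) = Cconj (qpar z).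
Proof.
  destruct z as [x y]. unfold qpar. simpl. replace (2 * PI * - x) with (- (2 * PI * x)) by ring.
  rewrite cos_neg, sin_neg, Ropp_involutive. apply C_ext; simpl; ring.
Qed.
Lemma F_refl a z : rser a -> F a (- Cconj z) = Cconj (F a z).
Proof. intros H. unfold F. rewrite qpar_refl. now apply Ev_conj. Qed.
Lemma cexp_conj w : cexp (Cconj w) = Cconj (cexp w).
Proof.
  unfold cexp. rewrite re_conj, im_conj, cos_neg, sin_neg. apply C_ext; simpl; ring.
Qed.
Lemma Delta_refl z : Delta (- Cconj z) = Cconj (Delta z).
Proof.
  unfold Delta. rewrite F_refl by (intros n; apply pser_lg). rewrite <- cexp_conj. f_equal.
  rewrite Cminus_conj, !Cmult_conj. unfold tpi. destruct (F lg z), z. apply C_ext; simpl; ring.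
Qed.

(* On the unit circle reflection and inversion agree, so z^t f(z) is real for a form f of weight 2t with real coefficients. *)
Lemma arc_real (f : C -> C) t th : f (- Cconj (eit th))%C = Cconj (f (eit th)) ->
  f (- / eit th)%C = (eit th ^ (2 * t) * f (eit th))%C -> Im (eit th ^ t * f (eit th)) = 0.
Proof.
  intros Hr HS. rewrite eit_conj, HS in Hr. pose proof (eit_neq0 th) as N.
  assert (E : Cconj (eit th ^ t * f (eit th)) = (eit th ^ t * f (eit th))%C).
  { rewrite Cmult_conj, <- Hr, Cpow_conj, eit_conj, Cpow_inv by exact N.
    replace (eit th ^ (2 * t))%C with (eit th ^ t * eit th ^ t)%C by (rewrite <- Cpow_add_r; f_equal; lia).
    field. now apply Cpow_nz. }
  apply (f_equal Im) in E. rewrite im_conj in E. lra.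
Qed.

Lemma Delta_arc_real th : PI / 2 <= th <= 2 * PI / 3 -> Im (eit th ^ 6 * Delta (eit th)) = 0.
Proof. intros H. apply (arc_real Delta 6); [apply Delta_refl | now apply Delta_S, arc_H]. Qed.

(** * Estimates in the fundamental domain *)

Lemma npow_growth k j : INR (3 + j) ^ k <= 3 ^ k * ((4 / 3) ^ k) ^ j.
Proof.
  induction j as [|j IH].
  - simpl. rewrite Rmult_1_r. replace (1 + 1 + 1) with 3 by ring. lra.
  - assert (H : INR (3 + S j) ^ k <= (4 / 3) ^ k * INR (3 + j) ^ k).
    { rewrite <- Rpow_mult_distr. apply pow_incr. split; [apply pos_INR|].
      replace (3 + S j)%nat with (S (3 + j)) by lia. rewrite S_INR, plus_INR. pose proof (pos_INR j). simpl (INR 3). lra. }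
    simpl pow at 3. pose proof (pow_le (4 / 3) k ltac:(lra)). nra.
Qed.

(** From index 3 on, passing from n to n + 1 multiplies n^k by at most (4/3)^k, so the tail is
    dominated by a geometric series. *)
Lemma series_tail3 (a : nat -> R) k r rho : 0 <= r -> (4 / 3) ^ k * r <= rho < 1 ->
  (forall n, 0 <= a n <= INR n ^ k) ->
  ex_series (fun j => a (3 + j)%nat * r ^ j) /\ Series (fun j => a (3 + j)%nat * r ^ j) <= 3 ^ k / (1 - rho).
Proof.
  intros Hr Hrho Ha.
  assert (Hk : 0 <= (4 / 3) ^ k) by (apply pow_le; lra).
  assert (Hrho0 : 0 <= rho) by nra.
  assert (Hb : forall j, 0 <= a (3 + j)%nat * r ^ j <= 3 ^ k * rho ^ j).
  { intros j. pose proof (Ha (3 + j)%nat) as [H1 H2]. pose proof (npow_growth k j) as Hg. pose proof (pow_le r j Hr).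
    split; [now apply Rmult_le_pos|].
    apply Rle_trans with (3 ^ k * ((4 / 3) ^ k) ^ j * r ^ j); [apply Rmult_le_compat_r; lra|].
    rewrite Rmult_assoc, <- Rpow_mult_distr. apply Rmult_le_compat_l; [apply pow_le; lra|]. apply pow_incr. nra. }
  assert (Hex : ex_series (fun j => 3 ^ k * rho ^ j)) by (apply ex_series_geomR; lra).
  split; [exact (ex_series_major _ _ Hb Hex)|].
  eapply Rle_trans; [apply (Series_le _ _ Hb Hex)|]. rewrite Series_scal_l, Series_geom by (rewrite Rabs_pos_eq; lra).
  unfold Rdiv. lra.
Qed.

(** On the lines Re z = 0 and Re z = -1/2 the imaginary part of q vanishes, so sign estimates nearby
    need errors proportional to Im q and not to |q|. *)
Lemma im_pow_bound (q : C) r n : 0 < r -> Cmod q <= r -> r * Rabs (Im (q ^ n)) <= INR n * r ^ n * Rabs (Im q).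
Proof.
  intros Hr Hq. induction n as [|n IH]; [simpl; rewrite Rabs_R0; lra|].
  rewrite Cpow_S, im_mult, S_INR. pose proof (Rabs_triang (Re q * Im (q ^ n)) (Im q * Re (q ^ n))) as Ht.
  rewrite !Rabs_mult in Ht. pose proof (re_le_Cmod q) as H1. pose proof (re_le_Cmod (q ^ n)) as H2. rewrite Cmod_pow in H2.
  assert (H3 : Cmod q ^ n <= r ^ n) by (apply pow_incr; split; [apply Cmod_ge_0 | exact Hq]).
  pose proof (Rabs_pos (Re q)). pose proof (Rabs_pos (Re (q ^ n))). pose proof (Rabs_pos (Im q)). pose proof (Rabs_pos (Im (q ^ n))).
  assert (Rabs (Re q) * Rabs (Im (q ^ n)) <= r * Rabs (Im (q ^ n))) by (apply Rmult_le_compat_r; lra).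
  assert (Rabs (Im q) * Rabs (Re (q ^ n)) <= Rabs (Im q) * r ^ n) by (apply Rmult_le_compat_l; lra).
  apply Rle_trans with (r * (INR n * r ^ n * Rabs (Im q) + Rabs (Im q) * r ^ n)); [|simpl; right; ring].
  apply Rle_trans with (r * (r * Rabs (Im (q ^ n)) + Rabs (Im q) * r ^ n)); [apply Rmult_le_compat_l; lra|].
  apply Rmult_le_compat_l; lra.
Qed.

Lemma sig_le s n : Cmod (sig s n) <= INR n ^ (S s).
Proof.
  eapply Rle_trans; [apply Cmod_sig|]. simpl. apply Rmult_le_compat_l; [apply pos_INR|].
  unfold pows. destruct n; [rewrite Cmod_0; apply pow_le, pos_INR|]. rewrite Cmod_Rp by (apply pow_le, pos_INR). lra.
Qed.

Lemma F_sig_split s z : in_H z -> exists w, F (sig s) z = (qpar z + sig s 2 * qpar z ^ 2 + w)%C /\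
  forall r rho, 0 < r -> Cmod (qpar z) <= r -> r < 1 -> (4 / 3) ^ (S (S s)) * r <= rho < 1 ->
    Cmod w <= 3 ^ (S s) / (1 - rho) * r ^ 3 /\ Rabs (Im w) <= 3 ^ (S (S s)) / (1 - rho) * r ^ 2 * Rabs (Im (qpar z)).
Proof.
  intros Hz. pose proof (qpar_lt1 z Hz) as Hq. set (q := qpar z) in *.
  pose proof (PSc_asum _ q (PSc_sig s) Hq) as Hs.
  exists (CSer (fun j => sig s (3 + j) * q ^ (3 + j))%C). split.
  - unfold F, Ev. fold q. rewrite (CSer_tail _ 3 Hs). f_equal. cbn [csum]. rewrite sig_1.
    replace (sig s 0) with (RtoC 0) by reflexivity. simpl Cpow. ring.
  - intros r rho Hr Hqr Hr1 Hrho.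
    assert (Hw0 : forall n, 0 <= Cmod (sig s n) <= INR n ^ S s) by (intros; split; [apply Cmod_ge_0 | apply sig_le]).
    assert (H43 : (4 / 3) ^ S s * r <= rho).
    { eapply Rle_trans; [|apply Hrho]. apply Rmult_le_compat_r; [lra|]. apply Rle_pow; [lra | lia]. }
    destruct (series_tail3 (fun n => Cmod (sig s n)) (S s) r rho ltac:(lra) (conj H43 (proj2 Hrho)) Hw0) as [Hex HS].
    split.
    + eapply Rle_trans; [apply (CSer_bound _ (fun j => r ^ 3 * (Cmod (sig s (3 + j)) * r ^ j)))|].
      * intros j. rewrite Cmod_mult, Cmod_pow. assert (Cmod q ^ (3 + j) <= r ^ (3 + j)) by (apply pow_incr; split; [apply Cmod_ge_0 | exact Hqr]).
        rewrite (pow_add r) in H. pose proof (Cmod_ge_0 (sig s (3 + j))).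
        apply Rle_trans with (Cmod (sig s (3 + j)) * (r ^ 3 * r ^ j)); [now apply Rmult_le_compat_l | right; ring].
      * now apply ex_series_scalR.
      * rewrite Series_scal_l, Rmult_comm. apply Rmult_le_compat_r; [apply pow_le; lra | exact HS].
    + assert (Hw1 : forall n, 0 <= INR n * Cmod (sig s n) <= INR n ^ S (S s)).
      { intros n. pose proof (pos_INR n). destruct (Hw0 n). split; [now apply Rmult_le_pos|].
        change (INR n ^ S (S s)) with (INR n * INR n ^ S s). now apply Rmult_le_compat_l. }
      destruct (series_tail3 (fun n => INR n * Cmod (sig s n)) (S (S s)) r rho ltac:(lra) Hrho Hw1) as [Hex2 HS2].
      assert (Hb : forall j, Rabs (Im (sig s (3 + j) * q ^ (3 + j))) <= (r ^ 2 * Rabs (Im q)) * (INR (3 + j) * Cmod (sig s (3 + j)) * r ^ j)).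
      { intros j. rewrite (C_real (sig s (3 + j))) at 1 by apply rser_sig. rewrite im_scal_l, Rabs_mult.
        pose proof (im_pow_bound q r (3 + j) Hr Hqr) as HI. pose proof (re_le_Cmod (sig s (3 + j))) as HR.
        apply (Rmult_le_reg_l r); [exact Hr|].
        replace (r * (Rabs (Re (sig s (3 + j))) * Rabs (Im (q ^ (3 + j))))) with (Rabs (Re (sig s (3 + j))) * (r * Rabs (Im (q ^ (3 + j))))) by ring.
        apply Rle_trans with (Cmod (sig s (3 + j)) * (INR (3 + j) * r ^ (3 + j) * Rabs (Im q))).
        - apply Rmult_le_compat; [apply Rabs_pos | apply Rmult_le_pos; [lra | apply Rabs_pos] | exact HR | exact HI].
        - right. rewrite pow_add. ring. }
      assert (HexR : ex_series (fun j => (r ^ 2 * Rabs (Im q)) * (INR (3 + j) * Cmod (sig s (3 + j)) * r ^ j))) by now apply ex_series_scalR.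
      change (Im (CSer (fun j => (sig s (3 + j) * q ^ (3 + j))%C))) with (Series (fun j => Im (sig s (3 + j) * q ^ (3 + j)))).
      eapply Rle_trans; [apply Series_Rabs, (ex_series_major _ _ (fun j => conj (Rabs_pos _) (Hb j)) HexR)|].
      eapply Rle_trans; [apply (Series_le _ _ (fun j => conj (Rabs_pos _) (Hb j)) HexR)|].
      rewrite Series_scal_l. replace (3 ^ S (S s) / (1 - rho) * r ^ 2 * Rabs (Im q)) with (r ^ 2 * Rabs (Im q) * (3 ^ S (S s) / (1 - rho))) by ring.
      apply Rmult_le_compat_l; [apply Rmult_le_pos; [apply pow2_ge_0 | apply Rabs_pos] | exact HS2].
Qed.

Lemma sig3_2 : sig 3 2 = RtoC 9.
Proof. unfold sig. simpl. apply C_ext; simpl; ring. Qed.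
Lemma sig5_2 : sig 5 2 = RtoC 33.
Proof. unfold sig. simpl. apply C_ext; simpl; ring. Qed.

Lemma q_small z : 0.866 <= Im z -> Cmod (qpar z) <= 0.00438.
Proof. intros H. rewrite Cmod_qpar. eapply Rle_trans; [apply (rq_mono _ _ H) | apply rq_866]. Qed.

(** The term 9 q^2 contributes 9 * 0.00438^2 to the modulus and the factor 18 * 0.00438 to the
    imaginary part; the tail from q^3 on makes up the rest. *)
Lemma sig3_est z : 0.866 <= Im z -> exists v, F (sig 3) z = (qpar z + v)%C /\
  Cmod v <= 0.00018 /\ Rabs (Im v) <= 0.0838 * Rabs (Im (qpar z)).
Proof.
  intros Hy. assert (Hz : in_H z) by (unfold in_H; lra). pose proof (q_small z Hy) as Hq.
  destruct (F_sig_split 3 z Hz) as (w & E & Hw). destruct (Hw 0.00438 0.02) as [H1 H2]; [lra | exact Hq | lra | lra|].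
  exists (sig 3 2 * qpar z ^ 2 + w)%C. split; [rewrite E; ring|]. rewrite sig3_2.
  pose proof (Cmod_ge_0 (qpar z)) as Hq0. split.
  - eapply Rle_trans; [apply Cmod_triangle|]. rewrite Cmod_mult, Cmod_pow, Cmod_Rp by lra.
    assert (Cmod (qpar z) ^ 2 <= 0.00438 ^ 2) by (apply pow_incr; lra). lra.
  - rewrite im_plus, im_scal_l. eapply Rle_trans; [apply Rabs_triang|]. rewrite Rabs_mult, (Rabs_pos_eq 9) by lra.
    pose proof (im_pow_bound (qpar z) 0.00438 2 ltac:(lra) Hq) as H3. replace (INR 2) with 2 in H3 by (simpl; ring).
    pose proof (Rabs_pos (Im (qpar z))). lra.
Qed.
Lemma sig5_est z : 0.866 <= Im z -> exists v, F (sig 5) z = (qpar z + v)%C /\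
  Cmod v <= 0.0007 /\ Rabs (Im v) <= 0.3345 * Rabs (Im (qpar z)).
Proof.
  intros Hy. assert (Hz : in_H z) by (unfold in_H; lra). pose proof (q_small z Hy) as Hq.
  destruct (F_sig_split 5 z Hz) as (w & E & Hw). destruct (Hw 0.00438 0.04) as [H1 H2]; [lra | exact Hq | lra | lra|].
  exists (sig 5 2 * qpar z ^ 2 + w)%C. split; [rewrite E; ring|]. rewrite sig5_2.
  pose proof (Cmod_ge_0 (qpar z)) as Hq0. split.
  - eapply Rle_trans; [apply Cmod_triangle|]. rewrite Cmod_mult, Cmod_pow, Cmod_Rp by lra.
    assert (Cmod (qpar z) ^ 2 <= 0.00438 ^ 2) by (apply pow_incr; lra). lra.
  - rewrite im_plus, im_scal_l. eapply Rle_trans; [apply Rabs_triang|]. rewrite Rabs_mult, (Rabs_pos_eq 33) by lra.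
    pose proof (im_pow_bound (qpar z) 0.00438 2 ltac:(lra) Hq) as H3. replace (INR 2) with 2 in H3 by (simpl; ring).
    pose proof (Rabs_pos (Im (qpar z))). lra.
Qed.

Lemma F_aff a c s z : PSc a -> in_H z -> a O = RtoC 1 -> (forall n, (1 <= n)%nat -> a n = (c * sig s n)%C) ->
  F a z = (1 + c * F (sig s) z)%C.
Proof.
  intros Ha Hz H0 H1. pose proof (qpar_lt1 z Hz) as Hq. unfold F.
  rewrite (Ev_ext a (padd pone (pscal c (sig s)))).
  - now rewrite Ev_add, Ev_scal, Ev_one by (exact Hq || apply PSc_one || (try apply PSc_scal; apply PSc_sig)).
  - intros [|n]; unfold padd, pone, pscal; [rewrite H0; change (sig s 0) with (RtoC 0); ring | rewrite H1 by lia; ring].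
Qed.
Lemma E4_0 : E4 O = RtoC 1.
Proof. unfold E4, padd, pscal, conv, D, E2. simpl. ring. Qed.
Lemma E6_0 : E6 O = RtoC 1.
Proof. unfold E6, padd, pscal, conv, D. cbn [csum Nat.sub]. rewrite E4_0.
  change (E2 0) with (RtoC 1). change (INR 0) with 0. ring. Qed.
Lemma F_E4_sig z : in_H z -> F E4 z = (1 + 240 * F (sig 3) z)%C.
Proof. intros Hz. apply F_aff; [apply PSc_E4 | exact Hz | apply E4_0 | intros; now apply E4_coef]. Qed.
Lemma F_E6_sig z : in_H z -> F E6 z = (1 + RtoC (-504) * F (sig 5) z)%C.
Proof. intros Hz. apply F_aff; [apply PSc_E6 | exact Hz | apply E6_0 | intros; now apply E6_coef]. Qed.

Lemma im_qpar_neg z : -(1/2) < Re z < 0 -> Im (qpar z) < 0.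
Proof.
  intros H. unfold qpar. simpl. pose proof PI_RGT_0.
  assert (sin (2 * PI * Re z) < 0) by (apply sin_lt_0_var; nra). pose proof (exp_pos (- (2 * PI * Im z))). nra.
Qed.

Lemma im_E4_neg z : 0.866 <= Im z -> -(1/2) < Re z < 0 -> Im (F E4 z) < 0.
Proof.
  intros Hy Hx. rewrite F_E4_sig by (unfold in_H; lra). destruct (sig3_est z Hy) as (v & -> & _ & Hv).
  pose proof (im_qpar_neg z Hx) as Hs. rewrite (Rabs_left (Im (qpar z))) in Hv by lra.
  apply Rabs_le_between in Hv. rewrite im_plus, im_RtoC, im_scal_l, im_plus. lra.
Qed.

(** The leading part (1 - 504 q)(1 + 240 conj(q)) has imaginary part -744 Im q > 0; the remaining
    contributions are multiples of |Im q| with total factor below 744. *)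
Lemma im_E6_E4 z : 0.866 <= Im z -> -(1/2) < Re z < 0 -> 0 < Im (F E6 z * Cconj (F E4 z)).
Proof.
  intros Hy Hx. assert (Hz : in_H z) by (unfold in_H; lra). rewrite F_E4_sig, F_E6_sig by exact Hz.
  destruct (sig3_est z Hy) as (v & -> & Hv & Hv'). destruct (sig5_est z Hy) as (w & -> & Hw & Hw').
  pose proof (im_qpar_neg z Hx) as Hs. pose proof (q_small z Hy) as Hq. set (q := qpar z) in *.
  rewrite (Rabs_left (Im q)) in Hv', Hw' by lra.
  pose proof (re_le_Cmod q) as R1. pose proof (re_le_Cmod v) as R2. pose proof (re_le_Cmod w) as R3.
  assert (E : Im ((1 + RtoC (-504) * (q + w)) * Cconj (1 + 240 * (q + v)))
    = -744 * Im q - 504 * Im w - 240 * Im v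
      - 120960 * (Im q * Re v + Im w * (Re q + Re v) - Im q * Re w - (Re q + Re w) * Im v)).
  { destruct q, v, w. simpl. ring. }
  rewrite E. set (s := - Im q) in *. replace (Im q) with (- s) in * by (unfold s; ring).
  assert (Hs0 : 0 < s) by lra.
  assert (B1 : Rabs (Im w * (Re q + Re v)) <= 0.3345 * s * 0.00456).
  { rewrite Rabs_mult. apply Rmult_le_compat; try apply Rabs_pos; [lra|]. eapply Rle_trans; [apply Rabs_triang | lra]. }
  assert (B2 : Rabs ((Re q + Re w) * Im v) <= 0.00508 * (0.0838 * s)).
  { rewrite Rabs_mult. apply Rmult_le_compat; try apply Rabs_pos; [eapply Rle_trans; [apply Rabs_triang | lra] | lra]. }
  assert (B3 : Rabs (- s * Re v) <= s * 0.00018).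
  { rewrite Rabs_mult, Rabs_Ropp, (Rabs_pos_eq s) by lra. apply Rmult_le_compat_l; lra. }
  assert (B4 : Rabs (- s * Re w) <= s * 0.0007).
  { rewrite Rabs_mult, Rabs_Ropp, (Rabs_pos_eq s) by lra. apply Rmult_le_compat_l; lra. }
  apply Rabs_le_between in B1, B2, B3, B4, Hv', Hw'. lra.
Qed.

(** * The level sets of j in the fundamental domain *)

(** Two forms of weight 12 whose coefficients of q^0 and q^1 agree. *)
Lemma disc_eq z : in_H z -> (F E4 z ^ 3 - F E6 z ^ 2)%C = (1728 * Delta z)%C.
Proof.
  intros Hz. pose proof PSc_E4 as P4. pose proof PSc_E6 as P6. pose proof PSc_eta as Pe.
  pose proof (PSc_conv _ _ P4 P4) as P44. pose proof (PSc_conv _ _ P4 P44) as P444. pose proof (PSc_conv _ _ P6 P6) as P66.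
  set (a := padd (conv E4 (conv E4 E4)) (pscal (RtoC (-1)) (conv E6 E6))).
  assert (Fa : forall z, in_H z -> F a z = (F E4 z ^ 3 - F E6 z ^ 2)%C).
  { intros x Hx. unfold a. rewrite F_padd, F_pscal, !F_conv by (try apply PSc_scal; assumption).
    replace (RtoC (-1)) with (- (1))%C by (rewrite <- RtoC_opp; reflexivity). simpl. ring. }
  assert (Fb : forall z, in_H z -> F (pscal 1728 (pup 1 eta)) z = (1728 * Delta z)%C).
  { intros x Hx. rewrite F_pscal, F_pup, Delta_eta by (try apply PSc_pup; assumption). simpl. ring. }
  rewrite <- Fa, <- Fb by exact Hz.
  apply (eq_forms 12 1); [now exists 6%nat | lia | | | | | | exact Hz].
  - apply PSc_add; [exact P444 | now apply PSc_scal].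
  - apply PSc_scal, PSc_pup, Pe.
  - intros x Hx. rewrite !Fa, E4_S, E6_S by (exact Hx || now apply in_H_inv). simpl. ring.
  - intros x Hx. rewrite !Fb, Delta_S by (exact Hx || now apply in_H_inv). ring.
  - assert (H41 : E4 1 = RtoC 240) by (rewrite E4_coef, sig_1 by lia; ring).
    assert (H61 : E6 1 = RtoC (-504)) by (rewrite E6_coef, sig_1 by lia; ring).
    intros n Hn. unfold a, padd, pscal, pup, conv.
    destruct n as [|[|n]]; [| |lia]; cbn [csum Nat.sub Nat.ltb Nat.leb];
      rewrite ?E4_0, ?E6_0, ?H41, ?H61; change (eta 0) with (RtoC 1); apply C_ext; simpl; ring.
Qed.

Lemma arc_derive f th l : cder f (eit th) l ->
  is_derive (fun t => Re (f (eit t))) th (Re (l * (Ci * eit th))) /\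
  is_derive (fun t => Im (f (eit t))) th (Im (l * (Ci * eit th))).
Proof.
  intros H. assert (HG : cder (fun w => f (cexp (Ci * w))) th (l * (Ci * eit th))).
  { eapply cder_eqv.
    - apply (cder_comp f (fun w => cexp (Ci * w)) th l); [rewrite <- eit_cexp; exact H|].
      apply (cder_comp cexp (fun w => Ci * w)%C); [apply cder_cexp | apply cder_scal, cder_id].
    - rewrite <- eit_cexp. ring. }
  split.
  - eapply is_derive_ext; [|exact (cder_re_derive _ _ _ HG)]. intros t. cbv beta. now rewrite eit_cexp.
  - eapply is_derive_ext; [|exact (cder_im_derive _ _ _ HG)]. intros t. cbv beta. now rewrite eit_cexp.
Qed.

Lemma arc_continuity f th l : cder f (eit th) l -> continuity_pt (fun t => Re (f (eit t))) th.
Proof.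
  intros H. apply derivable_continuous_pt. exists (Re (l * (Ci * eit th))). apply is_derive_Reals, (arc_derive f th l H).
Qed.

Lemma neg_on f a b : a <= b -> (forall t, a <= t <= b -> continuity_pt f t) -> f a < 0 ->
  (forall t, a <= t <= b -> f t <> 0) -> f b < 0.
Proof.
  intros Hab Hc Ha Hn. destruct (Rlt_or_le (f b) 0) as [Hb|Hb]; [assumption|]. exfalso.
  assert (Hb' : 0 < f b) by (assert (f b <> 0) by (apply Hn; lra); lra).
  assert (Hlt : a < b) by (destruct Hab as [Hab| ->]; [assumption | lra]).
  destruct (Ranalysis5.IVT_interv f a b Hc Hlt Ha Hb') as (t & Ht & E). now apply (Hn t).
Qed.

Lemma eit_PI2 : eit (PI / 2) = Ci.
Proof. unfold eit. now rewrite cos_PI2, sin_PI2. Qed.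

Definition oarc (th : R) : Prop := PI / 2 < th < 2 * PI / 3.

Lemma oarc_range th : oarc th -> -(1/2) < cos th < 0 /\ 0.866 <= sin th /\ in_H (eit th).
Proof.
  intros H. pose proof PI_RGT_0 as Hpi. unfold oarc in H. destruct (arc_range th) as [_ Hs]; [lra|].
  split; [|split; [exact Hs | apply arc_H; lra]]. split.
  - replace (-(1/2)) with (cos (2 * (PI / 3))) by (rewrite cos_2PI3; field). apply cos_decreasing_1; lra.
  - apply cos_lt_0; lra.
Qed.

Lemma E4_neq0_int z : 0.866 <= Im z -> -(1/2) < Re z < 0 -> F E4 z <> RtoC 0.
Proof. intros Hy Hx E. pose proof (im_E4_neg z Hy Hx) as H. rewrite E in H. simpl in H. lra. Qed.
Lemma E6_neq0_int z : 0.866 <= Im z -> -(1/2) < Re z < 0 -> F E6 z <> RtoC 0.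
Proof. intros Hy Hx E. pose proof (im_E6_E4 z Hy Hx) as H. rewrite E, Cmult_0_l in H. simpl in H. lra. Qed.

Lemma E4_axis_pos (y : R) : 0 < y -> exists x, 1 <= x /\ F E4 (Ci * y) = RtoC x.
Proof.
  intros Hy. destruct (F_axis_pos (sig 3) y (pser_sig 3) (PSc_sig 3) Hy) as (x & Hx & E).
  exists (1 + 240 * x). split; [lra|]. rewrite F_E4_sig, E, RtoC_plus, RtoC_mult by now apply in_H_axis. reflexivity.
Qed.

(** The function is real on the arc, equals -E4(i) < 0 at its upper end, and cannot change sign
    because E4 has no zero on the open arc. *)
Lemma z2E4_neg th : PI / 2 <= th < 2 * PI / 3 -> exists a, a < 0 /\ (eit th ^ 2 * F E4 (eit th))%C = RtoC a.
Proof.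
  intros H. pose proof PI_RGT_0 as Hpi. exists (Re (eit th ^ 2 * F E4 (eit th))).
  assert (Hreal : forall t, PI / 2 <= t <= th -> Im (eit t ^ 2 * F E4 (eit t)) = 0).
  { intros t Ht. apply (arc_real (F E4) 2); [apply F_refl, rser_E4 | apply E4_S, arc_H; lra]. }
  split; [|apply C_real, Hreal; lra].
  assert (H0 : Re (eit (PI / 2) ^ 2 * F E4 (eit (PI / 2))) < 0).
  { rewrite eit_PI2. destruct (E4_axis_pos 1 ltac:(lra)) as (x & Hx & E). rewrite Cmult_1_r in E. rewrite E. simpl. lra. }
  apply (neg_on (fun t => Re (eit t ^ 2 * F E4 (eit t))) (PI / 2) th); [lra | | exact H0 |].
  - intros t Ht. assert (Ht' : in_H (eit t)) by (apply arc_H; lra).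
    apply (arc_continuity (fun z => z ^ 2 * F E4 z)%C t (INR 2 * eit t ^ 1 * 1 * F E4 (eit t) + eit t ^ 2 * (tpi * F (D E4) (eit t)))).
    apply cder_mult; [apply (cder_pow (fun z => z) _ 1 1), cder_id | apply cder_F; [apply PSc_E4 | exact Ht']].
  - intros t Ht E. destruct (Req_dec t (PI / 2)) as [-> |Hne]; [lra|].
    destruct (oarc_range t ltac:(unfold oarc; lra)) as (Hc & Hs & Hh).
    pose proof (C_real _ (Hreal t Ht)) as ER. rewrite E in ER.
    apply (Cmult_neq_0 (eit t ^ 2) (F E4 (eit t))); [apply Cpow_nz, eit_neq0 | apply E4_neq0_int; simpl; lra | exact ER].
Qed.

Lemma z6D_neg th : PI / 2 <= th <= 2 * PI / 3 -> exists d, d < 0 /\ (eit th ^ 6 * Delta (eit th))%C = RtoC d.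
Proof.
  intros H. pose proof PI_RGT_0 as Hpi. exists (Re (eit th ^ 6 * Delta (eit th))).
  split; [|apply C_real, Delta_arc_real; lra].
  assert (H0 : Re (eit (PI / 2) ^ 6 * Delta (eit (PI / 2))) < 0).
  { rewrite eit_PI2. pose proof (Delta_axis 1 ltac:(lra)) as E. rewrite Cmult_1_r in E. rewrite E.
    pose proof (exp_pos (- (2 * PI * 1) - 24 * Re (F lg (Ci * 1)))) as Hp. fold (dl 1) in Hp. simpl. lra. }
  apply (neg_on (fun t => Re (eit t ^ 6 * Delta (eit t))) (PI / 2) th); [lra | | exact H0 |].
  - intros t Ht. assert (Ht' : in_H (eit t)) by (apply arc_H; lra).
    apply (arc_continuity (fun z => z ^ 6 * Delta z)%C t (INR 6 * eit t ^ 5 * 1 * Delta (eit t) + eit t ^ 6 * (tpi * F E2 (eit t) * Delta (eit t)))).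
    apply cder_mult; [apply (cder_pow (fun z => z) _ 1 5), cder_id | now apply cder_Delta].
  - intros t Ht E. pose proof (C_real _ (Delta_arc_real t ltac:(lra))) as ER. rewrite E in ER.
    apply (Cmult_neq_0 (eit t ^ 6) (Delta (eit t))); [apply Cpow_nz, eit_neq0 | apply Delta_neq0 | exact ER].
Qed.

(** z^2 E4, z^3 E6 and z^6 Delta are real numbers a, b, d with a, d < 0 and a^3 - b^2 = 1728 d, so j
    = a^3 / d = 1728 + b^2 / d. Further E4 = a / z^2 and cos(2 th) < 0 give Re E4 > 0, which later
    pins down the branch of the argument. *)
Lemma arc_J th : oarc th -> exists x, 0 < x < 1728 /\ (F E4 (eit th) ^ 3)%C = (x * Delta (eit th))%C /\ 0 < Re (F E4 (eit th)).
Proof.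
  intros Ho. pose proof (oarc_range th Ho) as (Hc & Hs & Hh). unfold oarc in Ho. pose proof (eit_neq0 th) as N.
  destruct (z2E4_neg th ltac:(lra)) as (a & Ha & Ea). destruct (z6D_neg th ltac:(lra)) as (d & Hd & Ed).
  assert (HI6 : Im (eit th ^ 3 * F E6 (eit th)) = 0)
    by (apply (arc_real (F E6) 3); [apply F_refl, rser_E6 | now apply E6_S]).
  pose proof (C_real _ HI6) as E6r. set (b := Re (eit th ^ 3 * F E6 (eit th))) in *.
  assert (Hb : b <> 0).
  { intros E0. rewrite E0 in E6r. apply (Cmult_neq_0 (eit th ^ 3) (F E6 (eit th))); [now apply Cpow_nz | apply E6_neq0_int; simpl; lra | exact E6r]. }
  pose proof (disc_eq _ Hh) as ED. set (z := eit th) in *.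
  assert (Nd : RtoC d <> RtoC 0) by (intros E0; apply RtoC_inj in E0; lra).
  assert (EJ : (F E4 z ^ 3)%C = (RtoC (a ^ 3 / d) * Delta z)%C).
  { apply (Cmult_cancel_l (z ^ 6)); [now apply Cpow_nz|].
    transitivity ((z ^ 2 * F E4 z) ^ 3)%C; [simpl; ring|]. rewrite Ea.
    transitivity (RtoC (a ^ 3 / d) * (z ^ 6 * Delta z))%C; [|ring]. rewrite Ed, <- RtoC_pow, <- RtoC_mult. f_equal. field. lra. }
  assert (EB : a ^ 3 - b ^ 2 = 1728 * d).
  { apply RtoC_inj. rewrite RtoC_minus, !RtoC_pow, <- Ea, <- E6r, RtoC_mult, <- Ed.
    transitivity (z ^ 6 * (F E4 z ^ 3 - F E6 z ^ 2))%C; [simpl; ring|]. rewrite ED. ring. }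
  exists (a ^ 3 / d). split; [|split; [exact EJ|]].
  - assert (Hid : / d < 0) by (now apply Rinv_lt_0_compat). assert (Hb2 : 0 < b ^ 2) by nra.
    assert (Ha3 : a ^ 3 < 0) by (assert (0 < a ^ 2) by nra; simpl in *; nra). split; [unfold Rdiv; nra|].
    replace (a ^ 3 / d) with (1728 + b ^ 2 * / d) by (replace (a ^ 3) with (1728 * d + b ^ 2) by lra; field; lra). nra.
  - assert (E4v : F E4 z = (RtoC a * / z ^ 2)%C).
    { apply (Cmult_cancel_l (z ^ 2)); [now apply Cpow_nz|]. rewrite Ea. field. exact N. }
    rewrite E4v, re_scal_l. unfold z. rewrite eit_pow, <- eit_conj, re_conj. simpl Re.
    replace (1 + 1) with 2 by ring. rewrite cos_2a.
    assert (H2 : cos th * cos th - sin th * sin th < 0) by nra. nra.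
Qed.

(** A value taken twice gives, by the mean value theorem, a critical point of Re j along the arc. Im
    j vanishes identically there, so j' would be 0, but j' = - tpi E4^2 E6 / Delta has no zero on
    the open arc. *)
Lemma arc_inj t1 t2 (x : R) : oarc t1 -> oarc t2 -> t1 < t2 ->
  (F E4 (eit t1) ^ 3)%C = (x * Delta (eit t1))%C -> (F E4 (eit t2) ^ 3)%C = (x * Delta (eit t2))%C -> False.
Proof.
  intros H1 H2 Hlt E1 E2. set (jj := fun z => (F E4 z ^ 3 * iDelta z)%C).
  assert (Hjx : forall t, (F E4 (eit t) ^ 3)%C = (x * Delta (eit t))%C -> jj (eit t) = RtoC x).
  { intros t E. unfold jj. rewrite E. transitivity (x * (Delta (eit t) * iDelta (eit t)))%C; [ring|]. rewrite Delta_inv. ring. }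
  assert (Hd : forall z, in_H z -> cder jj z (- tpi * F E4 z ^ 2 * F E6 z * iDelta z)).
  { intros z Hz. eapply cder_eqv.
    - apply cder_mult; [apply (cder_pow (F E4) z (tpi * F (D E4) z) 2), cder_F; [apply PSc_E4 | exact Hz] | now apply cder_iDelta].
    - rewrite F_E6 by exact Hz. replace (INR 3) with 3 by (simpl; ring). simpl. ring. }
  assert (Ho : forall t, t1 <= t <= t2 -> oarc t) by (unfold oarc in *; intros; lra).
  set (l := fun t => (- tpi * F E4 (eit t) ^ 2 * F E6 (eit t) * iDelta (eit t) * (Ci * eit t))%C).
  assert (HD : forall t, t1 <= t <= t2 -> is_derive (fun t => Re (jj (eit t))) t (Re (l t)) /\ is_derive (fun t => Im (jj (eit t))) t (Im (l t))).
  { intros t Ht. apply arc_derive, Hd, oarc_range, Ho, Ht. }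
  destruct (MVT_gen (fun t => Re (jj (eit t))) t1 t2 (fun t => Re (l t))) as (c & Hc & EM).
  - intros t Ht. rewrite Rmin_left, Rmax_right in Ht by lra. apply HD. lra.
  - intros t Ht. rewrite Rmin_left, Rmax_right in Ht by lra. apply derivable_continuous_pt. exists (Re (l t)). apply is_derive_Reals, HD, Ht.
  - rewrite Rmin_left, Rmax_right in Hc by lra. rewrite (Hjx _ E1), (Hjx _ E2) in EM.
    assert (R0 : Re (l c) = 0) by nra.
    assert (I0 : Im (l c) = 0).
    { pose proof (proj2 (HD c Hc)) as HDc. pose proof (is_derive_unique _ _ _ HDc) as HU. rewrite <- HU.
      apply is_derive_unique. apply (is_derive_ext_loc (fun _ => 0)); [|apply (is_derive_const 0)].
      pose proof (Ho c Hc) as Hoc. unfold oarc in Hoc.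
      assert (He : 0 < Rmin (c - PI / 2) (2 * PI / 3 - c)) by (apply Rmin_glb_lt; lra).
      exists (mkposreal _ He). intros t Ht. unfold ball in Ht; simpl in Ht. unfold AbsRing_ball, abs, minus, plus, opp in Ht; simpl in Ht.
      apply Rmin_Rgt_l in Ht. destruct Ht as [Ht1 Ht2]. apply Rabs_def2 in Ht1, Ht2.
      destruct (arc_J t) as (xt & _ & Et & _); [unfold oarc; lra|].
      unfold jj. rewrite Et. replace (xt * Delta (eit t) * iDelta (eit t))%C with (xt * (Delta (eit t) * iDelta (eit t)))%C by ring.
      rewrite Delta_inv, Cmult_1_r. reflexivity. }
    assert (L0 : l c = RtoC 0) by (now apply C_ext).
    destruct (oarc_range c (Ho c Hc)) as (Hcc & Hsc & _).
    assert (Ni : Ci <> RtoC 0) by (intros E0; apply (f_equal Im) in E0; simpl in E0; lra).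
    assert (Nid : iDelta (eit c) <> RtoC 0).
    { intros E0. pose proof (Delta_inv (eit c)) as Hi. rewrite E0, Cmult_0_r in Hi. apply RtoC_inj in Hi. lra. }
    revert L0. unfold l. repeat apply Cmult_neq_0.
    + intros E0. apply tpi_neq0. replace tpi with (- - tpi)%C by ring. rewrite E0. ring.
    + apply E4_neq0_int; simpl; lra.
    + apply E4_neq0_int; simpl; lra.
    + intros E0. apply RtoC_inj in E0. lra.
    + apply E6_neq0_int; simpl; lra.
    + exact Nid.
    + exact Ni.
    + apply eit_neq0.
Qed.

(** In the lower half-plane atan(Re w / -Im w) - PI / 2 is a smooth branch of the argument with
    values in (-PI, 0). *)
Lemma polar_neg w : Im w < 0 -> w = (Cmod w * cexp (Ci * (atan (Re w / - Im w) - PI / 2)%R))%C.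
Proof.
  intros Hw. destruct w as [X Y']. simpl Im in *. simpl Re. set (Y := - Y') in *.
  assert (HY : 0 < Y) by (unfold Y; lra).
  assert (Hm : Cmod (X, Y') = Y * sqrt (1 + (X / Y)²)).
  { unfold Cmod. simpl fst; simpl snd. rewrite <- (sqrt_pow2 Y) at 1 by lra. rewrite <- sqrt_mult by (unfold Rsqr; nra).
    f_equal. unfold Rsqr, Y. field. unfold Y in HY. lra. }
  pose proof (sqrt_lt_R0 (1 + (X / Y)²) ltac:(pose proof (Rle_0_sqr (X / Y)); lra)) as Hs.
  rewrite <- eit_cexp. unfold eit. replace (atan (X / Y) - PI / 2) with (- (PI / 2 - atan (X / Y))) by ring.
  rewrite cos_neg, sin_neg, cos_shift, sin_shift, sin_atan, cos_atan, Hm.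
  assert (EY : Y' = - Y) by (unfold Y; ring). generalize dependent (sqrt (1 + (X / Y)²)). intros S _ HS.
  rewrite EY. apply C_ext; simpl; field; lra.
Qed.

Lemma angle_zero A : -(2 * PI) < A < 2 * PI -> sin A = 0 -> 0 < cos A -> A = 0.
Proof.
  intros HA Hs Hc. pose proof PI_RGT_0 as Hpi.
  assert (Hpos : forall B, 0 < B < 2 * PI -> sin B = 0 -> 0 < cos B -> False).
  { intros B HB HsB HcB. destruct (Rtotal_order B PI) as [Hl|[-> |Hg]].
    - pose proof (sin_gt_0 B). lra.
    - rewrite cos_PI in HcB. lra.
    - pose proof (sin_lt_0 B). lra. }
  destruct (Rtotal_order A 0) as [Hl|[-> |Hg]]; [exfalso| reflexivity | exfalso; apply (Hpos A); lra].
  apply (Hpos (- A)); [lra | rewrite sin_neg; lra | rewrite cos_neg; lra].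
Qed.

Section Ray.
Context (x : R) (Hx : -(1/2) < x < 0).
Let P (y : R) : C := (x + Ci * y)%C.

Lemma P_re y : Re (P y) = x. Proof. unfold P. simpl. ring. Qed.
Lemma P_im y : Im (P y) = y. Proof. unfold P. simpl. ring. Qed.

(** A continuous branch of arg j = 3 arg E4 - arg Delta along the line; the argument of Delta is the
    imaginary part of its exponent. *)
Definition argj (y : R) : R :=
  3 * (atan (Re (F E4 (P y)) / - Im (F E4 (P y))) - PI / 2) - Im (tpi * P y - 24 * F lg (P y)).

Lemma ray_derive f y l : cder f (P y) l ->
  is_derive (fun t => Re (f (P t))) y (Re (l * Ci)) /\ is_derive (fun t => Im (f (P t))) y (Im (l * Ci)).
Proof.
  intros H. assert (HG : cder (fun w => f (x + Ci * w)%C) y (l * Ci)).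
  { apply (cder_comp f (fun w => x + Ci * w)%C y l); [exact H|].
    eapply cder_eqv; [apply cder_plus; [apply cder_const | apply cder_scal, cder_id] | ring]. }
  split; [exact (cder_re_derive _ _ _ HG) | exact (cder_im_derive _ _ _ HG)].
Qed.

(** By Ramanujan's equations the logarithmic derivative of j in y is 2 PI E6 / E4; its imaginary
    part is the derivative of the argument. *)
Lemma argj_derive y : 0.866 <= y ->
  is_derive argj y (2 * PI * (Im (F E6 (P y) * Cconj (F E4 (P y))) / Cmod (F E4 (P y)) ^ 2)).
Proof.
  intros Hy. assert (HP : in_H (P y)) by (unfold in_H; rewrite P_im; lra).
  pose proof (im_E4_neg (P y) ltac:(rewrite P_im; lra) ltac:(rewrite P_re; exact Hx)) as HI.
  destruct (ray_derive (F E4) y _ (cder_F _ _ PSc_E4 HP)) as [HR4 HI4].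
  destruct (ray_derive _ y _ (cder_arg _ HP)) as [_ HA].
  unfold argj. set (X := fun t => Re (F E4 (P t))) in *. set (Y := fun t => Im (F E4 (P t))) in *.
  assert (HY0 : Y y < 0) by exact HI.
  evar (dd : R). assert (HD : is_derive (fun t => 3 * (atan (X t / - Y t) - PI / 2) - Im (tpi * P t - 24 * F lg (P t))) y dd).
  { apply (is_derive_minus (fun t => 3 * (atan (X t / - Y t) - PI / 2))); [|exact HA].
    apply (is_derive_scal (fun t => atan (X t / - Y t) - PI / 2)).
    apply (is_derive_minus (fun t => atan (X t / - Y t)) (fun _ => PI / 2)); [|apply is_derive_const].
    apply (is_derive_comp atan (fun t => X t / - Y t)).
    - apply is_derive_Reals, derivable_pt_lim_atan.
    - apply (is_derive_div X (fun t => - Y t)); [exact HR4 | apply (is_derive_opp Y); exact HI4 | lra]. }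
  match goal with |- is_derive _ _ ?v => replace v with dd; [exact HD|] end. unfold dd.
  rewrite (F_E6 (P y) HP). change (X y) with (Re (F E4 (P y))). change (Y y) with (Im (F E4 (P y))) in HY0 |- *.
  destruct (F E4 (P y)) as [a b], (F E2 (P y)) as [e f], (F (D E4) (P y)) as [c d]. unfold tpi. simpl in HY0 |- *.
  unfold Cmod, minus, plus, opp, scal, mult, zero; simpl. unfold mult; simpl.
  replace (sqrt (a * (a * 1) + b * (b * 1)) * (sqrt (a * (a * 1) + b * (b * 1)) * 1)) with (a ^ 2 + b ^ 2)
    by (rewrite <- Rmult_assoc, (Rmult_1_r (_ * _)), sqrt_sqrt by nra; ring).
  field. split; nra.
Qed.

Lemma ray_angle y (x0 : R) : 0.866 <= y -> 0 < x0 -> (F E4 (P y) ^ 3)%C = (x0 * Delta (P y))%C ->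
  sin (argj y) = 0 /\ 0 < cos (argj y).
Proof.
  intros Hy Hx0 E. pose proof (im_E4_neg (P y) ltac:(rewrite P_im; lra) ltac:(rewrite P_re; exact Hx)) as HI.
  pose proof (polar_neg _ HI) as HP. unfold argj.
  set (al := atan (Re (F E4 (P y)) / - Im (F E4 (P y))) - PI / 2) in *.
  set (m := Cmod (F E4 (P y))) in *. unfold Delta in E. set (W := (tpi * P y - 24 * F lg (P y))%C) in *.
  assert (Hm : 0 < m). { unfold m. apply Cmod_gt_0. intros E0. rewrite E0 in HI. simpl in HI. lra. }
  assert (EQ : (RtoC (m ^ 3) * cexp (Ci * (3 * al - Im W)%R))%C = RtoC (x0 * exp (Re W))).
  { assert (HW : cexp W = (RtoC (exp (Re W)) * cexp (Ci * Im W))%C).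
    { rewrite <- eit_cexp. unfold cexp, eit. apply C_ext; simpl; ring. }
    assert (H1 : (cexp (Ci * Im W) * cexp (Ci * (3 * al - Im W)%R))%C = (cexp (Ci * al) ^ 3)%C).
    { rewrite <- !eit_cexp. rewrite eit_pow. unfold eit.
      replace (INR 3 * al) with (Im W + (3 * al - Im W)) by (simpl; ring). rewrite cos_plus, sin_plus. apply C_ext; simpl; ring. }
    assert (N : cexp (Ci * Im W) <> RtoC 0) by (rewrite <- eit_cexp; apply eit_neq0).
    apply (Cmult_cancel_l _ _ _ N).
    transitivity (RtoC (m ^ 3) * (cexp (Ci * Im W) * cexp (Ci * (3 * al - Im W)%R)))%C; [ring|]. rewrite H1.
    transitivity ((m * cexp (Ci * al)) ^ 3)%C; [rewrite RtoC_pow; simpl; ring|]. rewrite <- HP, E, HW, RtoC_mult. ring. }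
  rewrite <- eit_cexp in EQ. unfold eit in EQ. pose proof (f_equal Re EQ) as ER. pose proof (f_equal Im EQ) as EI.
  rewrite re_scal_l, re_RtoC in ER. rewrite im_scal_l, im_RtoC in EI. change (m ^ 3 * cos (3 * al - Im W) = x0 * exp (Re W)) in ER. change (m ^ 3 * sin (3 * al - Im W) = 0) in EI.
  pose proof (exp_pos (Re W)) as He. assert (Hm3 : 0 < m ^ 3) by now apply pow_lt.
  split; [apply (Rmult_eq_reg_l (m ^ 3)) | apply (Rmult_lt_reg_l (m ^ 3))]; nra.
Qed.

(** arg E4 lies in (-PI, 0), -2 PI x in (0, PI), and 24 Im lg has modulus at most 0.24. For the
    lower bound, Re E4 > 0 places arg E4 in (-PI / 2, 0). *)
Lemma argj_lt y : 0.866 <= y -> argj y < 2 * PI /\ (0 < Re (F E4 (P y)) -> -(2 * PI) < argj y).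
Proof.
  intros Hy. pose proof (lg_bound (P y) 0.866 ltac:(lra) ltac:(rewrite P_im; lra)) as HL.
  pose proof rq_866 as Hr. pose proof (rq_range 0.866 ltac:(lra)) as Hr0.
  assert (Hb : rq 0.866 / (1 - rq 0.866) ^ 2 <= 0.01).
  { apply (Rmult_le_reg_r ((1 - rq 0.866) ^ 2)); [nra|]. unfold Rdiv. rewrite Rmult_assoc, Rinv_l by nra. nra. }
  pose proof (im_le_Cmod (F lg (P y))) as Hi. apply Rabs_le_between in Hi.
  pose proof (atan_bound (Re (F E4 (P y)) / - Im (F E4 (P y)))) as Ha.
  assert (EI : Im (tpi * P y - 24 * F lg (P y)) = 2 * PI * x - 24 * Im (F lg (P y))).
  { unfold P, tpi. simpl. ring. }
  pose proof PI_lo as Hp. unfold argj. rewrite EI. split; [nra|]. intros HR.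
  assert (Hat : 0 < atan (Re (F E4 (P y)) / - Im (F E4 (P y)))).
  { rewrite <- atan_0. apply atan_increasing. apply Rdiv_lt_0_compat; [exact HR|].
    pose proof (im_E4_neg (P y) ltac:(rewrite P_im; lra) ltac:(rewrite P_re; exact Hx)). lra. }
  nra.
Qed.
End Ray.

Lemma on_circle (x y : R) : x ^ 2 + y ^ 2 = 1 -> 0 < y -> -(1/2) <= x <= 0 ->
  (x, y) = eit (acos x) /\ PI / 2 <= acos x <= 2 * PI / 3 /\ (-(1/2) < x < 0 -> oarc (acos x)).
Proof.
  intros H Hy Hx. pose proof PI_RGT_0 as Hpi. pose proof (acos_bound x) as Hb.
  pose proof (cos_acos x ltac:(lra)) as Hc. pose proof (sin_acos x ltac:(lra)) as Hs.
  assert (Hs' : sin (acos x) = y).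
  { rewrite Hs. replace (1 - x²) with (y²) by (unfold Rsqr; lra). apply sqrt_Rsqr. lra. }
  split; [unfold eit; now rewrite Hc, Hs'|].
  assert (H23 : cos (2 * PI / 3) = -(1/2)) by (replace (2 * PI / 3) with (2 * (PI / 3)) by field; rewrite cos_2PI3; field).
  split.
  - split.
    + destruct (Rle_or_lt (PI / 2) (acos x)) as [h|h]; [exact h|].
      assert (0 < cos (acos x)) by (apply cos_gt_0; lra). lra.
    + destruct (Rle_or_lt (acos x) (2 * PI / 3)) as [h|h]; [exact h|].
      assert (cos (acos x) < cos (2 * PI / 3)) by (apply cos_decreasing_1; lra). lra.
  - intros Hx'. split.
    + destruct (Rlt_or_le (PI / 2) (acos x)) as [h|h]; [exact h|].
      assert (0 <= cos (acos x)) by (apply cos_ge_0; lra). lra.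
    + destruct (Rlt_or_le (acos x) (2 * PI / 3)) as [h|h]; [exact h|].
      assert (cos (acos x) <= cos (2 * PI / 3)).
      { destruct h as [h|h]; [left; apply cos_decreasing_1; lra | rewrite h; lra]. } lra.
Qed.

Lemma no_J_interior (x y x0 : R) : -(1/2) < x < 0 -> 0 < y -> 1 < x ^ 2 + y ^ 2 -> 0 < x0 ->
  (F E4 (x + Ci * y) ^ 3)%C = (x0 * Delta (x + Ci * y))%C -> False.
Proof.
  intros Hx Hy Hr Hx0 E. set (y1 := sqrt (1 - x ^ 2)).
  assert (Hy1 : y1 ^ 2 = 1 - x ^ 2) by (apply pow2_sqrt; nra).
  assert (Hp1 : 0 <= y1) by apply sqrt_pos.
  assert (H866 : 0.866 <= y1) by (apply Rnot_lt_le; intros h; nra).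
  assert (Hlt : y1 < y) by nra.
  destruct (on_circle x y1 ltac:(lra) ltac:(lra) ltac:(lra)) as (Ez & _ & Ho). specialize (Ho Hx).
  destruct (arc_J _ Ho) as (x1 & Hx1 & E1 & HR). rewrite <- Ez in E1, HR.
  replace (x, y1) with (x + Ci * y1)%C in E1, HR by (apply C_ext; simpl; ring).
  destruct (ray_angle x Hx y1 x1 H866 ltac:(lra) E1) as [S1 C1].
  destruct (ray_angle x Hx y x0 ltac:(lra) Hx0 E) as [S0 C0].
  pose proof (argj_lt x Hx y1 H866) as [A1 B1]. specialize (B1 HR).
  pose proof (argj_lt x Hx y ltac:(lra)) as [A0 _].
  pose proof (angle_zero _ (conj B1 A1) S1 C1) as Z1.
  destruct (MVT_gen (argj x) y1 y (fun y => 2 * PI * (Im (F E6 (x + Ci * y) * Cconj (F E4 (x + Ci * y))) / Cmod (F E4 (x + Ci * y)) ^ 2))) as (c & Hc & EM).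
  - intros t Ht. rewrite Rmin_left, Rmax_right in Ht by lra. apply (argj_derive x Hx). lra.
  - intros t Ht. rewrite Rmin_left, Rmax_right in Ht by lra. apply derivable_continuous_pt.
    eexists. apply is_derive_Reals, (argj_derive x Hx). lra.
  - rewrite Rmin_left, Rmax_right in Hc by lra.
    pose proof (im_E6_E4 (x + Ci * c) ltac:(simpl; lra) ltac:(simpl; lra)) as Hi.
    pose proof (E4_neq0_int (x + Ci * c) ltac:(simpl; lra) ltac:(simpl; lra)) as Hn. apply Cmod_gt_0 in Hn.
    assert (Hpos : 0 < Im (F E6 (x + Ci * c) * Cconj (F E4 (x + Ci * c))) / Cmod (F E4 (x + Ci * c)) ^ 2)
      by (apply Rdiv_lt_0_compat; [exact Hi | nra]).
    pose proof PI_RGT_0 as Hpi. cbv beta in EM. rewrite Z1 in EM.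
    rewrite Rminus_0_r in EM. assert (HA : 0 < argj x y) by (rewrite EM; apply Rmult_lt_0_compat; [apply Rmult_lt_0_compat; [lra | exact Hpos] | lra]).
    pose proof (angle_zero (argj x y) ltac:(lra) S0 C0). lra.
Qed.

(* On the line Re z = -1/2 the function E4 / eta^8 is, up to a constant, real with derivative E6 / eta^8 > 0. *)
Definition E4w (z : C) : C := (F E4 z * cexp (- (/ 3) * (tpi * z + RtoC PI * Ci - 24 * F lg z)))%C.

Lemma cder_E4w z : in_H z ->
  cder E4w z (- tpi * / 3 * F E6 z * cexp (- (/ 3) * (tpi * z + RtoC PI * Ci - 24 * F lg z))).
Proof.
  intros Hz. unfold E4w. eapply cder_eqv.
  - apply cder_mult; [apply cder_F; [apply PSc_E4 | exact Hz]|].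
    apply (cder_comp cexp); [apply cder_cexp|]. apply (cder_scal _ (fun z => tpi * z + RtoC PI * Ci - 24 * F lg z)%C z (tpi * F E2 z)).
    replace (fun z => tpi * z + RtoC PI * Ci - 24 * F lg z)%C with (fun z => (tpi * z - 24 * F lg z) + RtoC PI * Ci)%C
      by (apply functional_extensionality; intros w; ring).
    eapply cder_eqv; [apply cder_plus; [now apply cder_arg | apply cder_const] | ring].
  - rewrite (F_E6 z Hz). field.
Qed.

Lemma half_line_refl (y : R) : (- Cconj (RtoC (-(1/2)) + Ci * y) = (RtoC (-(1/2)) + Ci * y) + 1)%C.
Proof. apply C_ext; simpl; field. Qed.

Lemma half_line_real a (y : R) : rser a -> F a (RtoC (-(1/2)) + Ci * y) = RtoC (Re (F a (RtoC (-(1/2)) + Ci * y))).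
Proof.
  intros H. apply C_real. pose proof (F_refl a (RtoC (-(1/2)) + Ci * y) H) as E.
  rewrite half_line_refl, F_T in E. apply (f_equal Im) in E. rewrite im_conj in E. lra.
Qed.

Lemma half_line_arg (y : R) : (- (/ 3) * (tpi * (RtoC (-(1/2)) + Ci * y) + RtoC PI * Ci - 24 * F lg (RtoC (-(1/2)) + Ci * y)))%C =
  RtoC ((2 * PI * y + 24 * Re (F lg (RtoC (-(1/2)) + Ci * y))) / 3).
Proof.
  rewrite (half_line_real lg) at 1 by (intros n; apply pser_lg). rewrite <- RtoC_inv by lra. unfold tpi. apply C_ext; simpl; field.
Qed.

(** rho = e^(2 pi i / 3) satisfies -1 / rho = rho + 1 and rho^4 = rho, so E4(rho) = rho E4(rho). *)
Lemma E4_rho : F E4 (eit (2 * PI / 3)) = RtoC 0.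
Proof.
  pose proof PI_RGT_0 as Hpi. set (r := eit (2 * PI / 3)).
  assert (Hr : in_H r) by (apply arc_H; lra). pose proof (E4_S r Hr) as E.
  assert (E1 : (- / r = r + 1)%C).
  { unfold r. rewrite <- eit_conj. unfold eit. replace (2 * PI / 3) with (2 * (PI / 3)) by field. rewrite cos_2PI3. apply C_ext; simpl; field. }
  rewrite E1, F_T in E. unfold r in E at 2. rewrite eit_pow in E.
  replace (INR 4 * (2 * PI / 3)) with (2 * PI / 3 + 2 * PI) in E by (simpl; field).
  unfold eit in E. rewrite cos_plus, sin_plus, cos_2PI, sin_2PI in E.
  assert (E' : F E4 r = (r * F E4 r)%C) by (rewrite E at 1; f_equal; unfold r, eit; apply C_ext; simpl; ring).
  assert (H0 : ((1 - r) * F E4 r)%C = RtoC 0) by (transitivity (F E4 r - r * F E4 r)%C; [ring | rewrite <- E'; ring]).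
  destruct (Ceq_dec (F E4 r) 0) as [e|e]; [exact e|]. exfalso. revert H0. apply Cmult_neq_0; [|exact e].
  intros E0. apply (f_equal Im) in E0. unfold r, eit in E0. simpl in E0. assert (0 < sin (2 * PI / 3)) by (apply sin_gt_0; lra). lra.
Qed.

(** q is negative on this line, so -504 q is positive and the tail, at most 504 * 0.0007 < 1, cannot
    outweigh the constant term. *)
Lemma half_line_E6_pos (y : R) : 0.866 <= y -> 0 < Re (F E6 (RtoC (-(1/2)) + Ci * y)).
Proof.
  intros Hy. rewrite F_E6_sig by (unfold in_H; simpl; lra).
  destruct (sig5_est (RtoC (-(1/2)) + Ci * y)) as (v & -> & Hv & _); [simpl; lra|].
  pose proof (re_le_Cmod v) as Hrv. apply Rabs_le_between in Hrv.
  assert (Hq : Re (qpar (RtoC (-(1/2)) + Ci * y)) <= 0).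
  { unfold qpar. simpl. replace (2 * PI * (- (1 / 2) + (0 * y - 1 * 0))) with (- PI) by field. rewrite cos_neg, cos_PI.
    match goal with |- exp ?e * _ <= 0 => pose proof (exp_pos e) end. nra. }
  rewrite re_plus, re_scal_l, re_plus, re_RtoC. lra.
Qed.

(** [E4w] is real here, vanishes at rho, where the line meets the arc, and increases upward from
    there because E6 > 0. *)
Lemma half_line_E4_pos (y : R) : 0 < y -> 1 < (-(1/2)) ^ 2 + y ^ 2 -> 0 < Re (F E4 (RtoC (-(1/2)) + Ci * y)).
Proof.
  intros Hy Hy1. set (P := fun y : R => (RtoC (-(1/2)) + Ci * y)%C). change (0 < Re (F E4 (P y))).
  set (y0 := sqrt 3 / 2). assert (Hs3 : sqrt 3 * sqrt 3 = 3) by (apply sqrt_sqrt; lra).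
  pose proof (sqrt_pos 3) as Hsp. assert (H0 : 0.866 <= y0) by (unfold y0; nra). assert (Hlt : y0 < y) by (unfold y0 in *; nra).
  assert (HP : forall t, y0 <= t -> in_H (P t)) by (intros t Ht; unfold in_H, P; simpl; lra).
  assert (HA : forall t : R, (- (/ 3) * (tpi * P t + RtoC PI * Ci - 24 * F lg (P t)))%C = RtoC ((2 * PI * t + 24 * Re (F lg (P t))) / 3))
    by exact half_line_arg.
  assert (H4 : forall t, F E4 (P t) = RtoC (Re (F E4 (P t)))) by (intros t; apply half_line_real, rser_E4).
  assert (H6 : forall t, F E6 (P t) = RtoC (Re (F E6 (P t)))) by (intros t; apply half_line_real, rser_E6).
  assert (HD : forall t, y0 <= t -> is_derive (fun t => Re (E4w (P t))) t (2 * PI / 3 * Re (F E6 (P t)) * exp ((2 * PI * t + 24 * Re (F lg (P t))) / 3))).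
  { intros t Ht. pose proof (proj1 (ray_derive (-(1/2)) E4w t _ (cder_E4w _ (HP t Ht)))) as H.
    match type of H with is_derive _ _ ?v => replace v with (2 * PI / 3 * Re (F E6 (P t)) * exp ((2 * PI * t + 24 * Re (F lg (P t))) / 3)) in H; [exact H|] end.
    rewrite HA, (H6 t), re_RtoC. generalize (Re (F E6 (P t))) ((2 * PI * t + 24 * Re (F lg (P t))) / 3).
    intros a b. rewrite <- RtoC_inv by lra. unfold cexp, tpi. simpl. rewrite cos_0, sin_0. field. }
  assert (HE : forall t, Re (E4w (P t)) = Re (F E4 (P t)) * exp ((2 * PI * t + 24 * Re (F lg (P t))) / 3)).
  { intros t. unfold E4w. rewrite HA, (H4 t), re_scal_l, re_RtoC. generalize (Re (F E4 (P t))) ((2 * PI * t + 24 * Re (F lg (P t))) / 3).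
    intros a b. unfold cexp. simpl. rewrite cos_0. ring. }
  destruct (MVT_gen (fun t => Re (E4w (P t))) y0 y (fun t => 2 * PI / 3 * Re (F E6 (P t)) * exp ((2 * PI * t + 24 * Re (F lg (P t))) / 3))) as (c & Hc & EM).
  - intros t Ht. rewrite Rmin_left, Rmax_right in Ht by lra. apply HD. lra.
  - intros t Ht. rewrite Rmin_left, Rmax_right in Ht by lra. apply derivable_continuous_pt.
    eexists. apply is_derive_Reals, HD. lra.
  - rewrite Rmin_left, Rmax_right in Hc by lra. cbv beta in EM. rewrite !HE in EM.
    assert (E0 : F E4 (P y0) = RtoC 0).
    { rewrite <- E4_rho. f_equal. unfold P, eit, y0. replace (2 * PI / 3) with (2 * (PI / 3)) by field.
      rewrite cos_2PI3, sin_2PI3. apply C_ext; simpl; field. }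
    rewrite E0 in EM. simpl (Re 0) in EM.
    pose proof (half_line_E6_pos c ltac:(lra)) as H6c. fold (P c) in H6c.
    pose proof PI_RGT_0 as Hpi. pose proof (exp_pos ((2 * PI * c + 24 * Re (F lg (P c))) / 3)) as Hec.
    pose proof (exp_pos ((2 * PI * y + 24 * Re (F lg (P y))) / 3)) as Hey.
    assert (HR : 0 < 2 * PI / 3 * Re (F E6 (P c)) * exp ((2 * PI * c + 24 * Re (F lg (P c))) / 3) * (y - y0)).
    { apply Rmult_lt_0_compat; [apply Rmult_lt_0_compat; [apply Rmult_lt_0_compat|]|]; lra. }
    apply (Rmult_lt_reg_r (exp ((2 * PI * y + 24 * Re (F lg (P y))) / 3))); lra.
Qed.

(** Together with [half_line_E4_pos] this makes j negative above rho on the left edge of the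
    domain. *)
Lemma half_line_Delta (y : R) : exists d, 0 < d /\ Delta (RtoC (-(1/2)) + Ci * y) = RtoC (- d).
Proof.
  set (L := Re (F lg (RtoC (-(1/2)) + Ci * y))). exists (exp (- (2 * PI * y) - 24 * L)). split; [apply exp_pos|].
  unfold Delta. rewrite (half_line_real lg) by (intros n; apply pser_lg). fold L.
  replace (tpi * (RtoC (-(1/2)) + Ci * y) - 24 * L)%C with ((- (2 * PI * y) - 24 * L)%R, - PI) by (unfold tpi; apply C_ext; simpl; field).
  unfold cexp. simpl. rewrite cos_neg, sin_neg, cos_PI, sin_PI. apply C_ext; simpl; ring.
Qed.

(** E6(i) = 0 by the law of weight 6 at the fixed point. On the axis E6 = 1 - 504 S(q) with S
    increasing in q, so 504 S drops below 1 above i. *)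
Lemma axis_E6_neq0 (y : R) : 1 < y -> F E6 (Ci * y) <> RtoC 0.
Proof.
  intros Hy E.
  assert (Ei : F E6 (Ci * 1) = RtoC 0).
  { pose proof (E6_S (Ci * 1) (in_H_axis 1 ltac:(lra))) as HS. rewrite Cmult_1_r in *.
    replace (- / Ci)%C with Ci in HS by (rewrite Ci_inv; reflexivity).
    replace (Ci ^ 6)%C with (- (1))%C in HS by (apply C_ext; simpl; ring).
    apply C_ext; [apply (f_equal Re) in HS | apply (f_equal Im) in HS]; revert HS; destruct (F E6 Ci) as [a b]; simpl; lra. }
  rewrite F_E6_sig in E by (apply in_H_axis; lra). rewrite F_E6_sig in Ei by (apply in_H_axis; lra).
  unfold F in E, Ei. rewrite qpar_axis in E, Ei.
  set (r := exp (- (2 * PI * y))) in *. set (r1 := exp (- (2 * PI * 1))) in *.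
  pose proof PI_RGT_0 as Hpi. assert (Hr : 0 <= r < 1) by (apply exp_neg_range; lra). assert (Hr1 : 0 <= r1 < 1) by (apply exp_neg_range; lra).
  assert (Hr0 : 0 < r1) by apply exp_pos. assert (Hlt : r < r1) by (apply exp_increasing; nra).
  destruct (Ev_pos (sig 5) r (pser_sig 5) (PSc_sig 5) Hr) as [V X]. destruct (Ev_pos (sig 5) r1 (pser_sig 5) (PSc_sig 5) Hr1) as [V1 X1].
  rewrite V in E. rewrite V1 in Ei. set (S := Series (fun n => Re (sig 5 n) * r ^ n)) in *. set (S1 := Series (fun n => Re (sig 5 n) * r1 ^ n)) in *.
  apply (f_equal Re) in E, Ei. simpl in E, Ei.
  assert (HS : S <= r / r1 * S1).
  { unfold S, S1. rewrite <- Series_scal_l. apply Series_le; [|now apply ex_series_scalR].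
    intros n. destruct (pser_sig 5 n) as [_ Hp]. split; [apply Rmult_le_pos; [exact Hp | apply pow_le; lra]|].
    destruct n as [|n].
    { assert (E0 : sig 5 0 = RtoC 0) by (unfold sig; simpl; apply C_ext; simpl; ring). rewrite E0. simpl. lra. }
    replace (r / r1 * (Re (sig 5 (Datatypes.S n)) * r1 ^ Datatypes.S n)) with (Re (sig 5 (Datatypes.S n)) * (r * r1 ^ n)) by (simpl; field; lra).
    apply Rmult_le_compat_l; [exact Hp|]. simpl. apply Rmult_le_compat_l; [lra | apply pow_incr; lra]. }
  assert (HS1 : S1 = 1 / 504) by lra. rewrite HS1 in HS.
  assert (Hq : r / r1 < 1) by (apply (Rmult_lt_reg_r r1); [lra|]; unfold Rdiv; rewrite Rmult_assoc, Rinv_l; lra). lra.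
Qed.

Lemma axis_E6_real (y : R) : F E6 (Ci * y) = RtoC (Re (F E6 (Ci * y))).
Proof.
  apply C_real. assert (E : (- Cconj (Ci * y) = Ci * y)%C) by (apply C_ext; simpl; ring).
  pose proof (F_refl E6 (Ci * y) rser_E6) as H. rewrite E in H. apply (f_equal Im) in H. rewrite im_conj in H. lra.
Qed.

(** * Special points of the fundamental domain *)

(** The three ways in which g can vanish once all roots of p are known to lie in (0, 1728). *)
Definition special (z : C) : Prop :=
  F E4 z = RtoC 0 \/ F E6 z = RtoC 0 \/ exists x : R, 0 < x < 1728 /\ (F E4 z ^ 3)%C = (x * Delta z)%C.

Lemma not_special_interior (x y : R) : -(1/2) < x < 0 -> 0 < y -> 1 < x ^ 2 + y ^ 2 -> ~ special (x + Ci * y).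
Proof.
  intros Hx Hy Hr. assert (Hy' : 0.866 <= y) by (apply Rnot_lt_le; intros h; nra).
  intros [E|[E|(x0 & Hx0 & E)]].
  - revert E. apply E4_neq0_int; simpl; lra.
  - revert E. apply E6_neq0_int; simpl; lra.
  - apply (no_J_interior x y x0 Hx Hy Hr ltac:(lra) E).
Qed.

Lemma special_refl z : special z -> special (- Cconj z).
Proof.
  unfold special. rewrite !F_refl, Delta_refl by (apply rser_E4 || apply rser_E6).
  assert (C0 : forall w, w = RtoC 0 -> Cconj w = RtoC 0) by (intros w ->; apply C_ext; simpl; ring).
  intros [E|[E|(x0 & Hx0 & E)]]; [left; now apply C0 | right; left; now apply C0 | right; right].
  exists x0. split; [exact Hx0|]. rewrite <- Cpow_conj, E. apply C_ext; simpl; ring.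
Qed.

Lemma special_on_arc z : in_F z -> special z -> on_arc z.
Proof.
  intros [Hz HF] Hs. destruct z as [x y]. unfold in_H in Hz. simpl in Hz, HF.
  assert (EC : Cmod (x, y) ^ 2 = x ^ 2 + y ^ 2).
  { unfold Cmod. rewrite pow2_sqrt; [reflexivity | simpl; nra]. }
  pose proof (Cmod_ge_0 (x, y)) as Hp.
  assert (Ez : (x, y) = (x + Ci * y)%C) by (apply C_ext; simpl; ring).
  destruct HF as [[Hm Hx]|[Hm Hx]].
  (* The right half is reflected into the left half, where j takes the conjugate value. *)
  2: { exfalso. apply special_refl in Hs. replace (- Cconj (x, y))%C with (RtoC (- x) + Ci * y)%C in Hs by (apply C_ext; simpl; ring).
       revert Hs. apply not_special_interior; try lra. nra. }
  destruct (Req_dec (x ^ 2 + y ^ 2) 1) as [E1|N1].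
  { destruct (on_circle x y E1 Hz Hx) as (E & H & _). now exists (acos x). }
  assert (Hr : 1 < x ^ 2 + y ^ 2) by nra. exfalso.
  destruct (Req_dec x 0) as [->|Hx0].
  { assert (Hy : 1 < y) by nra. rewrite Ez in Hs. replace (RtoC 0 + Ci * y)%C with (Ci * y)%C in Hs by ring.
    destruct (E4_axis_pos y Hz) as (e & He & Ee).
    destruct Hs as [E|[E|(x0 & Hxx & E)]].
    - rewrite Ee in E. apply RtoC_inj in E. lra.
    - now apply (axis_E6_neq0 y).
    (* E4^3 = E6^2 + 1728 Delta with E6 real and Delta > 0 forces j >= 1728 on the axis. *)
    - pose proof (disc_eq _ (in_H_axis y Hz)) as ED. rewrite E, axis_E6_real, Delta_axis in ED by exact Hz.
      apply (f_equal Re) in ED. simpl in ED. pose proof (exp_pos (- (2 * PI * y) - 24 * Re (F lg (Ci * y)))) as Hd. fold (dl y) in Hd.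
      simpl in ED. set (b := fst (F E6 (Ci * y))) in *. nra. }
  destruct (Req_dec x (-(1/2))) as [->|Hx1].
  { rewrite Ez in Hs. pose proof (half_line_E4_pos y Hz ltac:(lra)) as H4.
    destruct Hs as [E|[E|(x0 & Hx' & E)]].
    - rewrite E in H4. simpl in H4. lra.
    - pose proof (half_line_E6_pos y ltac:(apply Rnot_lt_le; intros h; nra)) as H6. rewrite E in H6. simpl in H6. lra.
    - destruct (half_line_Delta y) as (d & Hd & ED). rewrite ED, (half_line_real E4) in E by apply rser_E4.
      rewrite <- RtoC_pow, <- RtoC_mult in E. apply RtoC_inj in E. pose proof (pow_lt _ 3 H4). nra. }
  rewrite Ez in Hs. revert Hs. apply not_special_interior; lra.
Qed.

(** * Zeros of the form and roots of a polynomial in j *)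

(** Horner evaluation of c_0 x^(n-1) + ... + c_(n-1). The leading coefficient comes first because
    d_0 = 1 goes with the highest power of j. *)
Fixpoint pev (c : nat -> C) (n : nat) (x : C) : C :=
  match n with O => RtoC 0 | S m => (x * pev c m x + c m)%C end.

(** Synthetic division: the Horner values at r are the coefficients of the quotient by x - r. *)
Lemma pev_factor c n r x : (pev c (S n) x - pev c (S n) r)%C = ((x - r) * pev (fun m => pev c (S m) r) n x)%C.
Proof.
  induction n as [|n IH]; [simpl; ring|]. cbn [pev] in *.
  transitivity (x * ((x * pev c n x + c n) - (r * pev c n r + c n)) + (x - r) * (r * pev c n r + c n))%C; [ring|].
  rewrite IH. ring.
Qed.

(** Dividing out the given roots one after the other leaves the constant c_0, which is not 0. *)
Lemma pev_roots rs : forall c x, c O <> RtoC 0 -> NoDup rs ->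
  (forall r, In r rs -> pev c (S (length rs)) r = RtoC 0) -> pev c (S (length rs)) x = RtoC 0 -> In x rs.
Proof.
  induction rs as [|r rs IH]; intros c x Hc Hn Hr Hx.
  - simpl in Hx. exfalso. apply Hc. rewrite <- Hx. ring.
  - inversion Hn as [|? ? Hni Hn']; subst. simpl length in *.
    destruct (Ceq_dec x r) as [->|Hne]; [now left|]. right.
    assert (Hq : forall y, y <> r -> pev c (S (S (length rs))) y = RtoC 0 ->
                   pev (fun m => pev c (S m) r) (S (length rs)) y = RtoC 0).
    { intros y Hy E. pose proof (pev_factor c (S (length rs)) r y) as Hf. rewrite E, (Hr r (or_introl eq_refl)) in Hf.
      destruct (Ceq_dec (pev (fun m => pev c (S m) r) (S (length rs)) y) 0) as [e|e]; [exact e|]. exfalso.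
      assert (Hd : (y - r)%C <> RtoC 0) by (intros E0; apply Hy; now apply Ceq_minus).
      apply (Cmult_neq_0 _ _ Hd e). rewrite <- Hf. ring. }
    apply (IH (fun m => pev c (S m) r)); [|exact Hn' | | now apply Hq].
    + simpl. intros E. apply Hc. rewrite <- E. ring.
    + intros y Hy. apply Hq; [intros -> ; contradiction | apply Hr; now right].
Qed.

(** Meant for D = Delta(z) and x = j(z): the product x * D then stands for E4^3, so the sum is the
    expansion of g stripped of E4^al E6^be. *)
Lemma csum_pev c (D x : C) l : csum (fun m => c m * D ^ S m * (x * D) ^ (l - 1 - m))%C l = (D ^ l * pev c l x)%C.
Proof.
  induction l as [|l IH]; [simpl; ring|]. cbn [csum pev].
  rewrite (csum_ext _ (fun m => (x * D) * (c m * D ^ S m * (x * D) ^ (l - 1 - m)))%C).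
  - rewrite csum_scal, IH. replace (S l - 1 - l)%nat with O by lia. simpl. ring.
  - intros m Hm. replace (S l - 1 - m)%nat with (S (l - 1 - m)) by lia. simpl. ring.
Qed.

Lemma rser_next a : rser a -> rser (next a).
Proof. intros Ha. apply rser_conv; [intros n; apply Ha | intros n; apply pser_ieta]. Qed.
Lemma rser_res B n : (forall m, rser (B m)) -> rser (res B n).
Proof.
  intros HB. induction n as [|n IH]; [intros n; apply pser_ieta|]. apply rser_next. intros m. unfold padd, pscal.
  rewrite im_plus, im_mult, IH, HB, im_opp, IH. ring.
Qed.
Lemma dcf_real B n : (forall m, rser (B m)) -> dcf B n = RtoC (Re (dcf B n)).
Proof. intros HB. apply C_real, (rser_res B n HB). Qed.

Lemma rser_cpw a n : rser a -> rser (cpw a n).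
Proof. intros Ha. induction n as [|n IH]; [intros [|n]; reflexivity | now apply rser_conv]. Qed.
Lemma cpw_0 a n : a O = RtoC 1 -> cpw a n O = RtoC 1.
Proof. intros Ha. induction n as [|n IH]; [reflexivity|]. simpl. unfold conv. simpl. rewrite Ha, IH. ring. Qed.

(** The monomial E4^(al + 3 n) E6^be. With these in the role of B_m, the expansion in powers of
    Delta becomes a polynomial in j. *)
Fixpoint QF (al be n : nat) : nat -> C :=
  match n with O => conv (cpw E4 al) (cpw E6 be) | S m => conv E4 (conv E4 (conv E4 (QF al be m))) end.
Definition QB (al be l m : nat) : nat -> C := QF al be (l - 1 - m).

Lemma PSc_QF al be n : PSc (QF al be n).
Proof.
  induction n as [|n IH]; [apply PSc_conv; apply PSc_cpw; [apply PSc_E4 | apply PSc_E6]|].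
  cbn [QF]. repeat (apply PSc_conv; [apply PSc_E4|]). exact IH.
Qed.
Lemma rser_QF al be n : rser (QF al be n).
Proof.
  induction n as [|n IH]; [apply rser_conv; apply rser_cpw; [apply rser_E4 | apply rser_E6]|].
  cbn [QF]. repeat (apply rser_conv; [apply rser_E4|]). exact IH.
Qed.
Lemma rser_QB al be l m : rser (QB al be l m).
Proof. apply rser_QF. Qed.
Lemma F_QF al be n z : in_H z -> F (QF al be n) z = (F E4 z ^ (al + 3 * n) * F E6 z ^ be)%C.
Proof.
  intros Hz. pose proof PSc_E4 as P4. pose proof PSc_E6 as P6. induction n as [|n IH].
  - cbn [QF]. rewrite Nat.mul_0_r, Nat.add_0_r. now rewrite F_conv, !F_cpw by (assumption || now apply PSc_cpw).
  - cbn [QF]. pose proof (PSc_QF al be n) as PQ. pose proof (PSc_conv _ _ P4 PQ) as PQ1. pose proof (PSc_conv _ _ P4 PQ1) as PQ2.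
    rewrite !F_conv, IH by assumption. replace (al + 3 * S n)%nat with (S (S (S (al + 3 * n)))) by lia. rewrite !Cpow_S. ring.
Qed.
Lemma F_QB al be l m z : in_H z -> F (QB al be l m) z = (F E4 z ^ (al + 3 * (l - 1 - m)) * F E6 z ^ be)%C.
Proof. apply F_QF. Qed.
Lemma QF_0 al be n : QF al be n O = RtoC 1.
Proof.
  assert (H : forall a b : nat -> C, a O = RtoC 1 -> b O = RtoC 1 -> conv a b O = RtoC 1).
  { intros a b Ea Eb. unfold conv. simpl. rewrite Ea, Eb. ring. }
  induction n as [|n IH]; cbn [QF]; repeat (apply H; [apply E4_0|]); [|exact IH].
  apply H; apply cpw_0; [apply E4_0 | apply E6_0].
Qed.

Lemma csum_conj u n : Cconj (csum u n) = csum (fun m => Cconj (u m)) n.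
Proof. induction n as [|n IH]; simpl; [|rewrite Cplus_conj, IH; reflexivity]. apply C_ext; simpl; ring. Qed.

Lemma pow_m1 n : (-1) ^ n = 1 \/ (-1) ^ n = -1.
Proof. induction n as [|n [IH|IH]]; simpl; [now left | right | left]; rewrite IH; ring. Qed.

Lemma cos_INR_PI n : cos (INR n * PI) = (-1) ^ n.
Proof.
  induction n as [|n IH]; [rewrite Rmult_0_l; apply cos_0|].
  rewrite S_INR, Rmult_plus_distr_r, Rmult_1_l, neg_cos, IH. simpl. ring.
Qed.

(* Rel s x: the zero s of g gives the root x; its injectivity in s keeps the roots distinct. *)
Lemma roots_of_signs (f t : nat -> R) (g : R -> R) (Rel : R -> R -> Prop) N :
  (forall i, (i <= N)%nat -> f i = g (t i)) ->
  (forall i, (i < N)%nat -> t i < t (S i) /\ f i * f (S i) < 0 /\ forall s, t i <= s <= t (S i) -> continuity_pt g s) ->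
  (forall s, t O < s < t N -> g s = 0 -> exists x, Rel s x) ->
  (forall s s' x, t O < s < t N -> t O < s' < t N -> Rel s x -> Rel s' x -> s = s') ->
  exists xs, NoDup xs /\ length xs = N /\ forall x, In x xs -> exists s, t O < s < t N /\ Rel s x.
Proof.
  intros Hf Ht Hx Hinj.
  assert (Hmono : forall i j, (i <= j <= N)%nat -> t i <= t j).
  { intros i j Hij. assert (E : exists d, j = (i + d)%nat) by (exists (j - i)%nat; lia). destruct E as [d ->].
    induction d as [|d IH]; [rewrite Nat.add_0_r; lra|]. rewrite Nat.add_succ_r in *.
    destruct (Ht (i + d)%nat ltac:(lia)) as [Hs _]. specialize (IH ltac:(lia)). lra. }
  assert (HM : forall M, (M <= N)%nat -> exists xs, NoDup xs /\ length xs = M /\ forall x, In x xs -> exists s, t O < s < t M /\ Rel s x).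
  { induction M as [|M IH]; intros HM.
    - exists nil. split; [constructor | split; [reflexivity | intros x []]].
    - destruct (IH ltac:(lia)) as (xs & Hnd & Hlen & Hin). destruct (Ht M ltac:(lia)) as (Hlt & Hsg & Hc).
      rewrite !Hf in Hsg by lia.
      assert (Hz : exists s, t M < s < t (S M) /\ g s = 0).
      { assert (Hs : exists s, t M <= s <= t (S M) /\ g s = 0).
        { destruct (Rlt_or_le (g (t M)) 0) as [h|h].
          - destruct (Ranalysis5.IVT_interv g (t M) (t (S M)) Hc Hlt h ltac:(nra)) as (s & Hs & E). now exists s.
          - assert (h0 : g (t M) <> 0) by (intros e; rewrite e in Hsg; lra).
            destruct (Ranalysis5.IVT_interv (fun s => - g s) (t M) (t (S M))) as (s & Hs & E); [| exact Hlt | lra | nra |].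
            + intros s Hs. now apply continuity_pt_opp, Hc.
            + exists s. split; [exact Hs | lra]. }
        destruct Hs as (s & Hs & E). exists s. split; [|exact E].
        split; apply Rnot_le_lt; intros h; [replace s with (t M) in E by lra | replace s with (t (S M)) in E by lra]; rewrite E in Hsg; lra. }
      destruct Hz as (s & Hs & Eg). pose proof (Hmono O M ltac:(lia)) as HO. pose proof (Hmono (S M) N ltac:(lia)) as HN'.
      destruct (Hx s ltac:(lra) Eg) as (x & Hrel). exists (x :: xs). split; [|split].
      + constructor; [|exact Hnd]. intros Hi. destruct (Hin x Hi) as (s' & Hs' & Hrel').
        assert (s = s') by (apply (Hinj s s' x); [lra | lra | assumption | assumption]). lra.
      + simpl. now rewrite Hlen.
      + intros y [<-|Hy]; [exists s; split; [lra | exact Hrel]|]. destruct (Hin y Hy) as (s' & Hs' & Hr'). exists s'. split; [lra | exact Hr']. }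
  now apply HM.
Qed.

Section Form.
Context (al be l : nat) (a : nat -> C).
Context (Hal : (al <= 2)%nat) (Hbe : (be <= 1)%nat) (Hl : (1 <= l)%nat).
Let kap := (2 * al + 3 * be)%nat.
Let k := (12 * l + 2 * kap)%nat.
Context (Ha : PSc a) (HaS : forall z, in_H z -> F a (- / z) = (z ^ k * F a z)%C).
Context (H0 : a O = RtoC 0) (H1 : a 1%nat = RtoC 1) (Hn : forall n, (2 <= n <= l)%nat -> a n = RtoC 0).

Lemma form_expand z : in_H z -> F a z = csum (fun m => dcf (QB al be l) m * Delta z ^ S m * F (QB al be l m) z)%C l.
Proof.
  apply (miller_expand (QB al be l) k l a); [exists (6 * l + kap)%nat; unfold k; lia | unfold k, kap; lia | unfold k; lia | exact Hl | | | | exact Ha | exact HaS | exact H0 | exact H1 | exact Hn].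
  - intros m. apply PSc_QF.
  - intros m. apply QF_0.
  - intros m w Hm Hw. rewrite !F_QB, E4_S, E6_S by (exact Hw || now apply in_H_inv).
    rewrite !Cpow_mult_l, <- !Cpow_mult_r.
    replace (k - 12 * S m)%nat with (4 * (al + 3 * (l - 1 - m)) + 6 * be)%nat by (unfold k, kap; lia).
    rewrite (Cpow_add_r w). ring.
Qed.

(** The hypotheses fix the coefficients of [a] up to index l; that the whole form is real comes from
    its expansion, where the coefficients [dcf] and all factors are real. *)
Lemma form_refl z : in_H z -> F a (- Cconj z) = Cconj (F a z).
Proof.
  intros Hz. assert (Hz' : in_H (- Cconj z)) by (unfold in_H in *; destruct z; simpl in *; lra).
  rewrite !form_expand by assumption. rewrite csum_conj. apply csum_ext. intros m Hm.
  rewrite Delta_refl, F_refl by apply rser_QB. rewrite (dcf_real _ m (rser_QB al be l)).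
  rewrite !Cmult_conj, Cpow_conj. f_equal. f_equal. apply C_ext; simpl; ring.
Qed.

Lemma form_factor z (x : C) : in_H z -> (F E4 z ^ 3)%C = (x * Delta z)%C ->
  F a z = (F E4 z ^ al * F E6 z ^ be * (Delta z ^ l * pev (dcf (QB al be l)) l x))%C.
Proof.
  intros Hz E. rewrite form_expand, <- csum_pev, <- csum_scal by exact Hz. apply csum_ext. intros m Hm.
  rewrite F_QB by exact Hz. rewrite Cpow_add_r, Cpow_mult_r, E. ring.
Qed.

Lemma pev_zero z (x : C) : in_H z -> F a z = RtoC 0 -> F E4 z <> RtoC 0 -> F E6 z <> RtoC 0 ->
  (F E4 z ^ 3)%C = (x * Delta z)%C -> pev (dcf (QB al be l)) l x = RtoC 0.
Proof.
  intros Hz Hg N4 N6 E. rewrite (form_factor z x Hz E) in Hg.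
  destruct (Ceq_dec (pev (dcf (QB al be l)) l x) 0) as [e|e]; [exact e|]. exfalso. revert Hg.
  repeat apply Cmult_neq_0; try apply Cpow_nz; try assumption. apply Delta_neq0.
Qed.

(** p has degree l - 1, so the listed roots are all of them; and where E4 and E6 do not vanish, a
    zero of the form makes j a root of p. *)
Lemma special_of_roots rs z : NoDup rs -> S (length rs) = l ->
  (forall r, In r rs -> exists x : R, r = RtoC x /\ 0 < x < 1728 /\ pev (dcf (QB al be l)) l r = RtoC 0) ->
  in_H z -> F a z = RtoC 0 -> special z.
Proof.
  intros Hnd Hlen Hr Hz Hg. unfold special.
  destruct (Ceq_dec (F E4 z) 0) as [e|N4]; [now left | right].
  destruct (Ceq_dec (F E6 z) 0) as [e|N6]; [now left | right].
  assert (E : (F E4 z ^ 3)%C = (F E4 z ^ 3 * iDelta z * Delta z)%C).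
  { transitivity (F E4 z ^ 3 * (Delta z * iDelta z))%C; [rewrite Delta_inv|]; ring. }
  pose proof (pev_zero z _ Hz Hg N4 N6 E) as Hp.
  assert (Hin : In (F E4 z ^ 3 * iDelta z)%C rs).
  { apply (pev_roots rs (dcf (QB al be l))); [|exact Hnd | | now rewrite Hlen].
    - change (dcf (QB al be l) 0) with (ieta O). intros E0. apply (f_equal Re) in E0. simpl in E0. lra.
    - intros r Hi. rewrite Hlen. now destruct (Hr r Hi) as (x & _ & _ & Hx). }
  destruct (Hr _ Hin) as (x & Ex & Hx & _). exists x. split; [exact Hx|]. rewrite <- Ex. exact E.
Qed.

Lemma arc_form_sign th u : (13 <= l)%nat -> PI / 2 <= th <= 2 * PI / 3 -> (eit th ^ 6 * Delta (eit th))%C = RtoC u ->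
  Re (eit th ^ (6 * l + kap) * F a (eit th)) = u * Re (arcsum kap (l - 1) th u).
Proof.
  intros Hl13 Hth Hu. pose proof (arc_H th Hth) as Hh.
  rewrite <- re_scal_l. f_equal.
  rewrite (miller_expand (EB kap l) k l a); [ | exists (6 * l + kap)%nat; unfold k; lia | unfold k, kap; lia | unfold k; lia | exact Hl | | | | exact Ha | exact HaS | exact H0 | exact H1 | exact Hn | exact Hh].
  - unfold arcsum. replace (S (l - 1)) with l by lia. rewrite <- Hu, <- !csum_scal. apply csum_ext. intros m Hm.
    replace (6 * l + kap)%nat with (6 * (S m) + (6 * (l - 1 - m) + kap))%nat by lia. rewrite Cpow_add_r, Cpow_mult_r, !Cpow_S, !Cpow_mult_l. ring.
  - intros m. unfold EB. destruct (_ =? 0)%nat; [apply PSc_one | apply PSc_Eis].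
  - intros m. unfold EB. destruct (_ =? 0)%nat; reflexivity.
  - intros m w Hm Hw. unfold EB. replace (k - 12 * S m)%nat with (2 * (6 * (l - 1 - m) + kap))%nat by (unfold k; lia).
    destruct (Nat.eqb_spec (6 * (l - 1 - m) + kap) 0) as [->|Ne].
    + unfold F. rewrite !Ev_one. simpl. ring.
    + apply Eis_S; [unfold kap in *; lia | exact Hw].
Qed.

Lemma special_large z : (13 <= l)%nat -> in_H z -> F a z = RtoC 0 -> special z.
Proof.
  intros Hl13 Hz Hg. set (w := INR (6 * (l - 1) + kap)).
  assert (Hw : w = 6 * INR (l - 1) + 2 * INR al + 3 * INR be) by (unfold w, kap; rewrite !plus_INR, !mult_INR; simpl; ring).
  assert (Hlm : 12 <= INR (l - 1)) by (replace 12 with (INR 12) by (simpl; ring); apply le_INR; lia).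
  pose proof (pos_INR al) as Pal. pose proof (pos_INR be) as Pbe. pose proof PI_RGT_0 as Hpi.
  (* The l multiples of PI / w in [PI / 2, 2 PI / 3], where cos(w th) alternates between 1 and -1.
     The first index rounds up w / 2 = 3 (l - 1) + al + 3 be / 2, the last rounds down 2 w / 3 = 4
     (l - 1) + 4 al / 3 + 2 be. *)
  set (t := fun i : nat => PI * INR (3 * (l - 1) + al + 2 * be + i) / w).
  assert (Et : forall i, t i = PI * (3 * INR (l - 1) + INR al + 2 * INR be + INR i) / w)
    by (intros i; unfold t; rewrite !plus_INR, !mult_INR; simpl; f_equal; ring).
  assert (Hw0 : 0 < w) by lra.
  assert (Htm : forall i, t i < t (S i)).
  { intros i. rewrite !Et, S_INR. unfold Rdiv. apply Rmult_lt_compat_r; [now apply Rinv_0_lt_compat | nra]. }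
  assert (HtO : PI / 2 <= t O).
  { rewrite Et. apply (Rmult_le_reg_r w); [exact Hw0|]. unfold Rdiv at 2. rewrite Rmult_assoc, Rinv_l by lra. simpl. rewrite Hw. nra. }
  assert (HtN : t (l - 1)%nat <= 2 * PI / 3).
  { rewrite Et. apply (Rmult_le_reg_r w); [exact Hw0|]. unfold Rdiv at 1. rewrite Rmult_assoc, Rinv_l by lra. rewrite Hw. nra. }
  assert (Htr : forall i, (i <= l - 1)%nat -> PI / 2 <= t i <= 2 * PI / 3).
  { intros i Hi. assert (t O <= t i /\ t i <= t (l - 1)%nat); [|lra].
    rewrite !Et. apply le_INR in Hi. pose proof (pos_INR i). simpl (INR 0). unfold Rdiv.
    split; (apply Rmult_le_compat_r; [left; now apply Rinv_0_lt_compat | nra]). }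
  set (g := fun th => Re (eit th ^ (6 * l + kap) * F a (eit th))).
  assert (Hcos : forall i, cos (w * t i) = (-1) ^ (3 * (l - 1) + al + 2 * be + i)).
  { intros i. unfold t. rewrite <- cos_INR_PI. f_equal. field. lra. }
  (* The factor z^6 Delta is negative on the arc, so the sign is opposite to that of the cosine. *)
  assert (Hsign : forall i, (i <= l - 1)%nat -> g (t i) * (-1) ^ (3 * (l - 1) + al + 2 * be + i) < 0).
  { intros i Hi. pose proof (Htr i Hi) as Hr. destruct (z6D_neg (t i) Hr) as (u & Hu & Eu).
    unfold g. rewrite (arc_form_sign (t i) u Hl13 Hr Eu).
    destruct (arcsum_main kap (l - 1) (t i) u) as [L U]; [unfold kap; lia | lia | exact Hr | |].
    - rewrite <- Eu, Cmod_mult, Cmod_pow, Cmod_eit, pow1, Rmult_1_l. apply Delta_small. apply arc_range, Hr.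
    - fold w in L, U. rewrite Hcos in L, U. destruct (pow_m1 (3 * (l - 1) + al + 2 * be + i)) as [e|e]; rewrite e in *; nra. }
  destruct (roots_of_signs (fun i => g (t i)) t g
    (fun s x => (F E4 (eit s) ^ 3)%C = (x * Delta (eit s))%C /\ 0 < x < 1728 /\ pev (dcf (QB al be l)) l x = RtoC 0) (l - 1)) as (xs & Hnd & Hlen & Hin).
  - reflexivity.
  - intros i Hi. split; [apply Htm | split].
    + pose proof (Hsign i ltac:(lia)) as A. pose proof (Hsign (S i) ltac:(lia)) as A'. rewrite Nat.add_succ_r in A'.
      set (N := (3 * (l - 1) + al + 2 * be + i)%nat) in *. change ((-1) ^ S N) with (-1 * (-1) ^ N) in A'.
      destruct (pow_m1 N) as [e|e]; rewrite e in A, A'; nra.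
    + intros s Hs. assert (Hsr : PI / 2 <= s <= 2 * PI / 3) by (pose proof (Htr i ltac:(lia)); pose proof (Htr (S i) ltac:(lia)); lra).
      unfold g. replace (6 * l + kap)%nat with (S (6 * l + kap - 1)) by lia.
      apply (arc_continuity (fun z => z ^ (S (6 * l + kap - 1)) * F a z)%C s (INR (S (6 * l + kap - 1)) * eit s ^ (6 * l + kap - 1) * 1 * F a (eit s) + eit s ^ (S (6 * l + kap - 1)) * (tpi * F (D a) (eit s)))).
      apply cder_mult; [apply (cder_pow (fun z => z) _ 1 (6 * l + kap - 1)), cder_id | apply cder_F; [exact Ha | now apply arc_H]].
  - intros s Hs Eg. assert (Ho : oarc s) by (unfold oarc; lra). destruct (oarc_range s Ho) as (Hc & Hss & Hh).
    destruct (arc_J s Ho) as (x & Hx & Ex & _). exists x. split; [exact Ex | split; [exact Hx|]].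
    apply (pev_zero (eit s) x Hh); [|apply E4_neq0_int; simpl; lra | apply E6_neq0_int; simpl; lra | exact Ex].
    (* The function is real on the arc, so a zero of its real part is a zero of the form. *)
    assert (HI : Im (eit s ^ (6 * l + kap) * F a (eit s)) = 0).
    { apply (arc_real (F a) (6 * l + kap)); [now apply form_refl|]. replace (2 * (6 * l + kap))%nat with k by (unfold k; lia). now apply HaS. }
    pose proof (C_real _ HI) as E. unfold g in Eg. rewrite Eg in E.
    destruct (Ceq_dec (F a (eit s)) 0) as [e|e]; [exact e|]. exfalso. revert E. apply Cmult_neq_0; [apply Cpow_nz, eit_neq0 | exact e].
  - intros s s' x Hs Hs' (E & _) (E' & _). assert (Ho : oarc s) by (unfold oarc; lra). assert (Ho' : oarc s') by (unfold oarc; lra).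
    destruct (Rtotal_order s s') as [h|[h|h]]; [exfalso; now apply (arc_inj s s' x) | exact h | exfalso; now apply (arc_inj s' s x)].
  - apply (special_of_roots (map RtoC xs)); [| rewrite length_map; lia | | exact Hz | exact Hg].
    + apply NoDup_map_NoDup_ForallPairs; [intros x y _ _ E; now apply RtoC_inj | exact Hnd].
    + intros r Hr. apply in_map_iff in Hr. destruct Hr as (x & <- & Hx). destruct (Hin x Hx) as (s & _ & _ & Hx' & Hp). now exists x.
Qed.
End Form.

(** * Levels l <= 12 by exact computation *)

(** d_m depends only on coefficients of index at most m, and m < l <= 12. *)
Definition zterms : nat := 12.

Fixpoint zsum (f : nat -> Z) (n : nat) : Z :=
  match n with O => 0%Z | S m => (zsum f m + f m)%Z end.
Definition ztab (f : nat -> Z) : list Z := map f (seq 0 zterms).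
Definition znth (s : list Z) (n : nat) : Z := nth n s 0%Z.

Definition zsig (s n : nat) : Z :=
  zsum (fun c => if (n mod (S c) =? 0)%nat then Z.of_nat (n / S c) ^ Z.of_nat s else 0)%Z n.
Definition zE4 : list Z := ztab (fun n => match n with O => 1 | _ => 240 * zsig 3 n end%Z).
Definition zE6 : list Z := ztab (fun n => match n with O => 1 | _ => -504 * zsig 5 n end%Z).
(** The recursion of [pexp 24]; that its integer divisions are exact is certified by [zieta_ok]. *)
Fixpoint zpexp (n : nat) : list Z :=
  match n with
  | O => 1%Z :: nil
  | S m => let s := zpexp m in s ++ (24 * zsum (fun k => zsig 1 (n - k) * znth s k) n / Z.of_nat n)%Z :: nil
  end.
Definition zieta : list Z := zpexp (zterms - 1).

Definition zconv (s t : list Z) : list Z := ztab (fun n => zsum (fun k => znth s k * znth t (n - k))%Z (S n)).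
Fixpoint zpow (s : list Z) (n : nat) : list Z :=
  match n with O => ztab (fun n => match n with O => 1 | _ => 0 end%Z) | S m => zconv s (zpow s m) end.
Definition znext (s : list Z) : list Z := zconv (ztab (fun n => znth s (S n))) zieta.
Fixpoint zdcf (bs : list (list Z)) (r : list Z) : list Z :=
  match bs with
  | nil => nil
  | b :: bs' => znth r 0 :: zdcf bs' (znext (ztab (fun i => znth r i - znth r 0 * znth b i)%Z))
  end.
(** The list runs through the exponents n, n - 1, ..., 0, which is the order m = 0, 1, ... of
    [QB]. *)
Fixpoint zQF (al be n : nat) : list (list Z) :=
  match n with
  | O => zconv (zpow zE4 al) (zpow zE6 be) :: nil
  | S m => let r := zQF al be m in zconv zE4 (zconv zE4 (zconv zE4 (hd nil r))) :: r
  end.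
Fixpoint zpev (c : nat -> Z) (n : nat) (x : Z) : Z :=
  match n with O => 0%Z | S m => (x * zpev c m x + c m)%Z end.

(* The same integers separate the roots for all six residues of k mod 12. *)
Definition samples (l : nat) : list Z :=
  match l with
  | 1 => (0 :: nil)%Z
  | 2 => (0 :: 1728 :: nil)%Z
  | 3 => (0 :: 600 :: 1728 :: nil)%Z
  | 4 => (0 :: 300 :: 1000 :: 1728 :: nil)%Z
  | 5 => (0 :: 100 :: 600 :: 1300 :: 1728 :: nil)%Z
  | 6 => (0 :: 100 :: 400 :: 900 :: 1400 :: 1728 :: nil)%Z
  | 7 => (0 :: 50 :: 200 :: 600 :: 1000 :: 1500 :: 1728 :: nil)%Z
  | 8 => (0 :: 30 :: 150 :: 400 :: 800 :: 1200 :: 1500 :: 1728 :: nil)%Z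
  | 9 => (0 :: 20 :: 100 :: 300 :: 600 :: 900 :: 1300 :: 1600 :: 1728 :: nil)%Z
  | 10 => (0 :: 20 :: 100 :: 200 :: 400 :: 700 :: 1100 :: 1400 :: 1600 :: 1728 :: nil)%Z
  | 11 => (0 :: 10 :: 50 :: 150 :: 350 :: 600 :: 900 :: 1200 :: 1400 :: 1600 :: 1728 :: nil)%Z
  | _ => (0 :: 10 :: 50 :: 120 :: 300 :: 500 :: 700 :: 1000 :: 1200 :: 1500 :: 1650 :: 1728 :: nil)%Z
  end.

Definition signs_ok (al be l : nat) : bool :=
  let c := znth (zdcf (zQF al be (l - 1)) zieta) in
  let t := znth (samples l) in
  forallb (fun i => (0 <=? t i)%Z && (t i <? t (S i))%Z && (t (S i) <=? 1728)%Z && (zpev c l (t i) * zpev c l (t (S i)) <? 0)%Z)%bool (seq 0 (l - 1)).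

Lemma signs_ok_all : forallb (fun l => forallb (fun al => forallb (fun be => signs_ok al be l) (seq 0 2)) (seq 0 3)) (seq 1 12) = true.
Proof. vm_compute. reflexivity. Qed.

(** Past the end of a table [znth] returns 0, so each [znext] spoils one more trailing entry; N
    counts the entries that are still correct. *)
Definition sim (N : nat) (s : list Z) (a : nat -> C) : Prop := forall n, (n < N)%nat -> a n = RtoC (IZR (znth s n)).

Lemma znth_tab f n : (n < zterms)%nat -> znth (ztab f) n = f n.
Proof.
  intros H. unfold znth, ztab. rewrite (nth_indep _ 0%Z (f O)) by (rewrite length_map, length_seq; exact H).
  rewrite map_nth. now rewrite seq_nth.
Qed.

Lemma zsum_csum u f n : (forall k, (k < n)%nat -> u k = RtoC (IZR (f k))) -> csum u n = RtoC (IZR (zsum f n)).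
Proof.
  induction n as [|n IH]; intros H; [reflexivity|]. cbn [csum zsum].
  rewrite IH, H, plus_IZR, RtoC_plus by (intros; try apply H; lia). reflexivity.
Qed.

Lemma zsig_sig s n : sig s n = RtoC (IZR (zsig s n)).
Proof.
  apply zsum_csum. intros c Hc. destruct (Nat.eqb_spec (n mod S c) 0) as [E|E]; [|reflexivity].
  assert (Hd : (n / S c)%nat <> O) by (intros E0; pose proof (Nat.div_mod_eq n (S c)); lia).
  unfold pows. destruct (n / S c)%nat as [|q] eqn:Eq; [contradiction|]. rewrite INR_IZR_INZ, pow_IZR. reflexivity.
Qed.

Lemma sim_conv N s t a b : (N <= zterms)%nat -> sim N s a -> sim N t b -> sim N (zconv s t) (conv a b).
Proof.
  intros HN Hs Ht n Hn. unfold zconv. rewrite znth_tab by lia. apply zsum_csum. intros k Hk.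
  rewrite Hs, Ht, mult_IZR, RtoC_mult by lia. reflexivity.
Qed.

Lemma sim_pow s a n : sim zterms s a -> sim zterms (zpow s n) (cpw a n).
Proof.
  intros H. induction n as [|n IH]; [|now apply sim_conv].
  intros i Hi. simpl zpow. rewrite znth_tab by exact Hi. now destruct i.
Qed.

Lemma sim_E4 : sim zterms zE4 E4.
Proof.
  intros n Hn. unfold zE4. rewrite znth_tab by exact Hn. destruct n as [|n]; [apply E4_0|].
  rewrite E4_coef, zsig_sig, mult_IZR, RtoC_mult by lia. reflexivity.
Qed.
Lemma sim_E6 : sim zterms zE6 E6.
Proof.
  intros n Hn. unfold zE6. rewrite znth_tab by exact Hn. destruct n as [|n]; [apply E6_0|].
  rewrite E6_coef, zsig_sig, mult_IZR, RtoC_mult by lia. reflexivity.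
Qed.

Lemma zieta_ok : forallb (fun n => Z.of_nat (S n) * znth zieta (S n) =? 24 * zsum (fun k => zsig 1 (S n - k) * znth zieta k) (S n))%Z (seq 0 (zterms - 1)) = true.
Proof. vm_compute. reflexivity. Qed.

Lemma sim_ieta : sim zterms zieta ieta.
Proof.
  intros n. induction n as [n IH] using (well_founded_induction lt_wf). intros Hn. destruct n as [|n]; [reflexivity|].
  pose proof (proj1 (forallb_forall _ _) zieta_ok n ltac:(apply in_seq; lia)) as E. apply Z.eqb_eq in E.
  assert (Hne : RtoC (INR (S n)) <> RtoC 0) by (intros E0; apply RtoC_inj in E0; pose proof (INR_S_pos n); lra).
  apply (Cmult_cancel_l _ _ _ Hne). unfold ieta. rewrite pexp_S. fold ieta.
  rewrite (zsum_csum _ (fun k => zsig 1 (S n - k) * znth zieta k)%Z).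
  - rewrite INR_IZR_INZ, <- !RtoC_mult, <- !mult_IZR. f_equal. f_equal. exact (eq_sym E).
  - intros k Hk. rewrite zsig_sig, IH, mult_IZR, RtoC_mult by (unfold zterms in *; lia). reflexivity.
Qed.

Lemma sim_QF al be n : length (zQF al be n) = S n /\
  forall i, (i < S n)%nat -> sim zterms (nth i (zQF al be n) nil) (QF al be (n - i)).
Proof.
  induction n as [|n [IH1 IH2]].
  - split; [reflexivity|]. intros i Hi. replace i with O by lia.
    apply sim_conv; [lia | apply sim_pow, sim_E4 | apply sim_pow, sim_E6].
  - split; [cbn [zQF length]; now rewrite IH1|]. intros [|i] Hi; [|apply (IH2 i); lia].
    specialize (IH2 O ltac:(lia)). rewrite Nat.sub_0_r in IH2.
    cbn [zQF nth Nat.sub QF]. destruct (zQF al be n) as [|b bs]; [discriminate|].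
    repeat (apply sim_conv; [lia | apply sim_E4|]). exact IH2.
Qed.

Lemma sim_dcf B bs : forall N m r, (N <= zterms)%nat -> (length bs <= N)%nat ->
  (forall j, (j < length bs)%nat -> sim zterms (nth j bs nil) (B (m + j)%nat)) ->
  sim N r (res B m) -> forall i, (i < length bs)%nat -> dcf B (m + i) = RtoC (IZR (znth (zdcf bs r) i)).
Proof.
  induction bs as [|b bs IH]; intros N m r HN Hn HB Hr i Hi; simpl in Hn, Hi; [lia|].
  assert (Hr0 : res B m O = RtoC (IZR (znth r 0))) by (apply Hr; lia).
  destruct i as [|i]; [rewrite Nat.add_0_r; exact Hr0|].
  rewrite Nat.add_succ_r, <- Nat.add_succ_l. change (znth (zdcf (b :: bs) r) (S i)) with
    (znth (zdcf bs (znext (ztab (fun i => znth r i - znth r 0 * znth b i)%Z))) i).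
  apply (IH (N - 1)%nat); [lia | lia | | | lia].
  { intros j Hj. specialize (HB (S j) ltac:(simpl; lia)). now rewrite Nat.add_succ_r in HB. }
  apply sim_conv; [lia | | intros j Hj; apply sim_ieta; lia].
  intros j Hj. specialize (HB O ltac:(simpl; lia)). rewrite Nat.add_0_r in HB. rewrite !znth_tab by lia.
  change ((res B m (S j) + - res B m O * B m (S j))%C = RtoC (IZR (znth r (S j) - znth r 0 * znth b (S j))%Z)).
  rewrite Hr, Hr0, HB, minus_IZR, mult_IZR, RtoC_minus, RtoC_mult by lia. simpl nth. ring.
Qed.

Lemma zpev_pev (c : nat -> C) zc n x : (forall m, (m < n)%nat -> c m = RtoC (IZR (zc m))) ->
  pev c n (RtoC (IZR x)) = RtoC (IZR (zpev zc n x)).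
Proof.
  induction n as [|n IH]; intros H; [reflexivity|]. cbn [pev zpev].
  rewrite IH, H, plus_IZR, mult_IZR, RtoC_plus, RtoC_mult by (intros; try apply H; lia). reflexivity.
Qed.

Lemma pev_continuity c n x : continuity_pt (fun x : R => Re (pev c n x)) x.
Proof.
  assert (H : continuity_pt (fun x : R => Re (pev c n x)) x /\ continuity_pt (fun x : R => Im (pev c n x)) x); [|apply H].
  assert (Hc : forall r : R, continuity_pt (fun _ => r) x) by (intros r; now apply continuity_pt_const).
  induction n as [|n [IH1 IH2]]; [split; exact (Hc 0)|]. cbn [pev]. split.
  - apply (continuity_pt_ext (fun x : R => x * Re (pev c n x) + Re (c n))).
    + intros t. now rewrite re_plus, re_scal_l.
    + apply continuity_pt_plus; [apply continuity_pt_mult; [apply continuity_pt_id | exact IH1] | apply Hc].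
  - apply (continuity_pt_ext (fun x : R => x * Im (pev c n x) + Im (c n))).
    + intros t. now rewrite im_plus, im_scal_l.
    + apply continuity_pt_plus; [apply continuity_pt_mult; [apply continuity_pt_id | exact IH2] | apply Hc].
Qed.

Lemma pev_real c n (x : R) : (forall m, c m = RtoC (Re (c m))) -> pev c n x = RtoC (Re (pev c n x)).
Proof.
  intros H. induction n as [|n IH]; [reflexivity|]. cbn [pev]. rewrite IH, (H n), <- RtoC_mult, <- RtoC_plus. now rewrite re_RtoC.
Qed.

Lemma special_small al be l a z : (al <= 2)%nat -> (be <= 1)%nat -> (1 <= l <= 12)%nat -> PSc a ->
  (forall z, in_H z -> F a (- / z) = (z ^ (12 * l + 2 * (2 * al + 3 * be)) * F a z)%C) ->
  a O = RtoC 0 -> a 1%nat = RtoC 1 -> (forall n, (2 <= n <= l)%nat -> a n = RtoC 0) ->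
  in_H z -> F a z = RtoC 0 -> special z.
Proof.
  intros Hal Hbe Hl Ha HaS H0 H1 Hn Hz Hg. set (c := dcf (QB al be l)). set (zc := znth (zdcf (zQF al be (l - 1)) zieta)).
  assert (Hc : forall m, (m < l)%nat -> c m = RtoC (IZR (zc m))).
  { intros m Hm. destruct (sim_QF al be (l - 1)) as [E1 E2].
    apply (sim_dcf (QB al be l) (zQF al be (l - 1)) zterms O); rewrite ?E1; [lia | unfold zterms; lia | | exact sim_ieta | lia].
    intros j Hj. unfold QB. apply E2. lia. }
  assert (Hok : signs_ok al be l = true).
  { pose proof signs_ok_all as H. rewrite forallb_forall in H. specialize (H l ltac:(apply in_seq; lia)).
    rewrite forallb_forall in H. specialize (H al ltac:(apply in_seq; lia)).
    rewrite forallb_forall in H. exact (H be ltac:(apply in_seq; lia)). }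
  unfold signs_ok in Hok. fold zc in Hok. set (t := znth (samples l)) in Hok. rewrite forallb_forall in Hok.
  assert (Ht : forall i, (i < l - 1)%nat -> (0 <= t i /\ t i < t (S i) /\ t (S i) <= 1728 /\ zpev zc l (t i) * zpev zc l (t (S i)) < 0)%Z).
  { intros i Hi. specialize (Hok i ltac:(apply in_seq; lia)). rewrite !Bool.andb_true_iff, !Z.leb_le, !Z.ltb_lt in Hok. tauto. }
  set (g := fun x : R => Re (pev c l x)).
  assert (Hg' : forall i, g (IZR (t i)) = IZR (zpev zc l (t i))) by (intros i; unfold g; rewrite (zpev_pev c zc) by exact Hc; reflexivity).
  destruct (Nat.eq_dec l 1) as [El|El].
  (* For l = 1 the polynomial is constant and the list of roots is empty. *)
  { apply (special_of_roots al be l a Hal Hbe ltac:(lia) Ha HaS H0 H1 Hn nil z); [constructor | simpl; lia | intros r [] | exact Hz | exact Hg]. }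
  (* Here the variable is j itself, so each zero s is its own root and distinctness is immediate. *)
  destruct (roots_of_signs (fun i => g (IZR (t i))) (fun i => IZR (t i)) g (fun s x => s = x /\ g s = 0) (l - 1)) as (xs & Hnd & Hlen & Hin).
  - reflexivity.
  - intros i Hi. destruct (Ht i Hi) as (_ & A & _ & B). split; [now apply IZR_lt | split].
    + rewrite !Hg', <- mult_IZR. now apply IZR_lt.
    + intros s _. apply pev_continuity.
  - intros s _ E. now exists s.
  - intros s s' x _ _ [-> _] [-> _]. reflexivity.
  - destruct (Ht O ltac:(lia)) as (A & _). destruct (Ht (l - 2)%nat ltac:(lia)) as (_ & _ & B & _).
    replace (S (l - 2)) with (l - 1)%nat in B by lia. apply IZR_le in A, B.
    apply (special_of_roots al be l a Hal Hbe ltac:(lia) Ha HaS H0 H1 Hn (map RtoC xs) z); [ | rewrite length_map; lia | | exact Hz | exact Hg].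
    + apply NoDup_map_NoDup_ForallPairs; [intros x y _ _ E; now apply RtoC_inj | exact Hnd].
    + intros r Hr. apply in_map_iff in Hr. destruct Hr as (x & <- & Hx). destruct (Hin x Hx) as (s & Hs & -> & E). exists x.
      split; [reflexivity | split; [lra|]]. fold c. rewrite (pev_real c l x) by (intros m; apply dcf_real; intros i; apply rser_QB).
      change (RtoC (g x) = RtoC 0). now rewrite E.
Qed.

(** * From the definitions of the statement to coefficient sequences *)

(** Every radius r in (0, 1) is the modulus of q at i y with y = - ln r / (2 PI), and the expansion
    converges at that point. *)
Lemma qexp_PSc f a : has_qexp f a -> PSc a.
Proof.
  intros H. apply PSc_series. intros r Hr. pose proof PI_RGT_0 as Hpi.
  assert (Hln : ln r < 0) by (rewrite <- ln_1; apply ln_increasing; lra).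
  set (y := - ln r / (2 * PI)). assert (Hy : 0 < y) by (apply Rdiv_lt_0_compat; lra).
  exists (qpar (Ci * y)). split; [|exists (f (Ci * y)%C); apply H, in_H_axis, Hy].
  rewrite qpar_axis, Cmod_Rp by (left; apply exp_pos).
  replace (- (2 * PI * y)) with (ln r) by (unfold y; field; lra). apply exp_ln. lra.
Qed.

Lemma qexp_F f a z : has_qexp f a -> in_H z -> f z = F a z.
Proof.
  intros H Hz. eapply clim_unique; [apply is_series_clim, (H z Hz)|].
  apply CSer_lim, PSc_asum; [exact (qexp_PSc f a H) | now apply qpar_lt1].
Qed.

(** Each k' in {0, 4, 6, 8, 10, 14} is 4 al + 6 be with al <= 2 and be <= 1. *)
Lemma weight_decomp k : Nat.Even k -> (1 <= ell k)%nat ->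
  exists al be, (al <= 2)%nat /\ (be <= 1)%nat /\ k = (12 * ell k + 2 * (2 * al + 3 * be))%nat.
Proof.
  intros [m ->] Hl. unfold ell in *. pose proof (Nat.div_mod_eq (2 * m) 12) as E. pose proof (Nat.mod_upper_bound (2 * m) 12 ltac:(lia)) as Hu.
  assert (Hc : ((2 * m) mod 12 = 0 \/ (2 * m) mod 12 = 2 \/ (2 * m) mod 12 = 4 \/ (2 * m) mod 12 = 6 \/ (2 * m) mod 12 = 8 \/ (2 * m) mod 12 = 10)%nat) by lia.
  destruct Hc as [e|[e|[e|[e|[e|e]]]]]; rewrite e in *; simpl Nat.eqb in *; cbv iota in *.
  - exists 0%nat, 0%nat. lia.
  (* Residue 2 is the case k' = 14, where [ell] is one less than k / 12. *)
  - exists 2%nat, 1%nat. lia.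
  - exists 1%nat, 0%nat. lia.
  - exists 0%nat, 1%nat. lia.
  - exists 2%nat, 0%nat. lia.
  - exists 1%nat, 1%nat. lia.
Qed.

Theorem theorem1p2 :
  forall (k : nat) (g : C -> C),
    Nat.Even k -> (1 <= ell k)%nat -> is_g_k1 k g ->
    forall z : C, in_F z -> g z = RtoC 0 -> on_arc z.
Proof.
  intros k g Hev Hl [[_ HS] (a & Hq & H0 & H1 & Hn)] z HF Hg.
  destruct (weight_decomp k Hev Hl) as (al & be & Hal & Hbe & Ek). pose proof (qexp_PSc g a Hq) as Ha.
  assert (Hz : in_H z) by apply HF.
  assert (HaS : forall w, in_H w -> F a (- / w) = (w ^ (12 * ell k + 2 * (2 * al + 3 * be)) * F a w)%C).
  { intros w Hw. rewrite <- Ek, <- !(qexp_F g a) by (assumption || now apply in_H_inv). now apply HS. }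
  rewrite (qexp_F g a z Hq Hz) in Hg. apply special_on_arc; [exact HF|].
  destruct (Nat.le_gt_cases (ell k) 12) as [h|h].
  - apply (special_small al be (ell k) a z); try assumption. lia.
  - apply (special_large al be (ell k) a); assumption.
Qed.
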